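(* For every $k\in\mathbb{N}_*$ there exist a countable, deterministic, dense set $D_k\subset[0,\infty)$ and, almost surely, a right-continuous nondecreasing process $\theta_k^\infty$ such that $\lim_{n\to\infty}\widetilde\theta_k^n(t)=\theta_k^\infty(t)$ a.s. for every $t\in D_k$. Furthermore, for almost every $\underline\gamma$, for every $k\ge0$, $x|_k\in\mathbb{N}_*^k$ and $t\ge0$, $$\mathbb{E}_\gamma\big(\theta_{x|_k}^\infty(t)\big)\le t\,W(x|_k).$$
   Context: Notation. $\mathbb{N}_*=\{1,2,\ldots\}$, $\overline{\mathbb{N}}_*=\mathbb{N}_*\cup\{\infty\}$, $\mathbb{N}_*^0=\{\emptyset\}$. For $x|_k=(x_1,\ldots,x_k)$, $x|_j$ ($j\le k$) denotes its first $j$ coordinates and $x|_k y=(x_1,\ldots,x_k,y)$. Environment. $0<\alpha_1<\alpha_2<\cdots<1$ are real numbers with $\alpha_n\to1$. For each $k\in\mathbb{N}_*$ and $x|_{k-1}\in\mathbb{N}_*^{k-1}$, $\gamma_k(x|_{k-1}1)>\gamma_k(x|_{k-1}2)>\cdots>0$ are the ordered marks of a Poisson point process on $(0,\infty)$ with intensity measure $\mu_k(dt)=c_k t^{-1-\alpha_k}dt$, $c_k=\alpha_k/\Gamma(1-\alpha_k/\alpha_{k+1})$; these point processes are independent over $k$ and $x|_{k-1}$. $\underline\gamma$ denotes the whole collection of these variables; $\mathbb{E}_\gamma$ is conditional expectation given $\underline\gamma$. $\overline\gamma_k(x|_k)=\prod_{j=1}^k\gamma_j(x|_j)$, $\overline\gamma_0(\emptyset)=1$.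 For $k\le n$, $[x|_k]_n=\{y|_n\in\mathbb{N}_*^n: y|_k=x|_k\}$. Dynamics. Independently of the environment, and all independent: $T_i^{k,x}$ ($i,k,x\in\mathbb{N}_*$) are exponential random variables of mean 1, and $N^{k,x}$ ($k,x\in\mathbb{N}_*$) are rate 1 Poisson processes on $[0,\infty)$ with marks $0<\sigma_1^{k,x}<\sigma_2^{k,x}<\cdots$. Put $X_0\equiv\emptyset$ and recursively, for $k\ge1$, $t\ge0$, $$\Xi_k(t)=\sum_{x\in\mathbb{N}_*}\sum_{i=1}^{N^{k,x}(t)}\gamma_k(X_{k-1}(\sigma_i^{k,x})x)\,T_i^{k,x},$$ $X_k(t)=(X_{k-1}(\Xi_k^{-1}(t)),x)$ if $t\in\bigcup_{i\ge1}[\Xi_k(\sigma_i^{k,x}-),\Xi_k(\sigma_i^{k,x}))$ for some $x\in\mathbb{N}_*$, and $X_k(t)=(X_{k-1}(\Xi_k^{-1}(t)),\infty)$ otherwise, where $\Xi_k^{-1}(t)=\inf\{r\ge0:\Xi_k(r)>t\}$. (Almost surely $X_{k-1}(\sigma_i^{k,x})\in\mathbb{N}_*^{k-1}$ for all $i,x$.) Modified clocks. For $x|_k\in\mathbb{N}_*^k$, $k\ge0$, $W(x|_k)=\lim_{n\to\infty}\sum_{y|_n\in[x|_k]_n}\big(\overline\gamma_n(y|_n)/\overline\gamma_k(y|_k)\big)^{\alpha_{n+1}}$, which exists a.s. Let $\widetilde\Xi_j(t)=\sum_{x}\sum_{i=1}^{N^{j,x}(t)}W(X_{j-1}(\sigma_i^{j,x})x)\gamma_j(X_{j-1}(\sigma_i^{j,x})x)T_i^{j,x}$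 and $\widetilde\theta_k^n=\widetilde\Xi_n\circ\Xi_{n-1}\circ\cdots\circ\Xi_k$ for $n\ge k$. Pieces of the limit clock. Let $L_k(x|_k,t)=\int_0^t\mathbf{1}\{X_k(s)=x|_k\}ds$ (so $L_0(\emptyset,t)=t$), and let $\nu_{k+1}^\infty$ be the random Borel measure on $[0,\infty)$ with $\nu_{k+1}^\infty([0,t])=\theta_{k+1}^\infty(t)$. For $k\ge0$ and $x|_k\in\mathbb{N}_*^k$, $\theta_{x|_k}^\infty(t)=\nu_{k+1}^\infty(\{s\ge0: L_k(x|_k,s)\le t,\ X_k(s)=x|_k\})$; in particular $\theta_\emptyset^\infty=\theta_1^\infty$. *)

(* Defs.v *)
From mathcomp Require Import all_boot all_order all_algebra.
From mathcomp Require Import all_classical all_reals all_analysis.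
From mathcomp Require Import measurable_realfun.

Set Implicit Arguments.
Unset Strict Implicit.
Unset Printing Implicit Defensive.
Import Order.TTheory GRing.Theory Num.Theory.
Import numFieldNormedType.Exports.

Local Open Scope classical_set_scope.
Local Open Scope ring_scope.

(* Conventions.
   - The labels 1, 2, ... of vertices and the ranks i = 1, 2, ... of marks and
     of holding times are coded by 0, 1, ... : nat.  Levels k are not shifted:
     they start at 1, and the values at level 0 of alpha, holding times and
     Poisson marks are never used.
   - A vertex x|_k is a sequence of length k.  The environment variable
     gamma_k(x|_{k-1} x) is g s x, with s = x|_{k-1}; its level is (size s).+1.
   - A state of X_k is a sequence over option nat, None coding infinity. *)

Section Independence.
Context d (Omega : measurableType d) (R : realType) (P : probability Omega R).

Definition generated_sigma_algebra d' (T : measurableType d') (J : Type)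
    (Y : J -> Omega -> T) : set_system Omega :=
  <<s \bigcup_(j in [set: J]) preimage_set_system setT (Y j) measurable >>.

Definition mutually_independent (I : choiceType) (D : set I)
    (F : I -> set_system Omega) : Prop :=
  forall (r : seq I) (B : I -> set Omega), uniq r ->
    (forall i, i \in r -> D i /\ F i (B i)) ->
    P (\bigcap_(i in [set` r]) B i) = (\prod_(i <- r) P (B i))%E.

(* Z is a version of the conditional expectation given G of the nonnegative
   variable Y, where Y need only be almost surely equal to a measurable
   function. *)
Definition is_conditional_expectation (G : set_system Omega)
    (Y Z : Omega -> \bar R) : Prop :=
  [/\ (forall B : set (\bar R), measurable B -> G (Z @^-1` B)),
      (forall w, (0 <= Z w)%E) &
      exists Y' : Omega -> \bar R,
        [/\ measurable_fun setT Y', (forall w, (0 <= Y' w)%E),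
            {ae P, forall w, Y w = Y' w} &
            forall A, G A ->
              (\int[P]_(w in A) Z w = \int[P]_(w in A) Y' w)%E]].

(* Number of points of the point process {xi_0, xi_1, ...} in A. *)
Definition point_count (xi : nat -> Omega -> R) (A : set R) (w : Omega)
  : \bar R := counting [set i | A (xi i w)].

(* The second argument of poisson_prob is not used by the library; its value
   at rate 0 is the Dirac measure at 0, as it should be. *)
Definition poisson_point_process (mu : set R -> \bar R)
    (xi : nat -> Omega -> R) : Prop :=
  (forall A : set R, measurable A -> A `<=` `]0, +oo[ ->
    [/\ ((mu A < +oo)%E -> forall n : nat,
          P [set w | point_count xi A w = n%:R%:E] =
            poisson_prob (fine (mu A)) 0 [set n]) &
        (mu A = +oo%E -> P [set w | point_count xi A w = +oo%E] = 1%E)]) /\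
  (forall A : nat -> set R,
    (forall i, measurable (A i) /\ A i `<=` `]0, +oo[) ->
    trivIset setT A ->
    mutually_independent setT
      (fun i => preimage_set_system setT (point_count xi (A i)) measurable)).

End Independence.

Section Environment.
Context {R : realType}.

Definition Gamma (z : R) : R :=
  \int[lebesgue_measure]_(t in `]0, +oo[) (t `^ (z - 1) * expR (- t)).

Definition intensity (alpha : nat -> R) (k : nat) (A : set R) : \bar R :=
  let c := alpha k / Gamma (1 - alpha k / alpha k.+1) in
  (\int[lebesgue_measure]_(t in A) (c * t `^ (- 1 - alpha k))%:E)%E.

Definition gamma_bar (g : seq nat -> nat -> R) (s : seq nat) : R :=
  \prod_(j < size s) g (take j s) (nth 0%N s j).

Definition cylinder (s : seq nat) (n : nat) : set (seq nat) :=
  [set y | size y = n /\ take (size s) y = s].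

Definition W (alpha : nat -> R) (g : seq nat -> nat -> R) (s : seq nat)
  : \bar R :=
  limn (fun n => \esum_(y in cylinder s n)
    ((gamma_bar g y / gamma_bar g s) `^ alpha n.+1)%:E)%E.

End Environment.

(* The dynamics is defined realization by realization: g, T and sigma stand
   for the values at a sample point of the environment, of the holding times
   T_i^{k,x} = T k x i and of the marks sigma_i^{k,x} = sigma k x i. *)
Section Dynamics.
Context {R : realType}.
Variables (alpha : nat -> R) (g : seq nat -> nat -> R).
Variables (T sigma : nat -> nat -> nat -> R).

(* Weights of children of states with an infinite coordinate, which are almost
   surely never needed, are set to 0. *)
Definition extend (a : seq nat -> nat -> \bar R) (v : seq (option nat))
    (x : nat) : \bar R :=
  if all isSome v then a (pmap id v) x else 0%E.

(* Since the marks increase in i, the i-th mark is among the first N^{k,x}(t)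
   ones exactly when it is at most t.  Time is extended-valued so that clocks
   can be composed. *)
Definition clock (X : R -> seq (option nat)) (k : nat)
    (a : seq nat -> nat -> \bar R) (t : \bar R) : \bar R :=
  (\esum_(x in [set: nat]) \esum_(i in [set i | (sigma k x i)%:E <= t])
    (extend a (X (sigma k x i)) x * (T k x i)%:E))%E.

Definition clock_inverse (xi : \bar R -> \bar R) (t : R) : R :=
  inf [set r : R | 0 <= r /\ (t%:E < xi r%:E)%E].

Definition gamma_weight (s : seq nat) (x : nat) : \bar R := (g s x)%:E.

Definition W_gamma_weight (s : seq nat) (x : nat) : \bar R :=
  (W alpha g (rcons s x) * (g s x)%:E)%E.

Definition next_coordinate (xi : \bar R -> \bar R) (k : nat) (t : R)
  : option nat :=
  xget None [set o | exists x i, [/\ o = Some x,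
    (lim (xi r%:E @[r --> (sigma k x i)^'-]) <= t%:E)%E &
    (t%:E < xi (sigma k x i)%:E)%E]].

Fixpoint X (k : nat) : R -> seq (option nat) :=
  if k is j.+1 then
    let xi := clock (X j) k gamma_weight in
    fun t => rcons (X j (clock_inverse xi t)) (next_coordinate xi k t)
  else fun=> [::].

(* Xi k and Xi_tilde k are only used for k >= 1. *)
Definition Xi (k : nat) : \bar R -> \bar R := clock (X k.-1) k gamma_weight.

Definition Xi_tilde (k : nat) : \bar R -> \bar R :=
  clock (X k.-1) k W_gamma_weight.

(* Xi_(k + m - 1) \o ... \o Xi_k, with m factors *)
Definition Xi_comp (k m : nat) (t : \bar R) : \bar R :=
  iteri m (fun j => Xi (k + j)) t.

Definition theta_tilde (k n : nat) (t : R) : \bar R :=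
  Xi_tilde n (Xi_comp k (n - k) t%:E).

Definition at_vertex (s : seq nat) : set R :=
  [set u | X (size s) u = map Some s].

Definition L (s : seq nat) (t : R) : \bar R :=
  (\int[lebesgue_measure]_(u in `[0%R, t]) (\1_(at_vertex s) u)%:E)%E.

(* nu stands for the measure attached to the limit clock of level
   (size s).+1. *)
Definition theta_vertex (nu : set R -> \bar R) (s : seq nat) (t : R)
  : \bar R :=
  nu [set u | [/\ 0 <= u, (L s u <= t%:E)%E & at_vertex s u]].

End Dynamics.

Definition right_continuous_on_half_line {R : realType}
    {U : topologicalType} (f : R -> U) : Prop :=
  forall t, 0 <= t -> f u @[u --> t^'+] --> f t.

(* nu, extended by 0 to the negative half line, satisfies
   nu [0, t] = f t for all t >= 0. *)
Definition is_clock_measure {R : realType} (f : R -> R)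
    (nu : {measure set (measurableTypeR R) -> \bar R}) : Prop :=
  nu `]-oo, 0[%classic = 0%E /\
  forall t, 0 <= t -> nu `[0, t]%classic = (f t)%:E.

Section Model.
Context d (Omega : measurableType d) (R : realType) (P : probability Omega R).
Variables (gam : seq nat -> nat -> {RV P >-> R}).
Variables (T sigma : nat -> nat -> nat -> {RV P >-> R}).

(* The independent sources of randomness: the point processes of the
   environment, the holding times and the Poisson processes N^{k,x}. *)
Definition source : choiceType := (seq nat + (nat * nat * nat + nat * nat))%type.

Definition source_level (j : source) : nat :=
  match j with
  | inl s => (size s).+1
  | inr (inl (k, _, _)) => k
  | inr (inr (k, _)) => k
  end.

Definition source_sigma_algebra (j : source) : set_system Omega :=
  match j with
  | inl s => generated_sigma_algebra (fun x => gam s x : Omega -> R)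
  | inr (inl (k, x, i)) =>
      generated_sigma_algebra (fun _ : unit => T k x i : Omega -> R)
  | inr (inr (k, x)) =>
      generated_sigma_algebra (fun i => sigma k x i : Omega -> R)
  end.

Definition environment_sigma_algebra : set_system Omega :=
  generated_sigma_algebra (fun p : seq nat * nat => gam p.1 p.2 : Omega -> R).

Definition env (w : Omega) : seq nat -> nat -> R := fun s x => gam s x w.
Definition holding (w : Omega) : nat -> nat -> nat -> R :=
  fun k x i => T k x i w.
Definition marks (w : Omega) : nat -> nat -> nat -> R :=
  fun k x i => sigma k x i w.

End Model.

(* Main.v *)
(* Integrating out the environment level by level, the Laplace transforms of the
   approximations of W(s) form a martingale, so that W(s) exists and is finite,
   and by Fatou's lemma W(s) >= sum_x gamma(s x) W(s x).  Together with Campbell's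
   formula for the marks, this makes the increments over (p, q] of the modified
   clocks a nonnegative supermartingale in n.  Its mean, on an event of the past
   of level k - 1, is at most that of
     Lambda(p, q] = sum_(|s| = k - 1) W(s) Leb{u in (p, q] : X_(k-1)(u) = s},
   which is almost surely finite by induction on k.  Hence the modified clocks
   converge at rational times; the limit process is the right-continuous envelope
   of the limits, and it agrees with them at each rational time because
   Lambda(q, q + e] tends to 0.
   By Fatou's lemma the mean of the limit clock measure is bounded by Lambda on
   products of a past event with a dyadic interval, hence on the sigma-algebra
   that they generate.  Applied to the set of u with X_(k-1)(u) = s and
   L(s, u) <= t, whose Lebesgue measure is at most t, on an environment event A,
   this gives E[1_A theta_s(t)] <= t E[1_A W(s)]. *)
From HB Require Import structures.
Require Import Defs.
From mathcomp Require Import all_boot all_order all_algebra.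
From mathcomp Require Import all_classical all_reals all_analysis.
From mathcomp Require Import measurable_realfun ring lra zify.

Set Implicit Arguments.
Unset Strict Implicit.
Unset Printing Implicit Defensive.
Import Order.TTheory GRing.Theory Num.Theory.
Import numFieldNormedType.Exports.

Local Open Scope classical_set_scope.
Local Open Scope ring_scope.


(** * Sums over countable sets *)

(** Each [W(s)] turns out to be positive stable of index below 1, hence of infinite mean, so the
    means of the modified clocks may be infinite. Expectations are therefore localised: inequalities
    are stated against a nonnegative factor [Z] of the past, and convergence is proved on the past
    events where Lambda is at most an integer [K]. Measurability shapes the encoding. The recursion
    for [X] passes through inverse clocks and left limits; it is replaced by the sets [occ] of
    occupied times, one per vertex, whose joint measurability is a plain induction, and the link
    with [X] is made path by path. Absolute values and upper limits give nonnegative versions of all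
    quantities, defined everywhere and equal to those of the model on the almost sure event [good].
    Null sets are the last obstacle: a bound almost surely for each [t] is not a bound almost surely
    for all [t]. Conditional means are therefore compared at rational times and extended by right
    limits, and the extension has to be shown to be still a conditional mean. *)

Lemma measurable_bool_set d (T : measurableType d) (f : T -> bool) :
  measurable_fun setT f -> measurable [set x | f x].
Proof.
move=> mf; have := mf measurableT [set true]; rewrite setTI; exact.
Qed.

Lemma measurable_const_set d (T : measurableType d) (p : Prop) : measurable [set _ : T | p].
Proof.
have [h|h] := pselect p.
  by rewrite (_ : [set _ | _] = setT)//; apply/seteqP; split.
by rewrite (_ : [set _ | _] = set0)//; apply/seteqP; split.
Qed.

Lemma indic_iff (R : realType) (T U : Type) (A : set T) (B : set U) x y :
  (A x <-> B y) -> \1_A x = \1_B y :> R.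
Proof.
move=> h; rewrite !indicE; have [a|a] := pselect (A x).
  by rewrite !mem_set//; exact/h.
by rewrite !memNset// => /h.
Qed.

Lemma ae_forall_count d (T : measurableType d) (R : realType)
    (mu : {measure set T -> \bar R}) (I : countType) (Q : I -> T -> Prop) :
  (forall i, {ae mu, forall w, Q i w}) -> {ae mu, forall w, forall i, Q i w}.
Proof.
move=> h; have : {ae mu, forall w, forall n : nat,
    if pickle_inv n is Some i then Q i w else True}.
  by apply/ae_foralln => n; case: pickle_inv => [i|]; [exact: h|exact: nearW].
by apply: filterS => w hw i; have := hw (pickle i); rewrite pickleK_inv.
Qed.

Section esum_tools.
Context {R : realType}.
Local Open Scope ereal_scope.

(** The enumeration [pickle] turns a sum over a countable index into a series, for which monotone
    convergence and measurability are at hand; codes outside [D] contribute 0. *)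
Lemma esum_countE (I : countType) (D : set I) (f : I -> \bar R) :
  (forall i, D i -> 0 <= f i) ->
  \esum_(i in D) f i = \sum_(j <oo)
    (if pickle_inv j is Some i then (if i \in D then f i else 0) else 0).
Proof.
move=> f0; rewrite nneseries_esumT; last first.
  by move=> n; case: pickle_inv => // i; case: ifPn => // /set_mem /f0.
rewrite esum_mkcond [RHS](_ : _ = \esum_(j in range (@pickle I))
  (if pickle_inv j is Some i then (if i \in D then f i else 0) else 0)).
  rewrite esum_image; first by apply: eq_esum => i _; rewrite pickleK_inv.
  by move=> i j _ _ /(pcan_inj pickleK).
rewrite [RHS]esum_mkcond; apply: eq_esum => j _.
case: ifPn => // /negP h; case E: (pickle_inv j) => [i|//].
by exfalso; apply: h; apply/mem_set; exists i => //; have := @pickle_invK I j; rewrite E.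
Qed.

Lemma ge0_esumZl (I : countType) (D : set I) (f : I -> \bar R) (c : \bar R) :
  0 <= c -> (forall i, D i -> 0 <= f i) ->
  \esum_(i in D) c * f i = c * \esum_(i in D) f i.
Proof.
move=> c0 f0; rewrite !esum_countE//; last by move=> i Di; rewrite mule_ge0// f0.
have g0 : forall j : nat, (0 : \bar R) <= (match pickle_inv j with
    | Some i => if i \in D then f i else 0 | None => 0 end).
  by move=> j; case: pickle_inv => // i; case: ifPn => // /set_mem /f0.
move: c0; case: c => [c||]// c0.
  rewrite -nneseriesZl//; apply: eq_eseriesr => j _.
  by case: pickle_inv => [i|]; [case: ifPn|]; rewrite ?mule0.
(* Infinite factor: a null sum forces every term to vanish; otherwise one positive term already
   makes the left-hand side infinite. *)
have [z|/eqP] := eqVneq (\sum_(j <oo) (match pickle_inv j with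
    | Some i => if i \in D then f i else 0 | None => 0 end)) 0.
  rewrite z mule0 eseries0// => j _ _; case E: pickle_inv => [i|//].
  case: ifPn => // iD; rewrite (_ : f i = 0) ?mule0//.
  have := z; rewrite (@nneseriesD1 _ _ j)//.
  rewrite E iD => /eqP; rewrite padde_eq0 ?(f0 _ (set_mem iD))//.
    by case/andP => /eqP.
  by apply: nneseries_ge0 => *; exact: g0.
move=> nz.
have pos : 0 < \sum_(j <oo) (match pickle_inv j with
    | Some i => if i \in D then f i else 0 | None => 0 end).
  rewrite lt0e; apply/andP; split; first exact/eqP.
  by apply: nneseries_ge0 => *; exact: g0.
rewrite gt0_mulye//.
have [j jP] : exists j, (match pickle_inv j with
    | Some i => if i \in D then f i else 0 | None => 0 end) != 0 :> \bar R.
  apply: contrapT => /forallNP h; apply: nz; apply: eseries0 => j _ _.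
  by apply/eqP/negPn/negP; exact: h.
apply/eqP; rewrite -leye_eq; rewrite (@nneseriesD1 _ _ j)//; last first.
  by move=> k _; case: pickle_inv => // i; case: ifPn => // /set_mem /f0 h; rewrite mule_ge0.
move: jP; case: pickle_inv => [i|/eqP//]; case: ifPn => [iD fi|_ /eqP//].
rewrite gt0_mulye; last by rewrite lt0e fi f0//; exact: set_mem.
apply: leeDl; apply: nneseries_ge0 => k _ _; case: pickle_inv => // i'.
by case: ifPn => // /set_mem /f0 h; rewrite mule_ge0.
Qed.

Lemma esum_exchange (I J : choiceType) (A : set I) (B : set J)
    (a : I -> J -> \bar R) : (forall i j, A i -> B j -> 0 <= a i j) ->
  \esum_(i in A) \esum_(j in B) a i j = \esum_(j in B) \esum_(i in A) a i j.
Proof.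
move=> a0; rewrite !esum_esum//; last by move=> *; exact: a0.
rewrite (@reindex_esum _ _ _ (B `*`` (fun=> A)) _ (fun k => (k.2, k.1)))//.
split=> [[j i] [/= ? ?]//|[j i] [j' i'] _ _ /= [-> ->]//|[i j] [/= ? ?]].
by exists (j, i).
Qed.

Lemma integral_esum d (T : measurableType d) (mu : {measure set T -> \bar R})
    (D : set T) (I : countType) (A : set I) (f : I -> T -> \bar R) :
  measurable D -> (forall i, A i -> measurable_fun D (f i)) ->
  (forall i x, A i -> D x -> 0 <= f i x) ->
  \int[mu]_(x in D) (\esum_(i in A) f i x) =
  \esum_(i in A) (\int[mu]_(x in D) f i x).
Proof.
move=> mD mf f0.
have h j : measurable_fun D (fun x => match pickle_inv j with
    | Some i => if i \in A then f i x else 0 | None => 0 end).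
  case: pickle_inv => [i|]; last exact: measurable_cst.
  have [/set_mem/mf//|_] := boolP (i \in A); exact: measurable_cst.
rewrite esum_countE; last by move=> i Ai; apply: integral_ge0 => x; exact: f0.
transitivity (\int[mu]_(x in D) \sum_(j <oo) (match pickle_inv j with
    | Some i => if i \in A then f i x else 0 | None => 0 end)).
  apply: eq_integral => x /set_mem Dx; rewrite esum_countE// => i Ai.
  exact: f0.
rewrite integral_nneseries//; last first.
  by move=> j x Dx; case: pickle_inv => // i; case: ifPn => // /set_mem Ai; exact: f0.
apply: eq_eseriesr => j _; case: pickle_inv => [i|]; last by rewrite integral0.
by case: ifPn => //; rewrite integral0.
Qed.

Lemma measurable_esum d (T : measurableType d) (I : countType)
    (A : T -> set I) (f : I -> T -> \bar R) :
  (forall i, measurable [set x | A x i]) ->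
  (forall i, measurable_fun setT (f i)) -> (forall i x, 0 <= f i x) ->
  measurable_fun setT (fun x => \esum_(i in A x) f i x).
Proof.
move=> mA mf f0.
rewrite (_ : (fun x => _) = fun x => \sum_(j <oo) match pickle_inv j with
    | Some i => if i \in A x then f i x else 0 | None => 0 end); last first.
  by apply/funext => x; rewrite esum_countE.
apply: (@ge0_emeasurable_sum _ _ _ _ _ xpredT) => [j x _ _|j _].
  by case: pickle_inv => // i; case: ifPn.
case: pickle_inv => [i|]; last exact: measurable_cst.
apply: measurable_fun_ifT => //.
apply: (measurable_fun_bool true); rewrite setTI.
rewrite (_ : _ @^-1` _ = [set x | A x i])//.
by apply/seteqP; split => x /=; [move/set_mem|move/mem_set].
Qed.

End esum_tools.

(** * The Laplace kernel on extended reals *)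

Section enexp.
Context {R : realType}.
Local Open Scope ereal_scope.

(** The kernel [exp(-x)], continuous up to [+oo] where it vanishes: it makes bounded variables of
    possibly infinite sums, so that limits pass through expectations without any integrability. *)
Definition enexp (x : \bar R) : \bar R :=
  if x is r%:E then (expR (- r))%:E else 0.

Lemma enexp_ge0 x : 0 <= enexp x.
Proof. by case: x => // r; rewrite lee_fin expR_ge0. Qed.

Lemma enexp_le1 x : 0 <= x -> enexp x <= 1.
Proof.
case: x => [r| |]//; rewrite /enexp ?lee_fin => r0 //.
by rewrite -[leRHS]expR0 ler_expR oppr_le0.
Qed.

Lemma enexp0 : enexp 0 = 1. Proof. by rewrite /= oppr0 expR0. Qed.

Lemma enexpD x y : 0 <= x -> 0 <= y -> enexp (x + y) = enexp x * enexp y.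
Proof.
case: x y => [r| |] [s| |]//= *; rewrite ?mule0 ?mul0e//.
by rewrite opprD expRD EFinM.
Qed.

Lemma enexp_fin x : 0 <= x -> enexp x \is a fin_num.
Proof. by case: x. Qed.

Lemma measurable_enexp : measurable_fun setT enexp.
Proof.
rewrite (_ : enexp = fun x => if x \is a fin_num then (expR (- fine x))%:E else 0).
  apply: measurable_fun_ifT => //.
    apply: (measurable_fun_bool true); rewrite setTI.
    have := @emeasurable_fin_num _ (\bar R) R setT id measurableT (@measurable_id _ _ setT).
    by rewrite setTI.
  apply/measurable_EFinP; apply: measurableT_comp; first exact: measurable_expR.
  by apply: measurableT_comp => //; exact: fine_measurable.
by apply/funext => -[].
Qed.

Lemma enexp_le x y : 0 <= x -> x <= y -> enexp y <= enexp x.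
Proof.
case: x y => [r| |] [s| |]//=; rewrite ?lee_fin// ?expR_ge0//.
by rewrite ler_expR lerN2.
Qed.

Lemma cvg_enexp (T : Type) (F : set_system T) (FF : Filter F) (u : T -> \bar R) (l : \bar R) :
  (\forall n \near F, 0 <= u n) -> 0 <= l -> u x @[x --> F] --> l ->
  enexp (u x) @[x --> F] --> enexp l.
Proof.
move=> u0; case: l => [r| |]// l0.
  move=> /fine_cvgP[fu ru]; apply: (@cvg_trans _ ((expR (- fine (u x)))%:E @[x --> F])).
    by apply: near_eq_cvg; near=> x; rewrite -[in RHS](@fineK _ (u x)) //; near: x.
  apply: cvg_EFin; first by near=> x.
  by apply: continuous_cvg; [exact: continuous_expR|exact: cvgN].
move=> /cvgeyPge uy; apply/fine_cvgP; split.
  by near=> x; rewrite enexp_fin//; near: x.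
(* [exp(-x) <= e] as soon as [x >= - ln e]. *)
apply/cvgrPdist_le => /= e e0; have := uy (- ln e)%R.
apply: filterS2 u0 => x u0 ux; rewrite sub0r normrN.
move: u0 ux; case: (u x) => [s| |] // _; last by move=> _; rewrite /= normr0 ltW.
rewrite lee_fin /= => se; rewrite ger0_norm ?expR_ge0//.
by rewrite -[leRHS]lnK ?posrE// ler_expR lerNl.
Unshelve. all: by end_near. Qed.

End enexp.

(** * Nonnegative supermartingales *)

Section ereal_sequences.
Context {R : realType}.
Local Open Scope ereal_scope.

Lemma ereal_between (x y : \bar R) : 0 <= x -> x < y ->
  exists p q : rat, [/\ x < (ratr p)%:E, (ratr p < ratr q :> R)%R & (ratr q)%:E < y].
Proof.
move=> x0; have aux (r s : R) : (r < s)%R -> exists p q : rat,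
    [/\ (r < ratr p)%R, (ratr p < ratr q :> R)%R & (ratr q < s)%R].
  move=> rs; have [p] := rat_in_itvoo rs; rewrite in_itv/= => /andP[rp ps].
  have [q] := rat_in_itvoo ps; rewrite in_itv/= => /andP[pq qs].
  by exists p, q.
case: x x0 => [r| |]//= r0; case: y => [s| |]//.
  by rewrite lte_fin => /aux[p [q [? ? ?]]]; exists p, q; rewrite !lte_fin.
have /aux[p [q [? ? ?]]] : (r < r + 1)%R by rewrite ltrDl.
by exists p, q; rewrite !lte_fin ltry.
Qed.

Lemma limn_esup_gt_frequently (u : (\bar R)^nat) (b : \bar R) :
  b < limn_esup u -> forall n, exists2 m, (n <= m)%N & b < u m.
Proof.
rewrite limn_esup_lim (cvg_lim _ (@cvg_esups_inf _ u))// => h n.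
have : b < esups u n by apply: (lt_le_trans h); apply: ereal_inf_lbound; exists n.
by move=> /ereal_sup_gt[_ [m /= nm <-] bm]; exists m.
Qed.

Lemma limn_einf_lt_frequently (u : (\bar R)^nat) (b : \bar R) :
  limn_einf u < b -> forall n, exists2 m, (n <= m)%N & u m < b.
Proof.
move=> h n; have : - b < limn_esup (-%E \o u) by rewrite limn_esupN lteN2.
by move=> /limn_esup_gt_frequently/(_ n)[m nm]; rewrite /= lteN2; exists m.
Qed.

Lemma limn_einf_sup_cvg (u : (\bar R)^nat) (l : \bar R) :
  limn_einf u = l -> limn_esup u = l -> u n @[n --> \oo] --> l.
Proof.
move=> ul lu; apply: (@squeeze_cvge _ _ _ _ (einfs u) u (esups u)).
- apply: nearW => n; apply/andP; split.
    by apply: ereal_inf_lbound; exists n => //=.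
  by apply: ereal_sup_ubound; exists n => //=.
- by rewrite -ul limn_einf_lim; exact: is_cvg_einfs.
- by rewrite -lu limn_esup_lim; exact: is_cvg_esups.
Qed.

(** Without convergence there is a gap between the lower and upper limits, and two rationals in this
    gap are crossed infinitely often. *)
Lemma no_crossing_cvg (u : (\bar R)^nat) : (forall n, 0 <= u n) ->
  (forall p q : rat, (ratr p < ratr q :> R)%R ->
     (forall n, exists2 m, (n <= m)%N & u m < (ratr p)%:E) ->
     (forall n, exists2 m, (n <= m)%N & (ratr q)%:E < u m) -> False) ->
  u n @[n --> \oo] --> limn_einf u.
Proof.
move=> u0 h; apply: limn_einf_sup_cvg => //.
apply/eqP; rewrite eq_le limn_einf_sup andbT leNgt; apply/negP => lt.
have l0 : 0 <= limn_einf u.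
  rewrite limn_einf_lim; apply: lime_ge; first exact: is_cvg_einfs.
  by apply: nearW => n; apply: le_ereal_inf_tmp => _ [m _ <-].
have [p [q [lp pq ql]]] := ereal_between l0 lt.
apply: (h p q pq); first exact: limn_einf_lt_frequently.
exact: limn_esup_gt_frequently.
Qed.

End ereal_sequences.

Section supermartingale.
Context d (Omega : measurableType d) (R : realType) (P : probability Omega R).
Variables (F : nat -> set_system Omega) (M : nat -> Omega -> \bar R).
Local Open Scope ereal_scope.
Hypothesis F_sigma : forall n, sigma_algebra setT (F n).
Hypothesis F_meas : forall n, F n `<=` measurable.
Hypothesis F_mono : forall n, F n `<=` F n.+1.
Hypothesis M_adapted : forall n B, measurable B -> F n (M n @^-1` B).
Hypothesis M_ge0 : forall n w, 0 <= M n w.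
Hypothesis M_super : forall n A, F n A ->
  \int[P]_(w in A) M n.+1 w <= \int[P]_(w in A) M n w.
Hypothesis M_init : \int[P]_w M 0 w < +oo.

Let FT n : F n setT.
Proof.
have [h0 hC _] := F_sigma n.
by rewrite -(setD0 setT); exact: hC.
Qed.

Let FC n A : F n A -> F n (~` A).
Proof. by have [_ hC _] := F_sigma n; move=> /hC; rewrite setTD. Qed.

Let FI n A B : F n A -> F n B -> F n (A `&` B).
Proof.
move=> FA FB; have [_ _ _ /(_ A B)] := (sigma_algebraP (fun X _ => @subsetT _ X)).1 (F_sigma n).
exact.
Qed.

Let FU n A B : F n A -> F n B -> F n (A `|` B).
Proof. by move=> FA FB; rewrite -[_ `|` _]setCK setCU; apply/FC/FI; exact: FC. Qed.

Let mM n : measurable_fun setT (M n).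
Proof. by move=> _ B mB; rewrite setTI; apply/F_meas/M_adapted. Qed.

Lemma supermartingale_le n : \int[P]_w M n w <= \int[P]_w M 0 w.
Proof.
elim: n => // n; apply: le_trans.
by apply: M_super.
Qed.

Section upcrossings.
Variables a b : R.
Hypothesis ab : (a < b)%R.

(** The holding event of Doob's gambling strategy, entered below [a] and left above [b]. It is
    decided at time [n] and governs the step from [n] to [n + 1]. *)
Fixpoint rising n : set Omega :=
  if n is m.+1 then
    (rising m `&` [set w | M n w <= b%:E]) `|` (~` rising m `&` [set w | M n w < a%:E])
  else [set w | M 0 w < a%:E].

Let crossing n := rising n `&` [set w | b%:E < M n.+1 w].
Let start n := ~` rising n `&` [set w | M n.+1 w < a%:E].

Let F_lt n y : F n [set w | M n w < y].
Proof.
rewrite (_ : [set _ | _] = M n @^-1` `]-oo, y[).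
  by apply: M_adapted; exact: emeasurable_itv.
by apply/seteqP; split => w /=; rewrite in_itv.
Qed.

Let F_gt n y : F n [set w | y < M n w].
Proof.
rewrite (_ : [set _ | _] = M n @^-1` `]y, +oo[).
  by apply: M_adapted; exact: emeasurable_itv.
by apply/seteqP; split => w /=; rewrite in_itv/= andbT.
Qed.

Let F_le n y : F n [set w | M n w <= y].
Proof.
rewrite (_ : [set _ | _] = M n @^-1` `]-oo, y]).
  by apply: M_adapted; exact: emeasurable_itv.
by apply/seteqP; split => w /=; rewrite in_itv.
Qed.

Let F_rising n : F n (rising n).
Proof.
elim: n => [|n ih] /=; first exact: F_lt.
by apply: FU; apply: FI; rewrite ?F_le ?F_lt//; apply/F_mono => //; exact: FC.
Qed.

Let F_crossing n : F n.+1 (crossing n).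
Proof. by apply: FI; [apply/F_mono|exact: F_gt]. Qed.

Let F_start n : F n.+1 (start n).
Proof. by apply: FI; [apply/F_mono/FC|exact: F_lt]. Qed.

Let int_fin n A : measurable A -> \int[P]_(w in A) M n w \is a fin_num.
Proof.
move=> mA; rewrite ge0_fin_numE; last exact: integral_ge0.
apply: le_lt_trans M_init; apply: le_trans (supermartingale_le n).
exact: ge0_subset_integral.
Qed.

Let Pfin A : measurable A -> P A \is a fin_num.
Proof. by move=> mA; exact: fin_num_measure. Qed.

Let int_start n : \int[P]_(w in start n) M n.+1 w <= a%:E * P (start n).
Proof.
rewrite -integral_cst; last exact: F_meas.
have [a0|a0] := leP 0%R a; last first.
  rewrite (_ : start n = set0) ?integral_set0//.
  apply/seteqP; split => // w [_ /=] h; have := le_lt_trans (M_ge0 n.+1 w) h.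
  by rewrite lte_fin ltNge ltW.
apply: ge0_le_integral => //.
- exact: F_meas.
- exact: measurable_funTS.
- by move=> w [_ /=] /ltW.
Qed.

Let int_crossing n : b%:E * P (crossing n) <= \int[P]_(w in crossing n) M n.+1 w.
Proof.
have mc : measurable (crossing n) by apply: F_meas; exact: F_crossing.
have [b0|b0] := leP 0%R b; last first.
  apply: (@le_trans _ _ 0); last exact: integral_ge0.
  by rewrite mule_le0_ge0// lee_fin ltW.
rewrite -integral_cst//.
apply: ge0_le_integral => //.
- exact: measurable_funTS.
- by move=> w [_ /=] /ltW.
Qed.

(** Over one step the mean held on [rising n] does not increase; a crossing then removes more than
    [b] per unit of probability, and a new start adds less than [a]. Keeping the integral on the
    left makes the induction linear, with no case distinction on a final incomplete crossing. *)
Lemma upcrossing_inequality n :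
  \int[P]_(w in rising n) M n w + (b - a)%:E * \sum_(i < n) P (crossing i) <=
  a%:E * P (rising n).
Proof.
elim: n => [|n ih].
  rewrite big_ord0 mule0 adde0 /=.
  have mF : measurable [set w | M 0 w < a%:E] by apply: F_meas; exact: F_lt.
  have [a0|a0] := leP 0%R a.
    rewrite -integral_cst//; apply: ge0_le_integral => //.
    - exact: measurable_funTS.
    - by move=> w /= /ltW.
  rewrite (_ : [set _ | _] = set0) ?integral_set0 ?measure0 ?mule0//.
  apply/seteqP; split => // w /= h; have := le_lt_trans (M_ge0 0 w) h.
  by rewrite lte_fin ltNge ltW.
have mr := F_meas (F_rising n).
have mc := F_meas (F_crossing n).
have ms := F_meas (F_start n).
pose keep := rising n `&` [set w | M n.+1 w <= b%:E].
have mk : measurable keep by apply: (@F_meas n.+1); apply: FI => //; exact: F_mono.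
have split1 : rising n = keep `|` crossing n.
  rewrite -setIUr (_ : _ `|` _ = setT) ?setIT//.
  by apply/seteqP; split => // w _ /=; case: (leP (M n.+1 w) b%:E) => ?; [left|right].
have dis1 : [disjoint keep & crossing n].
  by apply/disj_setPS => w [[_ /= h] [_ /=]]; rewrite ltNge h.
have split2 : rising n.+1 = keep `|` start n by [].
have dis2 : [disjoint keep & start n] by apply/disj_setPS => w [[/= h _] [/=]].
have e1 : \int[P]_(w in keep) M n.+1 w + \int[P]_(w in crossing n) M n.+1 w <=
    \int[P]_(w in rising n) M n w.
  apply: le_trans (M_super (F_rising n)); rewrite [in leRHS]split1.
  by rewrite ge0_integral_setU//; exact: measurable_funTS.
have e2 : \int[P]_(w in rising n.+1) M n.+1 w =
    \int[P]_(w in keep) M n.+1 w + \int[P]_(w in start n) M n.+1 w.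
  by rewrite split2 ge0_integral_setU//; exact: measurable_funTS.
have p1 : P (rising n) = P keep + P (crossing n).
  by rewrite [in LHS]split1 measureU//; exact/disj_set2P.
have p2 : P (rising n.+1) = P keep + P (start n).
  by rewrite split2 measureU//; exact/disj_set2P.
rewrite big_ord_recr/= -/(rising n.+1) e2 p2.
have := int_start n; have := int_crossing n; move: e1 ih; rewrite p1.
have sfin : \sum_(i < n) P (crossing i) \is a fin_num.
  by apply/sum_fin_numP => i _ _; apply/Pfin/F_meas; exact: F_crossing.
move: (int_fin n.+1 mk) (int_fin n.+1 mc) (int_fin n.+1 ms) (int_fin n mr)
  (Pfin mk) (Pfin mc) (Pfin ms) sfin.
move: (\int[P]_(w in keep) M n.+1 w) (\int[P]_(w in crossing n) M n.+1 w)
  (\int[P]_(w in start n) M n.+1 w) (\int[P]_(w in rising n) M n w)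
  (P keep) (P (crossing n)) (P (start n)) (\sum_(i < n) P (crossing i)).
move=> [k||]// [c||]// [s||]// [r||]// [pk||]// [pc||]// [ps||]// [S||]// _ _ _ _ _ _ _ _.
rewrite -?(EFinD, EFinM) !lee_fin.
move: k c s r pk pc ps S => k c s r pk pc ps S.
by lra.
Qed.

(** The crossing probabilities have a sum of at most [|a| / (b - a)], so Borel-Cantelli leaves
    finitely many crossings. If both levels were visited forever, a visit below [a] after the last
    crossing would be followed by one above [b], that is, by another crossing. *)
Lemma upcrossing_finite : {ae P, forall w,
  ~ ((forall n, exists2 m, (n <= m)%N & M m w < a%:E) /\
     (forall n, exists2 m, (n <= m)%N & b%:E < M m w))}.
Proof.
have mc n : measurable (crossing n) by apply: F_meas; exact: F_crossing.
have s n : \sum_(0 <= i < n) P (crossing i) <= (`|a| / (b - a))%:E.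
  have ba : (0 < b - a)%R by rewrite subr_gt0.
  rewrite EFinM lee_pdivlMr// muleC.
  apply: (@le_trans _ _ (a%:E * P (rising n))).
    apply: le_trans (upcrossing_inequality n); rewrite big_mkord leeDr//.
    exact: integral_ge0.
  apply: (@le_trans _ _ (`|a|%:E * P (rising n))).
    by apply: lee_wpmul2r => //; rewrite lee_fin ler_norm.
  by rewrite -[leRHS]mule1 lee_pmul// ?lee_fin// probability_le1//; exact: F_meas.
have fin : \sum_(0 <= n <oo) P (crossing n) < +oo.
  apply: (@le_lt_trans _ _ (`|a| / (b - a))%:E); last exact: ltry.
  apply: lime_le; first exact: is_cvg_nneseries.
  exact: nearW.
have [N [mN N0 sub]] : P.-negligible (lim_sup_set crossing).
  exists (lim_sup_set crossing); split => //; last exact: lim_sup_set_cvg0.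
  by apply: bigcapT_measurable => n; apply: bigcup_measurable.
exists N; split => // w /= /contrapT[low high]; apply: sub.
apply: contrapT => nw.
have [n0 hn0] : exists n0, forall n, (n0 <= n)%N -> ~ crossing n w.
  apply: contrapT => /forallNP h; apply: nw => n _.
  by have /existsNP[m /not_implyP[nm /contrapT cm]] := h n; exists m.
(* Beyond the last crossing the holding event, once entered, is never left. *)
have stay n m : (n0 <= n)%N -> rising n w -> (n <= m)%N -> rising m w.
  move=> n0n rn; elim: m => [|m ih]; first by rewrite leqn0 => /eqP <-.
  rewrite leq_eqVlt => /predU1P[<-//|]; rewrite ltnS => nm.
  have rm := ih nm; left; split => //=.
  by rewrite leNgt; apply/negP => h; apply: (hn0 m) => //; exact: leq_trans nm.
have [m n0m ma] := low n0.+1.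
have rm : rising m w.
  case: m n0m ma => // m; rewrite ltnS => n0m ma.
  have [rm|rm] := pselect (rising m w); last by right.
  by apply: (stay m).
have [k mk kb] := high m.+1.
case: k mk kb => // k; rewrite ltnS => mk kb; apply: (hn0 k).
  by apply: leq_trans mk; exact: ltnW.
by split => //; apply: (stay m) => //; exact: ltnW.
Qed.

End upcrossings.

Theorem supermartingale_cvg : {ae P, forall w,
  M n w @[n --> \oo] --> limn_einf (M ^~ w) /\ limn_einf (M ^~ w) < +oo}.
Proof.
have cross : {ae P, forall w, forall n, match unpickle n with
    Some (p, q) => (ratr p < ratr q :> R)%R ->
    ~ ((forall n, exists2 m, (n <= m)%N & M m w < (ratr p)%:E) /\
     (forall n, exists2 m, (n <= m)%N & (ratr q)%:E < M m w)) | None => True end}.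
  apply: ae_foralln => n; case: unpickle => [[p q]|]; last exact: nearW.
  have [pq|_] := boolP ((ratr p : R) < ratr q)%R; last exact: nearW.
  by apply: filterS (upcrossing_finite pq).
have mM' : measurable_fun setT (fun w => limn_einf (M ^~ w)).
  rewrite (_ : (fun _ => _) = fun w => - limn_esup ((-%E \o M ^~ w))).
    apply: measurableT_comp => //; apply: measurable_fun_limn_esup => n.
    exact: measurableT_comp.
  by apply/funext => w; rewrite limn_esupN oppeK.
have fin : {ae P, forall w, limn_einf (M ^~ w) \is a fin_num}.
  have l0 w : 0 <= limn_einf (M ^~ w).
    rewrite limn_einf_lim; apply: lime_ge; first exact: is_cvg_einfs.
    by apply: nearW => n; apply: le_ereal_inf_tmp => _ [m _ <-].
  (* Fatou's lemma bounds the mean of the lower limit by that of [M 0], so this limit is almost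
     surely finite. *)
  have : P.-integrable setT (fun w => limn_einf (M ^~ w)).
    apply/integrableP; split => //.
    rewrite (eq_integral (fun w => limn_einf (M ^~ w))); last first.
      by move=> w _; rewrite gee0_abs.
    apply: le_lt_trans M_init; apply: (le_trans (fatou _ _ _ _)) => //.
    rewrite limn_einf_lim; apply: lime_le; first exact: is_cvg_einfs.
    apply: nearW => n; apply: (@le_trans _ _ (\int[P]_w M n w)).
      by apply: ereal_inf_lbound; exists n => //=.
    exact: supermartingale_le.
  by move=> /integrable_ae => /(_ measurableT); apply: filterS => w; apply.
apply: filterS2 cross fin => w cw fw; split; last by rewrite ltey_eq fw.
apply: no_crossing_cvg => // p q pq low high.
by have := cw (pickle (p, q)); rewrite pickleK => /(_ pq); apply.
Qed.

End supermartingale.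

(** * Independence *)

Section bounded_convergence.
Context d (Omega : measurableType d) (R : realType) (P : probability Omega R).
Local Open Scope ereal_scope.

Lemma bounded_cvg_integral (u : nat -> Omega -> \bar R) (v : Omega -> \bar R) :
  (forall n, measurable_fun setT (u n)) -> measurable_fun setT v ->
  (forall n w, 0 <= u n w <= 1) ->
  {ae P, forall w, u n w @[n --> \oo] --> v w} ->
  \int[P]_w u n w @[n --> \oo] --> \int[P]_w v w.
Proof.
move=> mu mv u01 uv.
have [] := @dominated_convergence _ _ _ P setT measurableT u v (cst 1) => //.
- by apply: filterS uv => w + _.
- by apply: finite_measure_integrable_cst.
- by apply: nearW => w n _; have /andP[? ?] := u01 n w; rewrite gee0_abs.
Qed.

Lemma ge0_integral0_ae (f : Omega -> \bar R) : measurable_fun setT f ->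
  (forall w, 0 <= f w) -> \int[P]_w f w = 0 -> {ae P, forall w, f w = 0}.
Proof.
move=> mf f0 i0; have [+ _] := ae_eq_integral_abs P measurableT mf.
rewrite (eq_integral f); last by move=> w _; rewrite gee0_abs.
by move=> /(_ i0); apply: filterS => w /(_ I).
Qed.

End bounded_convergence.

Section freezing.
Context d (Omega : measurableType d) (R : realType) (P : probability Omega R).
Local Open Scope ereal_scope.

(** Independence on rectangles identifies the joint law with the product of the marginal laws, and
    Tonelli's theorem integrates the second variable first. *)
Lemma freezing_fun d1 d2 (T1 : measurableType d1) (T2 : measurableType d2)
    (X : Omega -> T1) (Y : Omega -> T2) (h : T1 * T2 -> \bar R) :
  measurable_fun setT X -> measurable_fun setT Y ->
  (forall A B, measurable A -> measurable B ->
     P (X @^-1` A `&` Y @^-1` B) = P (X @^-1` A) * P (Y @^-1` B)) ->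
  measurable_fun setT h -> (forall z, 0 <= h z) ->
  \int[P]_w h (X w, Y w) = \int[P]_w \int[P]_w' h (X w, Y w').
Proof.
move=> mX mY ind mh h0.
pose PX : probability T1 R := distribution P (mfun_Sub (mem_set mX)).
pose PY : probability T2 R := distribution P (mfun_Sub (mem_set mY)).
have mXY : measurable_fun setT (fun w => (X w, Y w)) by exact: measurable_fun_pair.
pose Q : probability (T1 * T2)%type R := distribution P (mfun_Sub (mem_set mXY)).
have e : forall A, measurable A -> (PX \x PY) A = Q A.
  by apply: product_measure_unique => A B mA mB; rewrite /Q/= /pushforward/= -ind.
transitivity (\int[Q]_z h z).
  by rewrite ge0_integral_pushforward.
rewrite -(@eq_measure_integral _ _ _ setT Q (PX \x PY)); last by move=> A mA _; exact: e.
rewrite fubini_tonelli1// /fubini_F ge0_integral_pushforward//; last 2 first.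
  exact: measurable_fun_fubini_tonelli_F.
  by move=> x _; exact: integral_ge0.
apply: eq_integral => w _ /=; rewrite ge0_integral_pushforward//.
exact: measurable_fun_pair2.
Qed.

Lemma measurable_freeze d1 d2 (T1 : measurableType d1) (T2 : measurableType d2)
    (Y : Omega -> T2) (h : T1 * T2 -> \bar R) : measurable_fun setT Y ->
  measurable_fun setT h -> (forall z, 0 <= h z) ->
  measurable_fun setT (fun x => \int[P]_w h (x, Y w)).
Proof.
move=> mY mh h0; pose PY : probability T2 R := distribution P (mfun_Sub (mem_set mY)).
have := @measurable_fun_fubini_tonelli_F _ _ T1 T2 R PY h mh h0.
apply: eq_measurable_fun => x _; rewrite /fubini_F ge0_integral_pushforward//.
exact: measurable_fun_pair2.
Qed.

End freezing.

Section sub_sigma_algebras.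
Context d (Omega : measurableType d) (R : realType) (P : probability Omega R).
Context (I : choiceType) (D : set I) (F : I -> set_system Omega).
Local Open Scope ereal_scope.

Hypothesis F_sigma : forall i, sigma_algebra setT (F i).
Hypothesis F_meas : forall i, F i `<=` measurable.
Hypothesis F_indep : mutually_independent P D F.

(** The sample space carrying the sigma-algebra generated by the sources in [A]. Measurability with
    respect to part of the randomness becomes ordinary measurability of functions on [sub A]. *)
Notation sub A := (g_sigma_algebraType (\bigcup_(i in A) F i)).

Lemma sub_measurable (A : set I) : (@measurable _ (sub A)) `<=` @measurable _ Omega.
Proof.
apply: smallest_sub; first exact: sigma_algebra_measurable.
by move=> X [i _ /F_meas].
Qed.

Lemma sub_subset (A B : set I) : A `<=` B ->
  (@measurable _ (sub A)) `<=` @measurable _ (sub B).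
Proof.
move=> AB; apply: smallest_sub; first exact: smallest_sigma_algebra.
by move=> X [i /AB Bi FX]; apply: sub_gen_smallest; exists i.
Qed.

Lemma sub_measurable_fun d' (T : measurableType d') (A : set I) (f : Omega -> T) :
  measurable_fun setT (f : sub A -> T) -> measurable_fun setT f.
Proof. by move=> mf _ B mB; apply: (@sub_measurable A); exact: mf. Qed.

Lemma sub_measurable_funS d' (T : measurableType d') (A B : set I) (f : Omega -> T) :
  A `<=` B -> measurable_fun setT (f : sub A -> T) ->
  measurable_fun setT (f : sub B -> T).
Proof. by move=> AB mf _ C mC; apply: (sub_subset AB); exact: mf. Qed.

Let FT i : F i setT.
Proof. by have [h0 hC _] := F_sigma i; rewrite -(setD0 setT); exact: hC. Qed.

Let FI i A B : F i A -> F i B -> F i (A `&` B).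
Proof.
move=> FA FB; have [_ _ _ /(_ A B)] := (sigma_algebraP (fun X _ => @subsetT _ X)).1 (F_sigma i).
exact.
Qed.

(** A pi-system generating [sub A], made of the events of which [mutually_independent] speaks
    directly. *)
Let cyl (A : set I) : set_system Omega := [set X | exists r (B : I -> set Omega),
  [/\ uniq r, (forall i, i \in r -> A i /\ F i (B i)) &
      X = \bigcap_(i in [set` r]) B i]].

Let cyl_setI A : setI_closed (cyl A).
Proof.
move=> _ _ [r1 [B1 [u1 h1 ->]]] [r2 [B2 [u2 h2 ->]]].
exists (undup (r1 ++ r2)), (fun i => (if i \in r1 then B1 i else setT) `&`
  (if i \in r2 then B2 i else setT)); split; first exact: undup_uniq.
  move=> i; rewrite mem_undup mem_cat => h; split.
    by case/orP: h => [/h1[]|/h2[]].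
  apply: FI; first by case: ifPn => [/h1[]|].
  by case: ifPn => [/h2[]|].
apply/seteqP; split => w.
  move=> [w1 w2] i _; split; first by case: ifPn => // /w1.
  by case: ifPn => // /w2.
move=> h; split => i /= ir.
  by have [] := h i; rewrite /= ?mem_undup ?mem_cat ?ir.
by have [] := h i; rewrite /= ?mem_undup ?mem_cat ?ir ?orbT.
Qed.

Let cyl_gen A : <<s cyl A >> = <<s \bigcup_(i in A) F i >>.
Proof.
apply/seteqP; split.
  apply: smallest_sub; first exact: smallest_sigma_algebra.
  move=> _ [r [B [ur h ->]]]; rewrite bigcap_seq.
  rewrite big_seq; elim/big_ind : _ => //.
  - exact: (@measurableT _ (sub A)).
  - exact: (@measurableI _ (sub A)).
  - by move=> i /h[Ai FB]; apply: sub_gen_smallest; exists i.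
apply: smallest_sub; first exact: smallest_sigma_algebra.
move=> X [i Ai FX]; apply: sub_gen_smallest; exists [:: i], (fun=> X); split => //.
  by move=> j; rewrite inE => /eqP ->.
by apply/seteqP; split => w /= h; [move=> j _; exact: h|exact: (h i (mem_head _ _))].
Qed.

Let pi_indep (G : set_system Omega) (Y : set Omega) : setI_closed G ->
  <<s G >> `<=` measurable ->
  measurable Y -> (forall X, G X -> P (X `&` Y) = P X * P Y) ->
  forall X, <<s G >> X -> P (X `&` Y) = P X * P Y.
Proof.
move=> GI Gm mY h X GX.
have mm Z : @measurable _ (g_sigma_algebraType G) Z -> @measurable _ Omega Z by exact: Gm.
apply: (@dynkin_induction _ (g_sigma_algebraType G) G
  (fun Z => P (Z `&` Y) = P Z * P Y) erefl GI) => //.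
- by rewrite setTI probability_setT mul1e.
- move=> S /mm mS e; rewrite probability_setC// setIC -setDE measureD//; last first.
    by rewrite ltey_eq fin_num_measure.
  transitivity (P Y - P S * P Y); first by congr (_ - _); rewrite setIC; exact: e.
  rewrite muleBl ?mul1e ?fin_num_measure//.
- move=> S mS tS hS; rewrite setI_bigcupl measure_bigcup//; last 2 first.
    by move=> i _; apply: measurableI => //; exact: mm.
    by apply: trivIset_setIr.
  rewrite measure_bigcup//; last by move=> i _; exact: mm.
  rewrite (eq_eseriesr (fun i _ => hS i)) -[P Y]fineK ?fin_num_measure//.
  rewrite muleC -nneseriesZl//; apply: eq_eseriesr => i _.
  by rewrite muleC.
Qed.

(** Dynkin's argument, applied to each event in turn, reduces the claim to two cylinders. *)
Lemma independent_groups (A B : set I) (X Y : set Omega) :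
  A `<=` D -> B `<=` D -> A `&` B = set0 ->
  @measurable _ (sub A) X -> @measurable _ (sub B) Y ->
  P (X `&` Y) = P X * P Y.
Proof.
move=> AD BD AB mX mY.
have cylm C : <<s cyl C >> `<=` measurable.
  by rewrite cyl_gen; exact: sub_measurable.
have := mX; rewrite /measurable/= -cyl_gen.
apply: (pi_indep (@cyl_setI A) (@cylm A)); first exact: (sub_measurable mY).
move=> {mX}X cX; have mX : measurable X.
  by apply: (cylm A); exact: sub_gen_smallest.
have := mY; rewrite /measurable/= -cyl_gen setIC muleC.
move: Y {mY}; apply: (pi_indep (@cyl_setI B) (@cylm B)) => //.
move=> _ [r2 [B2 [u2 h2 ->]]]; case: cX => r1 [B1 [u1 h1 ->]].
have dis i : i \in r1 -> i \in r2 -> False.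
  move=> /h1[Ai _] /h2[Bi _]; have : (A `&` B) i by []; by rewrite AB.
have E1 : P (\bigcap_(i in [set` r1]) B1 i) = \prod_(i <- r1) P (B1 i).
  by apply: F_indep => // i /h1[/AD].
have E2 : P (\bigcap_(i in [set` r2]) B2 i) = \prod_(i <- r2) P (B2 i).
  by apply: F_indep => // i /h2[/BD].
rewrite E1 E2.
(* The index lists are disjoint, so the two families are glued into one and the independence
   hypothesis is applied to their concatenation. *)
pose C i := if i \in r1 then B1 i else B2 i.
rewrite (_ : _ `&` _ = \bigcap_(i in [set` r1 ++ r2]) C i).
  rewrite F_indep; first last.
  - move=> i; rewrite mem_cat /C; case: ifPn => [/h1[/AD]//|_ /= /h2[/BD]//].
  - rewrite cat_uniq u1 u2 andbT /=; apply/hasPn => i /= i2; apply/negP => i1.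
    exact: dis i1 i2.
  rewrite big_cat/= muleC; congr (_ * _).
    rewrite big_seq [RHS]big_seq; apply: eq_bigr => i i2.
    by rewrite /C; case: ifPn => // /dis/(_ i2).
  by rewrite big_seq [RHS]big_seq; apply: eq_bigr => i i1; rewrite /C i1.
apply/seteqP; split => w.
  move=> [w2 w1] i /=; rewrite mem_cat /C.
  by case: ifPn => [/w1//|_ /= /w2].
move=> h; split => i /= ir.
  have := h i; rewrite /= mem_cat ir orbT => /(_ isT); rewrite /C.
  by case: ifPn => // /dis/(_ ir).
by have := h i; rewrite /= mem_cat ir => /(_ isT); rewrite /C ir.
Qed.

Lemma sub_gen_measurable_fun d' (T : measurableType d') (A : set I) (f : Omega -> T) i :
  A i -> (forall B, measurable B -> F i (f @^-1` B)) ->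
  measurable_fun setT (f : sub A -> T).
Proof.
by move=> Ai mf _ B mB; rewrite setTI; apply: sub_gen_smallest; exists i => //; exact: mf.
Qed.

Lemma sub_id_measurable (A : set I) : measurable_fun setT (id : Omega -> sub A).
Proof. by move=> _ X mX; rewrite setTI; exact: sub_measurable mX. Qed.

(** [freezing_fun] for the identity map, seen once with values in [sub A] and once in [sub B]:
    measurability of [h] on the product says that each coordinate depends on its own sources. *)
Lemma freezing (A B : set I) (h : sub A * sub B -> \bar R) :
  A `<=` D -> B `<=` D -> A `&` B = set0 ->
  measurable_fun setT h -> (forall z, 0 <= h z) ->
  \int[P]_w h (w, w) = \int[P]_w \int[P]_w' h (w, w').
Proof.
move=> AD BD AB mh h0.
apply: (@freezing_fun _ _ _ P _ _ (sub A) (sub B) id id) => //.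
- exact: sub_id_measurable.
- exact: sub_id_measurable.
- by move=> X Y mX mY; apply: (independent_groups AD BD AB).
Qed.

(** * Laplace transforms of conditionally independent sums *)

Section laplace_product.
Variables (J : countType) (e : J -> I) (A : set I) (K : set J).
Variables (S C E : J -> Omega -> \bar R) (Z : Omega -> \bar R).
Hypothesis e_inj : injective e.
Hypothesis AD : A `<=` D.
Hypothesis eD : forall j, K j -> D (e j).
Hypothesis eA : forall j, K j -> ~ A (e j).
Hypothesis mS : forall j B, measurable B -> F (e j) (S j @^-1` B).
Hypothesis S0 : forall j w, 0 <= S j w.
Hypothesis mC : forall j, measurable_fun setT (C j : sub A -> \bar R).
Hypothesis C0 : forall j w, 0 <= C j w.
Hypothesis mE : forall j, measurable_fun setT (E j : sub A -> \bar R).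
Hypothesis E0 : forall j w, 0 <= E j w.
Hypothesis mZ : measurable_fun setT (Z : sub A -> \bar R).
Hypothesis Z01 : forall w, 0 <= Z w <= 1.
Hypothesis frozen : forall j w, K j ->
  \int[P]_w' enexp (C j w * S j w') = enexp (E j w).

(** One variable [S j] is integrated out at a time, everything else being frozen. The factor [Y] is
    general so that it can absorb [enexp (E j w)] before the induction hypothesis is used. *)
Let finite_product (r : seq J) (Y : Omega -> \bar R) : uniq r ->
  (forall j, j \in r -> K j) ->
  measurable_fun setT (Y : sub A -> \bar R) -> (forall w, 0 <= Y w) ->
  \int[P]_w (Y w * enexp (\sum_(j <- r) C j w * S j w)) =
  \int[P]_w (Y w * enexp (\sum_(j <- r) E j w)).
Proof.
elim: r Y => [|j r ih] Y.
  by move=> _ _ mY Y0; apply: eq_integral => w _; rewrite !big_nil.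
move=> /andP[jr ur] rK mY Y0.
have CS0 i w : 0 <= C i w * S i w by rewrite mule_ge0.
pose B := A `|` [set e i | i in [set` r]].
have AB : A `<=` B by left.
have mCS i : i \in r -> measurable_fun setT ((fun w => C i w * S i w) : sub B -> \bar R).
  move=> ir; apply: emeasurable_funM; first exact: sub_measurable_funS (mC i).
  by apply: (@sub_gen_measurable_fun _ _ _ _ (e i)) => [|? /mS//]; right; exists i.
pose Y' w := Y w * enexp (\sum_(i <- r) C i w * S i w).
have mY' : measurable_fun setT (Y' : sub B -> \bar R).
  apply: emeasurable_funM; first exact: sub_measurable_funS mY.
  apply: measurableT_comp; first exact: measurable_enexp.
  rewrite (_ : (fun _ => _) = fun w => \sum_(i <- r) (if i \in r then C i w * S i w else 0)).
    apply: emeasurable_sum => i; have [/mCS//|_] := boolP (i \in r).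
    exact: measurable_cst.
  by apply/funext => w; rewrite big_seq [RHS]big_seq; apply: eq_bigr => i ->.
pose h (z : sub B * sub [set e j]) := Y' z.1 * enexp (C j z.1 * S j z.2).
have mh : measurable_fun setT h.
  apply: emeasurable_funM.
    by apply: (@measurableT_comp _ _ _ _ _ _ (Y' : sub B -> \bar R)).
  apply: measurableT_comp; first exact: measurable_enexp.
  apply: emeasurable_funM.
    apply: (@measurableT_comp _ _ _ _ _ _ (C j : sub B -> \bar R)) => //.
    exact: sub_measurable_funS (mC j).
  apply: (@measurableT_comp _ _ _ _ _ _ (S j : sub [set e j] -> \bar R)) => //.
  exact: (@sub_gen_measurable_fun _ _ _ _ (e j) erefl (@mS j)).
have h0 z : 0 <= h z by rewrite mule_ge0 ?mule_ge0 ?enexp_ge0.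
transitivity (\int[P]_w h (w, w)).
  apply: eq_integral => w _; rewrite big_cons enexpD//; last exact: sume_ge0.
  by rewrite /h/= /Y' [X in _ * X]muleC muleA.
rewrite freezing//; last 3 first.
- by move=> _ [/AD//|[i /= ir <-]]; apply/eD/rK; rewrite inE ir orbT.
- by move=> _ ->; apply/eD/rK; rewrite mem_head.
- apply/seteqP; split => // i [Bi ij]; move: Bi; rewrite ij.
  case=> [/eA|[k /= kr /e_inj kj]]; first by apply; apply/rK; rewrite mem_head.
  by move: jr; rewrite -kj kr.
rewrite (eq_integral (fun w => (Y w * enexp (E j w)) * enexp (\sum_(i <- r) C i w * S i w))).
  rewrite ih//.
  - by apply: eq_integral => w _; rewrite big_cons enexpD// ?muleA//; exact: sume_ge0.
  - by move=> i ir; apply: rK; rewrite inE ir orbT.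
  - by apply: emeasurable_funM => //; apply: measurableT_comp => //; exact: measurable_enexp.
  - by move=> w; rewrite mule_ge0 ?enexp_ge0.
move=> w _; rewrite /h/= ge0_integralZl//.
- by rewrite (frozen _ (rK _ (mem_head _ _))) /Y' -[LHS]muleA -[RHS]muleA; congr (_ * _); exact: muleC.
- apply: measurableT_comp; first exact: measurable_enexp.
  by apply: measurable_funeM => _ U mU; rewrite setTI; apply/F_meas/mS.
- by move=> w' _; exact: enexp_ge0.
- by rewrite mule_ge0 ?enexp_ge0.
Qed.

(** Conditionally on the sources in [A] the transform of the sum is a product, so the exponents
    [E j] add up. Finite products pass to the limit by bounded convergence, which is why [Z] is kept
    in [[0, 1]]. *)
Lemma laplace_product :
  \int[P]_w (Z w * enexp (\esum_(j in K) (C j w * S j w))) =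
  \int[P]_w (Z w * enexp (\esum_(j in K) E j w)).
Proof.
pose g (n : nat) : option J := if pickle_inv n is Some j then
  (if j \in K then Some j else None) else None.
have gK : ocancel g pickle.
  move=> n; rewrite /g; case En : pickle_inv => [j|]//=; case: ifPn => //= _.
  by have := @pickle_invK J n; rewrite En.
pose r n := pmap g (iota 0 n).
have ur n : uniq (r n) by rewrite (pmap_uniq gK)// iota_uniq.
have rK n j : j \in r n -> K j.
  rewrite mem_pmap => /mapP[m _]; rewrite /g; case: pickle_inv => // i.
  by case: ifPn => // /set_mem Ki [->].
have sumr (f : J -> \bar R) : (forall j, 0 <= f j) ->
    \sum_(j <- r n) f j @[n --> \oo] --> \esum_(j in K) f j.
  move=> f0; rewrite esum_countE//.
  rewrite (_ : (fun n => _) = fun n => \sum_(0 <= i < n) match pickle_inv i with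
    | Some j => if j \in K then f j else 0 | None => 0 end).
    by apply: is_cvg_nneseries => n _ _; case: pickle_inv => // j; case: ifPn.
  apply/funext => n; rewrite /r /index_iota subn0; elim: (iota 0 n) => [|m s ihs].
    by rewrite !big_nil.
  rewrite /= big_cons -ihs /g; case: pickle_inv => [j|] /=; last by rewrite add0e.
  by case: ifPn => _ /=; rewrite ?big_cons ?add0e.
have CS0 i w : 0 <= C i w * S i w by rewrite mule_ge0.
have mCS i : measurable_fun [set: Omega] (fun w => C i w * S i w).
  apply: emeasurable_funM; first exact: sub_measurable_fun (mC i).
  by move=> _ B mB; rewrite setTI; apply/F_meas/mS.
have lim (f : J -> Omega -> \bar R) : (forall j w, 0 <= f j w) ->
    (forall j, measurable_fun [set: Omega] (f j)) ->
    \int[P]_w (Z w * enexp (\sum_(j <- r n) f j w)) @[n --> \oo] -->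
    \int[P]_w (Z w * enexp (\esum_(j in K) f j w)).
  move=> f0 mf; have mZ' : measurable_fun [set: Omega] Z by exact: sub_measurable_fun mZ.
  apply: bounded_cvg_integral.
  - move=> n; apply: emeasurable_funM => //.
    apply: measurableT_comp; first exact: measurable_enexp.
    exact: emeasurable_sum.
  - apply: emeasurable_funM => //.
    apply: measurableT_comp; first exact: measurable_enexp.
    apply: measurable_esum => // j; case: (pselect (K j)) => Kj.
      by rewrite (_ : [set _ | _] = setT)//; apply/seteqP; split.
    by rewrite (_ : [set _ | _] = set0)//; apply/seteqP; split.
  - move=> n w; have /andP[z0 z1] := Z01 w.
    have s0 : 0 <= \sum_(j <- r n) f j w by exact: sume_ge0.
    by rewrite mule_ge0 ?enexp_ge0//= -[leRHS]mule1 lee_pmul ?enexp_ge0 ?enexp_le1.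
  - apply: nearW => w; apply: cvgeZl.
      have /andP[z0 z1] := Z01 w; rewrite ge0_fin_numE//.
      by apply: (le_lt_trans z1); rewrite ltry.
    apply: cvg_enexp; [|exact: esum_ge0|exact: sumr].
    by apply: nearW => n; exact: sume_ge0.
have := lim _ CS0 mCS; have mE' j : measurable_fun [set: Omega] (E j).
  exact: sub_measurable_fun (mE j).
have := lim _ E0 mE'.
rewrite (_ : (fun n => \int[P]_w (Z w * enexp (\sum_(j <- r n) C j w * S j w))) =
  (fun n => \int[P]_w (Z w * enexp (\sum_(j <- r n) E j w)))); last first.
  apply/funext => n; apply: finite_product => //; first exact: rK.
  by move=> w; have /andP[] := Z01 w.
by move=> h1 h2; apply: (cvg_unique _ h2 h1).
Qed.

End laplace_product.

End sub_sigma_algebras.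

(** * Poisson point processes *)

Section natural_valued.
Context d (Omega : measurableType d) (R : realType) (P : probability Omega R).
Local Open Scope ereal_scope.

(** The point masses exhaust the probability, so the complement of the events [N = n], where [N] may
    be infinite, is null. *)
Lemma integral_natural_valued (N : Omega -> \bar R) (phi : \bar R -> \bar R) :
  measurable_fun setT N -> measurable_fun setT phi -> (forall x, 0 <= phi x) ->
  \sum_(n <oo) P [set w | N w = n%:R%:E] = 1 ->
  \int[P]_w phi (N w) = \sum_(n <oo) phi n%:R%:E * P [set w | N w = n%:R%:E].
Proof.
move=> mN mphi phi0 s1; pose B n := [set w | N w = n%:R%:E].
have mB n : measurable (B n).
  by have := mN measurableT _ (emeasurable_set1 n%:R%:E); rewrite setTI.
have tB : trivIset setT B.
  apply/trivIsetP => i j _ _ ij; apply/seteqP; split => // w [].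
  rewrite /B /= => -> [/eqP]; by rewrite eqr_nat (negbTE ij).
have mU : measurable (\bigcup_n B n) by exact: bigcup_measurable.
have U1 : P (\bigcup_n B n) = 1.
  by rewrite measure_bigcup//; rewrite -[RHS]s1; apply: eq_eseriesl => n; rewrite in_setT.
have mphiN : measurable_fun setT (fun w => phi (N w)) by exact: measurableT_comp.
transitivity (\int[P]_(w in \bigcup_n B n) phi (N w)).
  rewrite -[X in \int[P]_(w in X) _](setvU (\bigcup_n B n)) ge0_integral_setU//; last 3 first.
  - exact: measurableC.
  - exact: measurable_funTS.
  - by apply/disj_set2P; rewrite setICl.
  rewrite [X in X + _](_ : _ = 0) ?add0e//.
  have mC : measurable (~` (\bigcup_n B n)) by exact: measurableC.
  have P0 : P (~` (\bigcup_n B n)) = 0 by rewrite probability_setC// U1 subee.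
  rewrite -[RHS](@integral_abs_eq0 _ _ _ P _ (fun w => phi (N w)) mC _ P0).
    by apply: eq_integral => w _; rewrite gee0_abs.
  exact: measurable_funTS.
rewrite ge0_integral_bigcup//; last exact: measurable_funTS.
apply: eq_eseriesr => n _; rewrite -integral_cst; last exact: mB.
by apply: eq_integral => w /set_mem; rewrite /B /= => ->.
Qed.

End natural_valued.

Section poisson_process.
Context d (Omega : measurableType d) (R : realType) (P : probability Omega R).
Variables (mu : set R -> \bar R) (xi : nat -> Omega -> R).
Hypothesis mxi : forall i, measurable_fun setT (xi i).
Hypothesis ppp : poisson_point_process P mu xi.
Local Open Scope ereal_scope.

Lemma point_countE A w : point_count xi A w = \esum_(i in [set: nat]) (\1_A (xi i w))%:E.
Proof.
by rewrite /point_count counting_dirac nneseries_esumT.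
Qed.

Lemma point_count_ge0 A w : 0 <= point_count xi A w.
Proof. by rewrite point_countE; apply: esum_ge0. Qed.

Lemma measurable_point_count A : measurable A -> measurable_fun setT (point_count xi A).
Proof.
move=> mA; rewrite (_ : point_count xi A = fun w => \esum_(i in [set: nat]) (\1_A (xi i w))%:E).
  apply: measurable_esum => // [i|i].
    by rewrite (_ : [set _ | _] = setT)//; apply/seteqP; split.
  apply/measurable_EFinP; apply: measurableT_comp => //.
by apply/funext => w; exact: point_countE.
Qed.

Lemma sum_poisson_pmf (m : R) : (0 < m)%R -> \sum_(n <oo) (poisson_pmf m n)%:E = 1 :> \bar R.
Proof.
move=> m0; rewrite nneseries_esumT; last by move=> n; rewrite lee_fin poisson_pmf_ge0.
by rewrite -[RHS](@probability_setT _ _ R (poisson_prob m 0)) /= /poisson_prob m0.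
Qed.

Section finite_intensity.
Variables (A : set R) (m : R).
Hypothesis mA : measurable A.
Hypothesis A0 : A `<=` `]0%R, +oo[.
Hypothesis muA : mu A = m%:E.

Let law n : P [set w | point_count xi A w = n%:R%:E] = poisson_prob m 0 [set n].
Proof. by have [/(_ _ mA A0)[+ _] _] := ppp; rewrite muA /= => ->//; rewrite ltry. Qed.

Let law1 : \sum_(n <oo) P [set w | point_count xi A w = n%:R%:E] = 1.
Proof.
rewrite (eq_eseriesr (fun n _ => law n)).
rewrite -[RHS](@probability_setT _ _ R (poisson_prob m 0)).
rewrite [X in _ = poisson_prob m 0 X](_ : _ = \bigcup_n [set n]); last first.
  by apply/seteqP; split => // n _; exists n.
rewrite measure_bigcup//; first by apply: eq_eseriesl => n; rewrite in_setT.
by apply/trivIsetP => i j _ _ /eqP ij; apply/seteqP; split => // n [/= -> ].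
Qed.

Let law_pos n : (0 < m)%R -> poisson_prob m 0 [set n] = (poisson_pmf m n)%:E.
Proof.
by move=> m0; rewrite /poisson_prob m0 esum_set1// lee_fin poisson_pmf_ge0.
Qed.

Let law_nil n : (0 < m)%R = false -> poisson_prob m 0 [set n] = (n == 0%N)%:R%:E :> \bar R.
Proof.
move=> m0; rewrite /poisson_prob m0 diracE.
have -> // : (0%N \in [set n]) = (n == 0%N).
by apply/idP/idP => [/set_mem/= ->//|/eqP ->]; exact/mem_set.
Qed.

Hypothesis m0 : (0 <= m)%R.

Lemma laplace_count_fin (a : R) : (0 <= a)%R ->
  \int[P]_w enexp (a%:E * point_count xi A w) = enexp ((1 - expR (- a)) * m)%:E.
Proof.
move=> a0; rewrite (@integral_natural_valued _ _ _ _ _ (fun x => enexp (a%:E * x)))//; last 3 first.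
- exact: measurable_point_count.
- by apply: measurableT_comp; [exact: measurable_enexp|exact: measurable_funeM].
- by move=> x; exact: enexp_ge0.
rewrite (eq_eseriesr (fun n _ => congr1 (fun x => _ * x) (law n))).
have [mp|mn] := boolP (0 < m)%R; last first.
  have mz : m = 0%R by apply/eqP; rewrite eq_le m0 leNgt mn.
  rewrite (@nneseriesD1 _ _ 0%N)//; last by move=> n _; rewrite mule_ge0 ?enexp_ge0.
  rewrite eseries0; last first.
    by move=> n _ /= n0; rewrite law_nil ?(negbTE n0) ?mule0//; exact/negbTE.
  rewrite law_nil ?(negbTE mn)// eqxx mule1 adde0 mz mule0 mulr0.
  by [].
have ea : (0 < m * expR (- a))%R by rewrite mulr_gt0 ?expR_gt0.
(* Tilting the Poisson weights of parameter [m] by [exp(-a n)] gives those of parameter [m exp(-a)],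
   up to the constant [exp(-(1 - exp(-a)) m)]. *)
transitivity (\sum_(n <oo) (expR (- ((1 - expR (- a)) * m)))%:E * (poisson_pmf (m * expR (- a)) n)%:E).
  apply: eq_eseriesr => n _; rewrite law_pos// /poisson_pmf mp ea /=.
  rewrite -!EFinM; congr (_%:E); rewrite exprMn -expRM_natr mulNr.
  rewrite [RHS]mulrC -!mulrA; rewrite mulrCA; congr (_ * _)%R.
  congr (_ * (_ * _))%R; rewrite -expRD; congr expR.
  by ring.
rewrite nneseriesZl//; last by move=> n _; rewrite lee_fin poisson_pmf_ge0.
by rewrite sum_poisson_pmf// mule1.
Qed.

Lemma mean_count_fin : \int[P]_w point_count xi A w = m%:E.
Proof.
(* The positive part is taken because the test function has to be nonnegative on the whole extended
   line. *)
have -> : \int[P]_w point_count xi A w = \int[P]_w maxe 0 (point_count xi A w).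
  apply: eq_integral => w _; apply/esym/max_idPr; exact: point_count_ge0.
rewrite (@integral_natural_valued _ _ _ _ _ (maxe 0))//; last 3 first.
- exact: measurable_point_count.
- by apply: measurable_maxe.
- by move=> x; rewrite le_max lexx.
rewrite (eq_eseriesr (fun n _ => congr1 (fun x => _ * x) (law n))).
have h n : maxe 0 n%:R%:E = n%:R%:E :> \bar R by apply/max_idPr; rewrite lee_fin.
rewrite (eq_eseriesr (fun n _ => congr1 (fun x => x * _) (h n))).
have [mp|mn] := boolP (0 < m)%R; last first.
  have mz : m = 0%R by apply/eqP; rewrite eq_le m0 leNgt mn.
  rewrite eseries0; first by rewrite mz.
  move=> n _ _; rewrite law_nil; last exact/negbTE.
  by case: n => [|n]; rewrite ?mul0e ?mule0.
rewrite (@nneseries_recl _ xpredT)//=; last by move=> n _; rewrite mule_ge0.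
rewrite [X in X * _](_ : _ = 0)// mul0e add0e.
(* The term of index 0 vanishes and [(n + 1)] times the weight of [n + 1] is [m] times the weight of
   [n]. *)
transitivity (\sum_(n <oo) m%:E * (poisson_pmf m n)%:E).
  rewrite -(@nneseries_addn _ _ 1); last first.
    by move=> n; rewrite mule_ge0.
  apply: eq_eseriesr => n _; rewrite law_pos// addn1 -!EFinM; congr (_%:E).
  rewrite /poisson_pmf mp exprS factS natrM invfM.
  rewrite -!mulrA mulrCA; congr (_ * _)%R; rewrite mulrCA; congr (_ * _)%R.
  by rewrite !mulrA mulfV ?mul1r// pnatr_eq0.
rewrite nneseriesZl//; last by move=> n _; rewrite lee_fin poisson_pmf_ge0.
by rewrite sum_poisson_pmf// mule1.
Qed.

End finite_intensity.

Hypothesis mu0 : forall A, 0 <= mu A.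

Lemma mean_count_le (A : set R) : measurable A -> A `<=` `]0%R, +oo[ ->
  \int[P]_w point_count xi A w <= mu A.
Proof.
move=> mA A0; have := mu0 A; case E : (mu A) => [m||]//; rewrite ?leey// lee_fin => m0.
by rewrite (mean_count_fin mA A0 E).
Qed.

Lemma infinite_count (A : set R) : measurable A -> A `<=` `]0%R, +oo[ -> mu A = +oo ->
  {ae P, forall w, point_count xi A w = +oo}.
Proof.
move=> mA A0 E; have [/(_ _ mA A0)[_ /(_ E) h] _] := ppp.
have mS : measurable [set w | point_count xi A w = +oo].
  have := measurable_point_count mA measurableT (emeasurable_set1 +oo).
  by rewrite setTI.
exists (~` [set w | point_count xi A w = +oo]); split => //.
  exact: measurableC.
by rewrite probability_setC// h subee.
Qed.

Lemma laplace_count (A : set R) (a : R) : measurable A -> A `<=` `]0%R, +oo[ -> (0 <= a)%R ->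
  \int[P]_w enexp (a%:E * point_count xi A w) = enexp ((1 - expR (- a))%:E * mu A).
Proof.
move=> mA A0 a0; have := mu0 A; case E : (mu A) => [m||]//.
  by rewrite lee_fin => m0; rewrite (laplace_count_fin mA A0 E)// -EFinM.
(* Infinite intensity: for [a = 0] both exponents are 0 by the convention [0 * +oo = 0]; for [a > 0]
   the count is almost surely infinite and both sides vanish. *)
move=> _; have [<-|an] := eqVneq 0%R a.
  rewrite oppr0 expR0 subrr mul0e enexp0.
  rewrite (eq_integral (fun=> 1)); last by move=> w _; rewrite mul0e enexp0.
  by rewrite integral_cst// mul1e; exact: probability_setT.
have ap : (0 < a)%R by rewrite lt_neqAle an.
rewrite gt0_muley; last first.
  by rewrite lte_fin subr_gt0 -[ltRHS]expR0 ltr_expR oppr_lt0.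
rewrite /= -[RHS](@integral0 _ _ _ P setT).
apply: ge0_ae_eq_integral => //.
- apply: measurableT_comp; first exact: measurable_enexp.
  by apply: measurable_funeM; exact: measurable_point_count.
- by move=> w _; exact: enexp_ge0.
- by apply: filterS (infinite_count mA A0 E) => w + _ => ->; rewrite gt0_muley.
Qed.

(** [laplace_product] without conditioning, that is with [A = set0] and [Z = 1]: counts in disjoint
    sets are independent sources, each with the transform of [laplace_count]. *)
Lemma laplace_steps (A : nat -> set R) (a : nat -> R) :
  (forall j, measurable (A j) /\ A j `<=` `]0%R, +oo[) -> trivIset setT A ->
  (forall j, (0 <= a j)%R) ->
  \int[P]_w enexp (\esum_(j in [set: nat]) ((a j)%:E * point_count xi (A j) w)) =
  enexp (\esum_(j in [set: nat]) ((1 - expR (- a j))%:E * mu (A j))).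
Proof.
move=> hA tA a0; have [_ /(_ _ hA tA) ind] := ppp.
have mA j := (hA j).1; have A0 j := (hA j).2.
have e0 j : 0 <= (1 - expR (- a j))%:E :> \bar R.
  by rewrite lee_fin subr_ge0 -[leRHS]expR0 ler_expR oppr_le0.
pose F i := preimage_set_system setT (point_count xi (A i)) measurable.
have Fs i : sigma_algebra setT (F i).
  exact: (sigma_algebra_preimage setT (point_count xi (A i)) (sigma_algebra_measurable _)).
have Fm i : F i `<=` measurable.
  by move=> _ [B mB <-]; apply: measurable_point_count.
have := @laplace_product _ _ R P nat setT F Fs Fm ind nat id set0 setT
  (fun j => point_count xi (A j)) (fun j _ => (a j)%:E)
  (fun j _ => (1 - expR (- a j))%:E * mu (A j)) (fun=> 1).
have one (c : \bar R) : \int[P]_w (1 * c) = c.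
  transitivity (c * P setT); last by rewrite probability_setT mule1.
  by rewrite -integral_cst//; apply: eq_integral => w _; rewrite mul1e.
rewrite one; under eq_integral do rewrite mul1e.
apply => //.
- by move=> j _ [].
- by move=> j B mB; exists B => //; rewrite setTI.
- by move=> j w; rewrite lee_fin.
- by move=> j w; rewrite mule_ge0.
- by move=> w; rewrite lexx lee01.
- by move=> j w _; exact: laplace_count.
Qed.

End poisson_process.

Section esum_single.
Context {R : realType}.
Local Open Scope ereal_scope.

Lemma esum_single (I : choiceType) (f : I -> \bar R) (i : I) :
  0 <= f i -> (forall j, j != i -> f j = 0) -> \esum_(j in [set: I]) f j = f i.
Proof.
move=> fi fj; rewrite -[RHS]esum_set1// [RHS]esum_mkcond; apply: eq_esum => j _.
have [->|ji] := eqVneq j i; first by rewrite mem_set.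
by rewrite memNset ?fj//= => e; move: ji; rewrite e eqxx.
Qed.

End esum_single.

(** * The Laplace functional of a Poisson process with a density *)

Section laplace_functional.
Context d (Omega : measurableType d) (R : realType) (P : probability Omega R).
Variables (mu : set R -> \bar R) (xi : nat -> Omega -> R) (rho h : R -> R).
Hypothesis mxi : forall i, measurable_fun setT (xi i).
Hypothesis ppp : poisson_point_process P mu xi.
Hypothesis xi_gt0 : {ae P, forall w, forall i, 0 < xi i w}.
Hypothesis mrho : measurable_fun setT rho.
Hypothesis rho0 : forall t, 0 <= rho t.
Local Notation leb := (@lebesgue_measure R).
Hypothesis muE : forall A, mu A = (\int[leb]_(t in A) (rho t)%:E)%E.
Hypothesis mh : measurable_fun setT h.
Hypothesis h0 : forall t, 0 <= h t.
Local Open Scope ereal_scope.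

(** [hn n] rounds [h] down to a multiple of [2^-n]. It takes countably many values, so its sum over
    the points is a countable combination of counts in disjoint level sets. *)
Let lev n (t : R) := Num.truncn (2 ^+ n * h t)%R.

Let hn n t : R := ((lev n t)%:R / 2 ^+ n)%R.

Let lev_itv n t : ((lev n t)%:R <= 2 ^+ n * h t < (lev n t).+1%:R)%R.
Proof. by apply: truncn_itv; rewrite mulr_ge0// ltW. Qed.

Let hn_ge0 n t : (0 <= hn n t)%R.
Proof. by rewrite /hn divr_ge0// ltW. Qed.

Let hn_le n t : (hn n t <= h t)%R.
Proof. by rewrite /hn ler_pdivrMr// mulrC; have /andP[] := lev_itv n t. Qed.

Let hn_gt n t : (h t < hn n t + (2 ^+ n)^-1)%R.
Proof.
rewrite /hn -[X in (_ + X)%R]mul1r -mulrDl ltr_pdivlMr// mulrC -natr1 addrC natr1.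
by have /andP[] := lev_itv n t; rewrite addrC natr1.
Qed.

Let hn_mono t n m : (n <= m)%N -> (hn n t <= hn m t)%R.
Proof.
move=> nm; suff /nondecreasing_seqP : forall k, ((hn ^~ t) k <= (hn ^~ t) k.+1)%R by exact.
move=> k; rewrite /hn.
rewrite ler_pdivrMr// mulrAC ler_pdivlMr// exprS mulrA [(_ * 2)%R]mulrC -natrM.
apply: ler_wpM2r; first exact: ltW.
rewrite ler_nat -ltnS -(ltr_nat R).
have /andP[a _] := lev_itv k t; have /andP[_ b] := lev_itv k.+1 t.
apply: le_lt_trans b; rewrite natrM exprS -mulrA; apply: ler_wpM2l => //.
Qed.

Let hn_cvg t : hn n t @[n --> \oo] --> h t.
Proof.
apply: (@squeeze_cvgr _ _ _ _ (fun n => h t - (2 ^+ n)^-1)%R (cst (h t))).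
- by apply: nearW => n; rewrite /= hn_le lerBlDr ltW// hn_gt.
- rewrite -[X in _ --> X]subr0; apply: cvgB; first exact: cvg_cst.
  have := @cvg_geometric R 1 2^-1 _; rewrite /geometric/=.
  have -> : (fun n => 1 * 2^-1 ^+ n)%R = (fun n : nat => ((2 : R) ^+ n)^-1)%R.
    by apply/funext => n; rewrite mul1r exprVn.
  by apply; rewrite ger0_norm ?invr_ge0// invf_lt1// ltr1n.
- exact: cvg_cst.
Qed.

Let A n j := [set t : R | (0 < t)%R /\ lev n t = j].

Let mlev n j : measurable [set t | lev n t = j].
Proof.
rewrite (_ : [set _ | _] = (fun t => 2 ^+ n * h t)%R @^-1` `[j%:R, j.+1%:R[).
  rewrite -[X in measurable X]setTI; apply: measurable_funM => //; exact: measurable_itv.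
apply/seteqP; split => t /=; rewrite in_itv/=; first by move=> <-; exact: lev_itv.
by move=> jh; apply: truncn_def.
Qed.

Let mA n j : measurable (A n j).
Proof.
rewrite (_ : A n j = `]0%R, +oo[ `&` [set t | lev n t = j]).
  by apply: measurableI.
by apply/seteqP; split => t; rewrite /A /= in_itv /= andbT.
Qed.

Let A0 n j : A n j `<=` `]0%R, +oo[.
Proof. by move=> t [t0 _] /=; rewrite in_itv /= t0. Qed.

Let tA n : trivIset setT (A n).
Proof.
apply/trivIsetP => i j _ _ /eqP ij; apply/seteqP; split => // t [[_ a] [_ b]].
by apply: ij; rewrite -a -b.
Qed.

Let step_sum n t (phi : nat -> R) : (0 < t)%R -> (0 <= phi (lev n t))%R ->
  \esum_(j in [set: nat]) ((phi j)%:E * (\1_(A n j) t)%:E) = (phi (lev n t))%:E.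
Proof.
move=> t0 p0; rewrite (@esum_single _ _ _ (lev n t)).
- by rewrite indicE mem_set ?mule1.
- by rewrite mule_ge0.
- move=> j jl; rewrite indicE memNset ?mule0// => -[_ e].
  by move: jl; rewrite -e eqxx.
Qed.

Let mhn n : measurable_fun setT (hn n).
Proof.
have h1 j : measurable_fun setT (\1_[set t | lev n t = j] : R -> R).
  exact: measurable_indic.
have -> : hn n = fun t => fine (\esum_(j in [set: nat])
    ((j%:R / 2 ^+ n)%:E * (\1_[set t | lev n t = j] t)%:E)).
  apply/funext => t; rewrite (@esum_single _ _ _ (lev n t)).
  - by rewrite indicE mem_set ?mule1.
  - by rewrite mule_ge0// lee_fin divr_ge0// ltW.
  - move=> j jl; rewrite indicE memNset ?mule0// => e.
    by move: jl; rewrite -e eqxx.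
apply: measurableT_comp; first exact: fine_measurable.
apply: measurable_esum => [i|i|i t].
- by rewrite (_ : [set _ | _] = setT)//; apply/seteqP; split.
- by apply: measurable_funeM; exact/measurable_EFinP.
- by rewrite mule_ge0// lee_fin divr_ge0// ltW.
Qed.

Let e0 (x : R) : (0 <= x)%R -> (0 <= 1 - expR (- x))%R.
Proof. by move=> x0; rewrite subr_ge0 -[leRHS]expR0 ler_expR oppr_le0. Qed.

Let mpos : measurable (`]0%R, +oo[%classic : set R). Proof. exact: measurable_itv. Qed.

Let step_laplace n :
  \int[P]_w enexp (\esum_(i in [set: nat]) (hn n (xi i w))%:E) =
  enexp (\int[leb]_(t in `]0%R, +oo[) ((1 - expR (- hn n t)) * rho t)%:E).
Proof.
have mu0 B : 0 <= mu B by rewrite muE; apply: integral_ge0 => t _; rewrite lee_fin.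
have a0 j : (0 <= j%:R / 2 ^+ n :> R)%R by rewrite divr_ge0// ltW.
have := @laplace_steps _ _ R P mu xi mxi ppp mu0 (A n) (fun j => j%:R / 2 ^+ n)%R
  (fun j => conj (mA n j) (@A0 n j)) (@tA n) a0.
congr (_ = _).
- apply: ge0_ae_eq_integral => //.
  + apply: measurableT_comp; first exact: measurable_enexp.
    apply: measurable_esum => [i|i|i w].
    * by rewrite (_ : [set _ | _] = setT)//; apply/seteqP; split.
    * by apply: measurable_funeM; exact: measurable_point_count.
    * by rewrite mule_ge0 ?lee_fin ?point_count_ge0.
  + apply: measurableT_comp; first exact: measurable_enexp.
    apply: measurable_esum => [i|i|i w].
    * by rewrite (_ : [set _ | _] = setT)//; apply/seteqP; split.
    * by apply/measurable_EFinP; exact: measurableT_comp.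
    * by rewrite lee_fin.
  + by move=> w _; exact: enexp_ge0.
  + by move=> w _; exact: enexp_ge0.
  + apply: filterS xi_gt0 => w x0 _; congr enexp.
    transitivity (\esum_(j in [set: nat]) (\esum_(i in [set: nat])
        (((j%:R / 2 ^+ n)%R%:E : \bar R) * (\1_(A n j) (xi i w))%:E))).
      by apply: eq_esum => j _; rewrite point_countE ge0_esumZl.
    rewrite esum_exchange; last by move=> *; rewrite mule_ge0// lee_fin.
    by apply: eq_esum => i _; rewrite (@step_sum n _ (fun j => j%:R / 2 ^+ n)%R).
- congr enexp.
  transitivity (\esum_(j in [set: nat]) (\int[leb]_(t in `]0%R, +oo[)
      ((1 - expR (- (j%:R / 2 ^+ n)))%:E * (\1_(A n j) t)%:E * (rho t)%:E))).
    apply: eq_esum => j _; rewrite muE -ge0_integralZl//; last 3 first.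
    + exact: mA.
    + by apply/measurable_EFinP; exact: measurable_funTS.
    + by move=> t _; rewrite lee_fin.
    have eA : A n j = `]0%R, +oo[ `&` A n j by rewrite setIC; apply/esym/setIidl; exact: A0.
    rewrite [in LHS]eA integral_mkcondr; apply: eq_integral => t _.
    rewrite patchE indicE; case: ifPn => tA'; first by rewrite mule1.
    by rewrite mule0 mul0e.
  rewrite -integral_esum//; last 2 first.
  + move=> j _; apply: measurable_funTS; apply: emeasurable_funM.
      by apply: measurable_funeM; apply/measurable_EFinP; apply: measurable_indic; exact: mA.
    exact/measurable_EFinP.
  + by move=> j t _ _; rewrite !mule_ge0 ?lee_fin ?e0.
  apply: eq_integral => t /set_mem /=; rewrite in_itv/= andbT => t0.
  under eq_esum do rewrite muleC.
  rewrite ge0_esumZl; last 2 first.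
  + by rewrite lee_fin.
  + by move=> j _; rewrite mule_ge0 ?lee_fin ?e0.
  rewrite (@step_sum n _ (fun j => 1 - expR (- (j%:R / 2 ^+ n)))%R)//.
  by rewrite muleC EFinM.
Qed.

(** The identity for [hn n] passes to the limit by monotone convergence on both sides: against the
    counting measure of the points for the sum, against Lebesgue measure for the exponent, as
    [1 - exp(-x)] is increasing. *)
Theorem laplace_functional :
  \int[P]_w enexp (\esum_(i in [set: nat]) (h (xi i w))%:E) =
  enexp (\int[leb]_(t in `]0%R, +oo[) ((1 - expR (- h t)) * rho t)%:E).
Proof.
have sum0 (f : R -> R) w : (forall t, (0 <= f t)%R) ->
  0 <= \esum_(i in [set: nat]) (f (xi i w))%:E by move=> f0; apply: esum_ge0 => i _; rewrite lee_fin.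
have msum (f : R -> R) : measurable_fun setT f -> (forall t, (0 <= f t)%R) ->
    measurable_fun setT (fun w => enexp (\esum_(i in [set: nat]) (f (xi i w))%:E)).
  move=> mf f0; apply: measurableT_comp; first exact: measurable_enexp.
  apply: measurable_esum => [i|i|i w].
  - by rewrite (_ : [set _ | _] = setT)//; apply/seteqP; split.
  - by apply/measurable_EFinP; exact: measurableT_comp.
  - by rewrite lee_fin.
have l1 : \int[P]_w enexp (\esum_(i in [set: nat]) (hn n (xi i w))%:E) @[n --> \oo] -->
    \int[P]_w enexp (\esum_(i in [set: nat]) (h (xi i w))%:E).
  apply: bounded_cvg_integral.
  - by move=> n; exact: msum.
  - exact: msum.
  - by move=> n w; rewrite enexp_ge0 enexp_le1// sum0.
  - apply: nearW => w; apply: cvg_enexp.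
    + by apply: nearW => n; exact: sum0.
    + exact: sum0.
    have cE (f : nat -> \bar R) : (forall i, 0 <= f i) ->
        \esum_(i in [set: nat]) f i = \int[counting]_i f i.
      by move=> f0; rewrite ge0_integral_count// nneseries_esumT.
    rewrite cE; last by move=> i; rewrite lee_fin.
    have -> : (fun n => \esum_(i in [set: nat]) (hn n (xi i w))%:E) =
        (fun n => \int[counting]_i (hn n (xi i w))%:E).
      by apply/funext => n; apply: cE => i; rewrite lee_fin.
    rewrite (_ : \int[_]_i (h _)%:E = \int[counting]_i limn (fun n => (hn n (xi i w))%:E)).
      apply: cvg_monotone_convergence => //.
      - by move=> n i _; rewrite lee_fin.
      - by move=> i _ n m nm; rewrite lee_fin hn_mono.
    apply: eq_integral => i _; apply/esym/cvg_lim => //.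
    by apply: cvg_EFin; [exact: nearW|exact: hn_cvg].
have l2 : enexp (\int[leb]_(t in `]0%R, +oo[) ((1 - expR (- hn n t)) * rho t)%:E) @[n --> \oo] -->
    enexp (\int[leb]_(t in `]0%R, +oo[) ((1 - expR (- h t)) * rho t)%:E).
  apply: cvg_enexp.
  - by apply: nearW => n; apply: integral_ge0 => t _; rewrite lee_fin mulr_ge0// e0.
  - by apply: integral_ge0 => t _; rewrite lee_fin mulr_ge0// e0.
  rewrite (_ : \int[_]_(t in _) _ = \int[leb]_(t in `]0%R, +oo[)
      limn (fun n => ((1 - expR (- hn n t)) * rho t)%:E)).
    apply: cvg_monotone_convergence => //.
    - move=> n; apply/measurable_EFinP; apply: measurable_funTS.
      apply: measurable_funM => //; apply: measurable_funB => //.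
      apply: measurableT_comp; first exact: measurable_expR.
      by apply: measurableT_comp => //; exact: mhn.
    - by move=> n t _; rewrite lee_fin mulr_ge0// e0.
    - move=> t _ n m nm; rewrite lee_fin ler_wpM2r// lerD2l lerN2 ler_expR lerN2.
      exact: hn_mono.
  apply: eq_integral => t _; apply/esym/cvg_lim => //.
  apply: cvg_EFin; first exact: nearW.
  apply: cvgMr_tmp; apply: cvgB; first exact: cvg_cst.
  by apply: continuous_cvg; [exact: continuous_expR|apply: cvgN; exact: hn_cvg].
have e : (fun n => \int[P]_w enexp (\esum_(i in [set: nat]) (hn n (xi i w))%:E)) =
    (fun n => enexp (\int[leb]_(t in `]0%R, +oo[) ((1 - expR (- hn n t)) * rho t)%:E)).
  by apply/funext => n; exact: step_laplace.
by rewrite e in l1; exact: (cvg_unique _ l1 l2).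
Qed.

End laplace_functional.

(** * Stable weights *)

Section stable_integral.
Context {R : realType}.
Local Notation leb := (@lebesgue_measure R).
Implicit Types a b c x y s t v : R.

Lemma measurable_powRr a : measurable_fun setT (fun t : R => t `^ a).
Proof. exact: measurable_powR. Qed.

Lemma continuous_powR_gt0 a x : 0 < x -> {for x, continuous (fun t : R => t `^ a)}.
Proof.
move=> x0; apply: differentiable_continuous; apply/derivable1_diffP.
by apply: derivable_powR; rewrite in_itv/= x0.
Qed.

Lemma powR_derive a x : 0 < x ->
  derivable (fun t : R => t `^ a) x 1 /\ derive1 (fun t : R => t `^ a) x = a * x `^ (a - 1).
Proof.
move=> x0; have h := is_derive1_powR a x0; split; first by case: h.
by rewrite derive1E; case: h.
Qed.

Lemma cvg_powR_oo a : 0 < a -> t `^ (- a) @[t --> +oo] --> (0 : R).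
Proof.
move=> a0; apply/cvgrPdist_le => /= e e0.
near=> t; have t0 : 0 < t by near: t; exact: nbhs_pinfty_gt.
rewrite sub0r normrN ger0_norm ?powR_ge0// powRN -[leRHS]invrK lef_pV2 ?posrE ?invr_gt0 ?powR_gt0//.
have -> : e^-1 = (e^-1 `^ a^-1) `^ a.
  by rewrite -powRrM mulVf ?powRr1 ?gt_eqF// invr_ge0 ltW.
apply: ge0_ler_powR; rewrite ?nnegrE ?powR_ge0 ?ltW//.
Unshelve. all: by end_near. Qed.

Lemma integral_powR_tail a y : 0 < a -> 0 < y ->
  (\int[leb]_(t in `[y, +oo[) (t `^ (- 1 - a))%:E = (y `^ (- a) / a)%:E)%E.
Proof.
move=> a0 y0; pose F t : R := (- a)^-1 * t `^ (- a).
have dF x : 0 < x -> is_derive x 1 F (x `^ (- 1 - a)).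
  move=> x0; have [d1 d2] := powR_derive (- a) x0.
  have -> : x `^ (- 1 - a) = (- a)^-1 *: ((- a) * x `^ (- a - 1)).
    by rewrite /GRing.scale/= mulrA mulVf ?mul1r ?oppr_eq0 ?gt_eqF// addrC.
  apply: is_deriveZ; have := is_derive1_powR (- a) x0; exact.
rewrite (@ge0_continuous_FTC2y _ _ F y 0).
- rewrite -EFinB sub0r /F; congr EFin.
  by rewrite invrN mulNr opprK mulrC.
- by move=> x _; rewrite powR_ge0.
- apply: continuous_in_subspaceT => x; rewrite inE/= in_itv/= andbT => yx.
  by apply: continuous_powR_gt0; exact: lt_le_trans yx.
- rewrite -[X in _ --> X](mulr0 (- a)^-1); apply: cvgMl_tmp; exact: cvg_powR_oo.
- by move=> x yx; have [] := dF x (lt_trans y0 yx).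
- apply: cvg_at_right_filter; apply: cvgMl_tmp; exact: continuous_powR_gt0.
- move=> x; rewrite in_itv/= andbT => yx.
  by rewrite derive1E; have [] := dF x (lt_trans y0 yx).
Qed.

Lemma integral_expR_tail y :
  (\int[leb]_(t in `[y, +oo[) (expR (- t))%:E = (expR (- y))%:E)%E.
Proof.
pose F t : R := - expR (- t).
have dF x : is_derive x 1 F (expR (- x)).
  by rewrite /F; apply: is_derive_eq; rewrite /GRing.scale/= mulrN1 opprK.
rewrite (@ge0_continuous_FTC2y _ _ F y 0).
- by rewrite -EFinB sub0r /F opprK.
- by move=> x _; rewrite expR_ge0.
- apply: continuous_subspaceT => x; apply: continuous_comp; first exact: opp_continuous.
  exact: continuous_expR.
- rewrite -[X in _ --> X]oppr0; apply: cvgN; exact: cvgr_expR.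
- by move=> x _; have [] := dF x.
- apply: cvg_at_right_filter; apply: differentiable_continuous; apply/derivable1_diffP.
  by have [] := dF y.
- by move=> x _; rewrite derive1E; have [] := dF x.
Qed.

Lemma integral_expR_itv x : 0 <= x ->
  (\int[leb]_(t in `]0%R, x[) (expR (- t))%:E = (1 - expR (- x))%:E)%E.
Proof.
move=> x0; have h := integral_expR_tail 0%R; rewrite oppr0 expR0 in h.
have me D : measurable_fun D (fun t : R => (expR (- t))%:E).
  apply/measurable_EFinP; apply: measurable_funTS; apply: measurableT_comp => //.
have : (\int[leb]_(t in `[0%R, x[) (expR (- t))%:E + (expR (- x))%:E = 1)%E.
  rewrite -integral_expR_tail -h -ge0_integral_setU//.
  - congr (integral _ _ _); apply/seteqP; split => t /=; rewrite !in_itv/= ?andbT.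
      by case=> [/andP[]//|]; exact: le_trans.
    by move=> t0; case: (ltP t x) => tx; [left; rewrite t0|right].
  - exact: me.
  - by apply/disj_set2P/seteqP; split => // t [/=]; rewrite !in_itv/= andbT => /andP[_ /lt_geF ->].
rewrite -(@integral_itv_obnd_cbnd _ 0 (BLeft x))//.
case: (\int[leb]_(t in _) _)%E => [r||]//; rewrite -EFinD => -[e].
by rewrite -e addrK.
Qed.

Let measurable_gamma_integrand s (D : set R) :
  measurable_fun D (fun t : R => (t `^ (- s) * expR (- t))%:E).
Proof.
apply/measurable_EFinP; apply: measurable_funTS; apply: measurable_funM => //.
exact: measurableT_comp.
Qed.

(** Splitting at 1: the integrand is at most [t^-s] below, integrable since [s < 1], and at most
    [exp(-t)] above. It is at least [exp(-1)] on [(0, 1)], hence the positivity. Finiteness matters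
    because [Gamma] is the finite part of an extended integral. *)
Lemma Gamma_fin_gt0 s : 0 < s < 1 ->
  (\int[leb]_(t in `]0%R, +oo[) (t `^ (- s) * expR (- t))%:E)%E =
    (Gamma (1 - s))%:E /\ 0 < Gamma (1 - s).
Proof.
move=> /andP[s0 s1].
have e : 1 - s - 1 = - s by rewrite addrAC subrr add0r.
set I := (\int[leb]_(t in `]0%R, +oo[) (t `^ (- s) * expR (- t))%:E)%E.
have -> : Gamma (1 - s) = fine I by rewrite /Gamma /Rintegral e.
have mf D : measurable_fun D (fun t : R => (t `^ (- s) * expR (- t))%:E).
  exact: measurable_gamma_integrand.
have f0 t : (0 <= (t `^ (- s) * expR (- t))%:E)%E by rewrite lee_fin mulr_ge0 ?powR_ge0 ?expR_ge0.
have split0 : (I = \int[leb]_(t in `]0%R, 1%R[) (t `^ (- s) * expR (- t))%:E +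
    \int[leb]_(t in `[1%R, +oo[) (t `^ (- s) * expR (- t))%:E)%E.
  rewrite -ge0_integral_setU//.
  - congr (integral _ _ _); apply/seteqP; split => t /=; rewrite !in_itv/= ?andbT.
      by move=> t0; case: (ltP t 1) => tx; [left; rewrite t0|right].
    by case=> [/andP[]//|]; exact: lt_le_trans.
  - exact: mf.
  - by apply/disj_set2P/seteqP; split => // t [/=]; rewrite !in_itv/= andbT => /andP[_ /lt_geF ->].
have tail : (\int[leb]_(t in `[1%R, +oo[) (t `^ (- s) * expR (- t))%:E <= (expR (- 1))%:E)%E.
  rewrite -integral_expR_tail; apply: ge0_le_integral => //.
  - exact: mf.
  - by apply/measurable_EFinP; apply: measurable_funTS; exact: measurableT_comp.
  - move=> t /=; rewrite in_itv/= andbT => t1; rewrite lee_fin ler_piMl ?expR_ge0//.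
    rewrite powRN invf_le1 ?powR_gt0//; last exact: lt_le_trans t1.
    apply: (@le_trans _ _ (1 `^ s)); first by rewrite powR1.
    apply: ge0_ler_powR; rewrite ?nnegrE// ltW//.
    exact: lt_le_trans t1.
have head : (\int[leb]_(t in `]0%R, 1%R[) (t `^ (- s) * expR (- t))%:E <= ((1 - s)^-1)%:E)%E.
  (* The intervals avoid the singularity at 0, and the shift by 2 keeps their left end below 1. *)
  pose F n : set R := `]n.+2%:R^-1, 1[%classic.
  have -> : `]0%R, 1%R[%classic = \bigcup_n F n.
    apply/seteqP; split => t /=; rewrite ?in_itv/=.
      move=> /andP[t0 t1]; exists (Num.truncn t^-1) => //; rewrite /F/= in_itv/= t1 andbT.
      rewrite invf_plt ?posrE// (lt_trans (truncnS_gt _))// ltr_nat//.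
    by move=> [n _]; rewrite /F/= in_itv/= => /andP[nt ->]; rewrite (lt_trans _ nt).
  have cv : (\int[leb]_(t in F n) (t `^ (- s) * expR (- t))%:E @[n --> \oo] -->
      \int[leb]_(t in \bigcup_n F n) (t `^ (- s) * expR (- t))%:E)%E.
    apply: ge0_nondecreasing_set_cvg_integral => //.
    - apply/nondecreasing_seqP => n; apply/subsetPset => t; rewrite /F/= !in_itv/=.
      move=> /andP[nt ->]; rewrite andbT (le_lt_trans _ nt)//.
      by rewrite lef_pV2 ?posrE// ler_nat.
    - by move=> n; exact: measurable_itv.
    - by move=> n; exact: mf.
  rewrite -(cvg_lim _ cv)//; apply: lime_le; first by apply/cvg_ex; eexists; exact: cv.
  apply: nearW => n.
  have p0 : 0 < n.+2%:R^-1 :> R by rewrite invr_gt0.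
  have p1 : n.+2%:R^-1 < 1 :> R by rewrite invf_lt1// ltr1n.
  have q0 : 0 < 1 - s by rewrite subr_gt0.
  apply: (@le_trans _ _ (\int[leb]_(t in F n) (t `^ (- s))%:E)%E).
    apply: ge0_le_integral => //; first exact: measurable_itv.
    - exact: mf.
    - by apply/measurable_EFinP; apply: measurable_funTS.
    - move=> t; rewrite /F/= in_itv/= => /andP[nt _]; rewrite lee_fin ler_piMr ?powR_ge0//.
      by rewrite -[leRHS]expR0 ler_expR oppr_le0 ltW// (lt_trans p0).
  pose G (t : R) : R := (1 - s)^-1 * t `^ (1 - s).
  have dG x : 0 < x -> is_derive x 1 G (x `^ (- s)).
    move=> x0.
    have -> : x `^ (- s) = (1 - s)^-1 *: ((1 - s) * x `^ (1 - s - 1)).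
      by rewrite /GRing.scale/= mulrA mulVf ?mul1r ?gt_eqF// e.
    by apply: is_deriveZ; have := is_derive1_powR (1 - s) x0; exact.
  have cG x : 0 < x -> {for x, continuous G}.
    by move=> x0; apply: differentiable_continuous; apply/derivable1_diffP; case: (dG x x0).
  rewrite /F -(@integral_itv_bndoo _ _ _ _ true false); last first.
    by apply/measurable_EFinP; apply: measurable_funTS.
  rewrite (@continuous_FTC2 _ _ G)//.
  - rewrite -EFinB lee_fin /G powR1 mulr1 lerBlDr lerDl mulr_ge0 ?powR_ge0//.
    by rewrite invr_ge0 ltW.
  - apply: continuous_in_subspaceT => x; rewrite inE/= in_itv/= => /andP[nx _].
    by apply: continuous_powR_gt0; exact: lt_le_trans nx.
  - split.
    + by move=> x; rewrite in_itv/= => /andP[nx _]; case: (dG x (lt_trans p0 nx)).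
    + by apply: cvg_at_right_filter; exact: cG.
    + by apply: cvg_at_left_filter; exact: cG.
  - move=> x; rewrite in_itv/= => /andP[nx _].
    by rewrite derive1E; case: (dG x (lt_trans p0 nx)).
have Ifin : I \is a fin_num.
  rewrite ge0_fin_numE; last by apply: integral_ge0 => t _; exact: f0.
  rewrite split0; apply: (le_lt_trans (leeD head tail)).
  by rewrite -EFinD ltry.
split; first by rewrite fineK.
rewrite -lte_fin fineK// split0; apply: (@lt_le_trans _ _ (expR (- 1))%:E).
  by rewrite lte_fin expR_gt0.
apply: (@le_trans _ _ (\int[leb]_(t in `]0%R, 1%R[) (t `^ (- s) * expR (- t))%:E)%E).
  have -> : (expR (- 1))%:E = (\int[leb]_(t in `]0%R, 1%R[) (cst (expR (- 1))%:E t))%E.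
    by rewrite integral_cst//= lebesgue_measure_itv/= lte_fin ltr01 oppr0 adde0 mule1.
  apply: ge0_le_integral => //.
  - by move=> t _; rewrite lee_fin expR_ge0.
  - exact: mf.
  - move=> t /=; rewrite in_itv/= => /andP[t0 t1]; rewrite lee_fin.
    apply: (@le_trans _ _ (1 * expR (- t))).
      by rewrite mul1r ler_expR lerN2 ltW.
    rewrite ler_wpM2r ?expR_ge0// powRN invf_ge1 ?powR_gt0//.
    apply: (@le_trans _ _ (1 `^ s)); last by rewrite powR1.
    apply: ge0_ler_powR; rewrite ?nnegrE// ltW//.
by rewrite leeDl// integral_ge0.
Qed.

(** Write [1 - exp(-c t^b)] as the integral of [exp(-v)] over [0 < v < c t^b] and exchange the
    integrals: integrating in [t] leaves a power tail, and the integral in [v] is then that of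
    [Gamma (1 - a / b)]. The normalisation in [intensity] is the one that makes the result exactly
    [c^(a/b)]. *)
Lemma stable_integral a b c : 0 < a -> a < b -> 0 <= c ->
  (\int[leb]_(t in `]0%R, +oo[)
    ((1 - expR (- (c * t `^ b))) * ((a / Gamma (1 - a / b)) * t `^ (- 1 - a)))%:E)%E =
  (c `^ (a / b))%:E.
Proof.
move=> a0 ab c0; have b0 : 0 < b by exact: lt_trans ab.
have abs : 0 < a / b < 1 by rewrite divr_gt0//= ltr_pdivrMr// mul1r.
have [G1 G2] := Gamma_fin_gt0 abs.
set K := a / Gamma (1 - a / b); have K0 : 0 < K by rewrite divr_gt0.
have [->|cn] := eqVneq c 0.
  rewrite powR0 ?gt_eqF//; last by case/andP: abs.
  by rewrite integral0_eq// => t _; rewrite mul0r oppr0 expR0 subrr mul0r.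
have cp : 0 < c by rewrite lt_neqAle eq_sym cn.
have cG : 0 <= c `^ (a / b) / Gamma (1 - a / b) by rewrite divr_ge0 ?powR_ge0// ltW.
have eG : c `^ (a / b) / Gamma (1 - a / b) * Gamma (1 - a / b) = c `^ (a / b).
  by rewrite divfK// gt_eqF.
pose E : set (R * R) := [set z | 0 < z.1 /\ 0 < z.2 /\ z.2 < c * z.1 `^ b].
have mE : measurable E.
  have m1 : measurable_fun setT (fun z : R * R => 0 < z.1).
    by apply: measurable_fun_ltr => //; exact: measurable_fst.
  have m2 : measurable_fun setT (fun z : R * R => 0 < z.2).
    by apply: measurable_fun_ltr => //; exact: measurable_snd.
  have m3 : measurable_fun setT (fun z : R * R => z.2 < c * z.1 `^ b).
    apply: measurable_fun_ltr; first exact: measurable_snd.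
    apply: measurable_funM => //.
    exact: (measurableT_comp (measurable_powRr b) measurable_fst).
  have -> : E = [set z | 0 < z.1] `&` ([set z | 0 < z.2] `&` [set z | z.2 < c * z.1 `^ b]) by [].
  apply: measurableI; first exact: measurable_bool_set.
  by apply: measurableI; exact: measurable_bool_set.
pose k (z : R * R) : \bar R := ((expR (- z.2) * (K * z.1 `^ (- 1 - a))) * \1_E z)%:E.
have mk : measurable_fun setT k.
  apply/measurable_EFinP; apply: measurable_funM; last exact: measurable_indic.
  apply: measurable_funM.
    apply: measurableT_comp; first exact: measurable_expR.
    by apply: measurableT_comp => //; exact: measurable_snd.
  apply: measurable_funM => //.
  exact: (measurableT_comp (measurable_powRr _) measurable_fst).
have k0 z : (0 <= k z)%E.
  rewrite lee_fin mulr_ge0// mulr_ge0 ?expR_ge0// mulr_ge0 ?powR_ge0// ltW//.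
have e1 : (\int[leb]_x \int[leb]_y k (x, y) = \int[leb]_(t in `]0%R, +oo[)
    ((1 - expR (- (c * t `^ b))) * (K * t `^ (- 1 - a)))%:E)%E.
  rewrite [RHS]integral_mkcond; apply: eq_integral => t _; rewrite patchE.
  case: ifPn => [|]; last first.
    move=> tn; rewrite integral0_eq// => v _; rewrite /k indicE memNset ?mulr0//.
    by case=> /= t0 _; move: tn; rewrite notin_setE/= in_itv/= t0.
  move=> /set_mem/=; rewrite in_itv/= andbT => t0.
  have ct : 0 <= c * t `^ b by rewrite mulr_ge0 ?powR_ge0.
  rewrite EFinM -integral_expR_itv// [RHS]muleC -ge0_integralZl//; last 2 first.
  - by apply/measurable_EFinP; apply: measurable_funTS; exact: measurableT_comp.
  - by rewrite lee_fin mulr_ge0 ?powR_ge0// ltW.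
  rewrite [RHS]integral_mkcond; apply: eq_integral => v _; rewrite patchE /k/=.
  case: ifPn => [/set_mem/=|].
    rewrite in_itv/= => /andP[v0 vt]; rewrite indicE mem_set// mulr1.
    by rewrite mulrC EFinM.
  rewrite notin_setE/= in_itv/= => vt; rewrite indicE memNset ?mulr0//.
  by move=> [/= _ [v0 vv]]; apply: vt; rewrite v0 vv.
have e2 : (\int[leb]_y \int[leb]_x k (x, y) = \int[leb]_(v in `]0%R, +oo[)
   ((c `^ (a / b) / Gamma (1 - a / b))%:E * (v `^ (- (a / b)) * expR (- v))%:E))%E.
  rewrite [RHS]integral_mkcond; apply: eq_integral => v _; rewrite patchE.
  case: ifPn => [|]; last first.
    move=> vn; rewrite integral0_eq// => t _; rewrite /k indicE memNset ?mulr0//.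
    by case=> /= _ [v0 _]; move: vn; rewrite notin_setE/= in_itv/= v0.
  move=> /set_mem/=; rewrite in_itv/= andbT => v0.
  have vc : 0 < v / c by rewrite divr_gt0.
  pose y := (v / c) `^ b^-1; have y0 : 0 < y by rewrite powR_gt0.
  (* For fixed [v] the constraint on [t] is a half-line starting at [y = (v / c)^(1/b)]. *)
  have yE t : 0 < t -> (v < c * t `^ b) = (y < t).
    move=> t0; rewrite mulrC -ltr_pdivrMr//.
    have -> : v / c = y `^ b by rewrite /y -powRrM mulVf ?powRr1 ?gt_eqF// ltW.
    apply/idP/idP => h; last by apply: gt0_ltr_powR; rewrite ?nnegrE// ltW.
    rewrite ltNge; apply/negP => ty; move: h; rewrite ltNge => /negP; apply.
    by apply: ge0_ler_powR; rewrite ?nnegrE// ltW.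
  transitivity ((expR (- v) * K)%:E * \int[leb]_(t in `]y, +oo[) (t `^ (- 1 - a))%:E)%E.
    rewrite -ge0_integralZl//; last 3 first.
    - by apply/measurable_EFinP; apply: measurable_funTS.
    - by move=> t _; rewrite lee_fin powR_ge0.
    - by rewrite lee_fin mulr_ge0 ?expR_ge0// ltW.
    rewrite [RHS]integral_mkcond; apply: eq_integral => t _; rewrite patchE /k/=.
    case: ifPn => [/set_mem/=|].
      rewrite in_itv/= andbT => yt; have t0 := lt_trans y0 yt.
      by rewrite indicE mem_set ?mulr1 ?mulrA// /E/= yE.
    rewrite notin_setE/= in_itv/= andbT => yt; rewrite indicE memNset ?mulr0//.
    by move=> [/= t0 [_]]; rewrite yE// => vv; apply: yt.
  rewrite (@integral_itv_obnd_cbnd _ y +oo%O); last first.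
    by apply/measurable_EFinP; apply: measurable_funTS.
  rewrite integral_powR_tail// -!EFinM; congr EFin.
  have -> : y `^ (- a) = c `^ (a / b) * v `^ (- (a / b)).
    have e3 : b^-1 * - a = - (a / b) by rewrite mulrN mulrC.
    rewrite /y -powRrM e3 powRM ?invr_ge0// ?ltW//.
    rewrite mulrC; congr (_ * _).
    by rewrite -powR_inv1 ?ltW// -powRrM mulN1r opprK.
  rewrite /K; have an : a != 0 by rewrite gt_eqF.
  have gn : Gamma (1 - a / b) != 0 by rewrite gt_eqF.
  by move: (Gamma _) gn => G gn; move: (c `^ _) (v `^ _) (expR _) => p q r; field; rewrite an gn.
have e0 := @fubini_tonelli _ _ _ _ R leb leb k mk k0.
apply: etrans; first exact: (esym e1).
apply: etrans; first exact: e0.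
apply: etrans; first exact: e2.
apply: etrans.
  apply: ge0_integralZl.
  - exact: measurable_itv.
  - exact: measurable_gamma_integrand.
  - by move=> v _; rewrite lee_fin mulr_ge0 ?powR_ge0 ?expR_ge0.
  - by rewrite lee_fin.
by rewrite G1 -EFinM eG.
Qed.

End stable_integral.

(** * The weights W *)

Section cascade.
Context {R : realType}.
Local Open Scope ereal_scope.

(** The quotient of [gamma_bar y] by [gamma_bar s] for a descendant [y] of [s], in a form free of
    division that involves only the marks between the two. *)
Definition ratio (g : seq nat -> nat -> R) (s y : seq nat) : R :=
  (\prod_(size s <= j < size y) g (take j y) (nth 0%N y j))%R.

Definition wn (alpha : nat -> R) (g : seq nat -> nat -> R) (s : seq nat) (n : nat) : \bar R :=
  \esum_(y in cylinder s n) (ratio g s y `^ alpha n.+1)%:E.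

(** The upper limit is measurable and defined for every environment; it equals [W] wherever the
    approximations converge. *)
Definition Wsup alpha g s : \bar R := limn_esup (wn alpha g s).

Lemma wn_ge0 alpha g s n : 0 <= wn alpha g s n.
Proof. by apply: esum_ge0 => y _; rewrite lee_fin powR_ge0. Qed.

Lemma Wsup_ge0 alpha g s : 0 <= Wsup alpha g s.
Proof.
rewrite /Wsup limn_esup_lim; apply: lime_ge; first exact: is_cvg_esups.
apply: nearW => n; apply: (@le_trans _ _ (wn alpha g s n)); first exact: wn_ge0.
by apply: ereal_sup_ubound; exists n => /=.
Qed.

Lemma ratio_refl g s : ratio g s s = 1%R.
Proof. by rewrite /ratio big_geq. Qed.

Lemma ratio_rcons g s y x : (size s <= size y)%N ->
  ratio g s (rcons y x) = (ratio g s y * g y x)%R.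
Proof.
move=> sy; rewrite /ratio size_rcons big_nat_recr//=; congr (_ * _)%R.
  apply: eq_big_nat => j /andP[_ jy].
  by rewrite nth_rcons jy -cats1 takel_cat// ltnW.
by rewrite nth_rcons ltnn eqxx -cats1 take_size_cat.
Qed.

Lemma ratio_head g s x y : (size s < size y)%N -> take (size s).+1 y = rcons s x ->
  ratio g s y = (g s x * ratio g (rcons s x) y)%R.
Proof.
move=> sy e; rewrite /ratio big_ltn// size_rcons; congr (g _ _ * _)%R.
  by rewrite -(@take_takel _ _ (size s).+1)// e -cats1 take_size_cat.
by rewrite -(@nth_take (size s).+1)// e nth_rcons ltnn eqxx.
Qed.

Lemma ratio_gt0 g s y : (forall s' x, (0 < g s' x)%R) -> (0 < ratio g s y)%R.
Proof. by move=> g0; exact: prodr_gt0. Qed.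

Lemma ratioE g s y : (forall s' x, (0 < g s' x)%R) -> take (size s) y = s ->
  (gamma_bar g y / gamma_bar g s)%R = ratio g s y.
Proof.
move=> g0 e; have sy : (size s <= size y)%N by rewrite -e size_take_min geq_minr.
rewrite /gamma_bar -!(big_mkord xpredT (fun j => g (take j _) (nth 0%N _ j))).
rewrite (@big_cat_nat _ _ _ (size s))//= (_ : \prod_(0 <= i < size s) _ = gamma_bar g s)%R.
  rewrite /gamma_bar -(big_mkord xpredT (fun j => g (take j _) (nth 0%N _ j))).
  by rewrite mulrAC divff ?mul1r// gt_eqF// prodr_gt0.
rewrite /gamma_bar -(big_mkord xpredT (fun j => g (take j _) (nth 0%N _ j))).
apply: eq_big_nat => j /andP[_ js]; congr (g _ _).
  by rewrite -[in RHS]e take_takel// ltnW.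
by rewrite -[in RHS]e nth_take.
Qed.

Lemma cylinder_refl s : cylinder s (size s) = [set s].
Proof.
by apply/seteqP; split=> y /=; [case=> e; rewrite -e take_size|move=> ->; rewrite /cylinder/= take_size].
Qed.

(** Descendants grouped by their last step, the one that is integrated out in the martingale
    property. [esum_cylinder_head] groups them by the first step, which gives the recursion of [W]
    over the children. *)
Lemma esum_cylinder_rcons s n (f : seq nat -> \bar R) : (size s <= n)%N ->
  (forall y, 0 <= f y) ->
  \esum_(y in cylinder s n.+1) f y =
  \esum_(y in cylinder s n) \esum_(x in [set: nat]) f (rcons y x).
Proof.
move=> sn f0; rewrite esum_esum//.
rewrite (@reindex_esum _ _ _ (cylinder s n `*`` (fun=> setT)) _ (fun k => rcons k.1 k.2))//.
split=> [[y x] [[/= sy ty] _]|[y x] [y' x'] _ _ /rcons_inj[-> ->]//|y [/= sy ty]].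
  by rewrite /cylinder/= size_rcons sy -cats1 takel_cat// sy.
case/lastP: y sy ty => // y x; rewrite size_rcons => -[sy].
rewrite -cats1 takel_cat ?sy// => ty.
by exists (y, x); rewrite /= ?cats1.
Qed.

Lemma esum_cylinder_head s n (f : seq nat -> \bar R) : (size s < n)%N ->
  (forall y, 0 <= f y) ->
  \esum_(y in cylinder s n) f y =
  \esum_(x in [set: nat]) \esum_(y in cylinder (rcons s x) n) f y.
Proof.
move=> sn f0; rewrite esum_esum//.
rewrite (@reindex_esum _ _ _ ([set: nat] `*`` (fun x => cylinder (rcons s x) n)) _ snd)//.
have hd x y : take (size s).+1 y = rcons s x -> take (size s) y = s.
  by move=> e; rewrite -(@take_takel _ _ (size s).+1)// e -cats1 take_size_cat.
split=> [[x y] [_ [/= sy ty]]|[x y] [x' y'] /set_mem [_ [/= _ +]] /set_mem [_ [/= _ +]] e|y [/= sy ty]].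
- by split => //=; apply: (hd x); rewrite size_rcons in ty.
- rewrite !size_rcons; have -> : y = y' by [].
  by move=> -> /rcons_inj[->].
- exists (nth 0%N y (size s), y) => //; split => //=; split => //=.
  by rewrite size_rcons (take_nth 0%N) ?sy// ty.
Qed.

Lemma wn_refl alpha g s : wn alpha g s (size s) = 1.
Proof. by rewrite /wn cylinder_refl esum_set1 ratio_refl powR1. Qed.

Lemma wn_head alpha g s n : (forall s' x, (0 < g s' x)%R) -> (size s < n)%N ->
  wn alpha g s n =
  \esum_(x in [set: nat]) ((g s x `^ alpha n.+1)%:E * wn alpha g (rcons s x) n).
Proof.
move=> g0 sn; rewrite /wn esum_cylinder_head//; last by move=> y; rewrite lee_fin powR_ge0.
apply: eq_esum => x _; rewrite -ge0_esumZl//; last 2 first.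
- by rewrite lee_fin powR_ge0.
- by move=> y _; rewrite lee_fin powR_ge0.
apply: eq_esum => y [sy]; rewrite size_rcons => ty.
by rewrite (@ratio_head g s x)// ?sy// powRM ?EFinM// ltW ?ratio_gt0.
Qed.

Lemma limn_wn alpha g s : (forall s' x, (0 < g s' x)%R) ->
  W alpha g s = limn (wn alpha g s).
Proof.
move=> g0; rewrite /W; congr (limn _); apply/funext => n.
by apply: eq_esum => y [_ e]; rewrite ratioE.
Qed.

Lemma measurable_ratio d (T : measurableType d) (g : T -> seq nat -> nat -> R) s y n :
  (forall s' x, (size s' < n)%N -> measurable_fun setT (fun w => g w s' x)) ->
  (size y <= n)%N -> measurable_fun setT (fun w => ratio (g w) s y).
Proof.
move=> mg yn; rewrite /ratio.
apply: measurable_prod => j; rewrite mem_index_iota => /andP[_ jy].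
by apply: mg; rewrite size_take_min (leq_ltn_trans (geq_minl _ _))// (leq_trans jy).
Qed.

Lemma measurable_wn d (T : measurableType d) (g : T -> seq nat -> nat -> R) alpha s n :
  (forall s' x, (size s' < n)%N -> measurable_fun setT (fun w => g w s' x)) ->
  measurable_fun setT (fun w => wn alpha (g w) s n).
Proof.
move=> mg; rewrite /wn.
rewrite (_ : (fun w => _) = (fun w => \esum_(y in cylinder s n)
   (if size y == n then (ratio (g w) s y `^ alpha n.+1)%:E else 0))); last first.
  by apply/funext => w; apply: eq_esum => y [/= -> _]; rewrite eqxx.
apply: measurable_esum => [y|y|y w].
- by case: (pselect (cylinder s n y)) => h;
    [rewrite (_ : [set _ | _] = setT)|rewrite (_ : [set _ | _] = set0)]; (try by []);
    apply/seteqP; split.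
- case: eqP => [e|_]; last exact: measurable_cst.
  apply/measurable_EFinP.
  apply: (measurableT_comp (measurable_powRr (alpha n.+1))).
  by apply: (@measurable_ratio _ _ _ _ _ n) => //; rewrite e.
- by case: ifP => _ //; rewrite lee_fin powR_ge0.
Qed.

Lemma measurable_Wsup d (T : measurableType d) (g : T -> seq nat -> nat -> R) alpha s :
  (forall s' x, measurable_fun setT (fun w => g w s' x)) ->
  measurable_fun setT (fun w => Wsup alpha (g w) s).
Proof.
by move=> mg; apply: measurable_fun_limn_esup => n; exact: measurable_wn.
Qed.

End cascade.

Section cascade_limit.
Context d (Omega : measurableType d) (R : realType) (P : probability Omega R).
Variables (alpha : nat -> R) (gam : seq nat -> nat -> {RV P >-> R}).
Variables (I : choiceType) (D : set I) (F : I -> set_system Omega).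
Variable src : seq nat -> I.
Hypothesis src_inj : injective src.
Hypothesis srcD : forall s, D (src s).
Hypothesis F_sigma : forall i, sigma_algebra setT (F i).
Hypothesis F_meas : forall i, F i `<=` measurable.
Hypothesis F_indep : mutually_independent P D F.
Hypothesis F_src : forall s x B, measurable B -> F (src s) (gam s x @^-1` B).
Hypothesis alpha_gt0 : forall k, (0 < k)%N -> 0 < alpha k.
Hypothesis alpha_incr : forall k, (0 < k)%N -> alpha k < alpha k.+1.
Hypothesis alpha_cvg : alpha n @[n --> \oo] --> (1 : R).
Hypothesis gam_poisson : forall s,
  poisson_point_process P (intensity alpha (size s).+1) (gam s).
Hypothesis gam_gt0 : {ae P, forall w, forall s x, 0 < gam s x w}.
Local Open Scope ereal_scope.
Local Notation g := (env gam).
Let A n := [set src s | s in [set s | (size s < n)%N]].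
Local Notation sub B := (g_sigma_algebraType (\bigcup_(i in B) F i)).

Let mgam n s x : (size s < n)%N ->
  measurable_fun setT ((fun w => g w s x) : sub (A n) -> R).
Proof.
move=> sn; apply: (@sub_gen_measurable_fun _ _ _ _ _ _ _ _ (src s)); first by exists s.
by move=> B mB; exact: F_src.
Qed.

Let mwn n s : measurable_fun setT ((fun w => wn alpha (g w) s n) : sub (A n) -> \bar R).
Proof. by apply: measurable_wn => s' x s'n; exact: mgam. Qed.

Let mwnT n s : measurable_fun setT (fun w => wn alpha (g w) s n).
Proof. exact: (sub_measurable_fun F_meas (@mwn n s)). Qed.

(** Equal to the sum of [(lam ratio)^alpha_(n+1)]: with [lam] placed inside the power, the passage
    from one generation to the next leaves it unchanged. *)
Let scaled (lam : R) n s w := (lam `^ alpha n.+1)%:E * wn alpha (g w) s n.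

(* The marks of one vertex form a stable Poisson process; integrating them out
   shows that the Laplace transforms of the approximations of W form a martingale. *)
Let wn_step (lam : R) n s (Z : Omega -> \bar R) : (0 < lam)%R -> (size s <= n)%N ->
  measurable_fun setT (Z : sub (A n) -> \bar R) -> (forall w, 0 <= Z w <= 1) ->
  \int[P]_w (Z w * enexp (scaled lam n.+1 s w)) =
  \int[P]_w (Z w * enexp (scaled lam n s w)).
Proof.
move=> l0 sn mZ Z01.
pose a := alpha n.+1; pose b := alpha n.+2.
have a0 : (0 < a)%R by exact: alpha_gt0.
have ab : (a < b)%R by exact: alpha_incr.
have b0 : (0 < b)%R by exact: lt_trans ab.
pose c y w := ((lam * ratio (g w) s y) `^ b)%R.
pose S y w := \esum_(x in [set: nat]) (g w y x `^ b)%:E.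
(* The guard on the size makes [C y] and [E y] functions of the first [n] generations for every [y];
   it holds throughout the cylinder. *)
pose C y w := if size y == n then (c y w)%:E else 0.
pose E y w := if size y == n then (c y w `^ (a / b))%:E else 0.
have c0 y w : (0 <= c y w)%R by exact: powR_ge0.
have mc y : size y = n -> measurable_fun setT (c y : sub (A n) -> R).
  move=> e; apply: (measurableT_comp (measurable_powRr b)).
  apply: measurable_funM; first exact: measurable_cst.
  by apply: (@measurable_ratio _ _ _ _ _ _ n) => [s' x|]; [exact: mgam|rewrite e].
have mC y : measurable_fun setT (C y : sub (A n) -> \bar R).
  rewrite /C; case: eqP => [e|_]; last exact: measurable_cst.
  by apply/measurable_EFinP; exact: mc.
have mE y : measurable_fun setT (E y : sub (A n) -> \bar R).
  rewrite /E; case: eqP => [e|_]; last exact: measurable_cst.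
  by apply/measurable_EFinP; apply: (measurableT_comp (measurable_powRr (a / b))); exact: mc.
have S0 y w : 0 <= S y w by apply: esum_ge0 => x _; rewrite lee_fin powR_ge0.
have mS y B : measurable B -> F (src y) (S y @^-1` B).
  move=> mB; have := sigma_algebra_id (F_sigma (src y)).
  have mSy : measurable_fun setT (S y : g_sigma_algebraType (F (src y)) -> \bar R).
    apply: measurable_esum => [x|x|x w].
    - exact: measurable_const_set.
    - apply/measurable_EFinP; apply: (measurableT_comp (measurable_powRr b)).
      by move=> _ U mU; rewrite setTI; apply: sub_gen_smallest; exact: F_src.
    - by rewrite lee_fin powR_ge0.
  by move=> <-; rewrite -[X in <<s _ >> X]setTI; exact: mSy.
have C0 y w : 0 <= C y w by rewrite /C; case: ifP => // _; rewrite lee_fin.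
have E0 y w : 0 <= E y w by rewrite /E; case: ifP => // _; rewrite lee_fin powR_ge0.
(* With the first [n] generations fixed, the marks below [y] contribute [c^(a/b)] where
   [c = (lam ratio)^b]. This is [(lam ratio)^a], the term of [y] one generation earlier. *)
have frozen y w : cylinder s n y -> \int[P]_w' enexp (C y w * S y w') = enexp (E y w).
  move=> [e _]; rewrite /C /E e eqxx.
  pose h t := (c y w * t `^ b)%R.
  pose rho t := ((a / Gamma (1 - a / b)) * t `^ (- 1 - a))%R.
  have G0 : (0 < Gamma (1 - a / b))%R.
    by apply: (Gamma_fin_gt0 _).2; rewrite divr_gt0//= ltr_pdivrMr ?mul1r.
  have mh : measurable_fun setT h.
    by apply: measurable_funM => //; exact: measurable_powRr.
  have mrho : measurable_fun setT rho.
    by apply: measurable_funM => //; exact: measurable_powRr.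
  have := @laplace_functional _ _ R P (intensity alpha (size y).+1) (fun x => gam y x) rho h.
  rewrite -(stable_integral a0 ab (c0 y w)) => <-; [|by []|exact: gam_poisson| |exact: mrho| | |exact: mh|].
  - apply: eq_integral => w' _; congr enexp; rewrite -ge0_esumZl.
    + by apply: eq_esum => x _.
    + by rewrite lee_fin.
    + by move=> x _; rewrite lee_fin powR_ge0.
  - by apply: filterS gam_gt0 => w' + x; exact.
  - by move=> t; rewrite mulr_ge0 ?powR_ge0// divr_ge0// ltW.
  - by move=> B; rewrite /intensity e.
  - by move=> t; rewrite mulr_ge0 ?powR_ge0.
have := @laplace_product _ _ R P I D F F_sigma F_meas F_indep (seq nat) src (A n)
  (cylinder s n) S C E Z src_inj _ _ _ mS S0 mC C0 mE E0 mZ Z01 frozen.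
have mZT := sub_measurable_fun F_meas mZ.
have mEn y : measurable_fun setT (E y) := sub_measurable_fun F_meas (mE y).
have mCn y : measurable_fun setT (C y) := sub_measurable_fun F_meas (mC y).
have mSn y : measurable_fun setT (S y).
  by move=> _ B mB; rewrite setTI; apply/(F_meas (i := src y))/mS.
have Z0 w : 0 <= Z w by have /andP[] := Z01 w.
have mcyl y : measurable [set w : Omega | cylinder s n y] by exact: measurable_const_set.
move=> key; have {}key := key _ _ _.
transitivity (\int[P]_w (Z w * enexp (\esum_(y in cylinder s n) (C y w * S y w)))).
  apply: ge0_ae_eq_integral => //.
  - apply: emeasurable_funM => //; apply: (measurableT_comp measurable_enexp).
    by apply: measurable_funeM; exact: mwnT.
  - apply: emeasurable_funM => //; apply: (measurableT_comp measurable_enexp).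
    apply: measurable_esum => // [y|y w]; last by rewrite mule_ge0.
    exact: emeasurable_funM.
  - by move=> w _; rewrite mule_ge0 ?enexp_ge0.
  - by move=> w _; rewrite mule_ge0 ?enexp_ge0.
  apply: filterS gam_gt0 => w g0 _; congr (_ * enexp _).
  rewrite /scaled /wn esum_cylinder_rcons//; last by move=> y; rewrite lee_fin powR_ge0.
  rewrite -ge0_esumZl; last 2 first.
  - by rewrite lee_fin powR_ge0.
  - by move=> y _; apply: esum_ge0 => x _; rewrite lee_fin powR_ge0.
  apply: eq_esum => y [/= e ty]; rewrite /C e eqxx -!ge0_esumZl//; last 3 first.
  - by move=> x _; rewrite lee_fin powR_ge0.
  - by rewrite lee_fin powR_ge0.
  - by move=> x _; rewrite lee_fin powR_ge0.
  apply: eq_esum => x _; rewrite -!EFinM /c ratio_rcons ?e//.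
  have r0 : (0 <= ratio (g w) s y)%R by exact/ltW/ratio_gt0.
  have gw0 : (0 <= g w y x)%R by exact/ltW/g0.
  by rewrite !powRM ?mulrA ?mulr_ge0 ?(ltW l0).
  by rewrite lee_fin.
rewrite key => [|_ [y _ <-]||y]; [|exact: srcD|by move=> y _; exact: srcD|]; last first.
  by move=> [e _] [y' /= y'n /src_inj y'y]; move: y'n; rewrite y'y e ltnn.
apply: ge0_ae_eq_integral => //.
- apply: emeasurable_funM => //; apply: (measurableT_comp measurable_enexp).
  exact: measurable_esum.
- apply: emeasurable_funM => //; apply: (measurableT_comp measurable_enexp).
  by apply: measurable_funeM; exact: mwnT.
- by move=> w _; rewrite mule_ge0 ?enexp_ge0.
- by move=> w _; rewrite mule_ge0 ?enexp_ge0.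
apply: filterS gam_gt0 => w g0 _; congr (_ * enexp _).
rewrite /scaled /wn -ge0_esumZl; last 2 first.
- by rewrite lee_fin powR_ge0.
- by move=> y _; rewrite lee_fin powR_ge0.
apply: eq_esum => y [/= e ty]; rewrite /E e eqxx /c -EFinM -powRrM mulrCA divff ?gt_eqF//.
by rewrite mulr1 powRM// ltW// ratio_gt0.
Qed.

(** For [n = size s] the cylinder is reduced to [s] and the approximation is 1; the martingale
    property then preserves this transform. *)
Let laplace_wn (lam : R) s n : (0 < lam)%R -> (size s <= n)%N ->
  \int[P]_w enexp (scaled lam n s w) = enexp (lam `^ alpha (size s).+1)%:E.
Proof.
move=> l0; elim: n => [|n ih].
  rewrite leqn0 => /eqP e; rewrite -[RHS]mule1 -[in RHS](@probability_setT _ _ R P) -integral_cst//.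
  by apply: eq_integral => w _; rewrite /scaled -e wn_refl mule1.
rewrite leq_eqVlt => /predU1P[e|].
  rewrite -[RHS]mule1 -[in RHS](@probability_setT _ _ R P) -integral_cst//.
  by apply: eq_integral => w _; rewrite /scaled -e wn_refl mule1.
rewrite ltnS => sn; rewrite -(ih sn); have := @wn_step lam n s (cst 1) l0 sn.
have e f : \int[P]_w (cst 1 w * f w) = \int[P]_w f w by apply: eq_integral => w _; rewrite mul1e.
rewrite !e; apply; first exact: measurable_cst.
by move=> w; rewrite /= lee01 lexx.
Qed.

(** The bounded martingale [enexp (wn ...)] converges. Since [enexp] is strictly decreasing,
    infinitely many crossings of the weights over [p < q] would prevent its limit from lying on
    either side of [exp(-p)]. *)
Lemma wn_cvg : {ae P, forall w, forall s, wn alpha (g w) s n @[n --> \oo] --> Wsup alpha (g w) s}.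
Proof.
suff h s : {ae P, forall w, wn alpha (g w) s n @[n --> \oo] --> limn_einf (wn alpha (g w) s)}.
  have := ae_forall_count h; apply: filterS => w hw s; have c := hw s.
  rewrite /Wsup (_ : limn_esup _ = limn_einf (wn alpha (g w) s))//.
  by have [e1 e2] := cvg_limn_einf_sup c; rewrite e2.
pose M m w := enexp (wn alpha (g w) s (size s + m)).
have sc m w : scaled 1 m s w = wn alpha (g w) s m by rewrite /scaled powR1 mul1e.
pose G m : set_system Omega := @measurable _ (sub (A (size s + m))).
have mM m : measurable_fun setT (M m : sub (A (size s + m)) -> \bar R).
  by apply: (measurableT_comp measurable_enexp); exact: mwn.
have AS m k : (m <= k)%N -> A m `<=` A k.
  by move=> mk _ [y /= ym <-]; exists y => //=; exact: leq_trans mk.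
have Msup m B : G m B -> \int[P]_(w in B) M m.+1 w <= \int[P]_(w in B) M m w.
  move=> GB; have mB : measurable B by exact: (sub_measurable F_meas GB).
  have e k : \int[P]_(w in B) M k w = \int[P]_w ((\1_B w)%:E * enexp (scaled 1 (size s + k) s w)).
    rewrite integral_mkcond; apply: eq_integral => w _; rewrite patchE indicE sc.
    by case: ifP; rewrite ?mul1e ?mul0e.
  rewrite !e addnS wn_step// ?leq_addr//; last first.
    by move=> w; rewrite indicE; case: (w \in B); rewrite /= ?lexx ?lee01.
  by apply/measurable_EFinP; apply: measurable_indic.
have := @supermartingale_cvg _ _ R P G M.
move=> key; have {}key := key _ _ _ _ _ _ _.
have : {ae P, forall w, M n w @[n --> \oo] --> limn_einf (M ^~ w) /\ limn_einf (M ^~ w) < +oo}.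
  apply: key.
  - by move=> n; exact: sigma_algebra_measurable.
  - by move=> n; exact: sub_measurable.
  - by move=> n; apply: sub_subset; apply: AS; rewrite addnS.
  - by move=> n B mB; rewrite -[X in G n X]setTI; exact: mM.
  - by move=> n w; exact: enexp_ge0.
  - by move=> n B; exact: Msup.
  - apply: (@le_lt_trans _ _ (\int[P]_w cst 1 w)); last first.
      rewrite integral_cst// mul1e.
    exact: (le_lt_trans (probability_le1 P measurableT) (ltry _)).
    apply: ge0_le_integral => //.
    + by move=> w _; exact: enexp_ge0.
    + exact: (sub_measurable_fun F_meas (mM 0%N)).
    + by move=> w _; rewrite enexp_le1// wn_ge0.
apply: filterS => w [c _]; apply: no_crossing_cvg; first by move=> n; exact: wn_ge0.
move=> p q pq low high; set l := limn_einf (M^~w) in c.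
have c' : enexp (wn alpha (g w) s n) @[n --> \oo] --> l.
  by rewrite -(cvg_shiftn (size s)); under eq_fun do rewrite addnC.
have [c1|c1] := ltP l (enexp (ratr p)%:E).
  have [n _ hn] : \forall n \near \oo, enexp (wn alpha (g w) s n) < enexp (ratr p)%:E.
    exact: (c' _ (open_ereal_lt' c1)).
  have [m nm um] := low n; have := hn _ nm; rewrite ltNge => /negP; apply.
  by apply: enexp_le (ltW um); exact: wn_ge0.
have [n _ hn] : \forall n \near \oo, enexp (ratr q)%:E < enexp (wn alpha (g w) s n).
  apply: (c' _ (open_ereal_gt' (lt_le_trans _ c1))).
  by rewrite /= lte_fin ltr_expR ltrN2.
have [m nm um] := high n; have := hn _ nm; rewrite ltNge => /negP; apply.
(* A negative [q] is impossible: the weights would go below [p < q < 0]. *)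
have [q0|q0] := leP 0%R (ratr q : R); first by apply: enexp_le (ltW um); rewrite lee_fin.
have [k _ uk] := low 0%N; suff : wn alpha (g w) s k < 0 by rewrite ltNge wn_ge0.
by apply: (lt_trans uk); rewrite lte_fin (lt_trans pq).
Qed.

Let cvg_powR_alpha (x : R) : (0 < x)%R -> (x `^ alpha n.+1)%:E @[n --> \oo] --> x%:E.
Proof.
move=> x0; apply: cvg_EFin; first exact: nearW.
have -> : x = expR (1 * ln x) by rewrite mul1r lnK.
have -> : (fine \o fun n => ((expR (1 * ln x)) `^ alpha n.+1)%:E) = fun n => expR (alpha n.+1 * ln x).
  by apply/funext => n /=; rewrite /powR gt_eqF ?expR_gt0// expRK mul1r.
apply: continuous_cvg; first exact: continuous_expR.
by apply: cvgMr_tmp; rewrite cvg_shiftS.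
Qed.

Let mule_def_gt0 (x : R) (y : \bar R) : (0 < x)%R -> x%:E *? y.
Proof. by case: y => //= x0; rewrite gt_eqF. Qed.

(** In the limit, [E exp(-lam W) = exp(-lam^alpha)] with [alpha] taken at level [size s + 1]: [W(s)]
    has a positive stable law. The left side is at most the probability that [W(s)] is finite, and
    the right side is as close to 1 as desired for small [lam]. *)
Lemma Wsup_fin : {ae P, forall w, forall s, Wsup alpha (g w) s < +oo}.
Proof.
suff h s : {ae P, forall w, Wsup alpha (g w) s < +oo}.
  exact: ae_forall_count.
have mWs : measurable_fun setT (fun w => Wsup alpha (g w) s).
  by apply: measurable_Wsup => s' x; exact: measurable_funP.
have mB : measurable [set w | Wsup alpha (g w) s = +oo].
  rewrite (_ : [set _ | _] = (fun w => Wsup alpha (g w) s) @^-1` [set +oo]).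
    by rewrite -[X in measurable X]setTI; exact: mWs.
  by apply/seteqP; split.
have lim (lam : R) : (0 < lam)%R ->
    \int[P]_w enexp (lam%:E * Wsup alpha (g w) s) = enexp (lam `^ alpha (size s).+1)%:E.
  move=> l0.
  have sc0 n w : 0 <= scaled lam n s w by rewrite mule_ge0 ?wn_ge0// lee_fin powR_ge0.
  have L0 w : 0 <= lam%:E * Wsup alpha (g w) s by rewrite mule_ge0 ?Wsup_ge0// lee_fin ltW.
  have : \int[P]_w enexp (scaled lam n s w) @[n --> \oo] --> \int[P]_w enexp (lam%:E * Wsup alpha (g w) s).
    apply: bounded_cvg_integral.
    - move=> n; apply: (measurableT_comp measurable_enexp).
      by apply: measurable_funeM; exact: mwnT.
    - by apply: (measurableT_comp measurable_enexp); exact: measurable_funeM.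
    - by move=> n w; rewrite enexp_ge0 enexp_le1.
    - apply: filterS wn_cvg => w /(_ s) c; apply: cvg_enexp => //; first exact: nearW.
      apply: cvgeM => //.
        exact: mule_def_gt0.
      exact: cvg_powR_alpha.
  move=> c; apply: (cvg_unique _ c) => //; apply: cvg_near_cst.
  by exists (size s) => // n /= sn; rewrite laplace_wn.
have hle (lam : R) : (0 < lam)%R ->
    enexp (lam `^ alpha (size s).+1)%:E <= P (~` [set w | Wsup alpha (g w) s = +oo]).
  move=> l0; rewrite -lim//.
  rewrite -[X in P X]setIT -integral_indic//; last exact: measurableC.
  apply: ge0_le_integral => //.
  - by move=> w _; exact: enexp_ge0.
  - by apply: (measurableT_comp measurable_enexp); exact: measurable_funeM.
  - by apply/measurable_EFinP; apply: measurable_indic; exact: measurableC.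
  - move=> w _; rewrite indicE; have [/set_mem h|/negP h] := boolP (_ \in _).
      by rewrite enexp_le1// mule_ge0 ?Wsup_ge0// lee_fin ltW.
    have {}h : Wsup alpha (g w) s = +oo by apply: contrapT => h'; apply: h; exact/mem_set.
    by rewrite h gt0_muley ?lte_fin.
have one : 1 <= P (~` [set w | Wsup alpha (g w) s = +oo]).
  rewrite leNgt; apply/negP => lt1.
  have fp : P (~` [set w | Wsup alpha (g w) s = +oo]) \is a fin_num by rewrite fin_num_measure//; exact: measurableC.
  move: lt1 hle; rewrite -(fineK fp) lte_fin; set p := fine _ => p1 hle.
  have a0 : (0 < alpha (size s).+1)%R by exact: alpha_gt0.
  have p'0 : (0 < 1 - p)%R by rewrite subr_gt0.
  (* If this probability were [p < 1], taking [lam^alpha = 1 - p] would give [exp(-(1 - p)) <= p],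
     against the strict inequality [1 + x < exp x] for [x != 0]. *)
  have := hle _ (powR_gt0 (alpha (size s).+1)^-1 p'0).
  rewrite -powRrM mulVf ?(gt_eqF a0)// powRr1 ?(ltW p'0)//.
  have -> : enexp (1 - p)%:E = (expR (- (1 - p)))%:E by [].
  rewrite lee_fin leNgt => /negP; apply.
  have := @expR_gt1Dx R (- (1 - p))%R; rewrite oppr_eq0 subr_eq0 gt_eqF// => /(_ isT).
  by rewrite opprB addrCA subrr addr0.
have : P [set w | Wsup alpha (g w) s = +oo] = 0.
  apply/eqP; rewrite eq_le measure_ge0 andbT -(@leeD2rE _ 1)// add0e.
  rewrite -[leRHS](@probability_setT _ _ R P) -(setUv [set w | Wsup alpha (g w) s = +oo]).
  rewrite measureU ?setICr//; last exact: measurableC.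
  exact: leeD2l.
move=> z; exists [set w | Wsup alpha (g w) s = +oo]; split => // w /= /negP.
by rewrite -leNgt leye_eq => /eqP.
Qed.

(** At each finite generation [wn_head] is an identity, but the limit can be taken in finitely many
    terms at a time, which leaves an inequality. *)
Lemma Wsup_superharmonic : {ae P, forall w, forall s,
  \esum_(x in [set: nat]) ((g w s x)%:E * Wsup alpha (g w) (rcons s x)) <= Wsup alpha (g w) s}.
Proof.
apply: filterS2 wn_cvg gam_gt0 => w c g0 s.
have term x : ((g w s x `^ alpha n.+1)%:E * wn alpha (g w) (rcons s x) n) @[n --> \oo] -->
    (g w s x)%:E * Wsup alpha (g w) (rcons s x).
  by apply: cvgeM; [apply: mule_def_gt0; exact: g0|apply: cvg_powR_alpha; exact: g0|exact: c].
rewrite -nneseries_esumT; last by move=> n; rewrite mule_ge0 ?Wsup_ge0// lee_fin ltW// g0.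
apply: lime_le; first by apply: is_cvg_nneseries => n _ _; rewrite mule_ge0 ?Wsup_ge0// lee_fin ltW// g0.
apply: nearW => m.
have : (\sum_(0 <= x < m) ((g w s x `^ alpha n.+1)%:E * wn alpha (g w) (rcons s x) n)) @[n --> \oo] -->
   \sum_(0 <= x < m) ((g w s x)%:E * Wsup alpha (g w) (rcons s x)).
  by apply: cvg_nnesum => x _; [apply: nearW => n; rewrite mule_ge0 ?wn_ge0// lee_fin powR_ge0|exact: term].
move=> cs; rewrite -(cvg_lim (@ereal_hausdorff R) cs) -(cvg_lim (@ereal_hausdorff R) (c s)).
apply: lee_lim; [by apply/cvg_ex; eexists; exact: cs|by apply/cvg_ex; eexists; exact: c|].
exists (size s).+1 => // n /= sn; rewrite wn_head// -nneseries_esumT; last first.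
  by move=> x; rewrite mule_ge0 ?wn_ge0// lee_fin powR_ge0.
by apply: nneseries_lim_ge => x _ _; rewrite mule_ge0 ?wn_ge0// lee_fin powR_ge0.
Qed.

End cascade_limit.

(** * Path functionals *)

Definition parent (y : seq nat) : seq nat := take (size y).-1 y.
Definition label (y : seq nat) : nat := last 0%N y.

Lemma parent_rcons s x : parent (rcons s x) = s.
Proof. by rewrite /parent size_rcons -cats1 take_size_cat. Qed.

Lemma label_rcons s x : label (rcons s x) = x.
Proof. by rewrite /label last_rcons. Qed.

Lemma parentK y : (0 < size y)%N -> rcons (parent y) (label y) = y.
Proof. by case/lastP: y => // y x _; rewrite parent_rcons label_rcons. Qed.

Lemma size_parent y : size (parent y) = (size y).-1.
Proof. by rewrite size_takel// leq_pred. Qed.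

Section functionals.
Context {R : realType}.
Variables (g : seq nat -> nat -> R) (T sigma : nat -> nat -> nat -> R).
Local Open Scope ereal_scope.

Definition edge (y : seq nat) : \bar R := (g (parent y) (label y))%:E.

(** The argument [o] gives the occupied times of the vertices of the previous level: the marks kept
    are those of the last label of [y] that ring while its parent is occupied. *)
Definition visits (n : nat) (o : seq nat -> set R) (y : seq nat) (B : set R) : set nat :=
  [set i | B (sigma n (label y) i) /\ o (parent y) (sigma n (label y) i)].

Definition hold n o y B : \bar R :=
  \esum_(i in visits n o y B) (T n (label y) i)%:E.

(** The clock grouped by the vertex reached instead of by label and mark, and evaluated on any set
    [B] of times. The weight [a] distinguishes [Xi] from its modified version. *)
Definition wclock n o (a : seq nat -> \bar R) B : \bar R :=
  \esum_(y in [set y | size y = n]) (a y * hold n o y B).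

(** The times at which [X n] sits at [y], without inverse clock: [u] belongs to the jump of the
    clock of level [n] at a mark [v] of the last label of [y], and the parent is occupied at time
    [v]. In this form joint measurability in the sample point and [u] follows by induction. *)
Fixpoint occ (n : nat) : seq nat -> set R :=
  if n is m.+1 then fun y => [set u | exists i,
    let v := sigma n (label y) i in
    [/\ occ m (parent y) v,
        wclock n (occ m) edge [set v' | (v' < v)%R] <= u%:E &
        u%:E < wclock n (occ m) edge [set v' | (v' <= v)%R]]]
  else fun=> setT.

Definition upto (b : \bar R) : set R := [set v | v%:E <= b].
Definition within (a b : \bar R) : set R := [set v | a < v%:E <= b].

Definition rho k m (b : \bar R) : \bar R :=
  iteri m (fun j b => wclock (k + j) (occ (k + j).-1) edge (upto b)) b.

End functionals.

Lemma emeasurable_le_set d (U : measurableType d) (R : realType) (f h : U -> \bar R) :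
  measurable_fun setT f -> measurable_fun setT h -> measurable [set x | (f x <= h x)%E].
Proof.
move=> mf mh; rewrite (_ : [set _ | _] = ~` [set x | (h x < f x)%E]).
  by apply: measurableC; have := measurable_lte measurableT mh mf; rewrite setTI.
by apply/seteqP; split => x /=; [rewrite leNgt => /negP|move/negP; rewrite -leNgt].
Qed.

Section measurability.
Context d (U : measurableType d) (R : realType) (N : nat).
Variables (g : U -> seq nat -> nat -> R) (T sigma : U -> nat -> nat -> nat -> R).
Hypothesis g0 : forall w s x, 0 <= g w s x.
Hypothesis T0 : forall w k x i, 0 <= T w k x i.
Hypothesis mg : forall s x, measurable_fun setT (fun w => g w s x).
Hypothesis mT : forall k x i, (0 < k <= N)%N -> measurable_fun setT (fun w => T w k x i).
Hypothesis msigma : forall k x i, (0 < k <= N)%N -> measurable_fun setT (fun w => sigma w k x i).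
Local Open Scope ereal_scope.

Let mocc_at (o : U -> seq nat -> set R) := forall y, measurable [set z : U * R | o z.1 y z.2].

Lemma edge_ge0 w y : 0 <= edge (g w) y.
Proof. by rewrite lee_fin. Qed.

Lemma measurable_edge y : measurable_fun setT (fun w => edge (g w) y).
Proof. exact/measurable_EFinP. Qed.

(** The map [phi] makes room for a further parameter: with [V] a product with the time axis, [B] may
    depend on a mark or on the current time, as [measurable_occ] needs. The bound [N] on levels
    keeps the statement usable for each past sigma-algebra. *)
Lemma measurable_wclock_gen d' (V : measurableType d') (phi : V -> U) (B : V -> set R)
    (a : U -> seq nat -> \bar R) (o : U -> seq nat -> set R) n :
  (0 < n <= N)%N ->
  measurable_fun setT phi -> mocc_at o -> (forall w y, 0 <= a w y) ->
  (forall y, measurable_fun setT (fun w => a w y)) ->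
  (forall x i, measurable [set z | B z (sigma (phi z) n x i)]) ->
  measurable_fun setT
    (fun z => wclock (T (phi z)) (sigma (phi z)) n (o (phi z)) (a (phi z)) (B z)) /\
  (forall y, measurable_fun setT (fun z => hold (T (phi z)) (sigma (phi z)) n (o (phi z)) y (B z))).
Proof.
move=> nN mphi mo a0 ma mB.
have mh y : measurable_fun setT
    (fun z => hold (T (phi z)) (sigma (phi z)) n (o (phi z)) y (B z)).
  apply: measurable_esum => [i|i|i z]; last by rewrite lee_fin.
  - apply: measurableI; first exact: mB.
    pose psi z := (phi z, sigma (phi z) n (label y) i).
    have mpsi : measurable_fun setT psi.
      by apply: measurable_fun_pair => //; exact: (measurableT_comp (msigma _ _ nN) mphi).
    by have := mpsi measurableT _ (mo (parent y)); rewrite setTI.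
  - by apply/measurable_EFinP; exact: (measurableT_comp (mT _ _ nN) mphi).
split => //; apply: measurable_esum => [y|y|y z].
- exact: measurable_const_set.
- by apply: emeasurable_funM => //; exact: (measurableT_comp (ma y) mphi).
- by rewrite mule_ge0// esum_ge0// => i _; rewrite lee_fin.
Qed.

Lemma measurable_occ n : (n <= N)%N ->
  forall y, measurable [set z : U * R | occ (g z.1) (T z.1) (sigma z.1) n y z.2].
Proof.
elim: n => [|n ih] nN y; first exact: measurable_const_set.
have {}ih := ih (ltnW nN); have nN' : (0 < n.+1 <= N)%N by [].
have ms x i : measurable_fun setT (fun z : U * R => sigma z.1 n.+1 x i).
  exact: (measurableT_comp (msigma _ _ nN')).
rewrite (_ : [set _ | _] = \bigcup_i (
    [set z | occ (g z.1) (T z.1) (sigma z.1) n (parent y) (sigma z.1 n.+1 (label y) i)] `&`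
    ([set z | wclock (T z.1) (sigma z.1) n.+1 (occ (g z.1) (T z.1) (sigma z.1) n) (edge (g z.1))
        [set v' | (v' < sigma z.1 n.+1 (label y) i)%R] <= z.2%:E] `&`
    [set z | z.2%:E < wclock (T z.1) (sigma z.1) n.+1 (occ (g z.1) (T z.1) (sigma z.1) n) (edge (g z.1))
        [set v' | (v' <= sigma z.1 n.+1 (label y) i)%R] ]))); last first.
  by apply/seteqP; split => z /=; [move=> [i [? ? ?]]; exists i|move=> [i _ [? [? ?]]]; exists i].
apply: bigcup_measurable => i _; apply: measurableI; last apply: measurableI.
- pose psi (z : U * R) := (z.1, sigma z.1 n.+1 (label y) i).
  have mpsi : measurable_fun setT psi by apply: measurable_fun_pair.
  by have := mpsi measurableT _ (ih (parent y)); rewrite setTI.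
- have [m1 _] := @measurable_wclock_gen _ (U * R)%type fst
    (fun z => [set v' | (v' < sigma z.1 n.+1 (label y) i)%R]) (fun w => edge (g w))
    (fun w => occ (g w) (T w) (sigma w) n) n.+1 nN' (@measurable_fst _ _ _ _) ih
    edge_ge0 measurable_edge (fun x j => measurable_bool_set (measurable_fun_ltr (ms x j) (ms _ i))).
  apply: emeasurable_le_set => //.
  by apply/measurable_EFinP; exact: measurable_snd.
- have [m1 _] := @measurable_wclock_gen _ (U * R)%type fst
    (fun z => [set v' | (v' <= sigma z.1 n.+1 (label y) i)%R]) (fun w => edge (g w))
    (fun w => occ (g w) (T w) (sigma w) n) n.+1 nN' (@measurable_fst _ _ _ _) ih
    edge_ge0 measurable_edge (fun x j => measurable_bool_set (measurable_fun_ler (ms x j) (ms _ i))).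
  have := @measurable_lte _ _ _ setT measurableT (fun z : U * R => z.2%:E) _ _ m1.
  by rewrite setTI; apply; apply/measurable_EFinP; exact: measurable_snd.
Qed.

Let Xi w n := wclock (T w) (sigma w) n (occ (g w) (T w) (sigma w) n.-1).

Lemma measurable_clock (a : U -> seq nat -> \bar R) (B : U -> set R) n :
  (0 < n <= N)%N -> (forall w y, 0 <= a w y) ->
  (forall y, measurable_fun setT (fun w => a w y)) ->
  (forall x i, measurable [set w | B w (sigma w n x i)]) ->
  measurable_fun setT (fun w => Xi w n (a w) (B w)).
Proof.
move=> nN a0 ma mB; have nN' : (n.-1 <= N)%N.
  by case/andP: nN => _; exact/leq_trans/leq_pred.
by have [] := @measurable_wclock_gen _ U id B a (fun w => occ (g w) (T w) (sigma w) n.-1) n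
  nN (@measurable_id _ _ _) (measurable_occ nN') a0 ma mB.
Qed.

Lemma measurable_upto (b : U -> \bar R) n x i : (0 < n <= N)%N ->
  measurable_fun setT b -> measurable [set w | upto (b w) (sigma w n x i)].
Proof.
move=> nN mb; apply: emeasurable_le_set => //.
by apply/measurable_EFinP; exact: msigma.
Qed.

Lemma measurable_within (a b : U -> \bar R) n x i : (0 < n <= N)%N ->
  measurable_fun setT a -> measurable_fun setT b ->
  measurable [set w | within (a w) (b w) (sigma w n x i)].
Proof.
move=> nN ma mb; have ms : measurable_fun setT (fun w => (sigma w n x i)%:E).
  by apply/measurable_EFinP; exact: msigma.
rewrite (_ : [set _ | _] = [set w | a w < (sigma w n x i)%:E] `&`
   [set w | (sigma w n x i)%:E <= b w]).
  apply: measurableI; last exact: emeasurable_le_set.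
  by have := measurable_lte measurableT ma ms; rewrite setTI.
by apply/seteqP; split => w; rewrite /within/=; [move=> /andP[]|move=> [-> ->]].
Qed.

Lemma measurable_rho (b : U -> \bar R) k m : (0 < k)%N -> (k + m <= N.+1)%N ->
  measurable_fun setT b ->
  measurable_fun setT (fun w => rho (g w) (T w) (sigma w) k m (b w)).
Proof.
move=> k0 + mb; elim: m => [//|m ih] kmN; rewrite addnS in kmN.
have km : (0 < k + m <= N)%N by rewrite addn_gt0 k0.
apply: measurable_clock => // [w y|y|x i].
- exact: edge_ge0.
- exact: measurable_edge.
- by apply: measurable_upto => //; apply: ih; exact: ltnW.
Qed.

Variable Wt : U -> seq nat -> \bar R.
Hypothesis Wt0 : forall w y, 0 <= Wt w y.
Hypothesis mWt : forall y, measurable_fun setT (fun w => Wt w y).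

Lemma measurable_wclock_rho (a b : U -> \bar R) k n : (0 < k)%N -> (k <= n <= N)%N ->
  measurable_fun setT a -> measurable_fun setT b ->
  measurable_fun setT (fun w => Xi w n (fun y => Wt w y * edge (g w) y)
    (within (rho (g w) (T w) (sigma w) k (n - k) (a w))
            (rho (g w) (T w) (sigma w) k (n - k) (b w)))).
Proof.
move=> k0 /andP[kn nN] ma mb.
have n0 : (0 < n <= N)%N by rewrite nN (leq_trans k0).
apply: (@measurable_clock (fun w y => Wt w y * edge (g w) y)) => // [w y|y|x i].
- by rewrite mule_ge0 ?edge_ge0.
- by apply: emeasurable_funM => //; exact: measurable_edge.
- by apply: measurable_within => //; apply: measurable_rho => //; rewrite subnKC// leqW.
Qed.

Lemma measurable_wclock_upto_rho (b : U -> \bar R) k n : (0 < k)%N -> (k <= n <= N)%N ->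
  measurable_fun setT b ->
  measurable_fun setT (fun w => Xi w n (fun y => Wt w y * edge (g w) y)
    (upto (rho (g w) (T w) (sigma w) k (n - k) (b w)))).
Proof.
move=> k0 /andP[kn nN] mb.
have n0 : (0 < n <= N)%N by rewrite nN (leq_trans k0).
apply: (@measurable_clock (fun w y => Wt w y * edge (g w) y)) => // [w y|y|x i].
- by rewrite mule_ge0 ?edge_ge0.
- by apply: emeasurable_funM => //; exact: measurable_edge.
- by apply: measurable_upto => //; apply: measurable_rho => //; rewrite subnKC// leqW.
Qed.

Lemma measurable_occ_section (B : set (U * R)) n s : (n <= N)%N -> measurable B ->
  measurable_fun setT (fun w => lebesgue_measure
    (occ (g w) (T w) (sigma w) n s `&` [set u | B (w, u)] `&` `]0%R, +oo[)).
Proof.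
move=> nN mB; have mS := measurableI _ _ (measurableI _ _ (measurable_occ nN s) mB)
  (measurableX (@measurableT _ U) (measurable_itv `]0%R, +oo[ : measurable (_ : set R))).
have := measurable_fun_xsection (@lebesgue_measure R) mS.
apply: eq_measurable_fun => w _ /=; congr lebesgue_measure.
apply/seteqP; split => u; rewrite /xsection/=.
  by move=> /set_mem [[? ?] [_ ?]].
by move=> [[? ?] ?]; exact/mem_set.
Qed.

End measurability.

Section esum_sets.
Context {R : realType}.
Local Open Scope ereal_scope.

Lemma le_esum_set (I : choiceType) (A B : set I) (f : I -> \bar R) :
  A `<=` B -> (forall i, B i -> 0 <= f i) -> \esum_(i in A) f i <= \esum_(i in B) f i.
Proof.
move=> AB f0; rewrite esum_mkcond [leRHS]esum_mkcond; apply: le_esum => i _.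
case: ifPn => [/set_mem/AB Bi|_]; first by rewrite mem_set.
by case: ifPn => // /set_mem/f0.
Qed.

Lemma esum_setU (I : choiceType) (A B : set I) (f : I -> \bar R) :
  A `&` B = set0 -> (forall i, (A `|` B) i -> 0 <= f i) ->
  \esum_(i in A `|` B) f i = \esum_(i in A) f i + \esum_(i in B) f i.
Proof.
move=> AB f0; rewrite esum_mkcond [X in _ = X + _]esum_mkcond [X in _ = _ + X]esum_mkcond.
rewrite -esumD; last 2 first.
- by move=> i _; case: ifPn => // /set_mem Ai; apply: f0; left.
- by move=> i _; case: ifPn => // /set_mem Bi; apply: f0; right.
apply: eq_esum => i _; rewrite in_setU.
have [/set_mem Ai|nA] /= := boolP (i \in A); last by case: ifP => _; rewrite add0e.
rewrite ifF ?adde0//; apply: contraPF AB => /set_mem Bi.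
by move=> AB; have : (A `&` B) i by []; rewrite AB.
Qed.

Lemma esum_le_single (I : choiceType) (A : set I) (f : I -> \bar R) (i : I) :
  0 <= f i -> (forall j, A j -> j != i -> f j = 0) -> \esum_(j in A) f j <= f i.
Proof.
move=> fi fj; rewrite -[leRHS]esum_set1// esum_mkcond [leRHS]esum_mkcond.
apply: le_esum => j _; case: ifPn => [/set_mem Aj|]; last by case: ifP => // /set_mem ->.
have [->|ji] := eqVneq j i; first by rewrite mem_set.
by rewrite (fj j Aj ji); case: ifP => // /set_mem /= e; rewrite e eqxx in ji.
Qed.

(** A finite subset of an increasing union is contained in one of its members. *)
Lemma esum_bigcup_le (I : choiceType) (A : nat -> set I) (f : I -> \bar R) (l : \bar R) :
  (forall n m, (n <= m)%N -> A n `<=` A m) -> (forall i, 0 <= f i) ->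
  (forall n, \esum_(i in A n) f i <= l) -> \esum_(i in \bigcup_n A n) f i <= l.
Proof.
move=> A_mono f0 h; apply: ge_ereal_sup => _ [X [fX XA] <-].
suff [n Xn] : exists n, X `<=` A n.
  apply: le_trans (h n); apply: ereal_sup_ubound; exists X => //; split=> //.
case/finite_setP : fX => k; elim: k X XA => [|k ih] X XA.
  by rewrite II0 card_eq0 => /eqP ->; exists 0%N; exact: sub0set.
move=> /eq_cardSP[x Xx /ih[|n Xn]]; first by move=> y [/XA].
have [m _ Am] := XA _ Xx; exists (maxn n m) => y Xy.
have [->|/eqP yx] := eqVneq y x; first exact: (A_mono _ _ (leq_maxr _ _)).
by apply: (A_mono _ _ (leq_maxl _ _)); apply: Xn.
Qed.

Lemma nondecreasing_cvg_left (f : R -> \bar R) (v : R) (l : \bar R) : 0 <= l ->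
  (forall r, 0 <= f r) ->
  {homo f : r s / (r <= s)%R >-> r <= s} -> (forall r, (r < v)%R -> f r <= l) ->
  (forall y, y < l -> exists2 r, (r < v)%R & y < f r) ->
  f r @[r --> v^'-] --> l.
Proof.
move=> l0 f0 f_mono fl sup.
have ev y : y < l -> \forall r \near v^'-, y < f r.
  move=> /sup[r0 r0v yr]; near=> r; apply: (lt_le_trans yr); apply: f_mono.
  by apply: ltW; near: r; exact: nbhs_left_gt.
have evl : \forall r \near v^'-, f r <= l.
  by near=> r; apply: fl; near: r; exact: nbhs_left_lt.
case: l l0 fl sup ev evl => [l||]// l0 _ _ ev evl.
  apply/fine_cvgP; split.
    by apply: filterS evl => r fr; rewrite ge0_fin_numE// (le_lt_trans fr)// ltry.
  apply/cvgrPdist_le => /= e e0; have le : (l - e)%:E < l%:E by rewrite lte_fin ltrBlDr ltrDl.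
  apply: filterS2 evl (ev _ le) => r; have := f0 r; case: (f r) => [x||]//= _.
  rewrite lee_fin lte_fin => xl lx; rewrite ger0_norm ?subr_ge0// lerBlDr -lerBlDl.
  exact: ltW.
by apply/cvgeyPge => A; apply: filterS (ev A%:E (ltry _)) => r; exact: ltW.
Unshelve. all: by end_near. Qed.

Lemma lebesgue_ereal_itv_le (a b c : \bar R) : 0 <= a -> 0 <= c -> b <= a + c ->
  (@lebesgue_measure R) [set u | a <= u%:E < b] <= c.
Proof.
case: a => [a||]// _ c0; last first.
  move=> _; rewrite (_ : [set _ | _] = set0) ?measure0//.
  by apply/seteqP; split => u //= /andP[]; rewrite leye_eq.
case: b => [b||].
- case: c c0 => [c||]// c0; last by rewrite !leey.
  rewrite -EFinD lee_fin => bc; rewrite (_ : [set _ | _] = `[a, b[%classic).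
    rewrite lebesgue_measure_itv/=; case: ifPn => // _.
    by rewrite -EFinB lee_fin lerBlDl.
  by apply/seteqP; split => u; rewrite /= in_itv/= !lee_fin lte_fin.
- by case: c c0 => // c0; rewrite ?leey.
- rewrite (_ : [set _ | _] = set0) ?measure0//.
  by apply/seteqP; split => u //= /andP[].
Qed.

Lemma measurable_ereal_itv (a b : \bar R) : measurable ([set u | a <= u%:E < b] : set R).
Proof.
have mE : measurable_fun setT (@EFin R) by apply/measurable_EFinP.
rewrite (_ : [set _ | _] = [set u : R | a <= u%:E] `&` [set u : R | u%:E < b]).
  apply: measurableI; first exact: emeasurable_le_set.
  by have := measurable_lte measurableT mE (@measurable_cst _ _ _ _ _ b); rewrite setTI.
by apply/seteqP; split => u /=; [move=> /andP[]|move=> [-> ->]].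
Qed.

Lemma lebesgue_setU1_le (A : set R) (x : R) : measurable A ->
  (@lebesgue_measure R) (A `|` [set x]) <= lebesgue_measure A.
Proof.
move=> mA; have := @measureU2 _ _ _ (@lebesgue_measure R) A [set x] mA (measurable_set1 x).
by rewrite [X in _ <= _ + X -> _](_ : _ = 0) ?adde0//; exact: lebesgue_measure_set1.
Qed.

Lemma esum_sizeS n (f : seq nat -> \bar R) : (forall y, 0 <= f y) ->
  \esum_(y in [set y | size y = n.+1]) f y =
  \esum_(x in [set: nat]) \esum_(s in [set s | size s = n]) f (rcons s x).
Proof.
move=> f0; have e m : [set y : seq nat | size y = m] = cylinder [::] m.
  by apply/seteqP; split => y /=; [move=> ?; split => //; exact: take0|case].
rewrite !e esum_cylinder_rcons// esum_exchange//.
Qed.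

End esum_sets.

(** * Jumps of the clocks and occupation times along a fixed path *)

Section paths.
Context {R : realType}.
Variables (g : seq nat -> nat -> R) (T sigma : nat -> nat -> nat -> R).
Hypothesis g_gt0 : forall s x, 0 < g s x.
Hypothesis T_ge0 : forall k x i, 0 <= T k x i.
Hypothesis sigma_gt0 : forall k x i, (0 < k)%N -> 0 < sigma k x i.
Hypothesis no_ties : forall k x i x' i', (0 < k)%N ->
  sigma k x i = sigma k x' i' -> x = x' /\ i = i'.
Local Open Scope ereal_scope.
Local Notation occ := (occ g T sigma).
Local Notation wclock := (wclock T sigma).
Local Notation hold := (hold T sigma).
Local Notation visits := (visits sigma).
Local Notation edge := (edge g).
Local Notation leb := (@lebesgue_measure R).

Lemma wclockE n o a B : (0 < n)%N -> (forall y, 0 <= a y) -> wclock n o a B =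
  \esum_(k in [set k : seq nat * nat | size k.1 = n /\ visits n o k.1 B k.2])
    (a k.1 * (T n (label k.1) k.2)%:E).
Proof.
move=> n0 a0; rewrite /wclock; have T0 x i : 0 <= (T n x i)%:E by rewrite lee_fin T_ge0.
transitivity (\esum_(y in [set y | size y = n]) \esum_(i in visits n o y B)
    (a y * (T n (label y) i)%:E)).
  by apply: eq_esum => y _; rewrite /hold ge0_esumZl.
rewrite esum_esum; last by move=> *; rewrite mule_ge0.
by congr (esum _ _); apply/seteqP; split => k [].
Qed.

Lemma wclock_mono n o a B B' : (0 < n)%N -> (forall y, 0 <= a y) ->
  B `<=` B' -> wclock n o a B <= wclock n o a B'.
Proof.
move=> n0 a0 BB'; rewrite !wclockE//; apply: le_esum_set.
  by move=> k [? [/BB' ? ?]].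
by move=> k _; rewrite mule_ge0// lee_fin T_ge0.
Qed.

Lemma wclockU n o a B B' : (0 < n)%N -> (forall y, 0 <= a y) ->
  B `&` B' = set0 -> wclock n o a (B `|` B') = wclock n o a B + wclock n o a B'.
Proof.
move=> n0 a0 BB'; rewrite !wclockE// -esum_setU.
- congr (esum _ _); apply/seteqP; split => k /=.
    by move=> [? [[]]]; [left|right].
  by case=> -[? [? ?]]; split => //; split => //; [left|right].
- apply/seteqP; split => // k [[_ [B1 _]] [_ [B2 _]]].
  by have : (B `&` B') (sigma n (label k.1) k.2) by []; rewrite BB'.
- by move=> k _; rewrite mule_ge0// lee_fin T_ge0.
Qed.

Lemma edge_gt0 y : 0 < edge y. Proof. by rewrite lte_fin. Qed.

Let Xi n := wclock n (occ n.-1) edge.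

Let edge0 y : 0 <= edge y. Proof. exact/ltW/edge_gt0. Qed.

Let Xi_le n v v' : (0 < n)%N -> (v < v')%R ->
  Xi n [set r | (r <= v)%R] <= Xi n [set r | (r < v')%R].
Proof. by move=> n0 vv'; apply: wclock_mono => // r /= /le_lt_trans; exact. Qed.

(** Jump intervals at distinct times are disjoint because the clock is nondecreasing. Without ties,
    a jump determines its label, hence by induction the occupied vertex. *)
Lemma jump_unique n v v' (u : R) : (0 < n)%N ->
  Xi n [set r | (r < v)%R] <= u%:E < Xi n [set r | (r <= v)%R] ->
  Xi n [set r | (r < v')%R] <= u%:E < Xi n [set r | (r <= v')%R] -> v = v'.
Proof.
move=> n0 /andP[h1 h2] /andP[h3 h4]; apply/eqP; rewrite eq_le !leNgt; apply/andP; split.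
  apply/negP => /(Xi_le n0) h; have := lt_le_trans h4 (le_trans h h1).
  by rewrite ltxx.
apply/negP => /(Xi_le n0) h; have := lt_le_trans h2 (le_trans h h3).
by rewrite ltxx.
Qed.

Lemma occ_inj n s s' u : size s = n -> size s' = n -> occ n s u -> occ n s' u -> s = s'.
Proof.
elim: n s s' u => [|n ih] s s' u sn s'n; first by case: s sn s'n => //; case: s'.
move=> [i [oc1 a1 b1]] [i' [oc2 a2 b2]].
have e := @jump_unique n.+1 _ _ u (ltn0Sn n) (introT andP (conj a1 b1)) (introT andP (conj a2 b2)).
have [lx _] := no_ties (ltn0Sn n) e; rewrite -(@parentK s) ?sn// -(@parentK s') ?s'n// lx.
congr (rcons _ _); apply: (ih _ _ (sigma n.+1 (label s) i)) => //.
- by rewrite size_parent sn.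
- by rewrite size_parent s'n.
- by rewrite e.
Qed.

(** A mark is never shared and its parent is the one occupied vertex, so the jump of the clock there
    consists of a single weighted holding time. *)
Lemma jump_le n y i : (0 < n)%N -> size y = n -> occ n.-1 (parent y) (sigma n (label y) i) ->
  Xi n [set r | (r <= sigma n (label y) i)%R] <=
  Xi n [set r | (r < sigma n (label y) i)%R] + edge y * (T n (label y) i)%:E.
Proof.
move=> n0 yn oy; set v := sigma _ _ _ in oy *.
rewrite (_ : [set r | (r <= v)%R] = [set r | (r < v)%R] `|` [set v]); last first.
  apply/seteqP; split => r /=; rewrite le_eqVlt.
    by case/predU1P => [->|]; [right|left].
  by case=> [->|->]; rewrite ?eqxx ?orbT.
rewrite /Xi wclockU//; last first.
  by apply/seteqP; split => // r /= [+ e]; rewrite e ltxx.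
apply: leeD2l; rewrite wclockE//.
apply: (@esum_le_single _ _ _ (fun k => edge k.1 * (T n (label k.1) k.2)%:E) (y, i)).
  by rewrite mule_ge0// lee_fin T_ge0.
move=> [y' i'] [/= y'n [/= e o']] /negP[]; apply/eqP.
have [ly ->] := no_ties n0 e; congr pair.
rewrite -(@parentK y) ?yn// -(@parentK y') ?y'n// ly; congr rcons.
apply: (@occ_inj n.-1 _ _ v) => //; rewrite ?size_parent ?yn ?y'n//.
by move: o'; rewrite e.
Qed.

Lemma le_jump n y i : (0 < n)%N -> size y = n -> occ n.-1 (parent y) (sigma n (label y) i) ->
  Xi n [set r | (r < sigma n (label y) i)%R] + edge y * (T n (label y) i)%:E <=
  Xi n [set r | (r <= sigma n (label y) i)%R].
Proof.
move=> n0 yn oy; set v := sigma _ _ _ in oy *.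
rewrite (_ : [set r | (r <= v)%R] = [set r | (r < v)%R] `|` [set v]); last first.
  apply/seteqP; split => r /=; rewrite le_eqVlt.
    by case/predU1P => [->|]; [right|left].
  by case=> [->|->]; rewrite ?eqxx ?orbT.
rewrite /Xi wclockU//; last first.
  by apply/seteqP; split => // r /= [+ e]; rewrite e ltxx.
apply: leeD2l; rewrite wclockE//.
rewrite -(esum_set1 (a := fun k => edge k.1 * (T n (label k.1) k.2)%:E) (t := (y, i))) /=.
  by apply: le_esum_set => [_ ->//|k _]; rewrite mule_ge0// lee_fin.
by rewrite mule_ge0// lee_fin.
Qed.

Lemma measurable_within1 (a b : \bar R) : measurable (within a b).
Proof.
have mE : measurable_fun setT (@EFin R) by apply/measurable_EFinP.
rewrite (_ : within a b = [set u : R | a < u%:E] `&` [set u : R | u%:E <= b]).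
  apply: measurableI; last exact: emeasurable_le_set.
  by have := measurable_lte measurableT (@measurable_cst _ _ _ _ _ a) mE; rewrite setTI.
by apply/seteqP; split => u; rewrite /within/=; [move=> /andP[]|move=> [-> ->]].
Qed.

Lemma measurable_occ1 n y : measurable (occ n y).
Proof.
have g0 s x : (0 <= g s x)%R by exact: ltW.
have h := @measurable_occ _ unit R n (fun=> g) (fun=> T) (fun=> sigma)
  (fun=> g0) (fun=> T_ge0) (fun _ _ => @measurable_cst _ _ _ _ _ _)
  (fun _ _ _ _ => @measurable_cst _ _ _ _ _ _) (fun _ _ _ _ => @measurable_cst _ _ _ _ _ _) n (leqnn n) y.
have mtt : measurable_fun setT (fun u : R => (tt, u)) by apply: measurable_fun_pair.
by have := mtt measurableT _ h; rewrite setTI.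
Qed.

(** Time spent at [s] inside the image of the window [(a, b]] is covered by the jumps at marks of
    that window, whose lengths are bounded by [jump_le]. *)
Lemma occ_hold_le n s a b : (0 < n)%N -> size s = n ->
  leb (occ n s `&` within (Xi n (upto a)) (Xi n (upto b))) <=
  edge s * hold n (occ n.-1) s (within a b).
Proof.
case: n => // n _ sn; set A := Xi _ _; set B := Xi _ _.
have A0 : 0 <= A by apply: esum_ge0 => y _; rewrite mule_ge0 ?esum_ge0// => i _; rewrite lee_fin T_ge0.
pose v i := sigma n.+1 (label s) i.
pose Vis := visits n.+1 (occ n) s (within a b).
pose I i := if i \in Vis then [set u : R | Xi n.+1 [set r | (r < v i)%R] <= u%:E < Xi n.+1 [set r | (r <= v i)%R]] else set0.
have mI i : measurable (I i).
  by rewrite /I; case: ifP => _ //; exact: measurable_ereal_itv.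
have X0 C : 0 <= Xi n.+1 C.
  by apply: esum_ge0 => y _; rewrite mule_ge0 ?esum_ge0// => i _; rewrite lee_fin T_ge0.
(* The endpoint [B] may open a jump whose mark lies beyond [b]; a single point has measure 0 and is
   set aside. *)
have sub : occ n.+1 s `&` within A B `<=` [set fine B] `|` \bigcup_i I i.
  move=> u [[i [oi h1 h2]] /andP[Au uB]].
  have [<-|uB'] := eqVneq (u%:E) B; first by left.
  right; exists i => //; rewrite /I mem_set; first by rewrite /= h1 h2.
  split => //; apply/andP; split; [rewrite ltNge|rewrite leNgt]; apply/negP => h.
    suff : Xi n.+1 [set r | (r <= v i)%R] <= A by rewrite leNgt (lt_trans Au).
    by apply: wclock_mono => // r /= rv; apply: le_trans h; rewrite lee_fin.
  suff : B <= u%:E by rewrite leNgt lt_neqAle uB' uB.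
  apply: le_trans h1; apply: wclock_mono => // r /= rb.
  by rewrite -lte_fin; exact: le_lt_trans h.
apply: (@le_trans _ _ (leb (\bigcup_i I i))).
  have m1 : measurable ([set fine B] : set R) by exact: measurable_set1.
  apply: (@le_trans _ _ (leb ([set fine B] `|` \bigcup_i I i))).
    apply: le_measure; rewrite ?inE.
    - apply: measurableI; first exact: measurable_occ1.
      exact: measurable_within1.
    - by apply: measurableU; [exact: m1|exact: bigcupT_measurable].
    - exact: sub.
  by rewrite setUC; apply: lebesgue_setU1_le; exact: bigcupT_measurable.
rewrite -ge0_esumZl//; last by move=> i _; rewrite lee_fin.
rewrite esum_mkcond -nneseries_esumT; last first.
  by move=> i; case: ifP => // _; rewrite mule_ge0 ?edge0// lee_fin.
apply: (@le_trans _ _ (\sum_(0 <= i <oo) leb (I i))).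
  by apply: (measure_sigma_subadditive leb mI) => //; exact: bigcupT_measurable.
apply: lee_nneseries => [i _ _|i _]; first exact: measure_ge0.
rewrite /I; case: ifPn => [/set_mem [_ oi]|_]; last by rewrite measure0.
apply: lebesgue_ereal_itv_le => //; first by rewrite mule_ge0// lee_fin.
exact: jump_le.
Qed.

(** Jump intervals are disjoint, and each has the full length of its weighted holding time as long
    as the clock is finite at finite times; past an explosion they would be empty. *)
Lemma hold_le_occ n s : (0 < n)%N -> size s = n ->
  (forall v : R, Xi n (upto v%:E) < +oo) ->
  edge s * hold n (occ n.-1) s setT <= leb (occ n s `&` `]0%R, +oo[).
Proof.
case: n => // n _ sn fin.
pose v i := sigma n.+1 (label s) i.
have X0 C : 0 <= Xi n.+1 C.
  by apply: esum_ge0 => y _; rewrite mule_ge0 ?esum_ge0// => i _; rewrite lee_fin T_ge0.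
pose Vis := visits n.+1 (occ n) s setT.
pose I i := if i \in Vis then [set u : R | Xi n.+1 [set r | (r < v i)%R] <= u%:E < Xi n.+1 [set r | (r <= v i)%R]] else set0.
have mI i : measurable (I i).
  by rewrite /I; case: ifP => _ //; exact: measurable_ereal_itv.
have tI : trivIset setT I.
  apply/trivIsetP => i j _ _ ij; apply/seteqP; split => // u [].
  rewrite /I; case: ifP => // _ h1; case: ifP => // _ h2.
  have [_ e] := no_ties (ltn0Sn n) (jump_unique (ltn0Sn n) h1 h2).
  by rewrite e eqxx in ij.
have sub : \bigcup_i I i `<=` occ n.+1 s `&` `[0%R, +oo[.
  move=> u [i _]; rewrite /I; case: ifPn => // /set_mem [_ oi] /andP[h1 h2]; split.
    by exists i; split.
  by rewrite /= in_itv/= andbT -lee_fin; exact: le_trans h1.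
have -> : leb (occ n.+1 s `&` `]0%R, +oo[) = leb (occ n.+1 s `&` `[0%R, +oo[).
  apply/eqP; rewrite eq_le; apply/andP; split.
    apply: le_measure; rewrite ?inE.
    - by apply: measurableI; [exact: measurable_occ1|exact: measurable_itv].
    - by apply: measurableI; [exact: measurable_occ1|exact: measurable_itv].
    - by move=> u [? /=]; rewrite !in_itv/= !andbT => /ltW.
  apply: (@le_trans _ _ (leb ((occ n.+1 s `&` `]0%R, +oo[) `|` [set 0%R]))).
    apply: le_measure; rewrite ?inE.
    - by apply: measurableI; [exact: measurable_occ1|exact: measurable_itv].
    - apply: measurableU => //.
      by apply: measurableI; [exact: measurable_occ1|exact: measurable_itv].
    - move=> u [? /=]; rewrite !in_itv/= !andbT le_eqVlt => /predU1P[->|u0]; first by right.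
      by left; split => //=; rewrite in_itv/= u0.
  by apply: lebesgue_setU1_le; apply: measurableI; [exact: measurable_occ1|exact: measurable_itv].
apply: (@le_trans _ _ (leb (\bigcup_i I i))); last first.
  apply: le_measure => //; rewrite ?inE; first exact: bigcupT_measurable.
  by apply: measurableI; [exact: measurable_occ1|exact: measurable_itv].
have -> : leb (\bigcup_i I i) = \sum_(0 <= i <oo) leb (I i).
  by apply/esym/cvg_lim => //; apply: measure_semi_sigma_additive => //; exact: bigcupT_measurable.
rewrite -ge0_esumZl//; last by move=> i _; rewrite lee_fin.
rewrite esum_mkcond -nneseries_esumT; last first.
  by move=> i; case: ifP => // _; rewrite mule_ge0 ?edge0// lee_fin.
apply: lee_nneseries => [i _ _|i _]; first by case: ifP => // _; rewrite mule_ge0 ?edge0// lee_fin.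
rewrite /I; case: ifPn => [/set_mem [_ oi]|_]; last by [].
have f1 : Xi n.+1 [set r | (r <= v i)%R] \is a fin_num.
  by rewrite ge0_fin_numE// fin.
have f2 : Xi n.+1 [set r | (r < v i)%R] \is a fin_num.
  rewrite ge0_fin_numE//; apply: le_lt_trans (fin (v i)).
  by apply: wclock_mono => // r /= /ltW; rewrite /upto/= lee_fin.
have le := @le_jump n.+1 s i (ltn0Sn n) sn oi.
rewrite -/v in le; move: le; rewrite -(fineK f1) -(fineK f2) => le.
rewrite (_ : [set u : R | _] = `[fine (Xi n.+1 [set r | (r < v i)%R]), fine (Xi n.+1 [set r | (r <= v i)%R])[%classic); last first.
  by apply/seteqP; split => u; rewrite /= in_itv/= lee_fin lte_fin.
rewrite lebesgue_measure_itv/=.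
move: le; rewrite -EFinM -EFinD lee_fin; set a := fine _; set b := fine _.
move=> le; case: ifPn => [_|]; first by rewrite -EFinB lee_fin; lra.
by rewrite lte_fin -leNgt lee_fin; lra.
Qed.

(** A mark before [v] is at most [v - 1/(m + 1)] for some [m], so the closed windows exhaust the
    open one. This evaluates the left limit that occurs in [next_coordinate]. *)
Lemma clock_cvg_left n v : (0 < n)%N ->
  Xi n (upto r%:E) @[r --> v^'-] --> Xi n [set r | (r < v)%R].
Proof.
move=> n0; have X0 C : 0 <= Xi n C.
  by apply: esum_ge0 => y _; rewrite mule_ge0 ?edge0 ?esum_ge0// => i _; rewrite lee_fin.
apply: nondecreasing_cvg_left => //.
- move=> r r' rr'; apply: wclock_mono => // u; rewrite /upto/= !lee_fin => ur.
  exact: le_trans rr'.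
- move=> r rv; apply: wclock_mono => // u; rewrite /upto/= lee_fin => ur.
  exact: le_lt_trans rv.
- move=> y yl; apply: contrapT => h; move: yl; rewrite ltNge => /negP; apply.
  pose B m : set R := upto (v - m.+1%:R^-1)%:E.
  rewrite /Xi wclockE//.
  rewrite (_ : [set k | _] = \bigcup_m [set k : seq nat * nat | size k.1 = n /\ visits n (occ n.-1) k.1 (B m) k.2]).
    apply: esum_bigcup_le.
    - move=> m m' mm' k [kn [Bk ok]]; split => //; split => //; apply: le_trans Bk _.
      by rewrite lee_fin lerD2l lerN2 lef_pV2 ?posrE// ler_nat.
    - by move=> k; rewrite mule_ge0 ?edge0// lee_fin.
    - move=> m; rewrite -wclockE// leNgt; apply/negP => hm; apply: h.
      by exists (v - m.+1%:R^-1)%R => //; rewrite ltrBlDr ltrDl.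
  apply/seteqP; split => k /=; last first.
    move=> [m _ [kn [Bk ok]]]; split => //; split => //=.
    by move: Bk; rewrite /B/upto/= lee_fin => /le_lt_trans; apply; rewrite ltrBlDr ltrDl.
  move=> [kn [/= kv ok]]; set z := sigma _ _ _ in kv ok.
  have [m hm] := ltr_add_invr kv; exists m => //; split => //; split => //.
  by rewrite /B/upto/= lee_fin lerBrDr ltW.
Qed.

End paths.

(** * Identification with the recursively defined process *)

Section path_identities.
Context {R : realType}.
Variables (g : seq nat -> nat -> R) (T sigma : nat -> nat -> nat -> R).
Hypothesis g_gt0 : forall s x, 0 < g s x.
Hypothesis T_ge0 : forall k x i, 0 <= T k x i.
Hypothesis sigma_gt0 : forall k x i, (0 < k)%N -> 0 < sigma k x i.
Hypothesis no_ties : forall k x i x' i', (0 < k)%N ->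
  sigma k x i = sigma k x' i' -> x = x' /\ i = i'.
(* [Td] stands for the holding times of the model, which may differ from [T] at
   the unused level 0. *)
Variable Td : nat -> nat -> nat -> R.
Hypothesis TdE : forall k x i, (0 < k)%N -> Td k x i = T k x i.
Local Open Scope ereal_scope.
Local Notation occ := (occ g T sigma).
Local Notation wclock := (wclock T sigma).
Local Notation hold := (hold T sigma).
Local Notation visits := (visits sigma).
Local Notation edge := (edge g).
Local Notation leb := (@lebesgue_measure R).
Local Notation X := (X g Td sigma).
Let Xi n := wclock n (occ n.-1) edge.
Let edge0 y : 0 <= edge y. Proof. exact/ltW/edge_gt0. Qed.

Lemma size_X k u : size (X k u) = k.
Proof. by elim: k u => //= k ih u; rewrite size_rcons ih. Qed.

Let linked k := forall y u, size y = k -> X k u = map Some y <-> occ k y u.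

(** At each mark the sum over possible parents has one term, the actual state of [X k], or none when
    this state has an infinite coordinate, where [extend] is 0 as well. *)
Lemma clockE k (a : seq nat -> nat -> \bar R) (b : \bar R) : linked k ->
  (forall s x, 0 <= a s x) ->
  clock Td sigma (X k) k.+1 a b =
  wclock k.+1 (occ k) (fun y => a (parent y) (label y)) (upto b).
Proof.
move=> lk a0; have T0 x i : 0 <= (T k.+1 x i)%:E by rewrite lee_fin.
rewrite /wclock esum_sizeS; last first.
  by move=> y; rewrite mule_ge0// esum_ge0// => i _; rewrite lee_fin.
rewrite /clock; apply: eq_esum => x _.
transitivity (\esum_(s in [set s | size s = k]) \esum_(i in [set i | (sigma k.+1 x i)%:E <= b])
   (if i \in [set i | occ k s (sigma k.+1 x i)] then a s x * (T k.+1 x i)%:E else 0)); last first.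
  apply: eq_esum => s _; rewrite parent_rcons label_rcons /hold -ge0_esumZl// -esum_mkcondr.
  rewrite /visits parent_rcons label_rcons.
  by congr (esum _ _).
rewrite esum_exchange; last by move=> s i _ _; case: ifP => // _; rewrite mule_ge0.
apply: eq_esum => i _; rewrite TdE//; set v := sigma _ _ _.
rewrite /extend; case: ifPn => [allS|nS].
  pose s0 := pmap id (X k v); have e0 : X k v = map Some s0.
    rewrite /s0; elim: (X k v) allS => //= -[z|//] l ih /ih e.
    by rewrite /= -e.
  have s0k : size s0 = k by rewrite -(size_map Some) -e0 size_X.
  have o0 : occ k s0 v by apply/lk.
  apply/eqP; rewrite eq_le; apply/andP; split.
    rewrite -(@esum_set1 _ _ s0 (fun s => a s x * (T k.+1 x i)%:E)) ?mule_ge0//.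
    rewrite esum_mkcond [leRHS]esum_mkcond; apply: le_esum => s _.
    case: ifPn => [/set_mem /= ->|_].
      by rewrite mem_set//= mem_set.
    by case: ifP => // _; case: ifP => // _; rewrite mule_ge0.
  apply: (@le_trans _ _ ((fun s => a s x * (T k.+1 x i)%:E) s0)); last by [].
  apply: le_trans (esum_le_single (i := s0) _ _) _.
  - by case: ifP => // _; rewrite mule_ge0.
  - move=> s /= sk ss0; case: ifPn => // /set_mem /= /(lk _ _ sk).
    by rewrite e0 => /(inj_map (@Some_inj _)) e; rewrite e eqxx in ss0.
  - by case: ifP => // _; rewrite mule_ge0.
rewrite mul0e esum1// => s /= sk; case: ifPn => // /set_mem /= /(lk _ _ sk) e.
by move: nS; rewrite e; case/negP; elim: (s).
Qed.

(** The last coordinate of a state is finite exactly on a jump interval; the inverse clock then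
    returns the time of the mark, at which the induction hypothesis applies to the parent. *)
Lemma linkedP k : linked k.
Proof.
elim: k => [|k lk] y u; first by case: y.
case/lastP: y => // p x; rewrite size_rcons => -[pk].
set xi := clock Td sigma (X k) k.+1 (gamma_weight g).
have xiE b : xi b = Xi k.+1 (upto b).
  rewrite /xi (clockE _ lk); first by apply: eq_esum.
  by move=> s z; rewrite lee_fin ltW.
have limE v : lim (xi r%:E @[r --> v^'-]) = Xi k.+1 [set r | (r < v)%R].
  apply/cvg_lim => //; have -> : (fun r : R => xi r%:E) = (fun r => Xi k.+1 (upto r%:E)).
    by apply/funext => r; exact: xiE.
  exact: clock_cvg_left.
have upE v : Xi k.+1 (upto v%:E) = Xi k.+1 [set r | (r <= v)%R] by [].
(* On the jump interval of [v], the clock exceeds [u] at [v] and is at most [u] before, so the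
   generalised inverse at [u] is [v]. *)
have invE v : (0 < v)%R -> Xi k.+1 [set r | (r < v)%R] <= u%:E < Xi k.+1 [set r | (r <= v)%R] ->
    clock_inverse xi u = v.
  move=> v0 /andP[h1 h2]; rewrite /clock_inverse; apply/eqP; rewrite eq_le; apply/andP; split.
    apply: ge_inf; first by exists 0%R => r /= [].
    by split; [exact: ltW|rewrite xiE upE].
  apply: lb_le_inf; first by exists v; split; [exact: ltW|rewrite xiE upE].
  move=> r [_]; rewrite xiE => ur; rewrite leNgt; apply/negP => rv.
  suff : Xi k.+1 (upto r%:E) <= u%:E by rewrite leNgt ur.
  by apply: le_trans h1; apply: wclock_mono => // z; rewrite /upto/= lee_fin => /le_lt_trans; exact.
have -> : X k.+1 u = rcons (X k (clock_inverse xi u)) (next_coordinate sigma xi k.+1 u) by [].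
rewrite map_rcons; split.
- move=> /rcons_inj[e1 e2]; have : exists o, exists x' i, [/\ o = Some x',
    (lim (xi r%:E @[r --> (sigma k.+1 x' i)^'-]) <= u%:E)%E & (u%:E < xi (sigma k.+1 x' i)%:E)%E].
    apply: contrapT => h; move: e2; rewrite /next_coordinate xgetPN// => o ho.
    by apply: h; exists o.
  move=> /(xgetPex None); rewrite -/(next_coordinate sigma xi k.+1 u) e2.
  move=> [x' [i [[<-]]]]; rewrite limE xiE upE => h1 h2.
  exists i; rewrite parent_rcons label_rcons; split => //.
  rewrite -(@invE (sigma k.+1 x i)) ?sigma_gt0//; first exact/lk.
  by rewrite h1 h2.
- move=> [i]; rewrite parent_rcons label_rcons => -[op h1 h2].
  have h : Xi k.+1 [set r | (r < sigma k.+1 x i)%R] <= u%:E <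
    Xi k.+1 [set r | (r <= sigma k.+1 x i)%R] by rewrite h1 h2.
  rewrite (invE _ (sigma_gt0 _ _ _) h)//; congr rcons; first exact/lk.
  have : exists o, exists x' i, [/\ o = Some x',
    (lim (xi r%:E @[r --> (sigma k.+1 x' i)^'-]) <= u%:E)%E & (u%:E < xi (sigma k.+1 x' i)%:E)%E].
    by exists (Some x), x, i; rewrite limE xiE upE.
  move=> /(xgetPex None); rewrite -/(next_coordinate sigma xi k.+1 u).
  move=> [x' [i' [->]]]; rewrite limE xiE upE => h1' h2'.
  have h' := introT andP (conj h1' h2').
  (* [xget] may pick any witness; disjointness of the jumps shows that its label is [x]. *)
  by have [<- _] := no_ties (ltn0Sn k) (jump_unique g_gt0 T_ge0 (ltn0Sn k) h h').
Qed.

Lemma at_vertexE s : at_vertex g Td sigma s = occ (size s) s.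
Proof. by apply/seteqP; split => u; have h := @linkedP (size s) s u erefl; move/h. Qed.

Let Xi_compE k m b : (0 < k)%N -> Xi_comp g Td sigma k m b = rho g T sigma k m b.
Proof.
move=> k0; rewrite /Xi_comp /rho; elim: m => //= m ->.
case: k k0 => // k _; rewrite /Defs.Xi addSn /= clockE; [|exact: linkedP|].
  by apply: eq_esum.
by move=> s x; rewrite lee_fin ltW.
Qed.

Lemma theta_tildeE alpha k n t : (0 < k <= n)%N ->
  (forall s, 0 <= W alpha g s) ->
  theta_tilde alpha g Td sigma k n t =
  wclock n (occ n.-1) (fun y => W alpha g y * edge y) (upto (rho g T sigma k (n - k) t%:E)).
Proof.
move=> /andP[k0 kn] W0; rewrite /theta_tilde Xi_compE//; case: n kn => [|n] kn.
  by rewrite leqNgt k0 in kn.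
rewrite /Xi_tilde/= clockE; [|exact: linkedP|].
  by apply: eq_esum => y /= yn; rewrite /W_gamma_weight parentK ?yn.
by move=> s x; rewrite mule_ge0// lee_fin ltW.
Qed.

End path_identities.

Section path_estimates.
Context {R : realType}.
Variables (g : seq nat -> nat -> R) (T sigma : nat -> nat -> nat -> R).
Hypothesis g_gt0 : forall s x, 0 < g s x.
Hypothesis T_ge0 : forall k x i, 0 <= T k x i.
Hypothesis sigma_gt0 : forall k x i, (0 < k)%N -> 0 < sigma k x i.
Hypothesis no_ties : forall k x i x' i', (0 < k)%N ->
  sigma k x i = sigma k x' i' -> x = x' /\ i = i'.
Local Open Scope ereal_scope.
Local Notation occ := (occ g T sigma).
Local Notation wclock := (wclock T sigma).
Local Notation edge := (edge g).
Local Notation rho := (rho g T sigma).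
Local Notation leb := (@lebesgue_measure R).
Variable Wt : seq nat -> \bar R.
Hypothesis Wt0 : forall y, 0 <= Wt y.
Let edge0 y : 0 <= edge y. Proof. exact/ltW/edge_gt0. Qed.
Let Xi n := wclock n (occ n.-1) edge.
Let Xit n := wclock n (occ n.-1) (fun y => Wt y * edge y).
Let Wedge0 y : 0 <= Wt y * edge y. Proof. by rewrite mule_ge0. Qed.

(** The measure Lambda of the overview, for an arbitrary set [B] and restricted to positive
    times. *)
Definition mass_of n (B : set R) : \bar R :=
  \esum_(s in [set s | size s = n]) (Wt s * leb (occ n s `&` B `&` `]0%R, +oo[)).

Lemma mass_of_le n a b : (0 < n)%N ->
  mass_of n (within (Xi n (upto a)) (Xi n (upto b))) <= Xit n (within a b).
Proof.
move=> n0; apply: le_esum => s /= sn; rewrite -muleA; apply: lee_wpmul2l => //.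
apply: le_trans (occ_hold_le g_gt0 T_ge0 no_ties a b n0 sn).
have mo := measurable_occ1 sigma g_gt0 T_ge0 n s.
by apply: le_measure; rewrite ?inE; do ?[apply: measurableI]; do ?[exact: mo|exact: measurable_within1|exact: measurable_itv].
Qed.

Lemma rho_mono k m a b : (0 < k)%N -> a <= b -> rho k m a <= rho k m b.
Proof.
move=> k0; elim: m a b => // m ih a b ab.
rewrite /rho/=; apply: wclock_mono => //; first by rewrite addn_gt0 k0.
by move=> r /= ra; apply: le_trans ra (ih _ _ ab).
Qed.

Lemma rho0 k m : (0 < k)%N -> rho k m 0 = 0.
Proof.
move=> k0; elim: m => // m ih; rewrite /rho/= -/(rho k m 0) ih.
rewrite /wclock esum1// => y _; rewrite (_ : hold _ _ _ _ _ _ = 0) ?mule0//.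
rewrite /hold (_ : visits _ _ _ _ _ = set0) ?esum_set0//; apply/seteqP; split => // i [].
by rewrite /upto/= lee_fin leNgt sigma_gt0// addn_gt0 k0.
Qed.

Lemma wclock_within_add n a b c : (0 < n)%N -> a <= b -> b <= c ->
  Xit n (within a c) = Xit n (within a b) + Xit n (within b c).
Proof.
move=> n0 ab bc; rewrite /Xit -wclockU//.
  congr (wclock _ _ _ _); apply/seteqP; split => r.
    by move=> /andP[ar rc]; have [rb|br] := leP r%:E b; [left|right]; rewrite /within/= ?ar ?br.
  case=> /andP[h1 h2]; apply/andP; split => //; first exact: le_trans h2 _.
  exact: le_lt_trans h1.
by apply/seteqP; split => // r [/andP[_ h1] /andP[h2 _]]; have := le_lt_trans h1 h2; rewrite ltxx.
Qed.

Lemma wclock_uptoE n b : (0 < n)%N -> Xit n (upto b) = Xit n (within 0 b).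
Proof.
move=> n0; apply: eq_esum => y /= yn; congr (_ * _); congr (esum _ _).
apply/seteqP; split => i [h1 h2]; split => //; first by rewrite /within/= lte_fin sigma_gt0.
by have /andP[] := h1.
Qed.

End path_estimates.

(** * Poisson marks and exponential holding times *)

Section exponential_law.
Context d (Omega : measurableType d) (R : realType) (P : probability Omega R).
Variable S : {RV P >-> R}.
Hypothesis lawS : forall A, measurable A -> distribution P S A = exponential_prob 1 A.
Local Open Scope ereal_scope.
Local Notation leb := (@lebesgue_measure R).

Let PS (A : set R) : P (S @^-1` A) = distribution P S A. Proof. by []. Qed.

Let mS : measurable_fun setT (S : Omega -> R). Proof. exact: measurable_funP. Qed.

Lemma exponential_ge0 : {ae P, forall w, (0 <= S w)%R}.
Proof.
have mN : measurable (`]-oo, 0%R[ : set R) by exact: measurable_itv.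
exists (S @^-1` `]-oo, 0%R[); split.
- by rewrite -[X in measurable X]setTI; exact: mS.
- rewrite PS lawS// /exponential_prob integral0_eq// => x /=; rewrite in_itv/= => x0.
  by rewrite lt0_exponential_pdf.
- by move=> w /= /negP; rewrite -ltNge in_itv.
Qed.

Let itv0 x : (0 < x)%R -> P (S @^-1` `[0%R, x]) = (1 - expR (- x))%:E.
Proof. by move=> x0; rewrite PS lawS// exponential_prob_itv0c// mulN1r. Qed.

(** Layer-cake formula: the mean is the integral over [u > 0] of the tail, and the tail is at most
    the probability of leaving [[0, u]], namely [exp(-u)]. *)
Lemma exponential_mean : \int[P]_w (`|S w|%:E) <= 1.
Proof.
have mA : measurable_fun setT (fun w => `|S w|%R) by exact: measurableT_comp.
pose E : set (Omega * R) := [set z | (0 < z.2 < `|S z.1|)%R].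
have mE : measurable E.
  rewrite (_ : E = [set z | (0 < z.2)%R] `&` [set z | (z.2 < `|S z.1|)%R]).
    apply: measurableI; apply: measurable_bool_set; apply: measurable_fun_ltr => //.
    exact: (measurableT_comp mA).
  by apply/seteqP; split => z; rewrite /E/=; [move=> /andP[]|case=> -> ->].
have iE w : (`|S w|)%:E = \int[leb]_u (\1_E (w, u))%:E.
  transitivity (\int[leb]_u (\1_(`]0%R, `|S w|[%classic) u)%:E).
    rewrite integral_indic// setIT [RHS](@lebesgue_measure_itv R `]0%R, `|S w|%R[)/= lte_fin.
    case: ltP => [_|]; first by rewrite -EFinB subr0.
    by rewrite normr_le0 => /eqP ->; rewrite normr0.
  by apply: eq_integral => u _; congr (_%:E); rewrite !indicE; congr (_%:R);
    apply/idP/idP => /set_mem h; apply/mem_set; rewrite /= ?in_itv/= in h *.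
under eq_integral do rewrite iE.
rewrite -[leLHS]/(\int[P]_w fubini_F leb (fun z => (\1_E z)%:E) w).
have mI : measurable_fun setT (fun z : Omega * R => (\1_E z)%:E : \bar R).
  by apply/measurable_EFinP; exact: measurable_indic.
rewrite -fubini_tonelli1// fubini_tonelli2// /fubini_G.
have G u : \int[P]_w (\1_E (w, u))%:E <= ((expR (- u))%:E * (\1_(`]0%R, +oo[%classic) u)%:E).
  have [u0|u0] := ltP 0%R u; last first.
    rewrite [X in _ <= _ * (X)%:E](_ : _ = 0%R) ?mule0; last first.
      by rewrite indicE memNset//= in_itv/= andbT ltNge u0.
    rewrite integral0_eq// => w _; rewrite indicE memNset// /E/= ltNge u0.
    by [].
  rewrite [X in _ <= _ * (X)%:E](_ : _ = 1%R) ?mule1; last first.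
    by rewrite indicE mem_set//= in_itv/= andbT.
  have mC : measurable (S @^-1` `[0%R, u]).
    by rewrite -[X in measurable X]setTI; apply: mS => //; exact: measurable_itv.
  apply: (@le_trans _ _ (\int[P]_w (\1_(~` (S @^-1` `[0%R, u])) w)%:E)).
    apply: ge0_le_integral => //.
    - exact: (measurableT_comp mI (measurable_pair2 u)).
    - by apply/measurable_EFinP; apply: measurable_indic; exact: measurableC.
    - move=> w _; rewrite lee_fin !indicE ler_nat; case: (boolP ((w, u) \in E)) => // /set_mem /= /andP[_ uS].
      rewrite mem_set//= in_itv/= => /andP[s0 su]; move: uS; rewrite ger0_norm//.
      by rewrite ltNge su.
  rewrite integral_indic//; last exact: measurableC.
  have pc : P (~` (S @^-1` `[0%R, u])) = (expR (- u))%:E.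
    rewrite (probability_setC P mC) [X in _ - X](itv0 u0) -EFinB.
    by congr (_%:E); lra.
  by rewrite setIT le_eqVlt; apply/orP; left; apply/eqP; exact: pc.
apply: (@le_trans _ _ (\int[leb]_u ((expR (- u))%:E * (\1_(`]0%R, +oo[%classic) u)%:E))).
  apply: ge0_le_integral => //.
  - by move=> u _; apply: integral_ge0 => w _; rewrite lee_fin.
  - have := @measurable_fun_fubini_tonelli_G _ _ Omega _ R P (fun z : Omega * R => (\1_E z)%:E) mI.
    by apply=> z; rewrite lee_fin.
  - apply: emeasurable_funM.
      by apply/measurable_EFinP; apply: measurableT_comp.
    by apply/measurable_EFinP; apply: measurable_indic; exact: measurable_itv.
have := integral_expR_tail (0%R : R); rewrite oppr0 expR0 => <-.
rewrite [leRHS]integral_mkcond; apply: ge0_le_integral => //.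
- apply: emeasurable_funM.
    by apply/measurable_EFinP; apply: measurableT_comp.
  by apply/measurable_EFinP; apply: measurable_indic; exact: measurable_itv.
- apply/(measurable_restrictT _ _).1 => //.
  by apply/measurable_EFinP; apply: measurable_funTS; apply: measurableT_comp.
- move=> u _; rewrite patchE indicE; case: ifPn => [_|].
    by case: (_ \in _); rewrite ?mule1 ?mule0 ?lee_fin ?expR_ge0.
  move=> h; rewrite (_ : (u \in _) = false) ?mule0//; apply/negbTE; apply: contra h.
  by move=> /set_mem/=; rewrite in_itv/= => /andP[/ltW u0 _]; apply/mem_set; rewrite /= in_itv/= u0.
Qed.

(** [exp(-S)] is at most 1 on [S <= 1], an event of probability [1 - exp(-1)], and at most [exp(-1)]
    elsewhere; the constant is [exp(-1) + (1 - exp(-1))^2]. What matters is a bound below 1 common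
    to all holding times. *)
Lemma exponential_laplace : let L := \int[P]_w enexp (`|S w|%:E) in
  0 < L /\ L <= (1 - expR (-1) * (1 - expR (-1)))%:E.
Proof.
move=> L; have mE : measurable_fun setT (fun w => enexp (`|S w|%:E)).
  apply: (measurableT_comp measurable_enexp); apply/measurable_EFinP.
  exact: measurableT_comp.
pose B := S @^-1` `[0%R, 1%R].
have mB : measurable B.
  by rewrite -[X in measurable X]setTI; apply: mS => //; exact: measurable_itv.
have e1 : (expR (-1) < 1 :> R)%R by rewrite expR_lt1 ltrN10.
have PB : P B = (1 - expR (- 1))%:E by exact: itv0.
have mI : measurable_fun setT (fun w => (\1_B w)%:E : \bar R).
  by apply/measurable_EFinP; exact: measurable_indic.
split.
  apply: (@lt_le_trans _ _ (\int[P]_w ((expR (-1))%:E * (\1_B w)%:E))).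
    have -> : \int[P]_w ((expR (-1))%:E * (\1_B w)%:E) = (expR (-1))%:E * \int[P]_w (\1_B w)%:E.
      by apply: ge0_integralZl => //; rewrite lee_fin expR_ge0.
    rewrite integral_indic// setIT [X in _ * X]PB.
    by rewrite -EFinM lte_fin mulr_gt0 ?expR_gt0 ?subr_gt0.
  apply: ge0_le_integral => //.
  - exact: measurable_funeM.
  - move=> w _; rewrite indicE; have [/set_mem|_] := boolP (w \in B).
      rewrite /B/= in_itv/= => /andP[s0 s1].
      by rewrite mule1 lee_fin ler_expR lerN2 ger0_norm.
    by rewrite mule0 enexp_ge0.
apply: (@le_trans _ _ (\int[P]_w ((expR (-1))%:E + (1 - expR (-1))%:E * (\1_B w)%:E))).
  apply: ae_ge0_le_integral => //.
  - by move=> w _; exact: enexp_ge0.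
  - by move=> w _; rewrite adde_ge0 ?mule_ge0 ?lee_fin ?expR_ge0 ?subr_ge0 ?(ltW e1).
  - by apply: emeasurable_funD => //; exact: measurable_funeM.
  - apply: filterS exponential_ge0 => w s0 _.
    rewrite -EFinM -EFinD indicE /enexp lee_fin; have [_|h] := boolP (w \in B).
      rewrite mulr1 addrC subrK -[leRHS]expR0 ler_expR oppr_le0//.
    rewrite mulr0 addr0 ler_expR lerN2 ger0_norm// leNgt; apply/negP => s1.
    by move/negP: h; apply; apply/mem_set; rewrite /B/= in_itv/= s0 ltW.
have -> : \int[P]_w ((expR (-1))%:E + (1 - expR (-1))%:E * (\1_B w)%:E) =
    \int[P]_w (expR (-1))%:E + \int[P]_w ((1 - expR (-1))%:E * (\1_B w)%:E).
  apply: ge0_integralD => //.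
  - exact: measurable_funeM.
have -> : \int[P]_w ((1 - expR (-1))%:E * (\1_B w)%:E) = (1 - expR (-1))%:E * \int[P]_w (\1_B w)%:E.
  by apply: ge0_integralZl => //; rewrite lee_fin subr_ge0 ltW.
rewrite integral_indic// setIT [X in _ + _ * X]PB integral_cst// [X in _ * X](_ : _ = 1); last exact: probability_setT.
by rewrite mule1 -EFinM -EFinD lee_fin; set e := expR _; nra.
Qed.

End exponential_law.

Section marked_points.
Context d (Omega : measurableType d) (R : realType) (P : probability Omega R).
Context (I : choiceType) (D : set I) (F : I -> set_system Omega).
Hypothesis F_sigma : forall i, sigma_algebra setT (F i).
Hypothesis F_meas : forall i, F i `<=` measurable.
Hypothesis F_indep : mutually_independent P D F.
Local Open Scope ereal_scope.
Local Notation leb := (@lebesgue_measure R).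
Local Notation sub B := (g_sigma_algebraType (\bigcup_(i in B) F i)).
Variables (A : set I) (js : I) (jt : nat -> I).
Variables (xi S : nat -> Omega -> R).
Hypothesis AD : A `<=` D.
Hypothesis jsD : D js.
Hypothesis jtD : forall i, D (jt i).
Hypothesis jsA : ~ A js.
Hypothesis jtA : forall i, ~ A (jt i).
Hypothesis jt_js : forall i, jt i <> js.
Hypothesis jt_inj : injective jt.
Hypothesis Fxi : forall i B, measurable B -> F js (xi i @^-1` B).
Hypothesis FS : forall i B, measurable B -> F (jt i) (S i @^-1` B).
Hypothesis ppp : poisson_point_process P leb xi.
Hypothesis xi_gt0 : {ae P, forall w, forall i, (0 < xi i w)%R}.
Hypothesis S0 : forall i w, (0 <= S i w)%R.
Variable H : set (Omega * R).
Hypothesis mH : measurable (H : set (sub A * R)).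

Let mxi i : measurable_fun setT (xi i : Omega -> R).
Proof. by move=> _ B mB; rewrite setTI; apply: (F_meas (i := js)); exact: Fxi. Qed.

Let mSs i : measurable_fun setT (S i : Omega -> R).
Proof. by move=> _ B mB; rewrite setTI; apply: (F_meas (i := jt i)); exact: FS. Qed.

Let B := A `|` [set js].

Let BD : B `<=` D. Proof. by move=> j [/AD|->]. Qed.

Let mxiB i : measurable_fun setT (xi i : sub B -> R).
Proof. by apply: (@sub_gen_measurable_fun _ _ _ _ _ _ _ _ js); [right|exact: Fxi]. Qed.

Let hit i w := H (w, xi i w).

Let mhit i : measurable (hit i : set (sub B)).
Proof.
pose psi (w : sub B) : sub A * R := (w, xi i w).
have mpsi : measurable_fun setT psi.
  apply: measurable_fun_pair; last exact: mxiB.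
  by move=> _ C mC; rewrite setTI; apply: sub_subset mC; left.
by have := mpsi measurableT _ mH; rewrite setTI.
Qed.

Let mhit2 i : measurable ([set z : sub A * sub [set js] | H (z.1, xi i z.2)]).
Proof.
pose psi (z : sub A * sub [set js]) : sub A * R := (z.1, xi i z.2).
have mpsi : measurable_fun setT psi.
  apply: measurable_fun_pair; first exact: measurable_fst.
  apply: (measurableT_comp (f := (xi i : sub [set js] -> R))); last exact: measurable_snd.
  by apply: (@sub_gen_measurable_fun _ _ _ _ _ _ _ _ js); [by []|exact: Fxi].
by have := mpsi measurableT _ mH; rewrite setTI.
Qed.

Let Hw (w : Omega) : set R := [set u | H (w, u)] `&` `]0%R, +oo[.

Let mHw w : measurable (Hw w).
Proof.
apply: measurableI; last exact: measurable_itv.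
have mp : measurable_fun setT (fun u : R => (w, u) : sub A * R).
  by apply: measurable_fun_pair; [exact: measurable_cst|exact: measurable_id].
by have := mp measurableT _ mH; rewrite setTI.
Qed.

Let count w w' := \esum_(i in [set: nat]) (\1_([set z | H z]) (w, xi i w'))%:E : \bar R.

Let countE w : {ae P, forall w', count w w' = point_count xi (Hw w) w'}.
Proof.
apply: filterS xi_gt0 => w' x0; rewrite point_countE; apply: eq_esum => i _.
congr (_%:E); apply: indic_iff; split; last by case.
by move=> h; split => //; rewrite /= in_itv/= x0.
Qed.

Let mcount2 : measurable_fun setT (fun z : sub A * sub [set js] => count z.1 z.2).
Proof.
apply: measurable_esum => [i|i|i z]; last by rewrite lee_fin.
  exact: measurable_const_set.
apply/measurable_EFinP; rewrite (_ : (fun z => _) = \1_([set z : sub A * sub [set js] | H (z.1, xi i z.2)])).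
  by apply: measurable_indic.
by apply/funext => z; exact: indic_iff.
Qed.

Let mcount w : measurable_fun setT (count w).
Proof.
have := measurableT_comp mcount2 (@measurable_pair1 _ _ (sub A) (sub [set js]) w).
by move=> h _ C mC; apply: (@sub_measurable _ _ _ _ F_meas [set js]); exact: h.
Qed.

Let count0 w w' : 0 <= count w w'. Proof. by apply: esum_ge0 => i _; rewrite lee_fin. Qed.

Let mleb : measurable_fun setT (fun w : sub A => leb (Hw w)).
Proof.
have mS' := measurableI _ _ mH
  (measurableX (@measurableT _ (sub A)) (measurable_itv `]0%R, +oo[ : measurable (_ : set R))).
have := measurable_fun_xsection leb mS'.
apply: eq_measurable_fun => w _ /=; congr lebesgue_measure.
apply/seteqP; split => u; rewrite /xsection/=.
  by move=> /set_mem [? [_ ?]].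
by move=> [? ?]; exact/mem_set.
Qed.

Let JA : [set js] `<=` D. Proof. by move=> _ ->. Qed.
Let Ajs : A `&` [set js] = set0.
Proof. by apply/seteqP; split => // j [Aj ej]; apply: jsA; rewrite -ej. Qed.

Lemma campbell_le (Z : Omega -> \bar R) : measurable_fun setT (Z : sub A -> \bar R) ->
  (forall w, 0 <= Z w) -> (forall i, \int[P]_w (S i w)%:E <= 1) ->
  \int[P]_w (Z w * \esum_(i in [set i | H (w, xi i w)]) (S i w)%:E) <=
  \int[P]_w (Z w * leb (Hw w)).
Proof.
move=> mZ Z0 S1; have mZT := sub_measurable_fun F_meas mZ.
pose Zi i w := Z w * (\1_(hit i) w)%:E.
have Zi0 i w : 0 <= Zi i w by rewrite mule_ge0// lee_fin.
have mZi i : measurable_fun setT (Zi i : sub B -> \bar R).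
  apply: emeasurable_funM.
    by apply: sub_measurable_funS mZ; left.
  by apply/measurable_EFinP; apply: measurable_indic.
have mZiT i := sub_measurable_fun F_meas (mZi i).
have -> : \int[P]_w (Z w * \esum_(i in [set i | H (w, xi i w)]) (S i w)%:E) =
    \int[P]_w (\esum_(i in [set: nat]) (Zi i w * (S i w)%:E)).
  apply: eq_integral => w _.
  rewrite esum_mkcond -ge0_esumZl//; last by move=> i _; case: ifP => // _; rewrite lee_fin.
  apply: eq_esum => i _; rewrite /Zi indicE -muleA; congr (_ * _).
  have [h|h] := pselect (H (w, xi i w)); first by rewrite !mem_set ?mul1e.
  by rewrite !memNset ?mul0e.
rewrite integral_esum//; last 2 first.
- move=> i _; apply: emeasurable_funM => //; exact/measurable_EFinP.
- by move=> i w _ _; rewrite mule_ge0// lee_fin.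
apply: (@le_trans _ _ (\esum_(i in [set: nat]) (\int[P]_w Zi i w))).
  apply: le_esum => i _; pose h (z : sub B * sub [set jt i]) := Zi i z.1 * (S i z.2)%:E.
  have mh : measurable_fun setT h.
    apply: emeasurable_funM; first exact: (measurableT_comp (mZi i)).
    apply/measurable_EFinP; apply: (measurableT_comp (f := (S i : sub [set jt i] -> R))); last exact: measurable_snd.
    by apply: (@sub_gen_measurable_fun _ _ _ _ _ _ _ _ (jt i)); [by []|exact: FS].
  rewrite -[leLHS]/(\int[P]_w h (w, w)) (freezing F_sigma F_meas F_indep BD _ _ mh); last 3 first.
  - by move=> _ ->.
  - by apply/seteqP; split => // j [[Aj|ej] ej']; [apply: (@jtA i); rewrite -ej'|apply: (@jt_js i); rewrite -ej'].
  - by move=> z; rewrite mule_ge0// lee_fin.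
  apply: ge0_le_integral => //.
  - by move=> w _; apply: integral_ge0 => w' _; rewrite mule_ge0// lee_fin.
  - rewrite (_ : (fun w => _) = fun w => Zi i w * \int[P]_w' (S i w')%:E).
      by apply: emeasurable_funM => //; exact: measurable_cst.
    apply/funext => w; rewrite /h/= ge0_integralZl//; last by move=> w' _; rewrite lee_fin.
    exact/measurable_EFinP.
  - move=> w _; rewrite /h/= ge0_integralZl//; last 2 first.
    + exact/measurable_EFinP.
    + by move=> w' _; rewrite lee_fin.
    by rewrite -[leRHS]mule1; apply: lee_wpmul2l.
rewrite -integral_esum//.
(* Second average: the past is frozen and the marks are integrated out. *)
pose h (z : sub A * sub [set js]) := Z z.1 * count z.1 z.2.
have mh : measurable_fun setT h.
  by apply: emeasurable_funM; [exact: (measurableT_comp mZ)|exact: mcount2].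
have h0 z : 0 <= h z by rewrite mule_ge0.
have -> : \int[P]_w (\esum_(i in [set: nat]) Zi i w) = \int[P]_w h (w, w).
  apply: eq_integral => w _; by rewrite /h /count -ge0_esumZl.
rewrite (freezing F_sigma F_meas F_indep AD JA Ajs mh h0).
have mhw := measurable_freeze P (sub_id_measurable F_meas (A := [set js])) mh h0.
apply: ge0_le_integral => //.
- by move=> w _; exact: integral_ge0.
- exact: (sub_measurable_fun F_meas mhw).
- by apply: emeasurable_funM => //; exact: (sub_measurable_fun F_meas mleb).
move=> w _; rewrite /h/= ge0_integralZl//; apply: lee_wpmul2l => //.
apply: le_trans (mean_count_le mxi ppp _ (mHw w) _) => //; last first.
  by move=> u [].
rewrite le_eqVlt; apply/orP; left; apply/eqP; apply: ge0_ae_eq_integral => //.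
- by apply: measurable_point_count.
- by apply: filterS (countE w) => w' + _.
Qed.

(** A set of infinite measure catches infinitely many marks. Given the past and the marks, the
    Laplace transform of the sum is then an infinite product of factors at most [q < 1], hence 0,
    which forces an infinite sum. *)
Lemma marks_sum_infinite (q : R) : (q < 1)%R ->
  (forall i, let L := \int[P]_w enexp (S i w)%:E in 0 < L /\ L <= q%:E) ->
  {ae P, forall w, leb (Hw w) = +oo ->
    \esum_(i in [set i | H (w, xi i w)]) (S i w)%:E = +oo}.
Proof.
move=> q1 Lq.
have inf1 : {ae P, forall w, leb (Hw w) = +oo -> count w w = +oo}.
  pose h (z : sub A * sub [set js]) : \bar R :=
    if (leb (Hw z.1) == +oo) && (count z.1 z.2 < +oo) then 1 else 0.
  have mh : measurable_fun setT h.
    apply: measurable_fun_ifT; [apply: measurable_and| |]; [| |exact: measurable_cst..].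
      by apply: measurable_fun_eqe; [exact: (measurableT_comp mleb)|exact: measurable_cst].
    by apply: measurable_fun_lte; [exact: mcount2|exact: measurable_cst].
  have h0 z : 0 <= h z by rewrite /h; case: ifP.
  have hz : \int[P]_w h (w, w) = 0.
    rewrite (freezing F_sigma F_meas F_indep AD JA Ajs mh h0).
    apply: integral0_eq => w _; rewrite /h/=.
    have [lw|lw] := eqVneq (leb (Hw w)) +oo; last by rewrite integral0.
    rewrite (ge0_ae_eq_integral (g := cst 0)) ?integral0//.
    - apply: measurable_fun_ifT; [|exact: measurable_cst..].
      by apply: measurable_fun_lte; [exact: mcount|exact: measurable_cst].
    - by move=> w' _; case: ifP.
    - have Hpos : Hw w `<=` `]0%R, +oo[ by move=> u [].
      apply: filterS2 (countE w) (infinite_count mxi ppp (mHw w) Hpos lw) => w' e1 e2 _.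
      by rewrite e1 e2.
  have mhh : measurable_fun setT (fun w : Omega => h (w, w)).
    apply: (measurableT_comp mh); apply: measurable_fun_pair; exact: sub_id_measurable.
  apply: filterS (ge0_integral0_ae mhh (fun w => h0 _) hz) => w + lw.
  rewrite /h/= lw eqxx/=; case: ifPn => [_ /eqP|]; first by rewrite onee_eq0.
  by rewrite -leNgt leye_eq => /eqP.
pose L i := \int[P]_w enexp (S i w)%:E.
have fL i : L i \is a fin_num.
  have [l0 l1] := Lq i; rewrite ge0_fin_numE ?ltW//.
  exact: le_lt_trans l1 (ltry _).
have L0 i : (0 < fine (L i))%R by have [l0 _] := Lq i; rewrite -lte_fin fineK.
have L1 i : (fine (L i) <= q)%R by have [_ l1] := Lq i; rewrite -lee_fin fineK.
have q0 : (0 < q)%R by exact: lt_le_trans (L0 0%N) (L1 0%N).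
have lq : (0 < - ln q)%R by rewrite oppr_gt0 ln_lt0// q0.
(* The exponent contributed by the [i]-th holding time when its mark is caught; it is at least
   [- ln q > 0]. *)
pose c i : R := (- ln (fine (L i)))%R.
have cq i : (- ln q <= c i)%R by rewrite lerN2 ler_ln ?posrE.
have c0 i : (0 <= c i)%R by exact: le_trans (ltW lq) (cq i).
pose Z (w : Omega) : \bar R := if count w w == +oo then 1 else 0.
pose C i w := (\1_(hit i) w)%:E : \bar R.
pose E i w := (c i)%:E * (\1_(hit i) w)%:E.
have mcB : measurable_fun setT ((fun w => count w w) : sub B -> \bar R).
  apply: measurable_esum => [i|i|i w]; last by rewrite lee_fin.
    exact: measurable_const_set.
  apply/measurable_EFinP; rewrite (_ : (fun w => _) = \1_(hit i : set (sub B))).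
    by apply: measurable_indic.
  by apply/funext => w; exact: indic_iff.
have mC i : measurable_fun setT (C i : sub B -> \bar R).
  by apply/measurable_EFinP; apply: measurable_indic.
have mE i : measurable_fun setT (E i : sub B -> \bar R).
  by apply: emeasurable_funM; [exact: measurable_cst|exact: mC].
have mZ : measurable_fun setT (Z : sub B -> \bar R).
  apply: measurable_fun_ifT; [|exact: measurable_cst..].
  by apply: measurable_fun_eqe; [exact: mcB|exact: measurable_cst].
have C0 i w : 0 <= C i w by rewrite lee_fin.
have E0 i w : 0 <= E i w by rewrite mule_ge0 ?lee_fin.
have Z01 w : 0 <= Z w <= 1 by rewrite /Z; case: ifP; rewrite ?lexx ?lee01.
have FSE i V : measurable V -> F (jt i) ((fun w => (S i w)%:E) @^-1` V).
  move=> mV; apply: (FS i (B := EFin @^-1` V)); rewrite -[X in measurable X]setTI.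
  exact: (@EFin_measurable _ setT).
have SE0 i w : 0 <= (S i w)%:E by rewrite lee_fin.
have frozen i w : [set: nat] i -> \int[P]_w' enexp (C i w * (S i w')%:E) = enexp (E i w).
  move=> _; rewrite /C /E indicE; case: (_ \in _); rewrite ?mul1e ?mul0e ?mule1 ?mule0.
    under eq_integral do rewrite mul1e.
    rewrite -/(L i) -[LHS]fineK// /enexp /c opprK lnK ?posrE//.
  under eq_integral do rewrite mul0e.
  by rewrite enexp0 integral_cst// mul1e; exact: probability_setT.
have jB i : [set: nat] i -> ~ B (jt i).
  by move=> _ [/jtA//|/jt_js].
have key := laplace_product F_sigma F_meas F_indep jt_inj BD (fun i _ => jtD i) jB FSE SE0 mC C0 mE E0 mZ Z01 frozen.
have hitE w : count w w = \esum_(i in [set: nat]) C i w.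
  by apply: eq_esum => i _; congr (_%:E); exact: indic_iff.
have zero : \int[P]_w (Z w * enexp (\esum_(i in [set: nat]) (C i w * (S i w)%:E))) = 0.
  rewrite key; apply: integral0_eq => w _; rewrite /Z; case: eqP => [e|]; last by rewrite mul0e.
  rewrite (_ : esum _ _ = +oo) ?mule0//; apply/eqP; rewrite -leye_eq.
  apply: (@le_trans _ _ (\esum_(i in [set: nat]) ((- ln q)%:E * C i w))).
    rewrite ge0_esumZl; first by rewrite -hitE e gt0_muley.
      by rewrite lee_fin ltW.
    by move=> i _; exact: C0.
  by apply: le_esum => i _; apply: lee_wpmul2r => //; rewrite lee_fin.
have mCS i : measurable_fun setT (fun w : Omega => C i w * (S i w)%:E).
  by apply: emeasurable_funM; [exact: (sub_measurable_fun F_meas (mC i))|exact/measurable_EFinP].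
have mprod : measurable_fun setT (fun w : Omega => Z w * enexp (\esum_(i in [set: nat]) (C i w * (S i w)%:E))).
  apply: emeasurable_funM; first exact: (sub_measurable_fun F_meas mZ).
  apply: (measurableT_comp measurable_enexp); apply: measurable_esum => [i|//|i w].
    exact: measurable_const_set.
  by rewrite mule_ge0.
have prod0 w : 0 <= Z w * enexp (\esum_(i in [set: nat]) (C i w * (S i w)%:E)).
  by have /andP[z0 _] := Z01 w; rewrite mule_ge0 ?enexp_ge0.
apply: filterS2 inf1 (ge0_integral0_ae mprod prod0 zero) => w cinf + lw.
rewrite /Z (cinf lw) eqxx mul1e => e.
have -> : \esum_(i in [set i | H (w, xi i w)]) (S i w)%:E = \esum_(i in [set: nat]) (C i w * (S i w)%:E).
  rewrite esum_mkcond; apply: eq_esum => i _; rewrite /C indicE.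
  have [h|h] := pselect (H (w, xi i w)); first by rewrite !mem_set ?mul1e.
  by rewrite !memNset ?mul0e.
have : 0 <= \esum_(i in [set: nat]) (C i w * (S i w)%:E).
  by apply: esum_ge0 => i _; rewrite mule_ge0.
move: e; case: (esum _ _) => [r| |]//; move=> [] e.
by have := expR_gt0 (- r); rewrite e ltxx.
Qed.

End marked_points.

(** * The cascade model *)

Record cascade_model d (Omega : measurableType d) (R : realType) (P : probability Omega R)
    (alpha : nat -> R) (gam : seq nat -> nat -> {RV P >-> R})
    (T sigma : nat -> nat -> nat -> {RV P >-> R}) : Prop := CascadeModel {
  model_alpha_gt0 : 0 < alpha 1%N;
  model_alpha_incr : forall k, (0 < k)%N -> alpha k < alpha k.+1;
  model_alpha_cvg : alpha n @[n --> \oo] --> (1 : R);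
  model_gam_poisson : forall s, poisson_point_process P (intensity alpha (size s).+1) (gam s);
  model_gam_gt0 : forall s, {ae P, forall w, forall x, 0 < gam s x w};
  model_T : forall k x i, (0 < k)%N ->
    forall A, measurable A -> distribution P (T k x i) A = exponential_prob 1 A;
  model_sigma : forall k x, (0 < k)%N ->
    poisson_point_process P lebesgue_measure (sigma k x);
  model_sigma_ordered : forall k x, (0 < k)%N ->
    {ae P, forall w, forall i, 0 < sigma k x i w < sigma k x i.+1 w};
  model_indep : mutually_independent P [set j | (0 < source_level j)%N]
    (source_sigma_algebra gam T sigma) }.

(** The mean number of points at [v] is at most the Lebesgue measure of a singleton. *)
Lemma mark_atomless d (Omega : measurableType d) (R : realType) (P : probability Omega R)
    (xi : nat -> Omega -> R) (i : nat) (v : R) :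
  (forall i, measurable_fun setT (xi i)) ->
  poisson_point_process P lebesgue_measure xi ->
  {ae P, forall w, forall i, 0 < xi i w} -> {ae P, forall w, xi i w <> v}.
Proof.
move=> mxi ppp xi_gt0; have [v0|v0] := ltP 0 v; last first.
  by apply: filterS xi_gt0 => w /(_ i) x0 e; move: x0; rewrite e ltNge v0.
have m1 : measurable ([set v] : set R) by exact: measurable_set1.
have sub : [set v] `<=` `]0, +oo[ by move=> _ ->; rewrite /= in_itv/= v0.
have z : (\int[P]_w point_count xi [set v] w = 0)%E.
  apply/eqP; rewrite eq_le; apply/andP; split; last first.
    by apply: integral_ge0 => w _; exact: point_count_ge0.
  apply: le_trans (mean_count_le mxi ppp (fun A => measure_ge0 _ _) m1 sub) _.
  by rewrite lebesgue_measure_set1.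
apply: filterS (ge0_integral0_ae (measurable_point_count mxi m1)
  (fun w => point_count_ge0 xi [set v] w) z) => w e xv.
move: e; rewrite point_countE => e.
have : ((\1_[set v] (xi i w))%:E <= \esum_(j in [set: nat]) (\1_[set v] (xi j w))%:E :> \bar R)%E.
  rewrite -[leLHS](esum_set1 (a := fun j => (\1_[set v] (xi j w))%:E) (t := i)); last by rewrite lee_fin.
  by apply: le_esum_set => // j _; rewrite lee_fin.
by rewrite e indicE mem_set// lee_fin ler10.
Qed.

Section model.
Context d (Omega : measurableType d) (R : realType) (P : probability Omega R).
Variables (alpha : nat -> R) (gam : seq nat -> nat -> {RV P >-> R}).
Variables (T sigma : nat -> nat -> nat -> {RV P >-> R}).
Hypothesis hm : cascade_model alpha gam T sigma.
Local Open Scope ereal_scope.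
Local Notation leb := (@lebesgue_measure R).

(** Absolute values make the marks and holding times nonnegative at every sample point, so that
    measurability and Tonelli's theorem need no exceptional set. On [good] they change nothing at
    the levels of the model. *)
Definition gabs (w : Omega) (s : seq nat) (x : nat) : R := `|gam s x w|%R.
Definition Tabs (w : Omega) (k x i : nat) : R := `|T k x i w|%R.
Definition sig (w : Omega) (k x i : nat) : R := sigma k x i w.
Definition weight (w : Omega) : seq nat -> \bar R := Wsup alpha (gabs w).

Local Notation D := [set j : source | (0 < source_level j)%N].
Local Notation F := (source_sigma_algebra gam T sigma).
Local Notation sub A := (g_sigma_algebraType (\bigcup_(i in A) F i)).

Lemma source_sigma j : sigma_algebra setT (F j).
Proof. by case: j => [s|[[[k x] i]|[k x]]]; exact: smallest_sigma_algebra. Qed.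

Let gen_meas J (Y : J -> {RV P >-> R}) :
  generated_sigma_algebra (fun j => Y j : Omega -> R) `<=` measurable.
Proof.
apply: smallest_sub; first exact: sigma_algebra_measurable.
by move=> _ [j _ [B mB <-]]; rewrite setTI -[X in measurable X]setTI; exact: measurable_funP.
Qed.

Lemma source_meas j : F j `<=` measurable.
Proof. by case: j => [s|[[[k x] i]|[k x]]]; exact: gen_meas. Qed.

Let gen_in J (Y : J -> {RV P >-> R}) j (B : set R) : measurable B ->
  generated_sigma_algebra (fun j => Y j : Omega -> R) (Y j @^-1` B).
Proof.
by move=> mB; apply: sub_gen_smallest; exists j => //; exists B => //; rewrite setTI.
Qed.

Lemma source_gam s x (B : set R) : measurable B -> F (inl s) (gam s x @^-1` B).
Proof. exact: gen_in. Qed.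

Lemma source_T k x i (B : set R) : measurable B -> F (inr (inl (k, x, i))) (T k x i @^-1` B).
Proof. exact: (@gen_in _ (fun _ : unit => T k x i) tt). Qed.

Lemma source_Tabs k x i (B : set R) : measurable B ->
  F (inr (inl (k, x, i))) ((fun w => Tabs w k x i) @^-1` B).
Proof.
move=> mB; apply: (@source_T _ _ _ ((fun t : R => `|t|%R) @^-1` B)).
by rewrite -[X in measurable X]setTI; exact: normr_measurable.
Qed.

Lemma source_sigma_mark k x i (B : set R) : measurable B ->
  F (inr (inr (k, x))) (sigma k x i @^-1` B).
Proof. exact: gen_in. Qed.

(* The weights W involve all levels of the environment, so that the past of
   level n contains the whole environment. *)
Definition level_sources (n : nat) : set source :=
  [set j | match j with inl _ => True | inr _ => (0 < source_level j <= n)%N end].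

Lemma level_sources_D n : level_sources n `<=` D.
Proof. by move=> [s|j] //= /andP[]. Qed.

Lemma level_sources_mono n m : (n <= m)%N -> level_sources n `<=` level_sources m.
Proof. by move=> nm [s|j] //= /andP[-> /leq_trans]; apply. Qed.

Lemma gabs_ge0 w s x : (0 <= gabs w s x)%R. Proof. exact: normr_ge0. Qed.
Lemma Tabs_ge0 w k x i : (0 <= Tabs w k x i)%R. Proof. exact: normr_ge0. Qed.

Lemma measurable_gabs n s x :
  measurable_fun setT ((fun w => gabs w s x) : sub (level_sources n) -> R).
Proof.
apply: measurableT_comp => //.
by apply: (@sub_gen_measurable_fun _ _ _ _ _ _ _ _ (inl s)) => // B mB; exact: source_gam.
Qed.

Lemma measurable_Tabs n k x i : (0 < k <= n)%N ->
  measurable_fun setT ((fun w => Tabs w k x i) : sub (level_sources n) -> R).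
Proof.
move=> kn; apply: measurableT_comp => //.
apply: (@sub_gen_measurable_fun _ _ _ _ _ _ _ _ (inr (inl (k, x, i)))) => // B mB.
exact: source_T.
Qed.

Lemma measurable_sig n k x i : (0 < k <= n)%N ->
  measurable_fun setT ((fun w => sig w k x i) : sub (level_sources n) -> R).
Proof.
move=> kn.
apply: (@sub_gen_measurable_fun _ _ _ _ _ _ _ _ (inr (inr (k, x)))) => // B mB.
exact: source_sigma_mark.
Qed.

Lemma measurable_weight n y :
  measurable_fun setT ((fun w => weight w y) : sub (level_sources n) -> \bar R).
Proof. by apply: measurable_Wsup => s x; exact: measurable_gabs. Qed.

Lemma weight_ge0 w y : 0 <= weight w y. Proof. exact: Wsup_ge0. Qed.

Record good (w : Omega) : Prop := Good {
  good_gam : forall s x, (0 < gam s x w)%R;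
  good_T : forall k x i, (0 < k)%N -> (0 <= T k x i w)%R;
  good_sigma : forall k x i, (0 < k)%N -> (0 < sigma k x i w)%R;
  good_ties : forall k x i x' i', (0 < k)%N ->
    sigma k x i w = sigma k x' i' w -> x = x' /\ i = i';
  good_W : forall s, W alpha (env gam w) s = weight w s;
  good_fin : forall s, weight w s < +oo;
  good_super : forall s,
    \esum_(x in [set: nat]) (edge (gabs w) (rcons s x) * weight w (rcons s x)) <= weight w s }.

Lemma gam_gt0 : {ae P, forall w, forall s x, (0 < gam s x w)%R}.
Proof. exact: (ae_forall_count (I := seq nat) (model_gam_gt0 hm)). Qed.

Lemma sigma_gt0 k x : (0 < k)%N -> {ae P, forall w, forall i, (0 < sigma k x i w)%R}.
Proof. by move=> k0; apply: filterS (model_sigma_ordered hm x k0) => w h i; have /andP[] := h i. Qed.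

(** Different labels have independent mark processes: with one mark frozen at a value, the other
    process almost surely avoids that value. *)
Let ties_distinct k x i x' i' : (0 < k)%N -> x != x' ->
  {ae P, forall w, sigma k x i w <> sigma k x' i' w}.
Proof.
move=> k0 xx'; pose j : source := inr (inr (k, x)); pose j' : source := inr (inr (k, x')).
pose h (z : sub [set j] * sub [set j']) : \bar R := (sigma k x i z.1 == sigma k x' i' z.2)%:R%:E.
have mj : measurable_fun setT (sigma k x i : sub [set j] -> R).
  by apply: (@sub_gen_measurable_fun _ _ _ _ _ _ _ _ j) => // B mB; exact: source_sigma_mark.
have mj' : measurable_fun setT (sigma k x' i' : sub [set j'] -> R).
  by apply: (@sub_gen_measurable_fun _ _ _ _ _ _ _ _ j') => // B mB; exact: source_sigma_mark.
have mh : measurable_fun setT h.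
  rewrite (_ : h = fun z => if sigma k x i z.1 == sigma k x' i' z.2 then 1 else 0); last first.
    by apply/funext => z; rewrite /h; case: eqP.
  apply: measurable_fun_ifT; [|exact: measurable_cst..].
  by apply: measurable_fun_eqr; [exact: (measurableT_comp mj)|exact: (measurableT_comp mj')].
have h0 z : 0 <= h z by rewrite lee_fin.
have [jD jD'] : [set j] `<=` D /\ [set j'] `<=` D by split => _ ->.
have jj' : [set j] `&` [set j'] = set0.
  by apply/seteqP; split => // _ [-> [e]]; rewrite e eqxx in xx'.
have z0 : \int[P]_w h (w, w) = 0.
  rewrite (freezing source_sigma source_meas (model_indep hm) jD jD' jj' mh h0).
  apply: integral0_eq => w _; rewrite (ge0_ae_eq_integral (g := cst 0)) ?integral0//.
    have := measurableT_comp mh (@measurable_pair1 _ _ (sub [set j]) (sub [set j']) w).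
    by move=> m1 _ B mB; apply: (@sub_measurable _ _ _ _ source_meas [set j']); exact: m1.
  have := @mark_atomless _ _ _ P (sigma k x') i' (sigma k x i w)
    (fun i => measurable_funP _) (model_sigma hm x' k0) (sigma_gt0 x' k0).
  by apply: filterS => w' ne _; rewrite /h/=; case: eqP => // e; case: ne.
have mhh : measurable_fun setT (fun w : Omega => h (w, w)).
  apply: (measurableT_comp mh).
  by apply: measurable_fun_pair; exact: (sub_id_measurable source_meas).
apply: filterS (ge0_integral0_ae mhh (fun w => h0 _) z0) => w + e.
by rewrite /h/= e eqxx => -[/eqP]; rewrite oner_eq0.
Qed.

Let no_ties : {ae P, forall w, forall k x i x' i', (0 < k)%N ->
    sigma k x i w = sigma k x' i' w -> x = x' /\ i = i'}.
Proof.
have h1 : {ae P, forall w, forall p : nat * nat * nat * nat * nat,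
    let: (k, x, i, x', i') := p in (0 < k)%N -> x != x' -> sigma k x i w <> sigma k x' i' w}.
  apply: ae_forall_count => -[[[[k x] i] x'] i'].
  have [k0|k0] := posnP k; first by apply: nearW => w; rewrite k0.
  have [e|ne] := eqVneq x x'; first by apply: nearW => w _ /eqP.
  by apply: filterS (ties_distinct i i' k0 ne) => w.
have h2 : {ae P, forall w, forall p : nat * nat, (0 < p.1)%N ->
    forall i, (0 < sigma p.1 p.2 i w < sigma p.1 p.2 i.+1 w)%R}.
  apply: ae_forall_count => -[k x] /=; have [k0|k0] := posnP k.
    by apply: nearW => w; rewrite k0.
  by apply: filterS (model_sigma_ordered hm x k0) => w.
apply: filterS2 h1 h2 => w t1 t2 k x i x' i' k0 e.
have [xx'|xx'] := eqVneq x x'; last by case: (t1 (k, x, i, x', i') k0 xx').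
split => //; subst x'.
have lt m n : (m < n)%N -> (sigma k x m w < sigma k x n w)%R.
  elim: n => // n ih; rewrite ltnS leq_eqVlt => /predU1P[->|/ih mn].
    by have /andP[] := t2 (k, x) k0 n.
  by apply: (lt_trans mn); have /andP[] := t2 (k, x) k0 n.
by case: (ltngtP i i') => // /lt; rewrite e ltxx.
Qed.

Let alpha_gt0 k : (0 < k)%N -> (0 < alpha k)%R.
Proof.
case: k => // k _; elim: k => [|k ih]; first exact: (model_alpha_gt0 hm).
by apply: (lt_trans ih); exact: (model_alpha_incr hm).
Qed.

Lemma ae_good : {ae P, forall w, good w}.
Proof.
have T0 : {ae P, forall w, forall p : nat * nat * nat,
    (0 < p.1.1)%N -> (0 <= T p.1.1 p.1.2 p.2 w)%R}.
  apply: ae_forall_count => -[[k x] i] /=; have [k0|k0] := posnP k.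
    by apply: nearW => w; rewrite k0.
  by apply: filterS (exponential_ge0 (fun A => model_T hm x i k0 (A := A))) => w.
have s0 : {ae P, forall w, forall p : nat * nat, (0 < p.1)%N -> forall i, (0 < sigma p.1 p.2 i w)%R}.
  apply: ae_forall_count => -[k x] /=; have [k0|k0] := posnP k.
    by apply: nearW => w; rewrite k0.
  by apply: filterS (sigma_gt0 x k0) => w.
have inlD (s : seq nat) : D (inl s) by [].
have inl_inj : injective (inl : seq nat -> source) by move=> s s' [].
have c := wn_cvg inl_inj inlD source_sigma source_meas (model_indep hm) source_gam
  alpha_gt0 (model_alpha_incr hm) (model_gam_poisson hm) gam_gt0.
have f := Wsup_fin inl_inj inlD source_sigma source_meas (model_indep hm) source_gam
  alpha_gt0 (model_alpha_incr hm) (model_alpha_cvg hm) (model_gam_poisson hm) gam_gt0.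
have s := Wsup_superharmonic inl_inj inlD source_sigma source_meas (model_indep hm) source_gam
  alpha_gt0 (model_alpha_incr hm) (model_alpha_cvg hm) (model_gam_poisson hm) gam_gt0.
near=> w.
have gw s' x : (0 < gam s' x w)%R by move: s' x; near: w; exact: gam_gt0.
have cw s' : wn alpha (env gam w) s' n @[n --> \oo] --> Wsup alpha (env gam w) s' by move: s'; near: w.
have fw s' : Wsup alpha (env gam w) s' < +oo by move: s'; near: w.
have sw s' : \esum_(x in [set: nat]) ((env gam w s' x)%:E * Wsup alpha (env gam w) (rcons s' x))
    <= Wsup alpha (env gam w) s' by move: s'; near: w.
have eg : gabs w = env gam w.
  by apply/funext => y; apply/funext => x; rewrite /gabs ger0_norm// ltW.
split.
- exact: gw.
- move=> k x i k0; suff : forall p : nat * nat * nat,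
    (0 < p.1.1)%N -> (0 <= T p.1.1 p.1.2 p.2 w)%R by move=> /(_ (k, x, i) k0).
  by near: w.
- move=> k x i k0; suff : forall p : nat * nat, (0 < p.1)%N -> forall i, (0 < sigma p.1 p.2 i w)%R.
    by move=> /(_ (k, x) k0).
  by near: w.
- by near: w; exact: no_ties.
- by move=> y; rewrite limn_wn// /weight eg; apply/cvg_lim => //; exact: cw.
- by move=> y; rewrite /weight eg; exact: fw.
- move=> y; rewrite /weight eg; apply: le_trans (sw y).
  by apply: le_esum => x _; rewrite /edge parent_rcons label_rcons.
Unshelve. all: by end_near. Qed.

End model.

Lemma measurable_within_set d (U : measurableType d) (R : realType) (a b : U -> \bar R) :
  measurable_fun setT a -> measurable_fun setT b ->
  measurable [set z : U * R | within (a z.1) (b z.1) z.2].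
Proof.
move=> ma mb; have m2 : measurable_fun setT (fun z : U * R => z.2%:E).
  by apply/measurable_EFinP; exact: measurable_snd.
rewrite (_ : [set _ | _] = [set z : U * R | (a z.1 < z.2%:E)%E] `&`
   [set z : U * R | (z.2%:E <= b z.1)%E]).
  apply: measurableI; last by apply: emeasurable_le_set => //; exact: measurableT_comp.
  have := measurable_lte measurableT (measurableT_comp ma (@measurable_fst _ _ U _)) m2.
  by rewrite setTI.
by apply/seteqP; split => z; rewrite /within/=; [move=> /andP[]|move=> [-> ->]].
Qed.

Lemma rhoS (R : realType) (g : seq nat -> nat -> R) (T s : nat -> nat -> nat -> R) k n b :
  (k <= n)%N -> rho g T s k (n.+1 - k) b =
  wclock T s n (occ g T s n.-1) (edge g) (upto (rho g T s k (n - k) b)).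
Proof.
move=> kn; transitivity (wclock T s (k + (n - k)) (occ g T s (k + (n - k)).-1) (edge g)
  (upto (rho g T s k (n - k) b))); first by rewrite subSn.
by rewrite subnKC.
Qed.

(** * The supermartingale of the modified clocks *)

Section supermartingale.
Context d (Omega : measurableType d) (R : realType) (P : probability Omega R).
Variables (alpha : nat -> R) (gam : seq nat -> nat -> {RV P >-> R}).
Variables (T sigma : nat -> nat -> nat -> {RV P >-> R}).
Hypothesis hm : cascade_model alpha gam T sigma.
Local Open Scope ereal_scope.
Local Notation leb := (@lebesgue_measure R).
Local Notation D := [set j : source | (0 < source_level j)%N].
Local Notation F := (source_sigma_algebra gam T sigma).
Local Notation sub A := (g_sigma_algebraType (\bigcup_(i in A) F i)).
Local Notation g := (gabs gam).
Local Notation Th := (Tabs T).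
Local Notation sg := (sig sigma).
Local Notation Wt := (weight alpha gam).
Local Notation Lv := (level_sources).
Local Notation goodw := (good alpha gam T sigma).

Definition occw w := occ (g w) (Th w) (sg w).
Definition Xi_t w n B := wclock (Th w) (sg w) n (occw w n.-1) (fun y => Wt w y * edge (g w) y) B.
Definition Xi_o w n B := wclock (Th w) (sg w) n (occw w n.-1) (edge (g w)) B.
Definition massw w n B := mass_of (g w) (Th w) (sg w) (Wt w) n B.
Definition rhow w k m b := rho (g w) (Th w) (sg w) k m b.

Lemma good_gabs w : goodw w -> forall s x, (0 < g w s x)%R.
Proof. by move=> G s x; rewrite normr_gt0 gt_eqF// (good_gam G). Qed.

Lemma good_sig w : goodw w -> forall k x i, (0 < k)%N -> (0 < sg w k x i)%R.
Proof. by move=> G k x i; exact: (good_sigma G). Qed.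

Lemma good_sig_ties w : goodw w -> forall k x i x' i', (0 < k)%N ->
  sg w k x i = sg w k x' i' -> x = x' /\ i = i'.
Proof. exact: good_ties. Qed.

Lemma massw_ge0 w n B : 0 <= massw w n B.
Proof. by apply: esum_ge0 => s _; rewrite mule_ge0 ?weight_ge0. Qed.

Lemma Xi_t_ge0 w n B : 0 <= Xi_t w n B.
Proof.
apply: esum_ge0 => s _; rewrite mule_ge0//.
  by rewrite mule_ge0 ?weight_ge0// lee_fin gabs_ge0.
by apply: esum_ge0 => i _; rewrite lee_fin Tabs_ge0.
Qed.

Let m_occ n k s : (k <= n)%N ->
  measurable [set z : sub (Lv n) * R | occw z.1 k s z.2].
Proof.
move=> kn; apply: (@measurable_occ _ (sub (Lv n)) R n g Th sg) => //.
- by move=> w s' x; exact: gabs_ge0.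
- by move=> w k' x i; exact: Tabs_ge0.
- by move=> s' x; exact: measurable_gabs.
- by move=> k' x i ?; exact: measurable_Tabs.
- by move=> k' x i ?; exact: measurable_sig.
Qed.

Lemma measurable_massw n k (a b : Omega -> \bar R) : (k <= n)%N ->
  measurable_fun setT (a : sub (Lv n) -> \bar R) ->
  measurable_fun setT (b : sub (Lv n) -> \bar R) ->
  measurable_fun setT ((fun w => massw w k (within (a w) (b w))) : sub (Lv n) -> \bar R).
Proof.
move=> kn ma mb; apply: measurable_esum => [s|s|s w].
- exact: measurable_const_set.
- apply: emeasurable_funM; first exact: measurable_weight.
  have := @measurable_occ_section _ (sub (Lv n)) R n g Th sg
    (fun w s' x => gabs_ge0 gam w s' x) (fun w k' x i => Tabs_ge0 T w k' x i)
    (fun s' x => @measurable_gabs _ _ _ _ gam T sigma n s' x)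
    (fun k' x i h => @measurable_Tabs _ _ _ _ gam T sigma n k' x i h)
    (fun k' x i h => @measurable_sig _ _ _ _ gam T sigma n k' x i h)
    _ k s kn (measurable_within_set ma mb).
  by apply: eq_measurable_fun.
- by rewrite mule_ge0 ?weight_ge0.
Qed.

Lemma measurable_Xi_t n k m (a b : \bar R) : (0 < k)%N -> (k <= m <= n)%N ->
  measurable_fun setT ((fun w => Xi_t w m (within (rhow w k (m - k) a) (rhow w k (m - k) b)))
     : sub (Lv n) -> \bar R).
Proof.
move=> k0 kmn.
apply: (@measurable_wclock_rho _ (sub (Lv n)) R n g Th sg
    (fun w s' x => gabs_ge0 gam w s' x) (fun w k' x i => Tabs_ge0 T w k' x i)
    (fun s' x => @measurable_gabs _ _ _ _ gam T sigma n s' x)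
    (fun k' x i h => @measurable_Tabs _ _ _ _ gam T sigma n k' x i h)
    (fun k' x i h => @measurable_sig _ _ _ _ gam T sigma n k' x i h)
    Wt (weight_ge0 alpha gam) (fun y => @measurable_weight _ _ _ _ alpha gam T sigma n y)
    (fun=> a) (fun=> b)) => //.
Qed.

Lemma measurable_rhow n k m (a : \bar R) : (0 < k)%N -> (k + m <= n.+1)%N ->
  measurable_fun setT ((fun w => rhow w k m a) : sub (Lv n) -> \bar R).
Proof.
move=> k0 kmn.
apply: (@measurable_rho _ (sub (Lv n)) R n g Th sg
    (fun w s' x => gabs_ge0 gam w s' x) (fun w k' x i => Tabs_ge0 T w k' x i)
    (fun s' x => @measurable_gabs _ _ _ _ gam T sigma n s' x)
    (fun k' x i h => @measurable_Tabs _ _ _ _ gam T sigma n k' x i h)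
    (fun k' x i h => @measurable_sig _ _ _ _ gam T sigma n k' x i h)
    (fun=> a)) => //.
Qed.

Let subD n : Lv n `<=` D := @level_sources_D n.

Let Tmean k x i : (0 < k)%N -> \int[P]_w (Th w k x i)%:E <= 1.
Proof. by move=> k0; exact: (exponential_mean (fun A => model_T hm x i k0 (A := A))). Qed.

(** The window and the occupation of the parents belong to the past of level [n], so [campbell_le]
    applies to each vertex of level [n + 1]; superharmonicity of the weights then moves the bound
    back to level [n]. *)
Lemma Xi_t_le_mass n (a b Z : Omega -> \bar R) :
  measurable_fun setT (a : sub (Lv n) -> \bar R) ->
  measurable_fun setT (b : sub (Lv n) -> \bar R) ->
  measurable_fun setT (Z : sub (Lv n) -> \bar R) -> (forall w, 0 <= Z w) ->
  \int[P]_w (Z w * Xi_t w n.+1 (within (a w) (b w))) <=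
  \int[P]_w (Z w * massw w n (within (a w) (b w))).
Proof.
move=> ma mb mZ Z0.
pose c y w := Wt w y * edge (g w) y.
have c0 y w : 0 <= c y w by rewrite mule_ge0 ?weight_ge0// lee_fin gabs_ge0.
pose H y := [set z : sub (Lv n) * R | within (a z.1) (b z.1) z.2 /\ occw z.1 n (parent y) z.2].
have mH y : measurable (H y) by apply: measurableI; [exact: measurable_within_set|exact: m_occ].
pose l (y : seq nat) (w : Omega) : \bar R := leb ([set u | H y (w, u)] `&` `]0%R, +oo[).
have ml y : measurable_fun setT (l y : sub (Lv n) -> \bar R).
  have mS := measurableI _ _ (mH y)
    (measurableX (@measurableT _ (sub (Lv n))) (measurable_itv `]0%R, +oo[ : measurable (_ : set R))).
  have := measurable_fun_xsection leb mS.
  apply: eq_measurable_fun => w _ /=; congr lebesgue_measure.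
  apply/seteqP; split => u; rewrite /xsection/=.
    by move=> /set_mem [? [_ ?]].
  by move=> [? ?]; exact/mem_set.
pose h y w := hold (Th w) (sg w) n.+1 (occw w n) y (within (a w) (b w)).
have h0 y w : 0 <= h y w by apply: esum_ge0 => i _; rewrite lee_fin Tabs_ge0.
have mc y : measurable_fun setT (c y : sub (Lv n) -> \bar R).
  apply: emeasurable_funM; first exact: measurable_weight.
  by apply/measurable_EFinP; exact: measurable_gabs.
have mZc y : measurable_fun setT ((fun w => Z w * c y w) : sub (Lv n) -> \bar R).
  exact: emeasurable_funM.
have mh y : measurable_fun setT (h y).
  have LL : Lv n `<=` Lv n.+1 by exact: level_sources_mono.
  have ma' := sub_measurable_funS LL ma.
  have mb' := sub_measurable_funS LL mb.
  suff : measurable_fun setT (h y : sub (Lv n.+1) -> \bar R).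
    by move=> m1; exact: (sub_measurable_fun (@source_meas _ _ _ _ gam T sigma) m1).
  have nn : (0 < n.+1 <= n.+1)%N by rewrite leqnn.
  have [] := @measurable_wclock_gen _ (sub (Lv n.+1)) R n.+1 Th sg
    (fun w k' x i => Tabs_ge0 T w k' x i)
    (fun k' x i h => @measurable_Tabs _ _ _ _ gam T sigma n.+1 k' x i h)
    (fun k' x i h => @measurable_sig _ _ _ _ gam T sigma n.+1 k' x i h)
    _ (sub (Lv n.+1)) id (fun w => within (a w) (b w)) (fun _ _ => 0)
    (fun w => occw w n) n.+1 nn (@measurable_id _ _ _) (fun s => m_occ s (leqnSn n)) (fun _ _ => lexx _)
    (fun _ => @measurable_cst _ _ _ _ _ _) _.
    move=> x i; apply: (@measurable_within _ _ _ n.+1) => // k' x' i' kn.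
    exact: measurable_sig.
  by move=> _ /(_ y).
have sm := sub_measurable_fun (@source_meas _ _ _ _ gam T sigma).
have Zch y w : 0 <= Z w * c y w * h y w by exact: (mule_ge0 (mule_ge0 (Z0 w) (c0 y w)) (h0 y w)).
have Zcl y w : 0 <= Z w * c y w * l y w.
  exact: (mule_ge0 (mule_ge0 (Z0 w) (c0 y w)) (measure_ge0 _ _)).
have -> : \int[P]_w (Z w * Xi_t w n.+1 (within (a w) (b w))) =
    \esum_(y in [set y | size y = n.+1]) \int[P]_w (Z w * c y w * h y w).
  rewrite -integral_esum//.
  - apply: eq_integral => w _; rewrite -ge0_esumZl; last 2 first.
    + exact: Z0.
    + by move=> y _; exact: (mule_ge0 (c0 y w) (h0 y w)).
    by apply: eq_esum => y _; rewrite muleA.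
  - by move=> y _; apply: emeasurable_funM => //; exact: (sm _ _ _ _ (mZc y)).
apply: (@le_trans _ _ (\esum_(y in [set y | size y = n.+1]) \int[P]_w (Z w * c y w * l y w))).
  apply: le_esum => y /= yn.
  apply: (@campbell_le _ _ _ P source D F (@source_sigma _ _ _ _ gam T sigma)
    (@source_meas _ _ _ _ gam T sigma) (model_indep hm) (Lv n) (inr (inr (n.+1, label y)))
    (fun i => inr (inl (n.+1, label y, i))) (fun i => sigma n.+1 (label y) i)
    (fun i w => Th w n.+1 (label y) i)) => //.
  - by rewrite /level_sources/= ltnn.
  - by move=> i; rewrite /level_sources/= ltnn.
  - by move=> i B mB; exact: source_sigma_mark.
  - by move=> i B mB; exact: source_Tabs.
  - exact: (model_sigma hm).
  - exact: (sigma_gt0 hm).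
  - by move=> i w; exact: Tabs_ge0.
  - by move=> w; exact: (mule_ge0 (Z0 w) (c0 y w)).
  - by move=> i; exact: Tmean.
have mlT y : measurable_fun setT (l y) by exact: (sm _ _ _ _ (ml y)).
have mZcT y : measurable_fun setT (fun w => Z w * c y w) by exact: (sm _ _ _ _ (mZc y)).
rewrite -integral_esum//; last by move=> y _; exact: emeasurable_funM.
apply: ae_ge0_le_integral => //.
- by move=> w _; apply: esum_ge0 => y _; exact: Zcl.
- apply: measurable_esum => [y|y|y w]; first exact: measurable_const_set.
    by apply: emeasurable_funM.
  exact: Zcl.
- by move=> w _; rewrite mule_ge0 ?massw_ge0.
- apply: emeasurable_funM; first exact: (sm _ _ _ _ mZ).
  by apply: (sm _ _ (Lv n)); exact: measurable_massw.
apply: filterS (ae_good hm) => w G _.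
rewrite esum_sizeS; last by move=> y; exact: Zcl.
rewrite esum_exchange; last by move=> *; exact: Zcl.
rewrite -ge0_esumZl//; last by move=> s _; rewrite mule_ge0 ?weight_ge0.
apply: le_esum => s _.
set m := leb _.
(* All children of [s] see the same occupied time [m] of their parent, which factors out of the sum
   of their weights. *)
have -> : \esum_(j in [set: nat]) (Z w * c (rcons s j) w * l (rcons s j) w) =
    Z w * (m * \esum_(x in [set: nat]) (edge (g w) (rcons s x) * Wt w (rcons s x))).
  have m0 : 0 <= m by exact: measure_ge0.
  have ew x : 0 <= edge (g w) (rcons s x) * Wt w (rcons s x).
    by rewrite mule_ge0 ?weight_ge0// lee_fin gabs_ge0.
  rewrite -(ge0_esumZl m0 (fun x _ => ew x)).
  rewrite -(ge0_esumZl (Z0 w) (fun x _ => mule_ge0 m0 (ew x))).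
  apply: eq_esum => x _; rewrite -muleA; congr (_ * _); rewrite muleC; congr (_ * _); last exact: muleC.
  rewrite /l /H /= parent_rcons; congr (leb _); apply/seteqP; split => u.
    by move=> [[? ?] ?].
  by move=> [[? ?] ?].
apply: lee_wpmul2l => //; rewrite muleC; apply: lee_wpmul2r; first exact: measure_ge0.
exact: (good_super G).
Qed.

Lemma mass_le_Xi_t w n a b : goodw w -> (0 < n)%N ->
  massw w n (within (Xi_o w n (upto a)) (Xi_o w n (upto b))) <= Xi_t w n (within a b).
Proof.
move=> G n0; have := @mass_of_le _ (g w) (Th w) (sg w) (good_gabs G) (fun k x i => Tabs_ge0 T w k x i)
  (good_sig_ties G) (Wt w) (weight_ge0 alpha gam w) n a b n0.
exact.
Qed.

Section increments.
Variables (k : nat) (a b : \bar R).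
Hypothesis k0 : (0 < k)%N.

Definition increment n w := Xi_t w n (within (rhow w k (n - k) a) (rhow w k (n - k) b)).

(** In mean, the next increment is at most the occupation mass of its window at level [n]. That
    window is the image under [Xi_n] of the previous one, so path by path its mass is at most the
    current increment. *)
Lemma increment_super n (Z : Omega -> \bar R) : (k <= n)%N ->
  measurable_fun setT (Z : sub (Lv n) -> \bar R) -> (forall w, 0 <= Z w) ->
  \int[P]_w (Z w * increment n.+1 w) <= \int[P]_w (Z w * increment n w).
Proof.
move=> kn mZ Z0; have sm := sub_measurable_fun (@source_meas _ _ _ _ gam T sigma).
have kn1 : (k + (n.+1 - k) <= n.+1)%N by rewrite subnKC// leqW.
apply: le_trans (Xi_t_le_mass (measurable_rhow a k0 kn1) (measurable_rhow b k0 kn1) mZ Z0) _.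
apply: ae_ge0_le_integral => //.
- by move=> w _; rewrite mule_ge0 ?massw_ge0.
- apply: emeasurable_funM; first exact: (sm _ _ _ _ mZ).
  by apply: (sm _ _ (Lv n)); apply: measurable_massw => //; exact: measurable_rhow.
- by move=> w _; rewrite mule_ge0 ?Xi_t_ge0.
- apply: emeasurable_funM; first exact: (sm _ _ _ _ mZ).
  by apply: (sm _ _ (Lv n)); apply: measurable_Xi_t => //; rewrite kn leqnn.
apply: filterS (ae_good hm) => w G _; apply: lee_wpmul2l => //.
apply: le_trans (mass_le_Xi_t _ _ G _); last exact: leq_trans kn.
by rewrite /rhow (rhoS _ _ _ a kn) (rhoS _ _ _ b kn).
Qed.

(** For [n = k] the window is [(a, b]] itself and [Xi_t_le_mass] applies at level [k - 1]; later
    levels only decrease the mean. *)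
Lemma increment_le n (Z : Omega -> \bar R) : (k <= n)%N ->
  measurable_fun setT (Z : sub (Lv k.-1) -> \bar R) -> (forall w, 0 <= Z w) ->
  \int[P]_w (Z w * increment n w) <= \int[P]_w (Z w * massw w k.-1 (within a b)).
Proof.
move=> kn mZ Z0; elim: n kn => [|n ih]; first by rewrite leqNgt k0.
rewrite leq_eqVlt => /predU1P[<-|].
  rewrite /increment subnn /rhow /rho/=; case: k k0 mZ => // k' _ mZ.
  by apply: Xi_t_le_mass.
rewrite ltnS => kn; apply: le_trans (ih kn); apply: increment_super => //.
apply: sub_measurable_funS mZ; apply: level_sources_mono.
by apply: leq_trans kn; exact: leq_pred.
Qed.

End increments.

End supermartingale.

(** * Finiteness of the occupation mass *)

Section finiteness.
Context d (Omega : measurableType d) (R : realType) (P : probability Omega R).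
Variables (alpha : nat -> R) (gam : seq nat -> nat -> {RV P >-> R}).
Variables (T sigma : nat -> nat -> nat -> {RV P >-> R}).
Hypothesis hm : cascade_model alpha gam T sigma.
Local Open Scope ereal_scope.
Local Notation leb := (@lebesgue_measure R).
Local Notation D := [set j : source | (0 < source_level j)%N].
Local Notation F := (source_sigma_algebra gam T sigma).
Local Notation sub A := (g_sigma_algebraType (\bigcup_(i in A) F i)).
Local Notation g := (gabs gam).
Local Notation Th := (Tabs T).
Local Notation sg := (sig sigma).
Local Notation Wt := (weight alpha gam).
Local Notation Lv := (level_sources).
Local Notation goodw := (good alpha gam T sigma).
Local Notation occw := (occw gam T sigma).
Local Notation Xi_t := (Xi_t alpha gam T sigma).
Local Notation Xi_o := (Xi_o gam T sigma).
Local Notation massw := (massw alpha gam T sigma).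
Local Notation rhow := (rhow gam T sigma).
Local Notation increment := (increment alpha gam T sigma).
Let sm := sub_measurable_fun (@source_meas _ _ _ _ gam T sigma).

(** The indicator of an event of the past of level [k - 1] on which the mean of every increment is
    at most [K]. As [K] grows these events exhaust the finiteness of the mass, without any
    assumption on its mean. *)
Let cut (K : nat) k a b (w : Omega) : \bar R :=
  if massw w k.-1 (within a b) <= K%:R%:E then 1 else 0.

Let m_cut K k a b : measurable_fun setT (cut K k a b : sub (Lv k.-1) -> \bar R).
Proof.
apply: measurable_fun_ifT; [|exact: measurable_cst..].
apply: measurable_fun_lee; last exact: measurable_cst.
by apply: measurable_massw => //; exact: measurable_cst.
Qed.

Let cut_ge0 K k a b w : 0 <= cut K k a b w. Proof. by rewrite /cut; case: ifP. Qed.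

Let cut_bound K k a b n : (0 < k)%N -> (k <= n)%N ->
  \int[P]_w (cut K k a b w * increment k a b n w) <= K%:R%:E.
Proof.
move=> k0 kn.
apply: le_trans (increment_le hm a b k0 kn (@m_cut K k a b) (cut_ge0 K k a b)) _.
apply: (@le_trans _ _ (\int[P]_w cst K%:R%:E w)).
  apply: ge0_le_integral => //.
  - by move=> w _; rewrite mule_ge0 ?massw_ge0.
  - apply: emeasurable_funM; first exact: (sm (@m_cut K k a b)).
    by apply: (sm (A := Lv k.-1)); apply: measurable_massw => //; exact: measurable_cst.
  - move=> w _; rewrite /cut; case: ifP; first by rewrite mul1e.
    by move=> _; rewrite mul0e lee_fin.
rewrite integral_cst// -[leRHS]mule1; apply: lee_wpmul2l => //.
exact: (probability_le1 P measurableT).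
Qed.

Let finite_cut w k a b : massw w k.-1 (within a b) < +oo -> exists K, cut K k a b w = 1.
Proof.
have := massw_ge0 alpha gam T sigma w k.-1 (within a b).
rewrite /cut; case: (massw _ _ _) => [r| |]// r0 _; exists (Num.truncn r).+1.
by rewrite lee_fin ifT// ltW// truncnS_gt.
Qed.

Let m_increment k a b n : (0 < k)%N -> (k <= n)%N ->
  measurable_fun setT (increment k a b n : sub (Lv n) -> \bar R).
Proof. by move=> k0 kn; apply: measurable_Xi_t => //; rewrite kn leqnn. Qed.

(** The increments multiplied by [cut K] form an integrable supermartingale from level [k] on, and
    on the event of the cut they are the increments themselves. *)
Lemma increment_cvg k a b : (0 < k)%N ->
  {ae P, forall w, massw w k.-1 (within a b) < +oo ->
    increment k a b n w @[n --> \oo] --> limn_esup (increment k a b ^~ w) /\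
    limn_esup (increment k a b ^~ w) < +oo}.
Proof.
move=> k0.
suff h K : {ae P, forall w, cut K k a b w = 1 ->
    increment k a b n w @[n --> \oo] --> limn_esup (increment k a b ^~ w) /\
    limn_esup (increment k a b ^~ w) < +oo}.
  by have := ae_forall_count h; apply: filterS => w hw /finite_cut[K /hw].
pose M m w := cut K k a b w * increment k a b (k + m) w.
pose G m : set_system Omega := @measurable _ (sub (Lv (k + m))).
have m_cut' m : measurable_fun setT (cut K k a b : sub (Lv (k + m)) -> \bar R).
  apply: sub_measurable_funS (@m_cut K k a b); apply: level_sources_mono.
  by apply: leq_trans (leq_addr _ _); exact: leq_pred.
have mM m : measurable_fun setT (M m : sub (Lv (k + m)) -> \bar R).
  by apply: emeasurable_funM => //; apply: m_increment => //; exact: leq_addr.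
have M0 m w : 0 <= M m w by rewrite mule_ge0 ?Xi_t_ge0.
have Msup m B : G m B -> \int[P]_(w in B) M m.+1 w <= \int[P]_(w in B) M m w.
  move=> GB; have mB : measurable B by exact: (sub_measurable (@source_meas _ _ _ _ gam T sigma) GB).
  have e j : \int[P]_(w in B) M j w =
      \int[P]_w (((\1_B w)%:E * cut K k a b w) * increment k a b (k + j) w).
    rewrite integral_mkcond; apply: eq_integral => w _; rewrite patchE indicE.
    by case: ifP; rewrite ?mul1e ?mul0e.
  rewrite !e addnS; apply: increment_super => //; first exact: leq_addr.
    apply: emeasurable_funM => //.
    by apply/measurable_EFinP; apply: measurable_indic.
  by move=> w; rewrite mule_ge0// lee_fin.
have key : {ae P, forall w, M n w @[n --> \oo] --> limn_einf (M ^~ w) /\ limn_einf (M ^~ w) < +oo}.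
  have := @supermartingale_cvg _ _ R P G M; apply.
  - by move=> n; exact: sigma_algebra_measurable.
  - by move=> n; exact: sub_measurable (@source_meas _ _ _ _ gam T sigma) _.
  - by move=> n; apply: sub_subset; apply: level_sources_mono; rewrite addnS.
  - by move=> n B mB; rewrite -[X in G n X]setTI; exact: mM.
  - by move=> n w; exact: M0.
  - by move=> n B; exact: Msup.
  - apply: le_lt_trans (ltry K%:R); have := cut_bound K a b k0 (leqnn k).
    by rewrite /M addn0.
apply: filterS key => w [c fin] cw.
have c' : increment k a b n w @[n --> \oo] --> limn_einf (M ^~ w).
  rewrite -(cvg_shiftn k); apply: cvg_trans c.
  have -> : (fun n => increment k a b (n + k) w) = M ^~ w; last exact: cvg_id.
  by apply/funext => n; rewrite /M cw mul1e addnC.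
by have [_ e] := cvg_limn_einf_sup c'; rewrite e.
Qed.

(** The mean bound on a cut, taken at the initial level [n = k], gives almost sure finiteness
    there. *)
Lemma Xi_t_finite k a b : (0 < k)%N ->
  {ae P, forall w, massw w k.-1 (within a b) < +oo -> Xi_t w k (within a b) < +oo}.
Proof.
move=> k0; suff h K : {ae P, forall w, cut K k a b w = 1 -> Xi_t w k (within a b) < +oo}.
  by have := ae_forall_count h; apply: filterS => w hw /finite_cut[K /hw].
have inc w : increment k a b k w = Xi_t w k (within a b) by rewrite /increment subnn.
have mM : measurable_fun setT (fun w => cut K k a b w * increment k a b k w).
  apply: emeasurable_funM; first exact: (sm (@m_cut K k a b)).
  exact: (sm (@m_increment k a b k k0 (leqnn k))).
have iM : P.-integrable setT (fun w => cut K k a b w * increment k a b k w).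
  apply/integrableP; split => //; apply: le_lt_trans (ltry K%:R).
  apply: le_trans (cut_bound K a b k0 (leqnn k)); rewrite le_eqVlt; apply/orP; left; apply/eqP.
  by apply: eq_integral => w _; rewrite gee0_abs// mule_ge0 ?Xi_t_ge0.
apply: filterS (integrable_ae measurableT iM) => w /(_ I) + cw.
by rewrite cw mul1e inc fin_numE => /andP[_]; rewrite ltey.
Qed.

(** A single line of descent is enough to witness infinite occupation at every level. *)
Let zeros k : seq nat := nseq k 0%N.

Let parent_zeros k : parent (zeros k.+1) = zeros k.
Proof. by rewrite /parent /zeros size_nseq; exact: take_nseq. Qed.

Let label_zeros k : label (zeros k.+1) = 0%N.
Proof. by rewrite /label /zeros -[k.+1]addn1 nseqD cats1 last_rcons. Qed.

Let hold_infinite k : {ae P, forall w,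
  leb (occw w k (zeros k) `&` `]0%R, +oo[) = +oo ->
  hold (Th w) (sg w) k.+1 (occw w k) (zeros k.+1) setT = +oo}.
Proof.
pose H := [set z : sub (Lv k) * R | occw z.1 k (zeros k) z.2].
have mH : measurable H.
  apply: (@measurable_occ _ (sub (Lv k)) R k g Th sg) => //.
  - by move=> w s' x; exact: gabs_ge0.
  - by move=> w k' x i; exact: Tabs_ge0.
  - by move=> s' x; exact: measurable_gabs.
  - by move=> k' x i ?; exact: measurable_Tabs.
  - by move=> k' x i ?; exact: measurable_sig.
have q1 : (1 - expR (-1) * (1 - expR (-1)) < 1 :> R)%R.
  by rewrite ltrBlDr ltrDl mulr_gt0 ?expR_gt0// subr_gt0 expR_lt1 ltrN10.
have key := @marks_sum_infinite _ _ _ P source D F (@source_sigma _ _ _ _ gam T sigma)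
    (@source_meas _ _ _ _ gam T sigma) (model_indep hm) (Lv k) (inr (inr (k.+1, 0%N)))
    (fun i => inr (inl (k.+1, 0%N, i))) (fun i => sigma k.+1 0%N i)
    (fun i w => Th w k.+1 0%N i).
have {}key := key (@level_sources_D k) isT (fun=> isT).
have {}key := key _ _ _ _ _ _ _ _ _ H mH _ q1 _.
have h : {ae P, forall w : Omega, leb ([set u | H (w, u)] `&` `]0%R, +oo[) = +oo ->
    \esum_(i in [set i | H (w, sigma k.+1 0%N i w)]) (Th w k.+1 0%N i)%:E = +oo}.
  apply: key.
  - by rewrite /level_sources/= ltnn.
  - by move=> i; rewrite /level_sources/= ltnn.
  - by [].
  - by move=> i j [].
  - by move=> i B mB; exact: source_sigma_mark.
  - by move=> i B mB; exact: source_Tabs.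
  - exact: (model_sigma hm).
  - exact: (sigma_gt0 hm).
  - by move=> i w; exact: Tabs_ge0.
  - by move=> i; exact: (exponential_laplace (fun A => model_T hm 0%N i (ltn0Sn k) (A := A))).
apply: filterS h => w hw lw; rewrite /hold /visits label_zeros parent_zeros -(hw lw).
by congr (esum _ _); apply/seteqP; split => i //= [].
Qed.

Let massw_mono w n (A B : set R) : goodw w -> measurable A -> measurable B ->
  (forall s, size s = n -> occw w n s `&` A `<=` B) -> massw w n A <= massw w n B.
Proof.
move=> G mA mB AB; apply: le_esum => s /= sn; apply: lee_wpmul2l; first exact: weight_ge0.
have mo := measurable_occ1 (sg w) (good_gabs G) (fun k x i => Tabs_ge0 T w k x i) n s.
apply: le_measure; rewrite ?inE; do ?[apply: measurableI]; do ?[exact: mo|exact: mA|exact: mB|exact: measurable_itv].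
by move=> u [[ou Au] u0]; split => //; split => //; exact: (AB s sn).
Qed.

Let Xi_o0 w k : goodw w -> (0 < k)%N -> Xi_o w k (upto 0) = 0.
Proof.
move=> G k0; have := rho0 (g w) (Th w) (good_sig G) 1 k0.
by rewrite /rho/= addn0.
Qed.

(** Every occupied time lies below the total value of the clock. If this value is reached by time
    [b], the window up to [b] accounts for the whole mass of the next level. *)
Let within_inf_le w k (b : \bar R) : goodw w -> (0 < k)%N ->
  Xi_o w k (upto b) = Xi_o w k (upto +oo) ->
  massw w k (within 0 +oo) <= Xi_t w k (within 0 b).
Proof.
move=> G k0 e; apply: le_trans (mass_le_Xi_t 0 b G k0).
rewrite Xi_o0// e; apply: massw_mono => //; [exact: measurable_within1..|].
move=> s sk u [ou /andP[u0 _]]; apply/andP; split => //.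
case: k k0 sk ou e => // k _ sk [i [_ _ h]] _; apply: (le_trans (ltW h)).
have := @wclock_mono _ (Th w) (sg w) (fun k x i => Tabs_ge0 T w k x i) k.+1 (occw w k) (edge (g w)).
apply => //; first by move=> y; rewrite lee_fin gabs_ge0.
by move=> v _; rewrite /upto/= leey.
Qed.

(* The second alternative carries the induction: infinite occupation time at the
   vertex 0...0 produces infinitely many marks, hence an unbounded clock at the
   next level, which then covers any bounded interval in bounded time. *)
Lemma massw_finite k : {ae P, forall w,
  (forall m : nat, massw w k (within 0 m%:R%:E) < +oo) /\
  (massw w k (within 0 +oo) < +oo \/ leb (occw w k (zeros k) `&` `]0%R, +oo[) = +oo)}.
Proof.
elim: k => [|k ih].
  apply: filterS (ae_good hm) => w G; split; last first.
    right; rewrite /occw/= setTI lebesgue_measure_itv/= ltry.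
    by rewrite oppr0 adde0.
  move=> m; rewrite /massw /mass_of.
  rewrite (_ : [set s : seq nat | size s = 0%N] = [set [::]]); last first.
    by apply/seteqP; split => s /=; [move/size0nil|move=> ->].
  rewrite esum_set1; last by rewrite mule_ge0 ?weight_ge0.
  rewrite setTI; apply: lte_mul_pinfty.
  - exact: weight_ge0.
  - by rewrite ge0_fin_numE ?weight_ge0// (good_fin G).
  - apply: (@le_lt_trans _ _ (leb `]0%R, m%:R])); last first.
      by rewrite lebesgue_measure_itv/=; case: ifP => _; rewrite ?ltry.
    apply: le_measure; rewrite ?inE.
    + by apply: measurableI; [exact: measurable_within1|exact: measurable_itv].
    + exact: measurable_itv.
    + by move=> u [/andP[u0 um] _]; rewrite /= in_itv/= -!lte_fin -lee_fin u0.
have fin (b : \bar R) : {ae P, forall w, massw w k (within 0 b) < +oo -> Xi_t w k.+1 (within 0 b) < +oo}.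
  exact: (@Xi_t_finite k.+1 0 b).
have finN := ae_forall_count (fun m : nat => fin m%:R%:E).
near=> w.
have G : goodw w by near: w; exact: (ae_good hm).
have [ih1 ih2] : (forall m : nat, massw w k (within 0 m%:R%:E) < +oo) /\
  (massw w k (within 0 +oo) < +oo \/ leb (occw w k (zeros k) `&` `]0%R, +oo[) = +oo) by near: w.
have f1 (m : nat) : Xi_t w k.+1 (within 0 m%:R%:E) < +oo.
  have : forall i : nat, massw w k (within 0 i%:R%:E) < +oo -> Xi_t w k.+1 (within 0 i%:R%:E) < +oo by near: w.
  by apply.
have f2 : massw w k (within 0 +oo) < +oo -> Xi_t w k.+1 (within 0 +oo) < +oo by near: w; exact: fin.
have hold_oo : leb (occw w k (zeros k) `&` `]0%R, +oo[) = +oo ->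
  hold (Th w) (sg w) k.+1 (occw w k) (zeros k.+1) setT = +oo by near: w; exact: hold_infinite.
have all_of_inf : massw w k.+1 (within 0 +oo) < +oo ->
    (forall m : nat, massw w k.+1 (within 0 m%:R%:E) < +oo) /\
    (massw w k.+1 (within 0 +oo) < +oo \/ leb (occw w k.+1 (zeros k.+1) `&` `]0%R, +oo[) = +oo).
  move=> h; split; last by left.
  move=> m; apply: le_lt_trans h; apply: massw_mono => //; [exact: measurable_within1..|].
  by move=> s _ u [_ /andP[u0 _]]; rewrite /within/= u0 leey.
have wc_mono := @wclock_mono _ (Th w) (sg w) (fun k x i => Tabs_ge0 T w k x i) k.+1 (occw w k) (edge (g w)).
have Tw0 k' x i : (0 <= Th w k' x i)%R by exact: Tabs_ge0.
have edge0 y : 0 <= edge (g w) y by rewrite lee_fin gabs_ge0.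
case: ih2 => [inf|lw].
  by apply: all_of_inf; apply: le_lt_trans (f2 inf); exact: within_inf_le.
(* If the clock is infinite at an integer time, the part up to that time carries the whole mass of
   level [k + 1], which gives the first alternative. *)
have [[m em]|nofin] := pselect (exists m : nat, Xi_o w k.+1 (upto m%:R%:E) = +oo).
  apply: all_of_inf; apply: le_lt_trans (f1 m); apply: within_inf_le => //.
  rewrite em; apply/esym/eqP; rewrite -leye_eq.
  apply: (@le_trans _ _ (Xi_o w k.+1 (upto m%:R%:E))); first by rewrite em.
  by apply: wc_mono => // v _; rewrite /upto/= leey.
have finX (v : R) : Xi_o w k.+1 (upto v%:E) < +oo.
  have [m hmv] : exists m : nat, (v <= m%:R)%R.
    by exists (Num.truncn v).+1; rewrite ltW// truncnS_gt.
  apply: (@le_lt_trans _ _ (Xi_o w k.+1 (upto m%:R%:E))).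
    by apply: wc_mono => // u; rewrite /upto/= !lee_fin => /le_trans; exact.
  by rewrite ltey; apply/negP => /eqP e; apply: nofin; exists m.
have sz : size (zeros k.+1) = k.+1 by rewrite size_nseq.
have eg : 0 < edge (g w) (zeros k.+1) by rewrite lte_fin (good_gabs G).
have hl := hold_le_occ (good_gabs G) (fun k x i => Tabs_ge0 T w k x i) (good_sig_ties G) (ltn0Sn k) sz finX.
have prod_oo : edge (g w) (zeros k.+1) * hold (Th w) (sg w) k.+1 (occw w k) (zeros k.+1) setT = +oo.
  by rewrite hold_oo// gt0_muley.
split; last by right; apply/eqP; rewrite -leye_eq -prod_oo.
(* Here the clock is finite at finite times but its total is infinite, so it exceeds every [m] by
   some integer time [m']. *)
move=> m; have [m' mm'] : exists m' : nat, m%:R%:E <= Xi_o w k.+1 (upto m'%:R%:E).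
  apply: contrapT => /forallNP h.
  suff : +oo <= (m%:R%:E : \bar R) by [].
  rewrite -prod_oo; apply: (@le_trans _ _ (Xi_o w k.+1 setT)).
    rewrite -(esum_set1 (a := fun y => edge (g w) y * hold (Th w) (sg w) k.+1 (occw w k) y setT) (t := zeros k.+1)).
      apply: le_esum_set => [_ ->//|y _]; rewrite mule_ge0// esum_ge0// => i _.
      by rewrite lee_fin Tabs_ge0.
    by rewrite prod_oo.
  rewrite /Xi_o (wclockE (sg w) Tw0 _ _ (ltn0Sn k) edge0).
  rewrite (_ : [set k0 | _] = \bigcup_m' [set k0 : seq nat * nat | size k0.1 = k.+1 /\ visits (sg w) k.+1 (occw w k) k0.1 (upto m'%:R%:E) k0.2]).
    apply: esum_bigcup_le.
    - move=> i j ij [y l] [yn [Bk ok]]; split => //; split => //; apply: le_trans Bk _.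
      by rewrite lee_fin ler_nat.
    - by move=> y; rewrite mule_ge0// lee_fin Tabs_ge0.
    - move=> i; have := h i; move/negP; rewrite -ltNge => /ltW; apply: le_trans.
      have e := wclockE (sg w) Tw0 (occw w k) (upto i%:R%:E) (ltn0Sn k) edge0.
      by rewrite -e.
  apply/seteqP; split => -[y l] /=; last by move=> [i _ [yn [Bk ok]]].
  move=> [yn [_ ok]]; exists (Num.truncn (sg w k.+1 (label y) l)).+1 => //; split => //; split => //.
  by rewrite /upto/= lee_fin ltW// truncnS_gt.
apply: le_lt_trans (f1 m'); apply: le_trans (mass_le_Xi_t 0 _ G (ltn0Sn k)).
rewrite Xi_o0//; apply: massw_mono => //; [exact: measurable_within1..|].
by move=> s _ u [_ /andP[u0 um]]; rewrite /within/= u0/= (le_trans um).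
Unshelve. all: by end_near. Qed.

End finiteness.

(** * Comparison of measures *)

Section density.
Context d (U : measurableType d) (R : realType).
Variables (mu : {measure set U -> \bar R}) (phi : U -> \bar R).
Local Open Scope ereal_scope.

Definition density (B : set U) : \bar R := \int[mu]_(x in B) phi x.

Hypothesis mphi : measurable_fun setT phi.
Hypothesis phi0 : forall x, 0 <= phi x.

Let density0 : density set0 = 0. Proof. exact: integral_set0. Qed.

Let density_ge0 B : 0 <= density B. Proof. exact: integral_ge0. Qed.

Let density_sigma_additive : semi_sigma_additive density.
Proof.
move=> A mA tA mUA; rewrite /density ge0_integral_bigcup//.
  by apply: is_cvg_nneseries => n _ _; exact: integral_ge0.
exact: measurable_funTS.
Qed.

HB.instance Definition _ := isMeasure.Build _ _ _ density
  density0 density_ge0 density_sigma_additive.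

Definition density_measure : {measure set U -> \bar R} := density.

End density.

Section generated_comparison.
Context d (U : measurableType d) (R : realType).
Variables (m1 m2 : {measure set U -> \bar R}) (A : set_system U).
Local Open Scope ereal_scope.
Hypothesis A_meas : A `<=` measurable.
Hypothesis A_setC : forall B, A B -> A (~` B).
Hypothesis A_setU : forall B C, A B -> A C -> A (B `|` C).
Hypothesis A_setT : A setT.
Hypothesis m1_fin : m1 setT < +oo.
Hypothesis m2_fin : m2 setT < +oo.
Hypothesis A_le : forall B, A B -> m1 B <= m2 B.

Let m : {measure set U -> \bar R} := measure_add m1 m2.

Let mE B : m B = m1 B + m2 B. Proof. exact: measure_addE. Qed.

Let m_fin : m setT < +oo. Proof. by rewrite mE lte_add_pinfty. Qed.

Let m_fin_num B : measurable B -> m B \is a fin_num.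
Proof.
move=> mB; rewrite ge0_fin_numE//; apply: le_lt_trans m_fin.
by apply: le_measure; rewrite ?inE//; exact: measurableT.
Qed.

Let diff (B C : set U) := (B `\` C) `|` (C `\` B).

Let mdiff B C : measurable B -> measurable C -> measurable (diff B C).
Proof. by move=> mB mC; apply: measurableU; exact: measurableD. Qed.

(** Approximation by the algebra in the sum of both measures. This property, unlike the inequality
    to be proved, passes to complements and defines a sigma-algebra. *)
Let approx (B : set U) := measurable B /\
  forall e : R, (0 < e)%R -> exists2 C, A C & m (diff C B) <= e%:E.

Let approx_alg B : A B -> approx B.
Proof.
move=> AB; split; first exact: A_meas.
move=> e e0; exists B => //; rewrite /diff setDv setU0 measure0 lee_fin; exact: ltW.
Qed.

Let approx_setC B : approx B -> approx (~` B).
Proof.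
move=> [mB h]; split; first exact: measurableC.
move=> e e0; have [C AC hC] := h e e0; exists (~` C); first exact: A_setC.
rewrite (_ : diff (~` C) (~` B) = diff C B)//.
by rewrite /diff !setDE !setCK setUC (setIC (~` B)) (setIC (~` C)).
Qed.

Let approx_setU B C : approx B -> approx C -> approx (B `|` C).
Proof.
move=> [mB hB] [mC hC]; split; first exact: measurableU.
move=> e e0; have e2 : (0 < e / 2)%R by rewrite divr_gt0.
have [B' AB' hB'] := hB _ e2; have [C' AC' hC'] := hC _ e2.
exists (B' `|` C'); first exact: A_setU.
have [mB' mC'] := (A_meas AB', A_meas AC').
apply: (@le_trans _ _ (m (diff B' B `|` diff C' C))).
  apply: le_measure; rewrite ?inE; [apply: mdiff; exact: measurableU|apply: measurableU; exact: mdiff|].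
  move=> x [[[h|h] n]|[[h|h] n]].
  - by left; left; split => // Bx; apply: n; left.
  - by right; left; split => // Cx; apply: n; right.
  - by left; right; split => // Bx; apply: n; left.
  - by right; right; split => // Cx; apply: n; right.
apply: le_trans (measureU2 _ _ _) _; [exact: mdiff..|].
by rewrite [e]splitr EFinD leeD.
Qed.

Let approx_bigU (F : nat -> set U) n : (forall i, approx (F i)) ->
  approx (\big[setU/set0]_(i < n) F i).
Proof.
move=> hF; elim: n => [|n ih]; last by rewrite big_ord_recr/=; exact: approx_setU.
rewrite big_ord0; apply: approx_alg; rewrite -setCT; exact: A_setC.
Qed.

Let approx_sigma : sigma_algebra setT approx.
Proof.
split.
- by apply: approx_alg; rewrite -setCT; exact: A_setC.
- by move=> B hB; rewrite setTD; exact: approx_setC.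
- move=> F hF; have mF i : measurable (F i) by have [] := hF i.
  pose G n := \big[setU/set0]_(i < n) F i.
  have mG n : measurable (G n) by exact: bigsetU_measurable.
  have UG : \bigcup_n G n = \bigcup_n F n.
    apply/seteqP; split => x [n _].
      by rewrite /G -bigcup_mkord => -[i _ Fx]; exists i.
    by move=> Fx; exists n.+1 => //; rewrite /G -bigcup_mkord; exists n => /=.
  have mU : measurable (\bigcup_n F n) by exact: bigcupT_measurable.
  split => // e e0; have e2 : (0 < e / 2)%R by rewrite divr_gt0.
  have cv : m (G n) @[n --> \oo] --> m (\bigcup_n F n).
    rewrite -UG; apply: nondecreasing_cvg_mu => //; first by rewrite UG.
    by move=> i j ij; apply/subsetPset; exact: subset_bigsetU.
  have [n hn] : exists n, m (\bigcup_n F n) - (e / 2)%:E < m (G n).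
    have lt : m (\bigcup_n F n) - (e / 2)%:E < m (\bigcup_n F n).
      have := m_fin_num mU; case: (m _) => // r _.
      by rewrite -EFinB lte_fin ltrBlDr ltrDl.
    have [n _ hn] := cv _ (open_ereal_gt' lt); exists n; exact: (hn n (leqnn n)).
  have [_ /(_ _ e2)[C AC hC]] := approx_bigU n hF.
  exists C => //; have mC := A_meas AC.
  have GF : G n `<=` \bigcup_n F n by rewrite -UG; exact: bigcup_sup.
  apply: (@le_trans _ _ (m (diff C (G n) `|` (\bigcup_n F n `\` G n)))).
    apply: le_measure; rewrite ?inE; [exact: mdiff|apply: measurableU; [exact: mdiff|exact: measurableD]|].
    move=> x [[Cx nF]|[Fx nC]].
      by left; left; split => // /GF.
    have [Gx|nG] := pselect (G n x); first by left; right.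
    by right.
  apply: le_trans (measureU2 _ _ _) _; [exact: mdiff|exact: measurableD|].
  rewrite [e]splitr EFinD leeD//.
  rewrite measureD//; last by move: (m_fin_num mU); rewrite ge0_fin_numE.
  rewrite (_ : _ `&` G n = G n); last by rewrite setIC; exact/setIidl.
  rewrite leeBlDr ?m_fin_num// addeC -leeBlDr//; exact: ltW.
Qed.

Lemma measure_le_generated B : <<s A >> B -> m1 B <= m2 B.
Proof.
move=> /(smallest_sub approx_sigma approx_alg)[mB hB].
have mm1 C : measurable C -> m1 C <= m C by rewrite mE => mC; exact: leeDl.
have mm2 C : measurable C -> m2 C <= m C by rewrite mE => mC; exact: leeDr.
apply/lee_addgt0Pr => e e0; have e2 : (0 < e / 2)%R by rewrite divr_gt0.
have [C AC hC] := hB _ e2; have mC := A_meas AC.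
have mD := mdiff mC mB.
apply: (@le_trans _ _ (m1 C + (e / 2)%:E)).
  apply: (@le_trans _ _ (m1 (C `|` diff C B))).
    apply: le_measure; rewrite ?inE//; first exact: measurableU.
    move=> x Bx; have [Cx|nC] := pselect (C x); [by left|by right; right].
  apply: le_trans (measureU2 _ _ _) _ => //; apply: leeD => //.
  exact: le_trans (mm1 _ mD) hC.
rewrite [e]splitr EFinD addeA; apply: leeD; last by rewrite -splitr.
apply: (le_trans (A_le AC)).
apply: (@le_trans _ _ (m2 (B `|` diff C B))).
  apply: le_measure; rewrite ?inE//; first exact: measurableU.
  move=> x Cx; have [Bx|nB] := pselect (B x); [by left|by right; left].
apply: le_trans (measureU2 _ _ _) _ => //; apply: leeD => //.
exact: le_trans (mm2 _ mD) hC.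
Qed.

End generated_comparison.

(** * An algebra of dyadic steps in the time variable *)

Section dyadic_algebra.
Context d (U : measurableType d) (R : realType).

(** The index [j] of the dyadic interval [](j - 1)/2^N, j/2^N]] that contains [v]; the value 0
    collects all nonpositive [v]. *)
Definition level (N : nat) (v : R) : nat :=
  if v <= 0 then 0%N else `|Num.ceil (2 ^+ N * v)|%N.

(** One measurable section per dyadic interval, with all intervals of a given resolution allowed at
    once: complements are then immediate, and unions only require a common resolution. *)
Definition step_set (B : set (U * R)) := exists N (E : nat -> set U),
  (forall j, measurable (E j)) /\ B = [set z | E (level N z.2) z.1].

Lemma levelP N (v : R) j : (0 < j)%N -> (level N v = j) <->
  (j.-1%:R / 2 ^+ N < v <= j%:R / 2 ^+ N).
Proof.
move=> j0; have p0 : 0 < 2 ^+ N :> R by exact: exprn_gt0.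
rewrite ltr_pdivrMr// ler_pdivlMr// mulrC; split.
  rewrite /level; case: ifPn => [_ e|]; first by rewrite -e in j0.
  rewrite -ltNge => v0 <-; have c0 : (0 < Num.ceil (2 ^+ N * v))%R.
    rewrite ltNge; apply/negP => c; have /andP[_] := ceil_itv (2 ^+ N * v).
    rewrite leNgt (le_lt_trans _ (mulr_gt0 p0 v0))//.
    by rewrite -(ler_int R) in c.
  have := ceil_itv (2 ^+ N * v); case: (Num.ceil _) c0 => // [[//|n]] _ /=.
  by rewrite intS addrAC subrr add0r.
move=> /andP[a b]; have v0 : 0 < v.
  rewrite -(pmulr_rgt0 v p0); exact: le_lt_trans a.
rewrite /level ifN -?ltNge// (_ : Num.ceil _ = j%:Z)//.
apply: ceil_def; rewrite b andbT.
by case: j j0 a {b} => // j _ /=; rewrite intS addrAC subrr add0r.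
Qed.

Lemma level_eq0 N (v : R) : level N v = 0%N -> v <= 0.
Proof.
move=> e; rewrite leNgt; apply/negP => v0; move: e.
rewrite /level leNgt v0/= => /eqP; rewrite absz_eq0 => /eqP e.
have := ceil_itv (2 ^+ N * v); rewrite e => /andP[_].
by rewrite leNgt mulr_gt0// exprn_gt0.
Qed.

(** Coarsening the grid merges the intervals [2j - 1] and [2j] into [j]. *)
Lemma levelS N (v : R) : level N v = uphalf (level N.+1 v).
Proof.
have [v0|v0] := leP v 0; first by rewrite /level v0.
set j := level N.+1 v; have j0 : (0 < j)%N.
  by rewrite lt0n; apply/eqP => /level_eq0; rewrite leNgt v0.
have [+ _] := levelP N.+1 v j0; move=> /(_ erefl) /andP[a b].
have p0 : 0 < 2 ^+ N :> R by exact: exprn_gt0.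
have u0 : (0 < uphalf j)%N by rewrite uphalf_half; lia.
apply/levelP => //; move: a b; rewrite exprS !ltr_pdivrMr ?mulr_gt0// !ler_pdivlMr ?mulr_gt0//.
rewrite mulrCA => a b.
have h1 : 2 * (uphalf j).-1%:R <= j.-1%:R :> R.
  by rewrite -natrM ler_nat uphalf_half; have := odd_double_half j; case: (odd j) => /=; lia.
have h2 : j%:R <= 2 * (uphalf j)%:R :> R.
  by rewrite -natrM ler_nat uphalf_half; have := odd_double_half j; case: (odd j) => /=; lia.
have h3 := le_lt_trans h1 a; have h4 := le_trans b h2.
by apply/andP; split; [rewrite -(ltr_pM2l (ltr0n R 2))|rewrite -(ler_pM2l (ltr0n R 2))].
Qed.

Lemma measurable_level N j : measurable [set v : R | level N v = j].
Proof.
case: j => [|j].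
  rewrite (_ : [set _ | _] = `]-oo, 0]%classic); first exact: measurable_itv.
  by apply/seteqP; split => v /=; rewrite in_itv/=; [exact: level_eq0|rewrite /level => ->].
rewrite (_ : [set _ | _] = `]j%:R / 2 ^+ N, j.+1%:R / 2 ^+ N]%classic); first exact: measurable_itv.
apply/seteqP; split => v /=; rewrite in_itv/= => h.
  exact: (levelP N v (ltn0Sn j)).1 h.
exact: (levelP N v (ltn0Sn j)).2 h.
Qed.

Lemma level_le N : {homo level N : u v / (u <= v)%R >-> (u <= v)%N}.
Proof.
move=> u v uv; rewrite /level; case: (leP u 0) => // u0.
rewrite leNgt (lt_le_trans u0 uv)/=.
have p0 : 0 < 2 ^+ N :> R by exact: exprn_gt0.
have c0 : (0 <= Num.ceil (2 ^+ N * u))%R.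
  by rewrite -(ler_int R); apply: le_trans (ceil_ge _); rewrite mulr_ge0 ?ltW.
have cc : (Num.ceil (2 ^+ N * u) <= Num.ceil (2 ^+ N * v))%R.
  by apply: ceil_le; rewrite ler_pM2l.
by rewrite -lez_nat !gez0_abs// (le_trans c0).
Qed.

(** Two reals are told apart as soon as [2^-N] is smaller than their distance; the converse is
    monotonicity of [level]. *)
Lemma level_lt (c v : R) : 0 <= c -> c < v <-> exists N, (level N c < level N v)%N.
Proof.
move=> c0; split; last first.
  by move=> [N lt]; rewrite ltNge; apply/negP => /(level_le N); rewrite leqNgt lt.
move=> cv; have v0 := le_lt_trans c0 cv.
have [N hN] : exists N : nat, (v - c)^-1 < 2 ^+ N.
  exists (Num.truncn (v - c)^-1).+1; apply: (lt_le_trans (truncnS_gt _)).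
  by rewrite -natrX ler_nat ltnW// ltn_expl.
exists N; rewrite ltn_neqAle level_le ?ltW// andbT; apply/eqP => e.
have p0 : 0 < 2 ^+ N :> R by exact: exprn_gt0.
have j0 : (0 < level N v)%N.
  by rewrite lt0n; apply/eqP => /level_eq0; rewrite leNgt v0.
have /andP[_ b] := (levelP N v j0).1 erefl.
have /andP[a _] := (levelP N c j0).1 e.
have : v - c < 2 ^- N.
  rewrite ltrBlDr; apply: (le_lt_trans b); rewrite addrC -ltrBlDr.
  by apply: le_lt_trans a; case: (level N v) j0 => // j _ /=; rewrite -[j.+1]addn1 natrD mulrDl mul1r addrK.
by rewrite ltNge -[v - c]invrK lef_pV2 ?posrE ?invr_gt0 ?subr_gt0// ltW.
Qed.

Lemma step_set_refine N M (E : nat -> set U) : (N <= M)%N -> (forall j, measurable (E j)) ->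
  exists2 E' : nat -> set U, (forall j, measurable (E' j)) &
    [set z : U * R | E (level N z.2) z.1] = [set z | E' (level M z.2) z.1].
Proof.
move=> + mE; elim: M => [|M ih]; first by rewrite leqn0 => /eqP ->; exists E.
rewrite leq_eqVlt => /predU1P[->|]; first by exists E.
rewrite ltnS => /ih[E' mE' ->]; exists (fun j => E' (uphalf j)) => //.
by apply/seteqP; split => z /=; rewrite (levelS M z.2).
Qed.

Lemma step_set_meas : step_set `<=` measurable.
Proof.
move=> _ [N [E [mE ->]]].
rewrite (_ : [set _ | _] = \bigcup_j (E j `*` [set v : R | level N v = j])).
  apply: bigcupT_measurable => j; apply: measurableX => //; exact: measurable_level.
by apply/seteqP; split => z /=; [move=> h; exists (level N z.2)|move=> [j _ [/= ? ->]]].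
Qed.

Lemma step_setC B : step_set B -> step_set (~` B).
Proof.
move=> [N [E [mE ->]]]; exists N, (fun j => ~` E j); split => // j.
exact: measurableC.
Qed.

Lemma step_setU B C : step_set B -> step_set C -> step_set (B `|` C).
Proof.
move=> [N [E [mE ->]]] [M [E' [mE' ->]]].
have [E1 m1 ->] := step_set_refine (leq_maxl N M) mE.
have [E2 m2 ->] := step_set_refine (leq_maxr N M) mE'.
by exists (maxn N M), (fun j => E1 j `|` E2 j); split => // j; exact: measurableU.
Qed.

Lemma step_setT : step_set setT.
Proof. by exists 0%N, (fun=> setT); split => //; apply/seteqP. Qed.

(* Dyadic steps only resolve the positive half line. *)
Lemma measurable_step_set (B : set (U * R)) : measurable B ->
  <<s step_set >> (B `&` [set z | 0 < z.2]).
Proof.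
pose S := g_sigma_algebraType step_set.
have pos : @measurable _ S [set z | 0 < z.2].
  apply: sub_gen_smallest; exists 0%N, (fun j => if j is 0%N then set0 else setT).
  split => [[|j]//|]; apply/seteqP; split => z /=.
    by case E : (level 0 z.2) => // z0; have := level_eq0 E; rewrite leNgt z0.
  by rewrite /level; case: leP.
apply: (@smallest_sub _ (sigma_algebra setT) _
  [set B : set (U * R) | @measurable _ S (B `&` [set z | 0 < z.2])]).
- split => /=.
  + by rewrite set0I; exact: (@measurable0 _ S).
  + move=> C mC; rewrite (_ : _ `&` _ = [set z | 0 < z.2] `\` (C `&` [set z | 0 < z.2])).
      exact: (@measurableD _ S).
    apply/seteqP; split => z [h1 h2].
      by split => // -[Cz _]; case: h1.
    by split => //; split => // Cz; apply: h2.
  + by move=> F mF; rewrite setI_bigcupl; exact: (@bigcupT_measurable _ S).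
(* By [level_lt], half-lines in the time variable are countable unions of step sets, and they
   generate the Borel sets. *)
- have half (c : R) : (0 <= c)%R -> @measurable _ S [set z | c < z.2].
    move=> c0; rewrite (_ : [set z | c < z.2] =
        \bigcup_N [set z | (level N c < level N z.2)%N]); last first.
      apply/seteqP; split => z /=; first by move=> /(level_lt _ c0)[N ?]; exists N.
      by move=> [N _ h]; apply/(level_lt _ c0); exists N.
    apply: (@bigcupT_measurable _ S) => N; apply: sub_gen_smallest.
    exists N, (fun j => if (level N c < j)%N then setT else set0); split.
      by move=> j; case: ifP.
    by apply/seteqP; split => z /=; [move=> ->|case: ifP].
  move=> C [[E mE <-]|[V mV <-]]; rewrite setTI /=.
    apply: (@measurableI _ S) => //; apply: sub_gen_smallest.
    by exists 0%N, (fun=> E).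
  have : @measurable _ (measurableTypeR R) V by exact: mV.
  rewrite RGenOInfty.measurableE; move: V {mV}; apply: smallest_sub.
    split => /=.
    + by rewrite preimage_set0 set0I; exact: (@measurable0 _ S).
    + move=> V mV; rewrite (_ : _ `&` _ =
          [set z | 0 < z.2] `\` ((snd @^-1` V) `&` [set z | 0 < z.2])).
        exact: (@measurableD _ S).
      apply/seteqP; split => z [h1 h2].
        by split => // -[Cz _]; case: h1.
      by split => //; split => // Cz; apply: h2.
    + move=> V mV; rewrite preimage_bigcup setI_bigcupl; exact: (@bigcupT_measurable _ S).
  move=> _ [c ->] /=.
  (* Within the positive half-line a negative [c] may be replaced by 0, as [level_lt] requires. *)
  rewrite (_ : _ `&` _ = [set z | Num.max c 0 < z.2]).
    by apply: half; rewrite le_max lexx orbT.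
  apply/seteqP; split => z /=; rewrite in_itv/= andbT gt_max => /andP//.
Qed.

End dyadic_algebra.

(** * Limit clocks along a path *)

Section measurable_infimum.
Context d (U : measurableType d) (R : realType) (I : countType).
Variables (A : U -> set I) (h : I -> U -> \bar R).
Hypothesis mA : forall i, measurable [set x | A x i].
Hypothesis mh : forall i, measurable_fun setT (h i).

Lemma measurable_ereal_inf : measurable_fun setT (fun x => ereal_inf [set h i x | i in A x]).
Proof.
apply: (measurability (@ErealGenInftyO.G R)); first exact: ErealGenInftyO.measurableE.
move=> _ [_ [c ->] <-]; rewrite setTI.
rewrite (_ : _ @^-1` _ = \bigcup_i ([set x | A x i] `&` [set x | (h i x < c%:E)%E])).
  apply: countable_bigcupT_measurable; first exact: countableP.
  move=> i; apply: measurableI => //.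
  by have := measurable_lte measurableT (mh i) (@measurable_cst _ _ _ _ _ c%:E); rewrite setTI.
apply/seteqP; split => x /=; rewrite in_itv/=.
  by move=> /ereal_inf_lt[_ [i Ai <-] hc]; exists i.
move=> [i _ [Ai hc]]; apply: le_lt_trans hc; apply: ereal_inf_lbound.
by exists i.
Qed.

End measurable_infimum.

(** * Right limits, passage times and the measure of a clock *)

Section envelope.
Context {R : realType}.
Implicit Types (f : rat -> \bar R) (t r : R).
Local Open Scope ereal_scope.
Local Notation leb := (@lebesgue_measure R).

(** Since the rationals [q] are strictly greater than [t], the infimum is right-continuous and
    nondecreasing in [t] whatever [f] is. *)
Definition envelope f t : \bar R :=
  ereal_inf [set f q | q in [set q : rat | (0 <= q)%R /\ (t < ratr q)%R]].

(** First passage time of [f] above the level [r], read off at rational times; it is [+oo] when the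
    level is never reached. *)
Definition passage f r : \bar R :=
  ereal_inf [set (ratr q)%:E | q in [set q : rat | (0 <= q)%R /\ r%:E <= f q]].

Lemma envelope_le f q t : (0 <= q)%R -> (t < ratr q)%R -> envelope f t <= f q.
Proof. by move=> q0 tq; apply: ereal_inf_lbound; exists q. Qed.

Lemma envelope_mono f : {homo envelope f : s t / (s <= t)%R >-> s <= t}.
Proof.
move=> s t st; apply: le_ereal_inf_tmp => _ [q [q0 tq] <-].
by apply: envelope_le => //; exact: le_lt_trans tq.
Qed.

Lemma envelope_ge0 f t : (forall q, 0 <= f q) -> 0 <= envelope f t.
Proof. by move=> f0; apply: le_ereal_inf_tmp => _ [q _ <-]. Qed.

Lemma envelope_right_cvg f t : envelope f u @[u --> t^'+] --> envelope f t.
Proof.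
have := @nondecreasing_at_right_cvge R (envelope f) t +oo%O isT
  (fun x y _ _ xy => envelope_mono f xy).
rewrite (_ : ereal_inf _ = envelope f t)//; apply/eqP; rewrite eq_le; apply/andP; split.
  apply: le_ereal_inf_tmp => _ [q [q0 tq] <-].
  have [u tu uq] : exists2 u, (t < u)%R & (u < ratr q)%R.
    by exists ((t + ratr q) / 2)%R; rewrite midf_lt.
  apply: le_trans (envelope_le f q0 uq); apply: ereal_inf_lbound; exists u => //.
  by rewrite /= in_itv/= tu.
apply: le_ereal_inf_tmp => _ [u + <-]; rewrite /= in_itv/= andbT => tu.
exact/envelope_mono/ltW.
Qed.

Lemma passage_ge0 f r : 0 <= passage f r.
Proof. by apply: le_ereal_inf_tmp => _ [q [q0 _] <-]; rewrite lee_fin ler0q. Qed.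

(** A Galois connection between passage times and envelope. It makes [envelope f] the distribution
    function of the image of Lebesgue measure under [passage f]. *)
Lemma passage_leP f r t : {in [pred q : rat | (0 <= q)%R] &, {homo f : p q / (p <= q)%R >-> p <= q}} ->
  (0 <= t)%R -> (passage f r <= t%:E) <-> (r%:E <= envelope f t).
Proof.
move=> f_mono t0; split => h.
  apply: le_ereal_inf_tmp => _ [q [q0 tq] <-].
  have /ereal_inf_lt[_ [p [p0 rp] <-]] : passage f r < (ratr q)%:E.
    by apply: le_lt_trans h _; rewrite lte_fin.
  rewrite lte_fin => pq; apply: (le_trans rp); apply: f_mono => //.
  by rewrite ltW// -(ltr_rat R).
rewrite leNgt; apply/negP => tp.
have [q tq qp] : exists2 q : rat, (t < ratr q)%R & (ratr q)%:E < passage f r.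
  case: (passage f r) tp => [u||]//.
    rewrite lte_fin => /rat_in_itvoo[q]; rewrite in_itv/= => /andP[tq qu].
    by exists q.
  move=> _; have /rat_in_itvoo[q] : (t < t + 1)%R by rewrite ltrDl.
  by rewrite in_itv/= => /andP[tq _]; exists q; rewrite ?ltry.
have q0 : (0 <= q)%R by rewrite -(ler0q R) ltW// (le_lt_trans t0).
move: qp; rewrite ltNge => /negP; apply; apply: ereal_inf_lbound; exists q => //.
by split => //; apply: (le_trans h); exact: envelope_le.
Qed.

(** Levels with infinite passage time are removed before taking the image measure, since [fine]
    would send them to time 0. *)
Definition reached f : set R := [set r | (0 < r)%R /\ passage f r < +oo].

Lemma measurable_passage1 f : measurable_fun setT (passage f).
Proof.
apply: measurable_ereal_inf => q; last exact: measurable_cst.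
have m := @emeasurable_le_set _ R R (@EFin R) (cst (f q)).
rewrite (_ : [set _ | _] = [set r : R | (0 <= q)%R] `&` [set r | r%:E <= f q]); last first.
  by apply/seteqP; split.
apply: measurableI; first exact: measurable_const_set.
by apply: m => //; exact/measurable_EFinP.
Qed.

Lemma measurable_reached f : measurable (reached f).
Proof.
rewrite (_ : reached f = `]0%R, +oo[%classic `&` [set r | passage f r < +oo]).
  apply: measurableI; first exact: measurable_itv.
  have := measurable_lte measurableT (measurable_passage1 f) (@measurable_cst _ _ _ _ _ +oo).
  by rewrite setTI.
by apply/seteqP; split => r; rewrite /reached/= in_itv/= andbT.
Qed.

Lemma measurable_fine_passage f : measurable_fun setT (fun r => fine (passage f r) : measurableTypeR R).
Proof. exact: measurableT_comp (measurable_passage1 f). Qed.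

(* The measure with distribution function [envelope f] is the image of Lebesgue
   measure under the inverse of [envelope f]. *)
Definition clock_measure f : {measure set (measurableTypeR R) -> \bar R} :=
  measure_function_pushforward__canonical__measure_function_Measure
    (mrestr leb (measurable_reached f)) (measurable_fine_passage f).

Lemma clock_measureE f (B : set R) :
  clock_measure f B = leb [set r | [/\ (0 < r)%R, passage f r < +oo & B (fine (passage f r))]].
Proof.
rewrite /clock_measure /= /pushforward /mrestr; congr (leb _).
by apply/seteqP; split => r; rewrite /reached/=; [move=> [? [? ?]]|move=> [? ? ?]].
Qed.

Lemma clock_measure_neg f : clock_measure f `]-oo, 0%R[%classic = 0.
Proof.
rewrite clock_measureE (_ : [set _ | _] = set0) ?measure0//; apply/seteqP; split => // r [_ _].
by rewrite /= in_itv/= ltNge fine_ge0// passage_ge0.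
Qed.

Lemma lebesgue_prefix (a : \bar R) : 0 <= a -> leb [set r | (0 < r)%R /\ r%:E <= a] = a.
Proof.
case: a => [a||]//; last first.
  move=> _; rewrite (_ : [set _ | _] = `]0%R, +oo[%classic).
    by rewrite lebesgue_measure_itv/= ltry oppr0 adde0.
  by apply/seteqP; split => r; rewrite /= in_itv/= andbT ?leey// => -[].
rewrite lee_fin => a0; rewrite (_ : [set _ | _] = `]0%R, a]%classic).
  rewrite lebesgue_measure_itv/= lte_fin; case: ltP; first by rewrite oppr0 adde0.
  by move=> a0'; congr EFin; apply/eqP; rewrite eq_le a0 a0'.
by apply/seteqP; split => r; rewrite /= in_itv/= lee_fin; [move=> [-> ->]|move=> /andP[]].
Qed.

Lemma clock_measure_itv f t :
  {in [pred q : rat | (0 <= q)%R] &, {homo f : p q / (p <= q)%R >-> p <= q}} ->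
  (forall q, 0 <= f q) -> (0 <= t)%R -> clock_measure f `[0%R, t]%classic = envelope f t.
Proof.
move=> f_mono f0 t0; rewrite clock_measureE -[RHS]lebesgue_prefix ?envelope_ge0//.
congr (leb _); apply/seteqP; split => r /=; rewrite in_itv/=.
  move=> [r0 fin /andP[_ ut]]; split => //; apply/passage_leP => //.
  by rewrite -[passage _ _]fineK ?lee_fin// ge0_fin_numE ?passage_ge0.
move=> [r0 /(passage_leP _ f_mono t0) h]; have fin := le_lt_trans h (ltry _).
split => //; rewrite fine_ge0 ?passage_ge0//=.
by rewrite -lee_fin fineK// ge0_fin_numE ?passage_ge0.
Qed.

End envelope.

Section measurable_envelope.
Context d (U : measurableType d) (R : realType) (f : rat -> U -> \bar R).
Hypothesis mf : forall q, (0 <= q)%R -> measurable_fun setT (f q).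
Local Open Scope ereal_scope.

Lemma measurable_envelope t : measurable_fun setT (fun x => envelope (f^~ x) t).
Proof.
pose h q := if (0 <= q)%R then f q else cst 0.
rewrite (_ : (fun _ => _) = fun x => ereal_inf [set h q x | q in [set q : rat | (0 <= q)%R /\ (t < ratr q)%R]]).
  apply: measurable_ereal_inf => q; first exact: measurable_const_set.
  by rewrite /h; case: ifP => [/mf//|_]; exact: measurable_cst.
by apply/funext => x; congr ereal_inf; apply/seteqP; split => _ [q [q0 tq] <-];
  exists q => //; rewrite /h q0.
Qed.

Lemma measurable_passage : measurable_fun setT (fun z : U * R => passage (f^~ z.1) z.2).
Proof.
apply: measurable_ereal_inf => q; last exact: measurable_cst.
have [q0|q0] := boolP (0 <= q)%R; last first.
  rewrite (_ : [set _ | _] = set0)//; apply/seteqP; split => // z [h]; by rewrite h in q0.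
rewrite (_ : [set _ | _] = [set z : U * R | z.2%:E <= f q z.1]); last by apply/seteqP; split => z // -[].
apply: emeasurable_le_set; first by apply/measurable_EFinP.
exact: measurableT_comp (mf q0) _.
Qed.

End measurable_envelope.

Section path_limit.
Context {R : realType}.
Variables (alpha : nat -> R) (g : seq nat -> nat -> R) (T sigma : nat -> nat -> nat -> R).
Local Open Scope ereal_scope.
Local Notation leb := (@lebesgue_measure R).

Definition total_clock k n (q : R) : \bar R :=
  wclock T sigma n (occ g T sigma n.-1) (fun y => Wsup alpha g y * edge g y)
    (upto (rho g T sigma k (n - k) q%:E)).

Definition limit_clock k (q : rat) : \bar R :=
  limn_esup (fun n => total_clock k (k + n) (ratr q)).

Definition local_time (s : seq nat) (u : R) : \bar R :=
  leb (occ g T sigma (size s) s `&` `[0%R, u]%classic).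

Definition vertex_set (s : seq nat) (t : R) : set R :=
  [set u | [/\ (0 <= u)%R, local_time s u <= t%:E & occ g T sigma (size s) s u]].

Definition vertex_clock (s : seq nat) (t : R) : \bar R :=
  clock_measure (limit_clock (size s).+1) (vertex_set s t).

End path_limit.

Section measurable_vertex_set.
Context d (U : measurableType d) (R : realType) (N : nat).
Variables (g : U -> seq nat -> nat -> R) (T sigma : U -> nat -> nat -> nat -> R).
Hypothesis g0 : forall w s x, 0 <= g w s x.
Hypothesis T0 : forall w k x i, 0 <= T w k x i.
Hypothesis mg : forall s x, measurable_fun setT (fun w => g w s x).
Hypothesis mT : forall k x i, (0 < k <= N)%N -> measurable_fun setT (fun w => T w k x i).
Hypothesis msigma : forall k x i, (0 < k <= N)%N -> measurable_fun setT (fun w => sigma w k x i).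
Local Open Scope ereal_scope.
Local Notation leb := (@lebesgue_measure R).

Lemma measurable_occupation s : (size s <= N)%N -> measurable [set z : U * R | occ (g z.1) (T z.1) (sigma z.1) (size s) s z.2].
Proof. by move=> sN; exact: (@measurable_occ _ U R N g T sigma g0 T0 mg mT msigma). Qed.

Lemma measurable_local_time s : (size s <= N)%N ->
  measurable_fun setT (fun z : U * R => local_time (g z.1) (T z.1) (sigma z.1) s z.2).
Proof.
move=> sN; have mo := measurable_occupation sN.
have mS : measurable [set z : (U * R) * R |
    [/\ occ (g z.1.1) (T z.1.1) (sigma z.1.1) (size s) s z.2, (0 <= z.2)%R & (z.2 <= z.1.2)%R]].
  rewrite (_ : [set _ | _] = ((fun z : (U * R) * R => (z.1.1, z.2)) @^-1`
      [set z : U * R | occ (g z.1) (T z.1) (sigma z.1) (size s) s z.2]) `&`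
      ([set z : (U * R) * R | (0 <= z.2)%R] `&` [set z : (U * R) * R | (z.2 <= z.1.2)%R])).
    apply: measurableI.
      rewrite -[X in measurable X]setTI; apply: measurable_fun_pair => //.
      exact: measurableT_comp.
    by apply: measurableI; apply: measurable_bool_set; apply: measurable_fun_ler => //; exact: measurableT_comp.
  by apply/seteqP; split => z /=; [move=> [? ? ?]|move=> [? [? ?]]].
have := measurable_fun_xsection leb mS; apply: eq_measurable_fun => z _ /=.
rewrite /local_time; congr (leb _); apply/seteqP; split => u; rewrite /xsection/= in_itv/=.
  by move=> /set_mem[/= ? -> ->].
by move=> [? /andP[? ?]]; apply/mem_set.
Qed.

Lemma measurable_vertex_set s t : (size s <= N)%N ->
  measurable [set z : U * R | vertex_set (g z.1) (T z.1) (sigma z.1) s t z.2].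
Proof.
move=> sN; rewrite (_ : [set _ | _] = [set z : U * R | (0 <= z.2)%R] `&`
   ([set z : U * R | local_time (g z.1) (T z.1) (sigma z.1) s z.2 <= t%:E] `&`
    [set z : U * R | occ (g z.1) (T z.1) (sigma z.1) (size s) s z.2])).
  apply: measurableI; first by apply: measurable_bool_set; exact: measurable_fun_ler.
  apply: measurableI; last exact: measurable_occupation.
  by apply: emeasurable_le_set => //; exact: measurable_local_time.
by apply/seteqP; split => z /=; [move=> [? ? ?]|move=> [? [? ?]]].
Qed.

End measurable_vertex_set.

Section measurability.
Context d (U : measurableType d) (R : realType).
Variables (alpha : nat -> R) (g : U -> seq nat -> nat -> R) (T sigma : U -> nat -> nat -> nat -> R).
Hypothesis g0 : forall w s x, 0 <= g w s x.
Hypothesis T0 : forall w k x i, 0 <= T w k x i.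
Hypothesis mg : forall s x, measurable_fun setT (fun w => g w s x).
Hypothesis mT : forall k x i, (0 < k)%N -> measurable_fun setT (fun w => T w k x i).
Hypothesis msigma : forall k x i, (0 < k)%N -> measurable_fun setT (fun w => sigma w k x i).
Local Open Scope ereal_scope.
Local Notation leb := (@lebesgue_measure R).

Let mT' N k x i : (0 < k <= N)%N -> measurable_fun setT (fun w => T w k x i).
Proof. by move=> /andP[k0 _]; exact: mT. Qed.

Let ms' N k x i : (0 < k <= N)%N -> measurable_fun setT (fun w => sigma w k x i).
Proof. by move=> /andP[k0 _]; exact: msigma. Qed.

Lemma measurable_total_clock k n (q : R) : (0 < k <= n)%N ->
  measurable_fun setT (fun w => total_clock alpha (g w) (T w) (sigma w) k n q).
Proof.
move=> /andP[k0 kn].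
apply: (@measurable_wclock_upto_rho _ U R n g T sigma g0 T0 mg (@mT' n) (@ms' n)
  (fun w => Wsup alpha (g w)) (fun w y => Wsup_ge0 _ _ _) _ (fun=> q%:E)) => //.
- by move=> y; exact: measurable_Wsup.
- by rewrite kn leqnn.
Qed.

Lemma measurable_limit_clock k q : (0 < k)%N ->
  measurable_fun setT (fun w => limit_clock alpha (g w) (T w) (sigma w) k q).
Proof.
move=> k0; apply: measurable_fun_limn_esup => n.
by apply: measurable_total_clock; rewrite k0 leq_addr.
Qed.

Let passagew k (z : U * R) := passage (limit_clock alpha (g z.1) (T z.1) (sigma z.1) k) z.2.

Lemma measurable_limit_passage k : (0 < k)%N -> measurable_fun setT (passagew k).
Proof.
move=> k0.
exact: (@measurable_passage _ U R (fun q w => limit_clock alpha (g w) (T w) (sigma w) k q)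
  (fun q _ => measurable_limit_clock q k0)).
Qed.

Lemma measurable_passage_preimage k d' (V : measurableType d') (phi : U -> V) (B : set (V * R)) :
  (0 < k)%N -> measurable_fun setT phi -> measurable B ->
  measurable [set z : U * R | [/\ (0 < z.2)%R, passagew k z < +oo & B (phi z.1, fine (passagew k z))]].
Proof.
move=> k0 mphi mB; have mp := measurable_limit_passage k0.
rewrite (_ : [set _ | _] = [set z : U * R | (0 < z.2)%R] `&`
   ([set z | passagew k z < +oo] `&` (fun z : U * R => (phi z.1, fine (passagew k z))) @^-1` B)).
  apply: measurableI; first by apply: measurable_bool_set; exact: measurable_fun_ltr.
  apply: measurableI.
    by have := measurable_lte measurableT mp (@measurable_cst _ _ _ _ _ +oo); rewrite setTI.
  rewrite -[X in measurable X]setTI; apply: measurable_fun_pair => //; exact: measurableT_comp.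
by apply/seteqP; split => z /=; [move=> [? ? ?]|move=> [? [? ?]]].
Qed.

Lemma measurable_vertex_clock s t :
  measurable_fun setT (fun w => vertex_clock alpha (g w) (T w) (sigma w) s t).
Proof.
have mS := measurable_passage_preimage (ltn0Sn (size s)) (@measurable_id _ U setT)
  (@measurable_vertex_set _ U R (size s) g T sigma g0 T0 mg (@mT' _) (@ms' _) s t (leqnn _)).
have := measurable_fun_xsection leb mS; apply: eq_measurable_fun => w _ /=.
rewrite /vertex_clock clock_measureE; congr (leb _); apply/seteqP; split => r; rewrite /xsection/=.
  by move=> /set_mem.
by move=> h; apply/mem_set.
Qed.

End measurability.

Section vertex_clock_limits.
Context {R : realType}.
Variables (alpha : nat -> R) (g : seq nat -> nat -> R) (T sigma : nat -> nat -> nat -> R).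
Hypothesis g0 : forall s x, 0 <= g s x.
Hypothesis T0 : forall k x i, 0 <= T k x i.
Local Open Scope ereal_scope.

Lemma measurable_vertex_set1 s t : measurable (vertex_set g T sigma s t).
Proof.
have h := @measurable_vertex_set _ unit R (size s) (fun=> g) (fun=> T) (fun=> sigma)
  (fun=> g0) (fun=> T0) (fun _ _ => @measurable_cst _ _ _ _ _ _)
  (fun _ _ _ _ => @measurable_cst _ _ _ _ _ _) (fun _ _ _ _ => @measurable_cst _ _ _ _ _ _)
  s t (leqnn _).
have mtt : measurable_fun setT (fun u : R => (tt, u)) by apply: measurable_fun_pair.
by have := mtt measurableT _ h; rewrite setTI.
Qed.

Lemma vertex_clock_mono s :
  {homo vertex_clock alpha g T sigma s : t t' / (t <= t')%R >-> t <= t'}.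
Proof.
move=> t t' tt'; apply: le_measure; rewrite ?inE; [exact: measurable_vertex_set1..|].
by move=> u [u0 Lu ou]; split => //; apply: (le_trans Lu); rewrite lee_fin.
Qed.

(** The condition on the local time at [t] is the conjunction of those at [t + 1/(j + 1)];
    finiteness at [t + 1] gives continuity from above. *)
Lemma vertex_clock_right_cvg s t : vertex_clock alpha g T sigma s (t + 1) < +oo ->
  vertex_clock alpha g T sigma s (t + j.+1%:R^-1) @[j --> \oo] --> vertex_clock alpha g T sigma s t.
Proof.
move=> fin; pose G j : set (measurableTypeR R) := vertex_set g T sigma s (t + j.+1%:R^-1).
have -> : vertex_clock alpha g T sigma s t =
    clock_measure (limit_clock alpha g T sigma (size s).+1) (\bigcap_j G j).
  congr (clock_measure _ _); apply/seteqP; split => u.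
    move=> [u0 Lu ou] j _; split => //; apply: (le_trans Lu).
    by rewrite lee_fin lerDl invr_ge0.
  move=> h; have [u0 _ ou] := h 0%N I; split => //.
  apply/lee_addgt0Pr => e e0; have [_ Lu _] := h (Num.truncn e^-1) I.
  apply: (le_trans Lu); rewrite -EFinD lee_fin lerD2l invf_ple ?posrE//.
  by rewrite ltW// truncnS_gt.
apply: nonincreasing_cvg_mu.
- by rewrite /G invr1.
- by move=> j; exact: measurable_vertex_set1.
- by apply: bigcapT_measurable => j; exact: measurable_vertex_set1.
- move=> i j ij; apply/subsetPset => u [u0 Lu ou]; split => //; apply: (le_trans Lu).
  by rewrite lee_fin lerD2l lef_pV2 ?posrE// ler_nat ltnS.
Qed.

End vertex_clock_limits.

(** * Almost sure limits *)

Lemma ge0_cvgeD (R : realType) (u v : (\bar R)^nat) a b : (0 <= a)%E -> (0 <= b)%E ->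
  u n @[n --> \oo] --> a -> v n @[n --> \oo] --> b -> (u n + v n)%E @[n --> \oo] --> (a + b)%E.
Proof. by move=> a0 b0; apply: cvgeD; rewrite ge0_adde_def// inE. Qed.

Lemma limn_einf_ge0 (R : realType) (u : (\bar R)^nat) : (forall n, 0 <= u n)%E -> (0 <= limn_einf u)%E.
Proof.
move=> u0; rewrite limn_einf_lim; apply: lime_ge; first exact: is_cvg_einfs.
by apply: nearW => n; apply: le_ereal_inf_tmp => _ [m _ <-].
Qed.

Lemma limn_einf_le (R : realType) (u : (\bar R)^nat) c : (forall n, u n <= c)%E -> (limn_einf u <= c)%E.
Proof.
move=> uc; rewrite limn_einf_lim; apply: lime_le; first exact: is_cvg_einfs.
apply: nearW => n; apply: le_trans (uc n); apply: ereal_inf_lbound.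
by exists n => //=.
Qed.

Lemma limn_esup_ge0 (R : realType) (u : (\bar R)^nat) : (forall n, 0 <= u n)%E -> (0 <= limn_esup u)%E.
Proof. by move=> u0; apply: le_trans (limn_einf_sup _); exact: limn_einf_ge0. Qed.

Lemma measurable_limn_einf d (U : measurableType d) (R : realType) (u : (U -> \bar R)^nat) :
  (forall n, measurable_fun setT (u n)) -> measurable_fun setT (fun x => limn_einf (u^~ x)).
Proof.
move=> mu; rewrite (_ : (fun _ => _) = fun x => (- limn_esup (fun n => - u n x))%E).
  apply: measurableT_comp => //; apply: measurable_fun_limn_esup => n.
  exact: measurableT_comp.
apply/funext => x; rewrite -limn_einfN; congr limn_einf.
by apply/funext => n /=; rewrite oppeK.
Qed.

Section clock_limits.
Context d (Omega : measurableType d) (R : realType) (P : probability Omega R).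
Variables (alpha : nat -> R) (gam : seq nat -> nat -> {RV P >-> R}).
Variables (T sigma : nat -> nat -> nat -> {RV P >-> R}).
Hypothesis hm : cascade_model alpha gam T sigma.
Local Open Scope ereal_scope.
Local Notation leb := (@lebesgue_measure R).
Local Notation F := (source_sigma_algebra gam T sigma).
Local Notation sub A := (g_sigma_algebraType (\bigcup_(i in A) F i)).
Local Notation g := (gabs gam).
Local Notation Th := (Tabs T).
Local Notation sg := (sig sigma).
Local Notation Lv := (level_sources).
Local Notation goodw := (good alpha gam T sigma).
Local Notation massw := (massw alpha gam T sigma).
Local Notation increment := (increment alpha gam T sigma).
Let sm := sub_measurable_fun (@source_meas _ _ _ _ gam T sigma).

Definition total_clockw w := total_clock alpha (g w) (Th w) (sg w).
Definition limit_clockw k w := limit_clock alpha (g w) (Th w) (sg w) k.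

Section level.
Variable k : nat.
Hypothesis k0 : (0 < k)%N.
Local Notation fw := (limit_clockw k).

Definition limit_increment (p q : rat) w : \bar R :=
  limn_esup (fun n => increment k (ratr p)%:E (ratr q)%:E (n + k) w).

Record clock_limits (w : Omega) : Prop := ClockLimits {
  limits_good : goodw w;
  limits_mass : forall m : nat, massw w k.-1 (within 0 m%:R%:E) < +oo;
  limits_increment : forall p q : rat, (0 <= p)%R -> (p <= q)%R ->
    increment k (ratr p)%:E (ratr q)%:E n w @[n --> \oo] --> limit_increment p q w /\
    limit_increment p q w < +oo }.

Lemma massw_le w n (a a' b b' : \bar R) : goodw w -> a' <= a -> b <= b' ->
  massw w n (within a b) <= massw w n (within a' b').
Proof.
move=> G aa bb; apply: le_esum => s /= sn; apply: lee_wpmul2l; first exact: weight_ge0.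
have mo := measurable_occ1 (sg w) (good_gabs G) (fun k x i => Tabs_ge0 T w k x i) n s.
apply: le_measure; rewrite ?inE; do ?[apply: measurableI]; do ?[exact: mo|exact: measurable_within1|exact: measurable_itv].
move=> u [[ou /andP[au ub]] u0]; split => //; split => //; apply/andP; split.
  exact: le_lt_trans au.
exact: le_trans bb.
Qed.

Lemma ae_clock_limits : {ae P, forall w, clock_limits w}.
Proof.
have c := ae_forall_count (fun pq : rat * rat =>
  increment_cvg hm (ratr pq.1)%:E (ratr pq.2)%:E k0).
have f := massw_finite hm k.-1.
near=> w.
have G : goodw w by near: w; exact: (ae_good hm).
have [fin _] : (forall m : nat, massw w k.-1 (within 0 m%:R%:E) < +oo) /\
  (massw w k.-1 (within 0 +oo) < +oo \/
   leb (occw gam T sigma w k.-1 (nseq k.-1 0%N) `&` `]0%R, +oo[) = +oo) by near: w.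
split => // p q p0 pq.
have cw : forall pq : rat * rat, massw w k.-1 (within (ratr pq.1)%:E (ratr pq.2)%:E) < +oo ->
    increment k (ratr pq.1)%:E (ratr pq.2)%:E n w @[n --> \oo] -->
      limn_esup ((increment k (ratr pq.1)%:E (ratr pq.2)%:E)^~ w) /\
    limn_esup ((increment k (ratr pq.1)%:E (ratr pq.2)%:E)^~ w) < +oo by near: w.
have [|c' lc] := cw (p, q).
  apply: le_lt_trans (fin (Num.truncn (ratr q : R)).+1).
  by apply: massw_le; rewrite ?lee_fin ?ler0q// ltW// truncnS_gt.
have c2 : increment k (ratr p)%:E (ratr q)%:E (n + k) w @[n --> \oo] -->
    limn_esup ((increment k (ratr p)%:E (ratr q)%:E)^~ w).
  by move: c'; rewrite -(cvg_shiftn k).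
have -> : limit_increment p q w = limn_esup ((increment k (ratr p)%:E (ratr q)%:E)^~ w).
  exact: (cvg_limn_einf_sup c2).2.
exact: conj c' lc.
Unshelve. all: by end_near. Qed.

Lemma total_clock_ge0 w n q : 0 <= total_clockw w k n q.
Proof.
apply: esum_ge0 => s _; rewrite mule_ge0//.
  by rewrite mule_ge0 ?Wsup_ge0// lee_fin gabs_ge0.
by apply: esum_ge0 => i _; rewrite lee_fin Tabs_ge0.
Qed.

Lemma limit_clock_ge0 w q : 0 <= fw w q.
Proof. by apply: limn_esup_ge0 => n; exact: total_clock_ge0. Qed.

Lemma total_clock_increment w n q : goodw w -> (k <= n)%N ->
  total_clockw w k n q = increment k 0 q%:E n w.
Proof.
move=> G kn; have n0 := leq_trans k0 kn.
rewrite /total_clockw /total_clock /increment /rhow.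
have e0 := rho0 (g w) (Th w) (good_sig G) (n - k) k0.
rewrite e0; exact: (wclock_uptoE (g w) (Th w) (good_sig G) (weight alpha gam w) _ n0).
Qed.

Lemma increment_add w n (a b c : \bar R) : goodw w -> (k <= n)%N -> a <= b -> b <= c ->
  increment k a c n w = increment k a b n w + increment k b c n w.
Proof.
move=> G kn ab bc; have n0 := leq_trans k0 kn.
have Tw0 k' x i : (0 <= Th w k' x i)%R by exact: Tabs_ge0.
have mono a' b' := @rho_mono _ (g w) (Th w) (sg w) (good_gabs G) Tw0 k (n - k) a' b' k0.
exact: (wclock_within_add (sg w) (good_gabs G) Tw0 (weight_ge0 alpha gam w) n0 (mono _ _ ab) (mono _ _ bc)).
Qed.

Section one_path.
Variable w : Omega.
Hypothesis cw : clock_limits w.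

Lemma total_clock_cvg q : (0 <= q)%R ->
  total_clockw w k n (ratr q) @[n --> \oo] --> fw w q /\ fw w q = limit_increment 0 q w.
Proof.
move=> q0; have [c _] := limits_increment cw (lexx 0%R) q0.
have c' : total_clockw w k n (ratr q) @[n --> \oo] --> limit_increment 0 q w.
  apply: cvg_trans c; apply: near_eq_cvg; exists k => // n /= kn.
  by rewrite total_clock_increment// ?rmorph0//; exact: limits_good.
have e : fw w q = limit_increment 0 q w.
  have c2 : total_clockw w k (k + n) (ratr q) @[n --> \oo] --> limit_increment 0 q w.
    by move: c'; rewrite -(cvg_shiftn k); under eq_fun do rewrite addnC.
  exact: (cvg_limn_einf_sup c2).2.
rewrite e; exact: conj c' (erefl _).
Qed.

Lemma limit_clock_fin q : (0 <= q)%R -> fw w q < +oo.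
Proof.
by move=> q0; have [_ ->] := total_clock_cvg q0; have [] := limits_increment cw (lexx 0%R) q0.
Qed.

Lemma limit_clock_add p q : (0 <= p)%R -> (p <= q)%R ->
  fw w q = fw w p + limit_increment p q w.
Proof.
move=> p0 pq; have q0 := le_trans p0 pq.
have [_ eq] := total_clock_cvg q0; have [_ ep] := total_clock_cvg p0.
rewrite eq ep.
have [cq _] := limits_increment cw (lexx 0%R) q0.
have [cp fp] := limits_increment cw (lexx 0%R) p0.
have [cpq fpq] := limits_increment cw p0 pq.
have i0 a b : 0 <= limit_increment a b w by apply: limn_esup_ge0 => n; exact: Xi_t_ge0.
have c := ge0_cvgeD (i0 _ _) (i0 _ _) cp cpq.
have c' : increment k (ratr 0)%:E (ratr q)%:E n w @[n --> \oo] -->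
    limit_increment 0 p w + limit_increment p q w.
  apply: cvg_trans c; apply: near_eq_cvg; exists k; [exact: I|move=> n kn].
  apply/esym/increment_add; [exact: limits_good|exact: kn|by rewrite lee_fin ler_rat..].
by rewrite -(cvg_lim _ cq) ?(cvg_lim _ c').
Qed.

Lemma limit_clock_mono : {in [pred q : rat | (0 <= q)%R] &,
  {homo fw w : p q / (p <= q)%R >-> p <= q}}.
Proof.
move=> p q; rewrite !inE => p0 _ pq; rewrite (limit_clock_add p0 pq) leeDl//.
by apply: limn_esup_ge0 => n; exact: Xi_t_ge0.
Qed.

(** Additivity at [p = q = 0] reads [f(0) = f(0) + f(0)], and [f(0)] is finite. *)
Lemma limit_clock0 : fw w 0 = 0.
Proof.
have := limit_clock_add (lexx 0%R) (lexx 0%R).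
have [_ <-] := total_clock_cvg (lexx 0%R).
have := limit_clock_fin (lexx 0%R); have := limit_clock_ge0 w 0.
case: (fw w 0) => // r _ _ [] /eqP; rewrite -subr_eq subrr => /eqP <-//.
Qed.

End one_path.

Lemma measurable_limit_increment p q : measurable_fun setT (limit_increment p q).
Proof.
apply: measurable_fun_limn_esup => n; apply: (sm (A := Lv (n + k))).
by apply: measurable_Xi_t => //; rewrite leq_addl leqnn.
Qed.

(** Fatou's lemma for the increments multiplied by the indicator of the past event [E], each of
    which obeys the bound of [increment_le]. *)
Lemma integral_limit_increment (E : set (sub (Lv k.-1))) p q :
  measurable E -> (0 <= p)%R -> (p <= q)%R ->
  \int[P]_(w in E) limit_increment p q w <=
  \int[P]_(w in E) massw w k.-1 (within (ratr p)%:E (ratr q)%:E).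
Proof.
move=> mE p0 pq; pose Z (w : Omega) : \bar R := (\1_E w)%:E.
have mE' : measurable (E : set Omega) := sub_measurable (@source_meas _ _ _ _ gam T sigma) mE.
have mZ : measurable_fun setT (Z : sub (Lv k.-1) -> \bar R).
  by apply/measurable_EFinP; exact: measurable_indic.
have Z0 w : 0 <= Z w by rewrite lee_fin.
have ZE (f : Omega -> \bar R) : \int[P]_(w in E) f w = \int[P]_w (Z w * f w).
  rewrite integral_mkcond; apply: eq_integral => w _; rewrite patchE /Z indicE.
  by case: ifP; rewrite ?mul1e ?mul0e.
pose u n w := Z w * increment k (ratr p)%:E (ratr q)%:E (n + k) w.
have mu n : measurable_fun setT (u n).
  apply: emeasurable_funM; first exact: (sm mZ).
  by apply: (sm (A := Lv (n + k))); apply: measurable_Xi_t => //; rewrite leq_addl leqnn.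
have u0 n w : 0 <= u n w by rewrite mule_ge0 ?Xi_t_ge0.
rewrite !ZE; apply: (@le_trans _ _ (\int[P]_w limn_einf (u^~ w))).
  apply: ae_ge0_le_integral => //.
  - by move=> w _; rewrite mule_ge0//; apply: limn_esup_ge0 => n; exact: Xi_t_ge0.
  - by apply: emeasurable_funM; [exact: (sm mZ)|exact: measurable_limit_increment].
  - by move=> w _; apply: limn_einf_ge0 => n; exact: u0.
  - exact: measurable_limn_einf.
  apply: filterS ae_clock_limits => w cw _.
  have [c _] := limits_increment cw p0 pq.
  have c' : increment k (ratr p)%:E (ratr q)%:E (n + k) w @[n --> \oo] --> limit_increment p q w.
    by move: c; rewrite -(cvg_shiftn k).
  rewrite /u /Z indicE; case: (w \in E); last by rewrite mul0e; apply: limn_einf_ge0 => n; rewrite mul0e.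
  rewrite mul1e (_ : (fun n => _) = fun n => increment k (ratr p)%:E (ratr q)%:E (n + k) w).
    by have [-> _] := cvg_limn_einf_sup c'.
  by apply/funext => n; rewrite mul1e.
apply: le_trans (fatou P measurableT mu (fun n w _ => u0 n w)) _.
apply: limn_einf_le => n; exact: (increment_le hm _ _ k0 (leq_addl _ _) mZ Z0).
Qed.

End level.

End clock_limits.

(** * Comparison with the occupation measure *)

Lemma adde_cancel (R : realType) (x y z : \bar R) : x \is a fin_num -> (x + y = x + z)%E -> y = z.
Proof. by move=> xf /(congr1 (fun u => u - x)%E); rewrite (addeC x y) (addeC x z) !addeK. Qed.

Section comparison.
Context d (Omega : measurableType d) (R : realType) (P : probability Omega R).
Variables (alpha : nat -> R) (gam : seq nat -> nat -> {RV P >-> R}).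
Variables (T sigma : nat -> nat -> nat -> {RV P >-> R}).
Hypothesis hm : cascade_model alpha gam T sigma.
Local Open Scope ereal_scope.
Local Notation leb := (@lebesgue_measure R).
Local Notation F := (source_sigma_algebra gam T sigma).
Local Notation sub A := (g_sigma_algebraType (\bigcup_(i in A) F i)).
Local Notation g := (gabs gam).
Local Notation Th := (Tabs T).
Local Notation sg := (sig sigma).
Local Notation Wt := (weight alpha gam).
Local Notation Lv := (level_sources).
Local Notation occw := (occw gam T sigma).
Local Notation massw := (massw alpha gam T sigma).
Let sm := sub_measurable_fun (@source_meas _ _ _ _ gam T sigma).
Variable k : nat.
Hypothesis k0 : (0 < k)%N.
Local Notation fw := (limit_clockw alpha gam T sigma k).
Local Notation inc := (limit_increment alpha gam T sigma k).
Local Notation limits := (clock_limits alpha gam T sigma k).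
Local Notation past := (sub (Lv k.-1)).
Local Notation Q := (P \x leb).

Let m_occ s : measurable [set z : Omega * R | occw z.1 (size s) s z.2].
Proof.
apply: (@measurable_occ _ Omega R (size s) g Th sg) => //.
- by move=> w s' x; exact: gabs_ge0.
- by move=> w k' x i; exact: Tabs_ge0.
- by move=> s' x; exact: (sm (@measurable_gabs _ _ _ _ gam T sigma 0 s' x)).
- by move=> k' x i h; exact: (sm (@measurable_Tabs _ _ _ _ gam T sigma _ k' x i h)).
Qed.

(** The density of Lambda: on a good path it is the weight of the vertex of level [k - 1] occupied
    at time [z.2], and 0 when none is. It turns the random measure into a single measure on the
    product space. *)
Definition mass_density (z : Omega * R) : \bar R :=
  \esum_(s in [set s | size s = k.-1]) (Wt z.1 s * (\1_(occw z.1 k.-1 s) z.2)%:E).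

Lemma mass_density_ge0 z : 0 <= mass_density z.
Proof. by apply: esum_ge0 => s _; rewrite mule_ge0 ?weight_ge0. Qed.

Lemma measurable_weight_fst s : measurable_fun setT (fun z : Omega * R => Wt z.1 s).
Proof.
exact: (measurableT_comp (sm (@measurable_weight _ _ _ _ alpha gam T sigma 0 s)) measurable_fst).
Qed.

Let m_term s : size s = k.-1 ->
  measurable_fun setT (fun z : Omega * R => Wt z.1 s * (\1_(occw z.1 k.-1 s) z.2)%:E).
Proof.
move=> sk; apply: emeasurable_funM; first exact: measurable_weight_fst.
apply/measurable_EFinP; rewrite (_ : (fun _ => _) = \1_[set z : Omega * R | occw z.1 (size s) s z.2]).
  by apply: measurable_indic; exact: m_occ.
by apply/funext => z; apply: indic_iff; rewrite /= sk.
Qed.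

Lemma measurable_mass_density : measurable_fun setT mass_density.
Proof.
pose h s (z : Omega * R) := if size s == k.-1 then Wt z.1 s * (\1_(occw z.1 k.-1 s) z.2)%:E else 0.
rewrite (_ : mass_density = fun z => \esum_(s in [set s | size s = k.-1]) h s z).
  apply: measurable_esum => [s|s|s z]; first exact: measurable_const_set.
    by rewrite /h; case: eqP => [/m_term//|_]; exact: measurable_cst.
  by rewrite /h; case: ifP => // _; rewrite mule_ge0 ?weight_ge0.
by apply/funext => z; apply: eq_esum => s /= sk; rewrite /h sk eqxx.
Qed.

Lemma masswE w (B : set R) : measurable B ->
  massw w k.-1 B = \int[leb]_(v in B `&` `]0%R, +oo[) mass_density (w, v).
Proof.
move=> mB; have mB' : measurable (B `&` `]0%R, +oo[%classic : set R).
  by apply: measurableI => //; exact: measurable_itv.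
rewrite integral_esum//; last 2 first.
- move=> s /= sk; apply: measurable_funTS.
  exact: (measurableT_comp (m_term sk) (@measurable_pair1 _ _ Omega R w)).
- by move=> s v _ _; rewrite mule_ge0 ?weight_ge0.
apply: eq_esum => s /= sk.
have mo : measurable (occw w k.-1 s : set R).
  have := @measurable_pair1 _ _ Omega R w measurableT _ (m_occ s); rewrite setTI.
  by rewrite sk.
rewrite ge0_integralZl//; [|by apply/measurable_EFinP; exact: measurable_indic|exact: weight_ge0].
by rewrite integral_indic// setIA.
Qed.

Lemma prod_lebesgueE (B : set (Omega * R)) : Q B = \int[P]_w leb [set v | B (w, v)].
Proof.
apply: eq_integral => w _ /=; congr (leb _); apply/seteqP; split => v; rewrite /xsection/=.
  by move=> /set_mem.
by move=> h; apply/mem_set.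
Qed.

(** The identity map; its image measure is the restriction to the sigma-algebra in which only the
    past of level [k - 1] is seen. *)
Let to_past (z : Omega * R) : past * R := (z.1, z.2).

Let m_to_past : measurable_fun setT to_past.
Proof.
apply: measurable_fun_pair => //.
have mid := sub_id_measurable (@source_meas _ _ _ _ gam T sigma) (A := Lv k.-1).
exact: (measurableT_comp mid (@measurable_fst _ _ Omega R)).
Qed.

Definition mass_measure : {measure set (past * R) -> \bar R} :=
  measure_function_pushforward__canonical__measure_function_Measure
    (density_measure Q measurable_mass_density mass_density_ge0) m_to_past.

Lemma mass_measureE (B : set (past * R)) : mass_measure B = \int[Q]_(z in B) mass_density z.
Proof.
have e : to_past @^-1` B = (B : set (Omega * R)) by apply/seteqP; split => -[].
by rewrite -e.
Qed.

Lemma mass_measure_rect (A : set past) (a b : \bar R) : measurable A ->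
  mass_measure (A `*` (within a b `&` `]0%R, +oo[)) = \int[P]_(w in A) massw w k.-1 (within a b).
Proof.
move=> mA; have mA' : measurable (A : set Omega) := sub_measurable (@source_meas _ _ _ _ gam T sigma) mA.
have mI : measurable (within a b `&` `]0%R, +oo[%classic : set R).
  by apply: measurableI; [exact: measurable_within1|exact: measurable_itv].
rewrite mass_measureE integral_mkcond fubini_tonelli1//; first last.
- by move=> z; rewrite patchE; case: ifP => // _; exact: mass_density_ge0.
- apply/(measurable_restrictT _ (measurableX mA' mI)).
  by apply: measurable_funTS; exact: measurable_mass_density.
rewrite [RHS]integral_mkcond; apply: eq_integral => w _; rewrite /fubini_F [RHS]patchE.
have [wA|wA] := boolP (w \in A); last first.
  apply: integral0_eq => v _; rewrite patchE; case: ifP => // /set_mem[/= Aw _].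
  by rewrite (mem_set Aw) in wA.
rewrite masswE; last exact: measurable_within1.
rewrite [RHS]integral_mkcond; apply: eq_integral => v _; rewrite !patchE.
case: ifPn => [/set_mem[_ h]|nh]; first by rewrite mem_set.
by rewrite memNset// => h; move/negP: nh; apply; apply/mem_set; split => //; exact: set_mem.
Qed.

Let step j : rat := (j.+1%:R)^-1.

Let step_gt0 j : (0 < step j)%R. Proof. by rewrite invr_gt0. Qed.

(** The windows [(q, q + 1/(j + 1)]] decrease to the empty set, and [mass_measure] is continuous
    from above once it is finite. *)
Let cvg_mass_step (A : set past) (q : rat) : measurable A -> (0 <= q)%R ->
  \int[P]_(w in A) massw w k.-1 (within (ratr q)%:E (ratr (q + step 0))%:E) < +oo ->
  \int[P]_(w in A) massw w k.-1 (within (ratr q)%:E (ratr (q + step j))%:E) @[j --> \oo] --> 0.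
Proof.
move=> mA q0; pose G (j : nat) : set (past * R) := A `*` (within (ratr q)%:E (ratr (q + step j))%:E `&` `]0%R, +oo[%classic).
have mI j : measurable (within (ratr q)%:E (ratr (q + step j))%:E `&` `]0%R, +oo[%classic : set R).
  by apply: measurableI; [exact: measurable_within1|exact: measurable_itv].
have mG j : measurable (G j) by exact: measurableX.
have -> : (fun j => \int[P]_(w in A) massw w k.-1 (within (ratr q)%:E (ratr (q + step j))%:E)) =
    mass_measure \o G by apply/funext => j; rewrite /= mass_measure_rect.
rewrite -mass_measure_rect// => fin.
have G0 : \bigcap_j G j = set0.
  apply/seteqP; split => // -[w v] h.
  have qv : (ratr q < v)%R by have [_ [/= /andP[]]] := h 0%N I; rewrite lte_fin.
  pose j := Num.truncn (v - ratr q)^-1.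
  have [_ [/= /andP[_]]] := h j I; rewrite lee_fin rmorphD/= leNgt => /negP; case.
  rewrite -ltrBrDl /step fmorphV rmorph_nat invf_plt ?posrE ?subr_gt0// truncnS_gt//.
rewrite -(measure0 mass_measure) -G0; apply: nonincreasing_cvg_mu => //.
- by apply: bigcapT_measurable.
- move=> i j ij; apply/subsetPset => -[w v] [Aw [/andP[h1 h2] h3]]; split => //; split => //.
  apply/andP; split => //; apply: (le_trans h2); rewrite lee_fin ler_rat lerD2l.
  by rewrite /step lef_pV2 ?posrE// ler_nat ltnS.
Qed.

(* The increments over [q, q + 1/j] tend to 0 in mean where the occupation mass
   is bounded; being monotone in j, they tend to 0 almost surely. *)
Lemma ae_envelope q : (0 <= q)%R -> {ae P, forall w, envelope (fw w) (ratr q) = fw w q}.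
Proof.
move=> q0; pose I w := ereal_inf [set inc q (q + step j) w | j in [set: nat]].
have qs j : (q <= q + step j)%R by rewrite lerDl ltW.
have inc0 a b w : 0 <= inc a b w by apply: limn_esup_ge0 => n; exact: Xi_t_ge0.
have I0 w : 0 <= I w by apply: le_ereal_inf_tmp => _ [j _ <-].
have mI : measurable_fun setT I.
  apply: measurable_ereal_inf => j; first exact: measurable_const_set.
  exact: measurable_limit_increment.
pose E (K : nat) : set past := [set w | massw w k.-1 (within (ratr q)%:E (ratr (q + step 0))%:E) <= K%:R%:E].
have mE K : measurable (E K).
  apply: emeasurable_le_set; last exact: measurable_cst.
  by apply: measurable_massw => //; exact: measurable_cst.
have mE' K : measurable (E K : set Omega) := sub_measurable (@source_meas _ _ _ _ gam T sigma) (mE K).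
have zero K : {ae P, forall w, E K w -> I w = 0}.
  have z : \int[P]_w (I \_ (E K)) w = 0.
    rewrite -integral_mkcond; apply/eqP; rewrite eq_le; apply/andP; split; last exact: integral_ge0.
    have c := cvg_mass_step (mE K) q0.
    have fin : \int[P]_(w in E K) massw w k.-1 (within (ratr q)%:E (ratr (q + step 0))%:E) < +oo.
      apply: (@le_lt_trans _ _ (\int[P]_(w in E K) cst K%:R%:E w)).
        apply: ge0_le_integral => //.
        - by move=> w _; exact: massw_ge0.
        - apply: measurable_funTS; apply: (sm (A := Lv k.-1)).
          by apply: measurable_massw => //; exact: measurable_cst.
      rewrite integral_cst//; apply: lte_mul_pinfty => //.
      exact: le_lt_trans (probability_le1 P (mE' K)) (ltry _).
    rewrite -(cvg_lim _ (c fin))//; apply: lime_ge; first by apply/cvg_ex; exists 0; exact: c fin.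
    apply: nearW => j; apply: le_trans (integral_limit_increment hm k0 (mE K) q0 (qs j)).
    apply: ge0_le_integral => //.
    - exact: measurable_funTS.
    - by apply: measurable_funTS; exact: measurable_limit_increment.
    - by move=> w _; apply: ereal_inf_lbound; exists j.
  have mIE : measurable_fun setT (I \_ (E K : set Omega) : Omega -> \bar R).
    by apply/(measurable_restrictT _ (mE' K)); exact: measurable_funTS.
  have IE0 w : 0 <= (I \_ (E K)) w by rewrite patchE; case: ifP.
  apply: filterS (ge0_integral0_ae mIE IE0 z) => w + Ew.
  by rewrite patchE mem_set.
have zeros := ae_forall_count zero.
near=> w.
have cw : limits w by near: w; exact: (ae_clock_limits hm k0).
have zw : forall K, E K w -> I w = 0 by near: w.
apply/eqP; rewrite eq_le; apply/andP; split; last first.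
  apply: le_ereal_inf_tmp => _ [p [p0 qp] <-].
  by apply: limit_clock_mono => //; rewrite ltW// -(ltr_rat R).
have [K EK] : exists K, E K w.
  have := limits_mass cw (Num.truncn (ratr (q + step 0) : R)).+1.
  set m := massw _ _ _ => mfin.
  have : massw w k.-1 (within (ratr q)%:E (ratr (q + step 0))%:E) < +oo.
    apply: le_lt_trans mfin; apply: massw_le; first exact: limits_good cw.
      by rewrite lee_fin ler0q.
    by rewrite lee_fin ltW// truncnS_gt.
  have := massw_ge0 alpha gam T sigma w k.-1 (within (ratr q)%:E (ratr (q + step 0))%:E).
  rewrite /E/=; case: (massw _ _ _) => [r| |]// r0 _; exists (Num.truncn r).+1.
  by rewrite lee_fin ltW// truncnS_gt.
have Iw := zw K EK.
apply/lee_addgt0Pr => e e0.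
have : I w < e%:E by rewrite Iw lte_fin.
move=> /ereal_inf_lt[_ [j _ <-] je].
have qj := le_trans q0 (qs j).
apply: (@le_trans _ _ (fw w (q + step j))).
  by apply: envelope_le => //; rewrite ltr_rat ltrDl.
rewrite (limit_clock_add k0 cw q0 (qs j)); apply: leeD => //; exact: ltW.
Unshelve. all: by end_near. Qed.

(** Both sides complete [f(p)] to [f(q)], and [f(p)] is finite so that it can be cancelled. *)
Lemma clock_measure_within w p q : limits w -> (0 <= p)%R -> (p <= q)%R ->
  envelope (fw w) (ratr p) = fw w p -> envelope (fw w) (ratr q) = fw w q ->
  clock_measure (fw w) (within (ratr p)%:E (ratr q)%:E) = inc p q w.
Proof.
move=> cw p0 pq ep eq; have q0 := le_trans p0 pq.
have mono := limit_clock_mono k0 cw.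
have f0 r := limit_clock_ge0 alpha gam T sigma k w r.
have mp := clock_measure_itv mono f0 (_ : (0 <= ratr p :> R)%R).
have mq := clock_measure_itv mono f0 (_ : (0 <= ratr q :> R)%R).
have e : fw w q = fw w p + clock_measure (fw w) (within (ratr p)%:E (ratr q)%:E).
  rewrite -[in LHS]eq -[in RHS]ep -mp ?ler0q// -mq ?ler0q// -measureU; first last.
  - apply/seteqP; split => // v [/= + /andP[+ _]]; rewrite in_itv/= lte_fin => /andP[_ vp].
    by rewrite ltNge vp.
  - exact: measurable_within1.
  - exact: measurable_itv.
  congr (clock_measure _ _); apply/seteqP; split => v /=.
    rewrite in_itv/= => /andP[v0 vq]; have [vp|vp] := leP v (ratr p).
      by left; rewrite /= in_itv/= v0.
    by right; rewrite /within/= lte_fin lee_fin vp.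
  rewrite in_itv/=; case.
    by rewrite /= in_itv/= => /andP[-> vp]; rewrite (le_trans vp)// ler_rat.
  rewrite /within/= lte_fin lee_fin in_itv/= => /andP[pv ->]; rewrite andbT ltW//.
  by apply: le_lt_trans pv; rewrite ler0q.
move: e; rewrite (limit_clock_add k0 cw p0 pq).
have pf : fw w p \is a fin_num by rewrite (ge0_fin_numE (f0 p)); exact: limit_clock_fin.
by move=> /(adde_cancel pf)/esym.
Qed.

End comparison.

Lemma measure_bigcup_le d (U : measurableType d) (R : realType) (mu : {measure set U -> \bar R})
    (G : nat -> set U) (c : \bar R) :
  (forall n, measurable (G n)) -> (forall n m, (n <= m)%N -> G n `<=` G m) ->
  (forall n, mu (G n) <= c)%E -> (mu (\bigcup_n G n) <= c)%E.
Proof.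
move=> mG Gm h; have cv : mu (G n) @[n --> \oo] --> mu (\bigcup_n G n).
  apply: nondecreasing_cvg_mu => //; first exact: bigcupT_measurable.
  by move=> i j ij; apply/subsetPset; exact: Gm.
rewrite -(cvg_lim _ cv)//; apply: lime_le; last exact: nearW.
by apply/cvg_ex; exists (mu (\bigcup_n G n)).
Qed.

(** * The mean clock measure is dominated by the mean occupation measure *)

Section visits.
Context d (Omega : measurableType d) (R : realType) (P : probability Omega R).
Variables (alpha : nat -> R) (gam : seq nat -> nat -> {RV P >-> R}).
Variables (T sigma : nat -> nat -> nat -> {RV P >-> R}).
Hypothesis hm : cascade_model alpha gam T sigma.
Local Open Scope ereal_scope.
Local Notation leb := (@lebesgue_measure R).
Local Notation F := (source_sigma_algebra gam T sigma).
Local Notation sub A := (g_sigma_algebraType (\bigcup_(i in A) F i)).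
Local Notation g := (gabs gam).
Local Notation Th := (Tabs T).
Local Notation sg := (sig sigma).
Local Notation Lv := (level_sources).
Local Notation massw := (massw alpha gam T sigma).
Let sm := sub_measurable_fun (@source_meas _ _ _ _ gam T sigma).
Variable k : nat.
Hypothesis k0 : (0 < k)%N.
Local Notation fw := (limit_clockw alpha gam T sigma k).
Local Notation inc := (limit_increment alpha gam T sigma k).
Local Notation limits := (clock_limits alpha gam T sigma k).
Local Notation past := (sub (Lv k.-1)).
Local Notation Q := (P \x leb).
Local Notation mass_measure := (mass_measure alpha gam T sigma k).

Let m_past (A : set past) : measurable A -> measurable (A : set Omega).
Proof. by move=> mA; exact: (sub_measurable (@source_meas _ _ _ _ gam T sigma) mA). Qed.

Let m_passage d' (V : measurableType d') (phi : Omega -> V) (B : set (V * R)) :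
  measurable_fun setT phi -> measurable B ->
  measurable [set z : Omega * R | [/\ (0 < z.2)%R, passage (fw z.1) z.2 < +oo &
    B (phi z.1, fine (passage (fw z.1) z.2))]].
Proof.
move=> mphi mB; apply: (@measurable_passage_preimage _ Omega R alpha g Th sg _ _ _ _ _ k _ V phi B) => //.
- by move=> w s x; exact: gabs_ge0.
- by move=> w k' x i; exact: Tabs_ge0.
- by move=> s x; exact: (sm (@measurable_gabs _ _ _ _ gam T sigma 0 s x)).
- by move=> k' x i h; apply: (sm (@measurable_Tabs _ _ _ _ gam T sigma k' k' x i _)); rewrite h leqnn.
Qed.

Let mid := sub_id_measurable (@source_meas _ _ _ _ gam T sigma) (A := Lv k.-1).

Let reachedw : set (Omega * R) := [set z | (0 < z.2)%R /\ passage (fw z.1) z.2 < +oo].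

Let m_reachedw : measurable reachedw.
Proof.
have := @m_passage _ Omega id setT (@measurable_id _ _ setT) measurableT.
by rewrite (_ : [set _ | _] = reachedw)//; apply/seteqP; split => z; [move=> []|move=> []].
Qed.

Let locate (z : Omega * R) : past * R := (z.1, fine (passage (fw z.1) z.2)).

Let m_locate : measurable_fun setT locate.
Proof.
apply: measurable_fun_pair; first exact: (measurableT_comp mid (@measurable_fst _ _ Omega R)).
apply: measurableT_comp => //; apply: (@measurable_limit_passage _ Omega R alpha g Th sg) => //.
- by move=> w s x; exact: gabs_ge0.
- by move=> w k' x i; exact: Tabs_ge0.
- by move=> s x; exact: (sm (@measurable_gabs _ _ _ _ gam T sigma 0 s x)).
- by move=> k' x i h; apply: (sm (@measurable_Tabs _ _ _ _ gam T sigma k' k' x i _)); rewrite h leqnn.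
Qed.

(** The mean of the limit clock measure, as a measure on the product: the image of probability times
    Lebesgue under [(w, r) -> (w, passage time of r)], restricted to levels that are reached. *)
Definition visit_measure : {measure set (past * R) -> \bar R} :=
  measure_function_pushforward__canonical__measure_function_Measure
    (mrestr Q m_reachedw) m_locate.

Lemma visit_measure_prod (B : set (past * R)) : visit_measure B =
  Q [set z | [/\ (0 < z.2)%R, passage (fw z.1) z.2 < +oo & B (z.1, fine (passage (fw z.1) z.2))]].
Proof.
rewrite /visit_measure /= /pushforward /mrestr; congr (product_measure1 _ _ _).
by apply/seteqP; split => z; rewrite /reachedw/=; [move=> [? [? ?]]|move=> [? ? ?]].
Qed.

Lemma visit_measureE (B : set (past * R)) :
  visit_measure B = \int[P]_w clock_measure (fw w) [set v | B (w, v)].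
Proof.
rewrite visit_measure_prod prod_lebesgueE; apply: eq_integral => w _.
by rewrite clock_measureE.
Qed.

Lemma measurable_visit_section (B : set (past * R)) : measurable B ->
  measurable_fun setT (fun w => clock_measure (fw w) [set v | B (w, v)]).
Proof.
move=> mB; have mS := m_passage mid mB.
have := measurable_fun_xsection leb mS; apply: eq_measurable_fun => w _ /=.
rewrite clock_measureE; congr (leb _); apply/seteqP; split => r; rewrite /xsection/=.
  by move=> /set_mem.
by move=> h; apply/mem_set.
Qed.

Lemma visit_measure_rect (A : set past) p q : measurable A -> (0 <= p)%R -> (p <= q)%R ->
  visit_measure (A `*` within (ratr p)%:E (ratr q)%:E) = \int[P]_(w in A) inc p q w.
Proof.
move=> mA p0 pq; have q0 := le_trans p0 pq; have mA' := m_past mA.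
rewrite visit_measureE [RHS]integral_mkcond.
have mB : measurable (A `*` within (ratr p)%:E (ratr q)%:E : set (past * R)).
  by apply: measurableX => //; exact: measurable_within1.
apply: ae_eq_integral => //.
- exact: measurable_visit_section.
- apply/(measurable_restrictT _ mA'); apply: measurable_funTS.
  exact: measurable_limit_increment.
apply: filterS3 (ae_clock_limits hm k0) (ae_envelope hm k0 p0) (ae_envelope hm k0 q0) => w cw ep eq _.
rewrite patchE; case: ifPn => [/set_mem|] wA.
  rewrite -(clock_measure_within k0 cw p0 pq ep eq); congr (clock_measure _ _).
  by apply/seteqP; split => v //= [].
rewrite (_ : [set _ | _] = set0) ?measure0//; apply/seteqP; split => // v [/= Aw _].
by rewrite (mem_set Aw) in wA.
Qed.

Let rect_le (A : set past) p q : measurable A -> (0 <= p)%R -> (p <= q)%R ->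
  visit_measure (A `*` within (ratr p)%:E (ratr q)%:E) <=
  mass_measure (A `*` within (ratr p)%:E (ratr q)%:E).
Proof.
move=> mA p0 pq; rewrite visit_measure_rect//.
apply: le_trans (integral_limit_increment hm k0 mA p0 pq) _.
rewrite -mass_measure_rect//; apply: le_measure; rewrite ?inE.
- apply: measurableX => //; apply: measurableI; [exact: measurable_within1|exact: measurable_itv].
- by apply: measurableX => //; exact: measurable_within1.
- by move=> z [? [? _]].
Qed.

Section cut.
Variables (M K : nat).
Let E : set past := [set w | massw w k.-1 (within 0 M%:R%:E) <= K%:R%:E].
(** Both measures are finite on [C], as [measure_le_generated] requires. *)
Let C : set (past * R) := E `*` within 0 M%:R%:E.

Let mE : measurable E.
Proof.
apply: emeasurable_le_set; last exact: measurable_cst.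
by apply: measurable_massw => //; exact: measurable_cst.
Qed.

Let mC : measurable C. Proof. by apply: measurableX => //; exact: measurable_within1. Qed.

Let qM : (M%:R%:E = (ratr M%:R)%:E :> \bar R). Proof. by rewrite rmorph_nat. Qed.

Let mass_fin : mass_measure C < +oo.
Proof.
have -> : C = E `*` (within 0 M%:R%:E `&` `]0%R, +oo[%classic).
  apply/seteqP; split => z [Ez Iz]; split => //; last by case: Iz.
  by split => //; move: Iz => /andP[]; rewrite /= in_itv/= andbT.
rewrite mass_measure_rect//.
apply: (@le_lt_trans _ _ (\int[P]_(w in E) cst K%:R%:E w)).
  apply: ge0_le_integral => //.
  - exact: m_past.
  - by move=> w _; exact: massw_ge0.
  - apply: measurable_funTS; apply: (sm (A := Lv k.-1)).
    by apply: measurable_massw => //; exact: measurable_cst.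
rewrite integral_cst; last exact: m_past.
apply: lte_mul_pinfty => //; apply: le_lt_trans (probability_le1 P (m_past mE)) (ltry _).
Qed.

Let visit_fin : visit_measure C < +oo.
Proof.
apply: le_lt_trans mass_fin; have -> : C = E `*` within (ratr 0)%:E (ratr M%:R)%:E by rewrite /C qM rmorph0.
by apply: rect_le => //; rewrite ler0n.
Qed.

Let level_within N j : (0 < j)%N -> exists p q : rat, [/\ (0 <= p)%R, (p <= q)%R &
  [set v : R | level N v = j] `&` within 0 M%:R%:E = within (ratr p)%:E (ratr q)%:E].
Proof.
move=> j0; pose a : rat := (j.-1%:R / 2 ^+ N)%R; pose b : rat := (j%:R / 2 ^+ N)%R.
have p0 : (0 < 2 ^+ N :> rat)%R by exact: exprn_gt0.
have a0 : (0 <= a)%R by rewrite divr_ge0// ltW.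
have ab : (a <= b)%R by rewrite ler_pM2r ?invr_gt0// ler_nat leq_pred.
exists (Num.min a M%:R), (Num.min b M%:R); split.
- by rewrite le_min a0 ler0n.
- by rewrite le_min !ge_min ab lexx !orbT.
have ea : ratr a = (j.-1%:R / 2 ^+ N)%R :> R by rewrite fmorph_div/= rmorphXn/= !rmorph_nat.
have eb : ratr b = (j%:R / 2 ^+ N)%R :> R by rewrite fmorph_div/= rmorphXn/= !rmorph_nat.
have ra : (0 <= ratr a :> R)%R by rewrite ler0q.
have em x y : ratr (Num.min x y) = Num.min (ratr x) (ratr y) :> R.
  by rewrite !minEle ler_rat; case: ifP.
apply/seteqP; split => v; rewrite /within/= !lte_fin !lee_fin !em rmorph_nat.
  move=> [/(levelP N v j0) /andP[h1 h2] /andP[h3 h4]].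
  by rewrite gt_min le_min h4 ea h1 eb h2.
rewrite gt_min le_min => /andP[/orP[h1|h1] /andP[h2 h3]]; last by rewrite ltNge h3 in h1.
split; last by rewrite h3 (le_lt_trans ra h1).
by apply/(levelP N v j0); rewrite -ea -eb h1.
Qed.

(* Dyadic step sets form an algebra, on which the comparison reduces to
   rectangles with rational endpoints. *)
Let step_le B : step_set B -> visit_measure (B `&` C) <= mass_measure (B `&` C).
Proof.
move=> [N [S [mS ->]]].
pose G j : set (past * R) := (S j `&` E) `*` ([set v : R | level N v = j] `&` within 0 M%:R%:E).
have mG j : measurable (G j).
  apply: measurableX; first exact: measurableI.
  by apply: measurableI; [exact: measurable_level|exact: measurable_within1].
have tG : trivIset setT G.
  by apply/trivIsetP => i j _ _ ij; apply/seteqP; split => // z [[_ [/= ei _]] [_ [/= ej _]]];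
    rewrite -ei -ej eqxx in ij.
have -> : [set z | S (level N z.2) z.1] `&` C = \bigcup_j G j.
  apply/seteqP; split => z /=; first by move=> [Sz [Ez Iz]]; exists (level N z.2).
  by move=> [j _ [[Sz Ez] [/= e Iz]]]; split; [rewrite e|].
rewrite !measure_bigcup//; apply: lee_nneseries => // j _.
rewrite /G; case: j => [|j].
  rewrite (_ : _ `*` _ = set0) ?measure0//; apply/seteqP; split => // z [_ [/= /level_eq0 h /andP[]]].
  by rewrite lte_fin ltNge h.
have [p [q [p0 pq ->]]] := level_within N (ltn0Sn j).
by apply: rect_le => //; exact: measurableI.
Qed.

Lemma visit_le_mass_cut (B : set (past * R)) : measurable B ->
  visit_measure (B `&` C) <= mass_measure (B `&` C).
Proof.
move=> mB; have h := @measure_le_generated _ (past * R)%type R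
  (mrestr visit_measure mC) (mrestr mass_measure mC) (@step_set _ past R)
  (@step_set_meas _ past R) (@step_setC _ past R) (@step_setU _ past R) (@step_setT _ past R).
have {}h := h _ _ step_le _ (measurable_step_set mB).
have e : B `&` [set z | (0 < z.2)%R] `&` C = B `&` C.
  apply/seteqP; split => z; first by move=> [[]].
  by move=> [Bz [Ez /andP[z0 zM]]]; split; [split => //=; move: z0; rewrite lte_fin|split => //; apply/andP].
have h1 : visit_measure ([set: past * R] `&` C) < +oo by rewrite setTI; exact: visit_fin.
have h2 : mass_measure ([set: past * R] `&` C) < +oo by rewrite setTI; exact: mass_fin.
by rewrite -e; exact: (h h1 h2).
Qed.

End cut.

(** The sets on which the comparison is known exhaust the positive times, except for a null event,
    because bounded windows almost surely have finite mass. *)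
Lemma visit_le_mass (B : set (past * R)) : measurable B -> B `<=` [set z | (0 < z.2)%R] ->
  visit_measure B <= mass_measure B.
Proof.
move=> mB B0; pose I (M : nat) : set (past * R) := [set z | (z.2 <= M%:R)%R].
have mI M : measurable (I M) by apply: measurable_bool_set; exact: measurable_fun_ler.
have BI : B = \bigcup_M (B `&` I M).
  apply/seteqP; split => z; last by move=> [M _ []].
  by move=> Bz; exists (Num.truncn z.2).+1 => //; split => //; rewrite /I/= ltW// truncnS_gt.
rewrite [in leLHS]BI; apply: measure_bigcup_le.
- by move=> M; exact: measurableI.
- move=> i j ij z [Bz Iz]; split => //; apply: (le_trans Iz); by rewrite ler_nat.
move=> M; pose E (K : nat) : set past := [set w | massw w k.-1 (within 0 M%:R%:E) <= K%:R%:E].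
have mE K : measurable (E K).
  apply: emeasurable_le_set; last exact: measurable_cst.
  by apply: measurable_massw => //; exact: measurable_cst.
pose C K : set (past * R) := E K `*` within 0 M%:R%:E.
have mC K : measurable (C K) by apply: measurableX => //; exact: measurable_within1.
pose N : set past := ~` \bigcup_K E K.
have mN : measurable N by apply: measurableC; exact: bigcupT_measurable.
have PN : P N = 0.
  apply/eqP; rewrite eq_le measure_ge0 andbT.
  have := massw_finite hm k.-1.
  move=> /(negligibleS _) h; rewrite measure_le0; apply/eqP; apply: measure_negligible; first exact: m_past.
  apply: h => w Nw [fin _]; apply: Nw; have := fin M.
  have := massw_ge0 alpha gam T sigma w k.-1 (within 0 M%:R%:E).
  case e : (massw _ _ _) => [r| |]// r0 _; exists (Num.truncn r).+1 => //=.
  by rewrite /E/= e lee_fin ltW// truncnS_gt.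
have mNT : measurable (N `*` setT : set (past * R)) by exact: measurableX.
(* The product measure of [N] with the whole line is [0 * +oo = 0]. *)
have null : visit_measure (N `*` setT) = 0.
  apply/eqP; rewrite eq_le measure_ge0 andbT visit_measure_prod.
  apply: (@le_trans _ _ (Q (N `*` setT))).
    apply: le_measure; rewrite ?inE.
    - exact: (m_passage mid mNT).
    - by apply: measurableX => //; exact: m_past.
    - by move=> z [_ _ []].
  have e : Q (N `*` setT) = P N * leb setT.
    by apply: product_measure1E; [exact: m_past|exact: measurableT].
  by rewrite e PN mul0e.
apply: (@le_trans _ _ (visit_measure ((\bigcup_K (B `&` C K)) `|` N `*` setT))).
  apply: le_measure; rewrite ?inE.
  - exact: measurableI.
  - by apply: measurableU => //; apply: bigcupT_measurable => K; exact: measurableI.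
  move=> z [Bz Iz]; have [[K _ EK]|nE] := pselect ((\bigcup_K E K) z.1); last by right.
  left; exists K => //; split => //; split => //; rewrite /within/= lte_fin lee_fin Iz.
  by have -> := B0 _ Bz.
apply: le_trans (measureU2 _ _ _) _ => //.
  by apply: bigcupT_measurable => K; exact: measurableI.
rewrite [X in _ + X <= _](_ : _ = 0); last exact: null.
rewrite adde0; apply: measure_bigcup_le.
- by move=> K; exact: measurableI.
- move=> i j ij z [Bz [Ez Iz]]; split => //; split => //; apply: (le_trans Ez).
  by rewrite lee_fin ler_nat.
move=> K; apply: le_trans (visit_le_mass_cut M K mB) _.
by apply: le_measure; rewrite ?inE//; exact: (measurableI _ _ mB (mC K)).
Qed.

End visits.

(** Local time is nondecreasing in [v], so the condition on it defines an interval [V] starting at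
    0. For [v] in [V] the part of [C] up to [v] has measure at most [t], and it remains to let [v]
    approach the right end of [V]. *)
Lemma lebesgue_local_le (R : realType) (C : set R) (t : R) : measurable C -> 0 <= t ->
  (@lebesgue_measure R [set v : R | [/\ (0 <= v)%R,
    (lebesgue_measure (C `&` `[0%R, v]%classic) <= t%:E)%E & C v]] <= t%:E)%E.
Proof.
move=> mC t0; set S : set R := [set v | _].
pose V : set R := [set v | 0 <= v /\ (@lebesgue_measure R (C `&` `[0%R, v]%classic) <= t%:E)%E].
have mCv (v : R) : measurable (C `&` `[0%R, v]%classic : set R).
  by apply: measurableI => //; exact: measurable_itv.
have V_down u v : V v -> 0 <= u -> u <= v -> V u.
  move=> [v0 Lv] u0 uv; split => //; apply: le_trans Lv; apply: le_measure; rewrite ?inE; [exact: mCv..|].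
  by move=> x [Cx]; rewrite /= !in_itv/= => /andP[-> xu]; split => //; exact: le_trans uv.
have SE : S = C `&` V by apply/seteqP; split => v; [move=> []|move=> [? []]].
have mV : measurable V.
  apply: is_interval_measurable => u v Vu Vv x /andP[ux xv]; apply: (V_down x v) => //.
  by case: Vu => u0 _; exact: le_trans ux.
have mS : measurable S by rewrite SE; exact: measurableI.
(* [B] stands for the remainder between [v] and the supremum of [V], of arbitrarily small measure;
   it is empty when [V] is unbounded. *)
have cut v (B : set R) : V v -> measurable B -> (@lebesgue_measure R (S `&` (`[0%R, v]%classic `|` B)) <= t%:E + @lebesgue_measure R B)%E.
  move=> [v0 Lv] mB; apply: (@le_trans _ _ (@lebesgue_measure R ((C `&` `[0%R, v]%classic) `|` B))).
    apply: le_measure; rewrite ?inE.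
    - by apply: measurableI => //; apply: measurableU => //; exact: measurable_itv.
    - exact: (measurableU _ _ (mCv v) mB).
    - by move=> x [[_ _ Cx] [xv|Bx]]; [left|right].
  have h := @measureU2 _ _ _ (@lebesgue_measure R) _ _ (mCv v) mB.
  by apply: (le_trans h); apply: leeD.
have [ubV|nub] := pselect (has_ubound V); last first.
  have -> : S = \bigcup_n (S `&` `[0%R, n%:R]%classic).
    apply/seteqP; split => v; last by move=> [n _ []].
    move=> Sv; have [v0 _ _] := Sv; exists (Num.truncn v).+1 => //; split => //.
    by rewrite /= in_itv/= v0 ltW// truncnS_gt.
  apply: (@measure_bigcup_le _ _ _ (@lebesgue_measure R)).
  - by move=> n; apply: measurableI => //; exact: measurable_itv.
  - move=> i j ij v [Sv]; rewrite /= !in_itv/= => /andP[-> vi]; split => //.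
    by apply: (le_trans vi); rewrite ler_nat.
  move=> n; have [v Vv nv] : exists2 v, V v & n%:R <= v.
    apply: contrapT => h; apply: nub; exists n%:R => v Vv; rewrite leNgt; apply/negP => nv.
    by apply: h; exists v => //; exact: ltW.
  have := cut v set0 Vv measurable0; rewrite measure0 adde0; apply: le_trans.
  have mI (x : R) : measurable (`[0%R, x]%classic : set R) by exact: measurable_itv.
  apply: le_measure; rewrite ?inE.
  - exact: (measurableI _ _ mS (mI _)).
  - exact: (measurableI _ _ mS (measurableU _ _ (mI _) measurable0)).
  by move=> x [Sx]; rewrite /= !in_itv/= => /andP[x0 xn]; split => //; left; rewrite x0 (le_trans xn).
have [[v0 Vv0]|V0] := pselect (V !=set0); last first.
  rewrite SE (_ : V = set0) ?setI0 ?measure0 ?lee_fin//.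
  by apply/seteqP; split => // v Vv; apply: V0; exists v.
have hV : has_sup V by split => //; exists v0.
apply/lee_addgt0Pr => e e0.
have [v Vv bv] := sup_adherent e0 hV.
have := cut v `[v, sup V]%classic Vv (measurable_itv _).
rewrite lebesgue_measure_itv/= => h.
apply: (@le_trans _ _ (@lebesgue_measure R (S `&` (`[0%R, v]%classic `|` `[v, sup V]%classic)))).
  have mI (x y : R) : measurable (`[x, y]%classic : set R) by exact: measurable_itv.
  apply: le_measure; rewrite ?inE; [exact: mS|exact: (measurableI _ _ mS (measurableU _ _ (mI _ _) (mI _ _)))|].
  move=> x Sx; split => //; have [x0 Lx _] := Sx; have xb : x <= sup V by apply: sup_upper_bound.
  by have [xv|vx] := leP x v; [left|right]; rewrite /= in_itv/= ?x0 ?xb ?xv ?(ltW vx).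
apply: (le_trans h); apply: leeD => //; case: ifP => _; last by rewrite lee_fin ltW.
by rewrite -EFinB lee_fin lerBlDr -lerBlDl ltW.
Qed.

(** * Means of the vertex clocks on events of the past *)

Section vertex.
Context d (Omega : measurableType d) (R : realType) (P : probability Omega R).
Variables (alpha : nat -> R) (gam : seq nat -> nat -> {RV P >-> R}).
Variables (T sigma : nat -> nat -> nat -> {RV P >-> R}).
Hypothesis hm : cascade_model alpha gam T sigma.
Local Open Scope ereal_scope.
Local Notation leb := (@lebesgue_measure R).
Local Notation F := (source_sigma_algebra gam T sigma).
Local Notation sub A := (g_sigma_algebraType (\bigcup_(i in A) F i)).
Local Notation g := (gabs gam).
Local Notation Th := (Tabs T).
Local Notation sg := (sig sigma).
Local Notation Wt := (weight alpha gam).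
Local Notation Lv := (level_sources).
Let sm := sub_measurable_fun (@source_meas _ _ _ _ gam T sigma).
Local Notation fw := (limit_clockw alpha gam T sigma).

Definition vertex_clockw w s t := vertex_clock alpha (g w) (Th w) (sg w) s t.

Lemma measurable_vertex_clockw s t : measurable_fun setT (fun w => vertex_clockw w s t).
Proof.
apply: (@measurable_vertex_clock _ Omega R alpha g Th sg) => //.
- by move=> w s' x; exact: gabs_ge0.
- by move=> w k' x i; exact: Tabs_ge0.
- by move=> s' x; exact: (sm (@measurable_gabs _ _ _ _ gam T sigma 0 s' x)).
- by move=> k' x i h; apply: (sm (@measurable_Tabs _ _ _ _ gam T sigma k' k' x i _)); rewrite h leqnn.
Qed.

Section vertex_bound.
Variables (s : seq nat) (t : R).
Hypothesis t0 : (0 <= t)%R.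
Local Notation k := (size s).+1.
Local Notation past := (sub (Lv (size s))).
Local Notation vset w := (vertex_set (g w) (Th w) (sg w) s t).

Let B (A : set past) : set (past * R) := [set z | [/\ A z.1, vset z.1 z.2 & (0 < z.2)%R]].

Let mB A : measurable A -> measurable (B A).
Proof.
move=> mA; have mv : measurable [set z : past * R | vset z.1 z.2].
  apply: (@measurable_vertex_set _ past R (size s) g Th sg) => //.
  - by move=> w s' x; exact: gabs_ge0.
  - by move=> w k' x i; exact: Tabs_ge0.
  - by move=> s' x; exact: measurable_gabs.
  - by move=> k' x i ?; exact: measurable_Tabs.
  - by move=> k' x i ?; exact: measurable_sig.
rewrite (_ : B A = (A `*` `]0%R, +oo[%classic) `&` [set z : past * R | vset z.1 z.2]).
  by apply: measurableI => //; apply: measurableX => //; exact: measurable_itv.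
apply/seteqP; split => z; rewrite /B/=; first by move=> [? ? z0]; split => //; split => //; rewrite /= in_itv/= z0.
by move=> [[? /=]]; rewrite in_itv/= andbT.
Qed.

Let mvset w : measurable (vset w : set R).
Proof. by apply: measurable_vertex_set1; [exact: gabs_ge0|exact: Tabs_ge0]. Qed.

(** On the vertex set [s] is the only occupied vertex, so the density there is [W(s)];
    [lebesgue_local_le] bounds the length of that set by [t]. *)
Let mass_le (A : set past) : measurable A ->
  mass_measure alpha gam T sigma k (B A) <= t%:E * \int[P]_(w in A) Wt w s.
Proof.
move=> mA; have mA' : measurable (A : set Omega) := sub_measurable (@source_meas _ _ _ _ gam T sigma) mA.
have mWt : measurable_fun setT (fun w => Wt w s).
  exact: (sm (@measurable_weight _ _ _ _ alpha gam T sigma 0 s)).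
have mB' : measurable (B A : set (Omega * R)).
  pose id' (z : Omega * R) : past * R := (z.1, z.2).
  have mid' : measurable_fun setT id'.
    apply: measurable_fun_pair => //.
    have mid := sub_id_measurable (@source_meas _ _ _ _ gam T sigma) (A := Lv (size s)).
    exact: (measurableT_comp mid (@measurable_fst _ _ Omega R)).
  by have := mid' measurableT _ (mB mA); rewrite setTI.
rewrite mass_measureE integral_mkcond fubini_tonelli1//; first last.
- by move=> z; rewrite patchE; case: ifP => // _; exact: mass_density_ge0.
- apply/(measurable_restrictT _ mB').
  by apply: measurable_funTS; exact: measurable_mass_density.
rewrite -ge0_integralZl//; first last.
- by move=> w _; exact: weight_ge0.
- exact: measurable_funTS.
rewrite [leRHS]integral_mkcond.
apply: ae_ge0_le_integral => //.
- move=> w _; apply: integral_ge0 => v _; rewrite patchE; case: ifP => // _.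
  exact: mass_density_ge0.
- apply: measurable_fun_fubini_tonelli_F.
  + apply/(measurable_restrictT _ mB').
    by apply: measurable_funTS; exact: measurable_mass_density.
  + by move=> z; rewrite patchE; case: ifP => // _; exact: mass_density_ge0.
- by move=> w _; rewrite patchE; case: ifP => // _; rewrite mule_ge0 ?weight_ge0.
- apply/(measurable_restrictT _ mA'); apply: measurable_funTS.
  exact: emeasurable_funM.
apply: filterS (ae_good hm) => w G _.
rewrite /fubini_F patchE; case: ifPn => [/set_mem|] Aw; last first.
  rewrite integral0_eq// => v _; rewrite patchE; case: ifP => // /set_mem[/= h _ _].
  by rewrite (mem_set h) in Aw.
have mC : measurable (occ (g w) (Th w) (sg w) (size s) s).
  exact: (measurable_occ1 (sg w) (good_gabs G) (fun k x i => Tabs_ge0 T w k x i)).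
have mv := mvset w.
apply: (@le_trans _ _ (\int[leb]_v (Wt w s * (\1_(vset w) v)%:E))).
  apply: ge0_le_integral => //.
  - by move=> v _; rewrite patchE; case: ifP => // _; exact: mass_density_ge0.
  - have mf : measurable_fun setT (mass_density alpha gam T sigma k \_ (B A : set (Omega * R))).
      apply/(measurable_restrictT _ mB').
      by apply: measurable_funTS; exact: measurable_mass_density.
    exact: (measurableT_comp mf (@measurable_pair1 _ _ Omega R w)).
  - by apply: emeasurable_funM => //; apply/measurable_EFinP; exact: measurable_indic.
  move=> v _; rewrite patchE; case: ifPn => [/set_mem[/= _ vv _]|_]; last by rewrite mule_ge0 ?weight_ge0.
  have [_ _ ov] := vv; rewrite indicE mem_set// mule1 /mass_density/=.
  apply: le_trans (esum_le_single (i := s) _ _) _.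
  - by rewrite mule_ge0 ?weight_ge0.
  - move=> s' /= es ne; rewrite indicE memNset ?mule0// => os'; move/eqP: ne; apply.
    exact: (occ_inj (good_gabs G) (fun k x i => Tabs_ge0 T w k x i) (good_sig_ties G) es (erefl _) os' ov).
  by rewrite -[leRHS]mule1; apply: lee_wpmul2l; rewrite ?weight_ge0// lee_fin indicE; case: (_ \in _).
rewrite ge0_integralZl//; [|by apply/measurable_EFinP; exact: measurable_indic|exact: weight_ge0].
rewrite integral_indic// setIT muleC; apply: lee_wpmul2r; first exact: weight_ge0.
exact: lebesgue_local_le mC t0.
Qed.

Lemma integral_vertex_clock_le (A : set past) : measurable A ->
  \int[P]_(w in A) vertex_clockw w s t <= t%:E * \int[P]_(w in A) Wt w s.
Proof.
move=> mA; have mA' : measurable (A : set Omega) := sub_measurable (@source_meas _ _ _ _ gam T sigma) mA.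
apply: le_trans (mass_le mA).
apply: le_trans (visit_le_mass hm (ltn0Sn (size s)) (mB mA) _); last by move=> z [].
rewrite visit_measureE [leLHS]integral_mkcond; apply: ae_ge0_le_integral => //.
- by move=> w _; rewrite patchE; case: ifP.
- apply/(measurable_restrictT _ mA'); apply: measurable_funTS.
  exact: measurable_vertex_clockw.
- exact: (measurable_visit_section alpha (ltn0Sn (size s)) (mB mA)).
apply: filterS2 (ae_clock_limits hm (ltn0Sn (size s))) (ae_envelope hm (ltn0Sn (size s)) (lexx 0%R)).
move=> w cw e0 _; rewrite patchE; case: ifPn => [/set_mem|] Aw; last exact: measure_ge0.
have G := limits_good cw.
(* The comparison of measures concerns positive times. At time 0 there is no atom, since the
   envelope agrees there with the limit of the modified clocks, which is 0. *)
have z : clock_measure (fw k w) `[0%R, 0%R]%classic = 0.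
  have mono := limit_clock_mono (ltn0Sn (size s)) cw.
  have ge := limit_clock_ge0 alpha gam T sigma k w.
  have := clock_measure_itv mono ge (lexx 0%R).
  by rewrite -[X in envelope _ X](rmorph0 (ratr : rat -> R)) e0 (limit_clock0 (ltn0Sn _) cw).
have mpos : measurable (vset w `&` `]0%R, +oo[%classic : set R).
  by apply: measurableI; [exact: mvset|exact: measurable_itv].
have -> : [set v | B A (w, v)] = vset w `&` `]0%R, +oo[%classic.
  apply/seteqP; split => v; rewrite /B/= in_itv/= andbT; first by move=> [].
  by move=> [].
rewrite /vertex_clockw /vertex_clock -[leRHS]add0e -z.
apply: (@le_trans _ _ (clock_measure (fw k w) (`[0%R, 0%R]%classic `|` (vset w `&` `]0%R, +oo[%classic)))).
  apply: le_measure; rewrite ?inE.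
  - exact: mvset.
  - by apply: measurableU => //; exact: measurable_itv.
  - move=> v vv; have [v0 _ _] := vv; have [vp|vp] := ltP 0%R v.
      by right; split => //; rewrite /= in_itv/= vp.
    by left; rewrite /= in_itv/= v0 vp.
by apply: measureU2 => //; exact: measurable_itv.
Qed.

End vertex_bound.

End vertex.

(** * Conditional expectation *)

Section envelope_of_monotone.
Context {R : realType}.
Variable K : R -> \bar R.
Local Open Scope ereal_scope.
Hypothesis K_mono : {homo K : s t / (s <= t)%R >-> s <= t}.

Lemma envelope_cvg t : (0 <= t)%R ->
  K (t + j.+1%:R^-1)%R @[j --> \oo] --> envelope (fun q => K (ratr q)) t.
Proof.
move=> t0; have dec : nonincreasing_seq (fun j => K (t + j.+1%:R^-1)%R).
  by move=> i j ij; apply: K_mono; rewrite lerD2l lef_pV2 ?posrE// ler_nat ltnS.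
have := ereal_nonincreasing_cvgn dec.
rewrite (_ : ereal_inf _ = envelope (fun q => K (ratr q)) t)//.
apply/eqP; rewrite eq_le; apply/andP; split.
  apply: le_ereal_inf_tmp => _ [q [q0 tq] <-]; pose j := Num.truncn (ratr q - t)^-1.
  apply: (@le_trans _ _ (K (t + j.+1%:R^-1)%R)); first by apply: ereal_inf_lbound; exists j.
  apply: K_mono; rewrite -lerBrDl invf_ple ?posrE ?subr_gt0//.
  by rewrite ltW// truncnS_gt.
apply: le_ereal_inf_tmp => _ [j _ <-]; have /rat_in_itvoo[q] : (t < t + j.+1%:R^-1)%R by rewrite ltrDl invr_gt0.
rewrite in_itv/= => /andP[tq qj]; apply: le_trans (K_mono (ltW qj)).
by apply: envelope_le => //; rewrite -(ler0q R) (le_trans t0)// ltW.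
Qed.

End envelope_of_monotone.

Lemma integral_envelope_cvg d (U : measurableType d) (R : realType) (mu : {measure set U -> \bar R})
    (K : R -> U -> \bar R) (A : set U) (t : R) :
  measurable A -> (forall s, measurable_fun setT (K s)) -> (forall s x, 0 <= K s x)%E ->
  (forall x, {homo K^~ x : s t / s <= t >-> (s <= t)%E}) -> 0 <= t ->
  (\int[mu]_(x in A) K (t + 1)%R x < +oo)%E ->
  (\int[mu]_(x in A) K (t + j.+1%:R^-1)%R x @[j --> \oo] -->
     \int[mu]_(x in A) envelope (fun q => K (ratr q) x) t)%E.
Proof.
move=> mA mK K0 Km t0 fin.
have [] := @dominated_convergence _ U R mu A mA (fun j => K (t + j.+1%:R^-1))
  (fun x => envelope (fun q => K (ratr q) x) t) (K (t + 1)).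
- by move=> j; exact: measurable_funTS.
- by apply: measurable_funTS; apply: (measurable_envelope (f := fun q x => K (ratr q) x)).
- by apply: nearW => x _; exact: (envelope_cvg (Km x) t0).
- apply/integrableP; split; first exact: measurable_funTS.
  by under eq_integral => x _ do rewrite gee0_abs//.
- apply: nearW => x j _; rewrite gee0_abs//; apply: Km.
  by rewrite lerD2l invf_le1// ler1n.
by [].
Qed.

(** On the event [h <= p < q <= f] the integral bound gives [q P(A) <= p P(A)], hence [P(A) = 0];
    rational pairs cover the event [h < f]. Each [A] bounds [h], so integrability is not assumed. *)
Lemma ae_le_of_integral d (U : measurableType d) (R : realType) (P : probability U R)
    (f h : U -> \bar R) :
  measurable_fun setT f -> measurable_fun setT h ->
  (forall x, 0 <= f x)%E -> (forall x, 0 <= h x)%E ->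
  (forall p q : R, let A := [set x | h x <= p%:E /\ q%:E <= f x]%E in
    \int[P]_(x in A) f x <= \int[P]_(x in A) h x)%E ->
  {ae P, forall x, f x <= h x}%E.
Proof.
move=> mf mh f0 h0 fh.
suff key (pq : rat * rat) : {ae P, forall x,
    ~ [/\ h x <= (ratr pq.1 : R)%:E, (pq.1 < pq.2)%R & (ratr pq.2 : R)%:E <= f x]%E}.
  apply: filterS (ae_forall_count key) => x nx; rewrite leNgt; apply/negP => /(ereal_between (h0 x)).
  by move=> [p [q [hp pq qf]]]; apply: (nx (p, q)); split; [exact: ltW|rewrite -(ltr_rat R)|exact: ltW].
case: pq => p q /=; have [pq|qp] := ltP p q; last by apply: nearW => x [].
set A : set U := [set x | h x <= (ratr p)%:E /\ (ratr q)%:E <= f x]%E.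
have mA : measurable A.
  by apply: measurableI; apply: emeasurable_le_set => //; exact: measurable_cst.
have PA : P A = 0%E; last first.
  by exists A; split => // x /= nn; apply: contrapT => nA; apply: nn => -[? _ ?]; apply: nA.
have [/eqP A0|/set0P[x0 [hx _]]] := boolP (A == set0); first by rewrite A0 measure0.
have p0 : 0 <= ratr p :> R by rewrite -lee_fin (le_trans (h0 x0)).
have q0 : 0 <= ratr q :> R by rewrite (le_trans p0)// ler_rat ltW.
have : ((ratr q)%:E * P A <= (ratr p)%:E * P A)%E.
  rewrite -!integral_cst//; apply: le_trans (le_trans (fh (ratr p) (ratr q)) _).
    by apply: ge0_le_integral => //; [exact: measurable_funTS|move=> x []].
  by apply: ge0_le_integral => //; [exact: measurable_funTS|move=> x []].
have PAfin : P A \is a fin_num by exact: fin_num_measure.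
rewrite -(fineK PAfin) -!EFinM lee_fin => h1; congr EFin; apply/eqP.
rewrite eq_le fine_ge0// andbT leNgt; apply/negP => r_gt0.
by move: h1; rewrite ler_pM2r// leNgt ltr_rat pq.
Qed.

Section conditional.
Context d (Omega : measurableType d) (R : realType) (P : probability Omega R).
Variables (alpha : nat -> R) (gam : seq nat -> nat -> {RV P >-> R}).
Variables (T sigma : nat -> nat -> nat -> {RV P >-> R}).
Hypothesis hm : cascade_model alpha gam T sigma.
Local Open Scope ereal_scope.
Local Notation F := (source_sigma_algebra gam T sigma).
Local Notation sub A := (g_sigma_algebraType (\bigcup_(i in A) F i)).
Local Notation g := (gabs gam).
Local Notation Th := (Tabs T).
Local Notation sg := (sig sigma).
Local Notation Wt := (weight alpha gam).
Let F_meas := @source_meas _ _ _ _ gam T sigma.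
Let sm := sub_measurable_fun F_meas.

Definition environment_sources : set source := [set j | if j is inl _ then True else False].
Definition dynamic_sources : set source :=
  [set j | if j is inl _ then False else (0 < source_level j)%N].
Local Notation Ev := (sub environment_sources).
Local Notation Dy := (sub dynamic_sources).

Lemma environment_sub (A : set Omega) : environment_sigma_algebra gam A -> measurable (A : set Ev).
Proof.
apply: smallest_sub; first exact: sigma_algebra_measurable.
move=> _ [[s x] _ [B mB <-]]; rewrite setTI; apply: sub_gen_smallest.
by exists (inl s) => //; exact: source_gam.
Qed.

Lemma sub_environment (A : set Ev) : measurable A -> environment_sigma_algebra gam A.
Proof.
apply: smallest_sub; first exact: smallest_sigma_algebra.
move=> B [[s|//] _]; apply: smallest_sub; first exact: smallest_sigma_algebra.
move=> _ [x _ [C mC <-]]; apply: sub_gen_smallest; exists (s, x) => //.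
by exists C.
Qed.

Let m_gabs s x : measurable_fun setT ((fun w => g w s x) : Ev -> R).
Proof.
apply: measurableT_comp => //.
by apply: (@sub_gen_measurable_fun _ _ _ _ _ _ _ _ (inl s)) => // B mB; exact: source_gam.
Qed.

Let m_Tabs k x i : (0 < k)%N -> measurable_fun setT ((fun w => Th w k x i) : Dy -> R).
Proof.
move=> k0; apply: measurableT_comp => //.
apply: (@sub_gen_measurable_fun _ _ _ _ _ _ _ _ (inr (inl (k, x, i)))) => // B mB.
exact: source_T.
Qed.

Let m_sig k x i : (0 < k)%N -> measurable_fun setT ((fun w => sg w k x i) : Dy -> R).
Proof.
move=> k0.
apply: (@sub_gen_measurable_fun _ _ _ _ _ _ _ _ (inr (inr (k, x)))) => // B mB.
exact: source_sigma_mark.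
Qed.

(** The vertex clock with environment and dynamics taken at separate sample points, the form in
    which one of them can be frozen. *)
Let joint s t (z : Ev * Dy) : \bar R := vertex_clock alpha (g z.1) (Th z.2) (sg z.2) s t.

Let m_joint s t : measurable_fun setT (joint s t).
Proof.
apply: (@measurable_vertex_clock _ (Ev * Dy)%type R alpha (fun z => g z.1) (fun z => Th z.2) (fun z => sg z.2)).
- by move=> z s' x; exact: gabs_ge0.
- by move=> z k' x i; exact: Tabs_ge0.
- by move=> s' x; exact: (measurableT_comp (m_gabs s' x) (@measurable_fst _ _ Ev Dy)).
- by move=> k' x i h; exact: (measurableT_comp (m_Tabs x i h) (@measurable_snd _ _ Ev Dy)).
- by move=> k' x i h; exact: (measurableT_comp (m_sig x i h) (@measurable_snd _ _ Ev Dy)).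
Qed.

Let joint_ge0 s t z : 0 <= joint s t z. Proof. exact: measure_ge0. Qed.

(* The dynamics being independent of the environment, integrating them out gives
   the conditional mean for each fixed t. *)
Definition section_mean s t (w : Omega) : \bar R :=
  \int[P]_w' vertex_clock alpha (g w) (Th w') (sg w') s t.

(** Right limits of the conditional means at rational times: a version of the whole family in [t]
    for which a bound at rational times extends to all [t] off a single null set. *)
Definition mean_clock s t w := envelope (fun q => section_mean s (ratr q) w) t.

Lemma measurable_section_mean s t : measurable_fun setT (section_mean s t : Ev -> \bar R).
Proof.
exact: (measurable_freeze P (sub_id_measurable F_meas (A := dynamic_sources)) (m_joint s t) (joint_ge0 s t)).
Qed.

Lemma section_mean_ge0 s t w : 0 <= section_mean s t w.
Proof. by apply: integral_ge0 => w' _; exact: measure_ge0. Qed.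

Lemma section_mean_mono s w : {homo (section_mean s)^~ w : t t' / (t <= t')%R >-> t <= t'}.
Proof.
move=> t t' tt'; have m u : measurable_fun setT (fun w' : Omega => vertex_clock alpha (g w) (Th w') (sg w') s u).
  apply: (sm (A := dynamic_sources)).
  exact: (measurableT_comp (m_joint s u) (@measurable_pair1 _ _ Ev Dy w)).
apply: ge0_le_integral => //.
by move=> w' _; apply: vertex_clock_mono => //; [exact: gabs_ge0|exact: Tabs_ge0].
Qed.

Lemma integral_section_mean s t (A : set Ev) : measurable A ->
  \int[P]_(w in A) section_mean s t w = \int[P]_(w in A) vertex_clockw alpha gam T sigma w s t.
Proof.
move=> mA; pose h (z : Ev * Dy) := (\1_A z.1)%:E * joint s t z.
have m1 : measurable_fun setT (fun z : Ev * Dy => (\1_A z.1)%:E : \bar R).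
  apply/measurable_EFinP; apply: measurableT_comp => //; exact: measurable_indic.
have mh : measurable_fun setT h by exact: emeasurable_funM.
have h0 z : 0 <= h z by rewrite mule_ge0// lee_fin.
have ZE (f : Omega -> \bar R) : \int[P]_(w in A) f w = \int[P]_w ((\1_A w)%:E * f w).
  rewrite integral_mkcond; apply: eq_integral => w _; rewrite patchE indicE.
  by case: ifP; rewrite ?mul1e ?mul0e.
have D1 : environment_sources `<=` [set j : source | (0 < source_level j)%N] by move=> [s'|].
have D2 : dynamic_sources `<=` [set j : source | (0 < source_level j)%N] by move=> [s'|].
have D12 : environment_sources `&` dynamic_sources = set0.
  by apply/seteqP; split => // -[s'|j] [].
have := freezing (@source_sigma _ _ _ _ gam T sigma) F_meas (model_indep hm) D1 D2 D12 mh h0.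
rewrite !ZE => ->; apply: eq_integral => w _.
rewrite /h/= ge0_integralZl//.
apply: (sm (A := dynamic_sources)).
exact: (measurableT_comp (m_joint s t) (@measurable_pair1 _ _ Ev Dy w)).
Qed.

Lemma measurable_weight_env s : measurable_fun setT ((fun w => Wt w s) : Ev -> \bar R).
Proof. by apply: measurable_Wsup => s' x; exact: m_gabs. Qed.

Lemma integral_section_mean_le s t (A : set Ev) : measurable A -> (0 <= t)%R ->
  \int[P]_(w in A) section_mean s t w <= t%:E * \int[P]_(w in A) Wt w s.
Proof.
move=> mA t0; rewrite integral_section_mean//.
have EL : environment_sources `<=` level_sources (size s) by move=> [s'|].
have mA' := sub_subset EL mA.
exact: (integral_vertex_clock_le hm t0 mA').
Qed.

(** The events used by [ae_le_of_integral] are defined through functions of the environment, so the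
    bound in mean is available on each of them. *)
Lemma section_mean_le s t : (0 <= t)%R -> {ae P, forall w, section_mean s t w <= t%:E * Wt w s}.
Proof.
move=> t0.
have mtW : measurable_fun setT (fun w : Ev => t%:E * Wt w s).
  by apply: emeasurable_funM => //; exact: measurable_weight_env.
apply: ae_le_of_integral.
- exact: (sm (measurable_section_mean s t)).
- exact: (sm mtW).
- by move=> w; exact: section_mean_ge0.
- by move=> w; rewrite mule_ge0 ?weight_ge0.
move=> p q; cbv zeta; set A : set Omega := [set x | _]; have mA : measurable (A : set Ev).
  by apply: measurableI; apply: emeasurable_le_set => //; exact: measurable_section_mean.
rewrite ge0_integralZl//; first exact: integral_section_mean_le.
- exact: (sub_measurable F_meas mA).
- by apply: measurable_funTS; exact: (sm (measurable_weight_env s)).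
- by move=> w _; exact: weight_ge0.
Qed.

Lemma mean_clock_ge0 s t w : 0 <= mean_clock s t w.
Proof. by apply: envelope_ge0 => q; exact: section_mean_ge0. Qed.

Lemma measurable_mean_clock s t : measurable_fun setT (mean_clock s t : Ev -> \bar R).
Proof.
apply: (@measurable_envelope _ Ev R (fun q w => section_mean s (ratr q) w)) => q _.
exact: measurable_section_mean.
Qed.

Lemma mean_clock_le : {ae P, forall w, forall s t, (0 <= t)%R -> mean_clock s t w <= t%:E * Wt w s}.
Proof.
have h : {ae P, forall w, forall sq : seq nat * rat, (0 <= sq.2)%R ->
    section_mean sq.1 (ratr sq.2) w <= (ratr sq.2)%:E * Wt w sq.1}.
  apply: ae_forall_count => -[s q] /=; have [q0|q0] := boolP (0 <= q)%R; last by apply: nearW => w.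
  have q0' : (0 <= ratr q :> R)%R by rewrite ler0q.
  by apply: filterS (section_mean_le s q0') => w.
apply: filterS2 h (ae_good hm) => w hw G s t t0.
have := good_fin G s; have := weight_ge0 alpha gam w s.
case e : (Wt w s) => [c| |]// c0 _; apply/lee_addgt0Pr => ep ep0.
have c1 : (0 < c + 1)%R by rewrite ltr_wpDl// -lee_fin.
(* The tolerance makes [(q - t) c] at most [ep]; the denominator [c + 1] is positive even when
   [c = 0]. *)
have /rat_in_itvoo[q] : (t < t + ep / (c + 1))%R by rewrite ltrDl divr_gt0.
rewrite in_itv/= => /andP[tq qt].
have q0 : (0 <= q)%R by rewrite -(ler0q R) (le_trans t0)// ltW.
apply: (le_trans (envelope_le _ q0 tq)); apply: (le_trans (hw (s, q) q0)) => /=.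
rewrite e -EFinM lee_fin; rewrite -lerBlDl -mulrBl.
apply: (@le_trans _ _ (ep / (c + 1) * c)%R).
  by apply: ler_wpM2r; [rewrite -lee_fin|rewrite lerBlDl ltW].
by rewrite mulrAC ler_pdivrMr// ler_wpM2l ?ltW// ltrDl.
Qed.

(** At each [t + 1/(j + 1)] the section mean has the same integral as the vertex clock, and both
    families decrease to their right limits. Dominated convergence applies on the events
    [W(s) <= N], where the means at [t + 1] are finite; the truncation is removed by letting [N]
    grow. *)
Lemma integral_mean_clock s t (A : set Ev) : measurable A -> (0 <= t)%R ->
  \int[P]_(w in A) mean_clock s t w = \int[P]_(w in A) vertex_clockw alpha gam T sigma w s t.
Proof.
move=> mA t0; pose Y := vertex_clockw alpha gam T sigma.
have mY u : measurable_fun setT (Y^~ s ^~ u) := measurable_vertex_clockw alpha gam T sigma s u.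
have Y0 w u : 0 <= Y w s u by exact: measure_ge0.
have mm : measurable_fun setT (mean_clock s t) by exact: (sm (measurable_mean_clock s t)).
pose B N : set Ev := A `&` [set w | Wt w s <= N%:R%:E].
have mB N : measurable (B N).
  by apply: measurableI => //; apply: emeasurable_le_set => //; exact: measurable_weight_env.
have mB' N : measurable (B N : set Omega) := sub_measurable F_meas (mB N).
have step N : \int[P]_(w in B N) mean_clock s t w = \int[P]_(w in B N) Y w s t.
  have fin : \int[P]_(w in B N) section_mean s (t + 1) w < +oo.
    have t1 : (0 <= t + 1)%R by rewrite addr_ge0.
    apply: (le_lt_trans (integral_section_mean_le s (mB N) t1)).
    apply: lte_mul_pinfty; rewrite ?lee_fin//.
    apply: (@le_lt_trans _ _ (\int[P]_(w in B N) cst N%:R%:E w)).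
      apply: ge0_le_integral => //.
      - by move=> w _; exact: weight_ge0.
      - by apply: measurable_funTS; exact: (sm (measurable_weight_env s)).
      - by move=> w [].
    rewrite integral_cst//; apply: lte_mul_pinfty; rewrite ?lee_fin//.
    exact: le_lt_trans (probability_le1 P (mB' N)) (ltry _).
  have c1 := integral_envelope_cvg (mB' N) (fun u => sm (measurable_section_mean s u))
    (section_mean_ge0 s) (section_mean_mono s) t0 fin.
  have fin' : \int[P]_(w in B N) Y w s (t + 1)%R < +oo by rewrite -integral_section_mean.
  have Ym w : {homo Y w s : u v / (u <= v)%R >-> u <= v}.
    by apply: vertex_clock_mono; [exact: gabs_ge0|exact: Tabs_ge0].
  have c2 := integral_envelope_cvg (K := fun u w => Y w s u) (mB' N) mY (fun u w => Y0 w u) Ym t0 fin'.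
  have c3 : \int[P]_(w in B N) section_mean s (t + j.+1%:R^-1)%R w @[j --> \oo] -->
      \int[P]_(w in B N) envelope (fun q => Y w s (ratr q)) t.
    apply: cvg_trans c2; apply: near_eq_cvg; apply: nearW => j.
    by rewrite integral_section_mean.
  rewrite /mean_clock -(cvg_lim _ c1)// (cvg_lim _ c3)//.
  have iY : P.-integrable (B N) (fun w => Y w s (t + 1)%R).
    apply/integrableP; split; first exact: measurable_funTS.
    by under eq_integral => w _ do rewrite gee0_abs//.
  apply: ae_eq_integral => //.
  - by apply: measurable_funTS; apply: (measurable_envelope (f := fun q w => Y w s (ratr q))).
  - exact: measurable_funTS.
  (* The vertex clock is its own right limit wherever it is finite at [t + 1], hence almost
     everywhere on [B N]. *)
  apply: filterS (integrable_ae (mB' N) iY) => w fw Bw.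
  have {}fw : Y w s (t + 1)%R < +oo by have := fw Bw; rewrite ge0_fin_numE.
  have e1 := envelope_cvg (Ym w) t0.
  have e2 := vertex_clock_right_cvg (gabs_ge0 gam w) (Tabs_ge0 T w) fw.
  by rewrite -(cvg_lim _ e1)// (cvg_lim _ e2).
pose m1 : {measure set Omega -> \bar R} := density_measure P mm (mean_clock_ge0 s t).
pose m2 : {measure set Omega -> \bar R} := density_measure P (mY t) (fun w => Y0 w t).
have mA' : measurable (A : set Omega) := sub_measurable F_meas mA.
have mBU : measurable (\bigcup_N B N : set Omega) by exact: bigcupT_measurable.
have B_mono i j : (i <= j)%N -> B i `<=` B j.
  by move=> ij w [Aw Ww]; split => //; apply: (le_trans Ww); rewrite lee_fin ler_nat.
have eU : \int[P]_(w in \bigcup_N B N) mean_clock s t w = \int[P]_(w in \bigcup_N B N) Y w s t.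
  have c (m : {measure set Omega -> \bar R}) : m (B N) @[N --> \oo] --> m (\bigcup_N B N).
    by apply: nondecreasing_cvg_mu => // i j ij; apply/subsetPset; exact: B_mono.
  have c1 := c m1; have c2 := c m2.
  rewrite -[LHS]/(m1 (\bigcup_N B N)) -[RHS]/(m2 (\bigcup_N B N)).
  have c3 : m2 (B N) @[N --> \oo] --> m1 (\bigcup_N B N).
    by apply: cvg_trans c1; apply: near_eq_cvg; apply: nearW => N; exact: step.
  by rewrite -(cvg_lim _ c3)// (cvg_lim _ c2).
have full (f : Omega -> \bar R) : measurable_fun setT f ->
    \int[P]_(w in A) f w = \int[P]_(w in \bigcup_N B N) f w.
  move=> mf; rewrite integral_mkcond [RHS]integral_mkcond; apply: ae_eq_integral => //.
  - by apply/(measurable_restrictT _ mA'); exact: measurable_funTS.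
  - by apply/(measurable_restrictT _ mBU); exact: measurable_funTS.
  apply: filterS (ae_good hm) => w G _; rewrite !patchE; congr (if _ then _ else _).
  apply/idP/idP => /set_mem h; apply/mem_set; last by have [N _ []] := h.
  have := good_fin G s; have := weight_ge0 alpha gam w s.
  case e : (Wt w s) => [c| |]// c0 _; exists (Num.truncn c).+1 => //; split => //=.
  by rewrite e lee_fin ltW// truncnS_gt.
by rewrite full// eU full.
Qed.

End conditional.

Section limit_theorem.
Context d (Omega : measurableType d) (R : realType) (P : probability Omega R).
Variables (alpha : nat -> R) (gam : seq nat -> nat -> {RV P >-> R}).
Variables (T sigma : nat -> nat -> nat -> {RV P >-> R}).
Hypothesis hm : cascade_model alpha gam T sigma.
Local Open Scope ereal_scope.
Local Notation F := (source_sigma_algebra gam T sigma).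
Local Notation g := (gabs gam).
Local Notation Th := (Tabs T).
Local Notation sg := (sig sigma).
Local Notation Wt := (weight alpha gam).
Local Notation fw := (limit_clockw alpha gam T sigma).
Local Notation limits := (clock_limits alpha gam T sigma).
Let sm := sub_measurable_fun (@source_meas _ _ _ _ gam T sigma).

Definition limit_value k t w := envelope (fw k w) t.

Lemma measurable_limit_value k t : (0 < k)%N -> measurable_fun setT (limit_value k t).
Proof.
move=> k0; apply: (@measurable_envelope _ Omega R (fun q w => fw k w q)) => q _.
apply: (@measurable_limit_clock _ Omega R alpha g Th sg) => //.
- by move=> w s x; exact: gabs_ge0.
- by move=> w k' x i; exact: Tabs_ge0.
- by move=> s x; exact: (sm (@measurable_gabs _ _ _ _ gam T sigma 0 s x)).
- by move=> k' x i h; apply: (sm (@measurable_Tabs _ _ _ _ gam T sigma k' k' x i _)); rewrite h leqnn.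
Qed.

Lemma limit_value_ge0 k t w : 0 <= limit_value k t w.
Proof. by apply: envelope_ge0 => q; exact: limit_clock_ge0. Qed.

Lemma limit_value_fin k t w : (0 < k)%N -> limits k w -> (0 <= t)%R ->
  limit_value k t w \is a fin_num.
Proof.
move=> k0 cw t0; rewrite ge0_fin_numE ?limit_value_ge0//.
have /rat_in_itvoo[q] : (t < t + 1)%R by rewrite ltrDl.
rewrite in_itv/= => /andP[tq _].
have q0 : (0 <= q)%R by rewrite -(ler0q R) (le_trans t0)// ltW.
exact: le_lt_trans (envelope_le _ q0 tq) (limit_clock_fin k0 cw q0).
Qed.

(** Level 0 is given the constant 0, which makes the process a random variable for every index. *)
Let mfine k t : measurable_fun setT (fun w => if (0 < k)%N then fine (limit_value k t w) else 0%R).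
Proof.
have [k0|k0] := posnP k; first exact: measurable_cst.
by apply: measurableT_comp => //; exact: measurable_limit_value.
Qed.

Definition limit_process k t : {RV P >-> R} := mfun_Sub (mem_set (mfine k t)).

Lemma limit_processE k t w : (0 < k)%N -> limit_process k t w = fine (limit_value k t w).
Proof. by move=> k0; rewrite /limit_process /= k0. Qed.

Section good_path.
Variable w : Omega.
Hypothesis G : good alpha gam T sigma w.

Let env_gabs : env gam w = g w.
Proof.
apply/funext => s; apply/funext => x; rewrite /env /gabs ger0_norm// ltW//.
exact: (good_gam G).
Qed.

Let holding_Tabs k x i : (0 < k)%N -> holding T w k x i = Th w k x i.
Proof. by move=> k0; rewrite /holding /Tabs ger0_norm//; exact: (good_T G x i k0). Qed.

Let W_weight s : W alpha (g w) s = Wt w s.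
Proof. by rewrite -env_gabs; exact: (good_W G). Qed.

Lemma theta_tilde_total k n t : (0 < k <= n)%N ->
  theta_tilde alpha (env gam w) (holding T w) (marks sigma w) k n t =
  total_clockw alpha gam T sigma w k n t.
Proof.
move=> kn; rewrite env_gabs.
rewrite (theta_tildeE (good_gabs G) (Tabs_ge0 T w) (good_sig G) (good_sig_ties G) holding_Tabs)//; last first.
  by move=> s; rewrite W_weight weight_ge0.
rewrite /total_clockw /total_clock.
have -> : W alpha (g w) = Wsup alpha (g w) by apply/funext => y; exact: W_weight.
by [].
Qed.

Lemma theta_vertex_clock s t :
  theta_vertex (env gam w) (holding T w) (marks sigma w)
    (clock_measure (fw (size s).+1 w)) s t = vertex_clockw alpha gam T sigma w s t.
Proof.
rewrite /theta_vertex /vertex_clockw /vertex_clock; congr (clock_measure _ _).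
have av := at_vertexE (good_gabs G) (Tabs_ge0 T w) (good_sig G) (good_sig_ties G) holding_Tabs s.
have mo := measurable_occ1 (sg w) (good_gabs G) (Tabs_ge0 T w) (size s) s.
have LE u : L (env gam w) (holding T w) (marks sigma w) s u = local_time (g w) (Th w) (sg w) s u.
  rewrite /L /local_time env_gabs av integral_indic//; exact: measurable_itv.
apply/seteqP; split => u; rewrite /vertex_set/=.
  by move=> [u0]; rewrite LE env_gabs av.
by move=> [u0 Lu ou]; rewrite LE env_gabs av.
Qed.

End good_path.

End limit_theorem.

Theorem theorem4p4 (R : realType) (d : measure_display)
    (Omega : measurableType d) (P : probability Omega R)
    (alpha : nat -> R)
    (gam : seq nat -> nat -> {RV P >-> R})
    (T sigma : nat -> nat -> nat -> {RV P >-> R})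
    (alpha_gt0 : 0 < alpha 1%N)
    (alpha_incr : forall k, (0 < k)%N -> alpha k < alpha k.+1)
    (alpha_lt1 : forall k, (0 < k)%N -> alpha k < 1)
    (alpha_cvg : alpha n @[n --> \oo] --> (1 : R))
    (gam_poisson : forall s,
      poisson_point_process P (intensity alpha (size s).+1) (gam s))
    (gam_ordered : forall s,
      {ae P, forall w, forall x, 0 < gam s x.+1 w < gam s x w})
    (T_exponential : forall k x i, (0 < k)%N ->
      forall A, measurable A -> distribution P (T k x i) A = exponential_prob 1 A)
    (sigma_poisson : forall k x, (0 < k)%N ->
      poisson_point_process P lebesgue_measure (sigma k x))
    (sigma_ordered : forall k x, (0 < k)%N ->
      {ae P, forall w, forall i, 0 < sigma k x i w < sigma k x i.+1 w})
    (independence : mutually_independent P [set j | (0 < source_level j)%N]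
      (source_sigma_algebra gam T sigma)) :
  exists (D : nat -> set R) (theta : nat -> R -> {RV P >-> R}),
    (forall k, (0 < k)%N ->
      [/\ [/\ countable (D k), D k `<=` `[0, +oo[ &
              `[0, +oo[ `<=` closure (D k)],
          {ae P, forall w,
            {in `[0, +oo[ &, {homo (fun t => theta k t w) : s t / s <= t}} /\
            right_continuous_on_half_line (fun t => theta k t w)} &
          forall t, D k t -> {ae P, forall w,
            theta_tilde alpha (env gam w) (holding T w) (marks sigma w) k n t
              @[n --> \oo] --> (theta k t w)%:E}]) /\
    exists nu : nat -> Omega -> {measure set (measurableTypeR R) -> \bar R},
      (forall k, (0 < k)%N ->
        {ae P, forall w, is_clock_measure (fun t => theta k t w) (nu k w)}) /\
      (* The family of versions of the conditional expectations is required to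
         be right-continuous in t, which determines it up to one null set. *)
      exists Egamma : seq nat -> R -> Omega -> \bar R,
        [/\ forall s t, 0 <= t ->
              is_conditional_expectation P (environment_sigma_algebra gam)
                (fun w => theta_vertex (env gam w) (holding T w)
                   (marks sigma w) (nu (size s).+1 w) s t)
                (Egamma s t),
            {ae P, forall w, forall s,
              right_continuous_on_half_line (fun t => Egamma s t w)} &
            {ae P, forall w, forall s t, 0 <= t ->
              (Egamma s t w <= t%:E * W alpha (env gam w) s)%E}].
Proof.
have hm : cascade_model alpha gam T sigma.
  split => // s; apply: filterS (gam_ordered s) => w h x.
  by have /andP[h1 h2] := h x; exact: lt_trans h2.
have limits k : (0 < k)%N -> {ae P, forall w, clock_limits alpha gam T sigma k w}.
  by move=> k0; exact: (ae_clock_limits hm k0).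
pose fw k w := limit_clockw alpha gam T sigma k w.
have value k w t : (0 < k)%N -> clock_limits alpha gam T sigma k w -> 0 <= t ->
    (limit_process alpha gam T sigma k t w)%:E = envelope (fw k w) t.
  by move=> k0 cw t0; rewrite limit_processE// fineK//; exact: limit_value_fin.
(* The nonnegative rationals serve as the set of times for every level. *)
exists (fun=> [set ratr q | q in [set q : rat | 0 <= q]]), (limit_process alpha gam T sigma); split.
  move=> k k0; split.
  - split.
    + exact/(sub_countable (card_image_le _ _))/countableP.
    + by move=> _ [q q0 <-]; rewrite /= in_itv/= andbT ler0q.
    + move=> x; rewrite /= in_itv/= andbT => x0 B /nbhs_ballP[e /= e0 Be].
      have /rat_in_itvoo[q] : x < x + e by rewrite ltrDl.
      rewrite in_itv/= => /andP[xq qe]; exists (ratr q); split.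
        by exists q => //=; rewrite -(ler0q R) (le_trans x0)// ltW.
      apply: Be; rewrite /ball/= ltr0_norm ?subr_lt0// opprB ltrBlDl//.
  - apply: filterS (limits k k0) => w cw; split.
      move=> s t; rewrite !in_itv/= !andbT => s0 t0 st.
      by have := envelope_mono (fw k w) st; rewrite -!value// lee_fin.
    move=> t t0; have := @envelope_right_cvg _ (fw k w) t; rewrite -value// => /fine_cvgP[_ c].
    apply: cvg_trans c; apply: near_eq_cvg; apply: nearW => u /=.
    by rewrite k0.
  - move=> _ [q q0 <-].
    (* At a rational time the envelope almost surely returns the limit of the modified clocks
       itself. *)
    apply: filterS2 (limits k k0) (ae_envelope hm k0 q0) => w cw eq.
    have q0' : 0 <= ratr q :> R by rewrite ler0q.
    rewrite value// /fw eq; have [c _] := total_clock_cvg k0 cw q0.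
    apply: cvg_trans c; apply: near_eq_cvg; exists k; [exact: I|move=> n kn].
    apply/esym; apply: theta_tilde_total; first exact: (limits_good cw).
    by rewrite k0.
exists (fun k w => clock_measure (fw k w)); split.
  move=> k k0; apply: filterS (limits k k0) => w cw; split; first exact: clock_measure_neg.
  move=> t t0; rewrite (value _ _ _ k0 cw t0).
  exact: (clock_measure_itv (limit_clock_mono k0 cw) (limit_clock_ge0 alpha gam T sigma k w) t0).
exists (mean_clock alpha gam T sigma); split.
- move=> s t t0; split.
  + move=> B mB; apply: (@sub_environment _ _ _ _ gam T sigma).
    by rewrite -[X in measurable X]setTI; exact: measurable_mean_clock.
  + by move=> w; exact: mean_clock_ge0.
  exists (fun w => vertex_clockw alpha gam T sigma w s t); split.
  + exact: measurable_vertex_clockw.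
  + by move=> w; exact: measure_ge0.
  + by apply: filterS (ae_good hm) => w G; exact: theta_vertex_clock.
  + by move=> A mA; apply: (integral_mean_clock hm) => //; exact: environment_sub.
(* Right-continuity holds at every sample point, the version being an envelope. *)
- by apply: nearW => w s t t0; exact: envelope_right_cvg.
- apply: filterS2 (mean_clock_le hm) (ae_good hm) => w hw G s t t0.
  by rewrite (good_W G); exact: hw.
Qed.
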